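(* Let $(J^s)_{s\in(1/2,1)}$ satisfy Hypotheses (H1) and (H2) below with constant $\delta>0$ and limit kernel $J^1$. For $\varepsilon>0$, $s\in(1/2,1)$ let $F^s_\varepsilon$ be the probability equilibrium of $\partial_tu=\varepsilon^{-2s}(J^s_\varepsilon*u-u)+\mathrm{div}(xu)$ and $F_\varepsilon$ the probability equilibrium of $\partial_tu=\varepsilon^{-2}(J^1_\varepsilon*u-u)+\mathrm{div}(xu)$. Let $0\le k<m<1$ and $\theta=\frac{m-k}{m+d/2}$. Then there is a constant $C$ such that for all $s\in(1/2,1)$ and all $\varepsilon\in\Big(0,\sqrt{\tfrac{2}{4+2\delta+d}}\Big)$, $$\|F^s_\varepsilon-F_\varepsilon\|_{L^1_k}\le C(1-s)^\theta\big(1+\varepsilon^{\delta\theta}|\log\varepsilon|\big).$$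
   Context: $\langle x\rangle=(1+|x|^2)^{1/2}$; $\|f\|_{L^1_k}=\int\langle x\rangle^k|f|$; $\hat f(\xi)=\int e^{-ix\cdot\xi}f$; $J_\varepsilon(x)=\varepsilon^{-d}J(x/\varepsilon)$. An equilibrium is a probability density solving the stationary equation weakly. Hypothesis (H1): $(J^s)_{s\in(1/2,1)}$ is a family of probability densities on $\mathbb{R}^d$ with $J^s\in L^1\cap L^p$ for some $p\in(1,\infty]$, such that (i) $\int\min\{1,|y|^2\}J^s<\infty$; (ii) there exist $\delta,C_0>0$ independent of $s$ with $\hat J^s(\xi)=1-|\xi|^{2s}+R_s(\xi)$, $|R_s(\xi)|\le C_0|\xi|^{2s+\delta}$ for $|\xi|\le1$; (iii) there exist $C,R>0$, $\Psi$ with $\int(1+|x|^2)|\Psi|<\infty$, $\int x\Psi=0$, independent of $s$, with $J^s(x)\le C(1-s)|x|^{-d-2s}+\Psi(x)$ for $|x|\ge R$. Hypothesis (H2): $J^1$ is a probability density with $\hat J^1(\xi)=1-|\xi|^2+R_1(\xi)$, $|R_1(\xi)|\le C_0|\xi|^{2+\delta}$ for $|\xi|\le1$, and there is $\mathfrak C>0$ with $\left|\frac{1-\hat J^s(\xi)}{|\xi|^{2s}}-\frac{1-\hat J^1(\xi)}{|\xi|^2}\right|\le\mathfrak C(1-s)|\xi|^\delta\max(1,|\log|\xi||)$ for all $s\in(1/2,1)$, $\xi\in\mathbb{R}^d$. *)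

(* Defs.v *)
From HB Require Import structures.
From mathcomp Require Import all_boot all_order all_algebra.
From mathcomp Require Import all_classical all_reals all_analysis.
Set Implicit Arguments. Unset Strict Implicit. Unset Printing Implicit Defensive.
Import Order.TTheory GRing.Theory Num.Theory.
Import numFieldNormedType.Exports.
Local Open Scope classical_set_scope.
Local Open Scope ring_scope.

Section Defs.
Variable R : realType.

Definition vdot (d : nat) (x y : 'rV[R]_d) : R := \sum_i x 0 i * y 0 i.
Definition vnorm (d : nat) (x : 'rV[R]_d) : R := Num.sqrt (vdot x x).
Definition japan (d : nat) (x : 'rV[R]_d) : R := Num.sqrt (1 + vnorm x ^+ 2).

Definition rects (d : nat) : set (set 'rV[R]_d) :=
  [set A | exists B : 'I_d -> set R,
     (forall i, measurable (B i)) /\ A = [set x : 'rV[R]_d | forall i, B i (x 0 i)]].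
Definition borelRd (d : nat) : set (set 'rV[R]_d) := <<s @rects d >>.
Definition meas_fun (d : nat) (f : 'rV[R]_d -> R) : Prop :=
  forall B : set R, measurable B -> @borelRd d (f @^-1` B).

(* Lebesgue integral over R^d of a nonnegative function, computed as the
   iterated one-dimensional Lebesgue integral (Tonelli). *)
Fixpoint iint (n : nat) : ('rV[R]_n -> \bar R) -> \bar R :=
  match n return ('rV[R]_n -> \bar R) -> \bar R with
  | 0 => fun f => f 0
  | n'.+1 => fun f =>
      (\int[@lebesgue_measure R]_x iint (fun v : 'rV[R]_n' => f (row_mx (const_mx (x : R) : 'rV[R]_1) v)))%E
  end.

Definition Lint (d : nat) (f : 'rV[R]_d -> R) : \bar R :=
  (iint (fun x => (Num.max (f x) 0)%:E) - iint (fun x => (Num.max (- f x) 0)%:E))%E.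

Definition null_set (d : nat) (N : set 'rV[R]_d) : Prop :=
  exists A, @borelRd d A /\ N `<=` A /\ iint (fun x => (\1_A x : R)%:E) = 0%E.

Definition in_Lp (d : nat) (p : \bar R) (f : 'rV[R]_d -> R) : Prop :=
  meas_fun f /\
  match p with
  | r%:E => (iint (fun x => (`|f x| `^ r)%:E) < +oo)%E
  | +oo%E => exists M : R, null_set [set x | M < `|f x|]
  | -oo%E => False
  end.

Definition prob_density (d : nat) (f : 'rV[R]_d -> R) : Prop :=
  meas_fun f /\ (forall x, 0 <= f x) /\ iint (fun x => (f x)%:E) = 1%E.

(* Fourier transform hat f(xi) = int e^{-i x.xi} f(x) dx, real and imaginary parts *)
Definition hatRe (d : nat) (f : 'rV[R]_d -> R) (xi : 'rV[R]_d) : R :=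
  fine (Lint (fun x => cos (vdot x xi) * f x)).
Definition hatIm (d : nat) (f : 'rV[R]_d -> R) (xi : 'rV[R]_d) : R :=
  - fine (Lint (fun x => sin (vdot x xi) * f x)).
Definition cmod (a b : R) : R := Num.sqrt (a ^+ 2 + b ^+ 2).

Definition scale (d : nat) (eps : R) (J : 'rV[R]_d -> R) : 'rV[R]_d -> R :=
  fun x => eps `^ (- d%:R) * J (eps^-1 *: x).
Definition conv (d : nat) (K F : 'rV[R]_d -> R) : 'rV[R]_d -> R :=
  fun x => fine (Lint (fun y => K (x - y) * F y)).

Definition pd (d : nat) (i : 'I_d) (f : 'rV[R]_d -> R) : 'rV[R]_d -> R :=
  fun x => 'D_(delta_mx 0 i) f x.
Fixpoint iter_pd (d : nat) (l : seq 'I_d) (f : 'rV[R]_d -> R) : 'rV[R]_d -> R :=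
  match l with [::] => f | i :: l' => pd i (iter_pd l' f) end.
Definition smooth (d : nat) (f : 'rV[R]_d -> R) : Prop :=
  forall l : seq 'I_d, continuous (iter_pd l f) /\
    forall (i : 'I_d) (x : 'rV[R]_d), derivable (iter_pd l f) x (delta_mx 0 i).
Definition test_fun (d : nat) (phi : 'rV[R]_d -> R) : Prop :=
  smooth phi /\ exists M : R, forall x, M < vnorm x -> phi x = 0.

(* F is an equilibrium (probability density, weak stationary solution) of
     d_t u = eps^{-alpha} (K_eps * u - u) + div(x u),
   i.e. for every test function phi,
     int eps^{-alpha} (K_eps*F - F) phi - int F x.grad phi = 0. *)
Definition equilibrium (d : nat) (K : 'rV[R]_d -> R) (eps alpha : R)
    (F : 'rV[R]_d -> R) : Prop :=
  prob_density F /\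
  forall phi, test_fun phi ->
    Lint (fun x => eps `^ (- alpha) * (conv (scale eps K) F x - F x) * phi x
                   - F x * (\sum_i x 0 i * pd i phi x)) = 0%E.

Definition H1 (d : nat) (J : R -> 'rV[R]_d -> R) (delta C0 : R) : Prop :=
  0 < delta /\ 0 < C0 /\
  (forall s, 1/2 < s < 1 ->
     prob_density (J s) /\
     (exists p : \bar R, (1%:E < p)%E /\ in_Lp p (J s)) /\
     (iint (fun y => (Num.min 1 (vnorm y ^+ 2) * J s y)%:E) < +oo)%E /\
     (forall xi, vnorm xi <= 1 ->
        cmod (hatRe (J s) xi - (1 - vnorm xi `^ (2 * s))) (hatIm (J s) xi)
          <= C0 * vnorm xi `^ (2 * s + delta))) /\
  (exists (C Rr : R) (Psi : 'rV[R]_d -> R),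
     0 < C /\ 0 < Rr /\ meas_fun Psi /\
     (iint (fun x => ((1 + vnorm x ^+ 2) * `|Psi x|)%:E) < +oo)%E /\
     (forall i : 'I_d, Lint (fun x => x 0 i * Psi x) = 0%E) /\
     forall s, 1/2 < s < 1 -> forall x, Rr <= vnorm x ->
       J s x <= C * (1 - s) * vnorm x `^ (- d%:R - 2 * s) + Psi x).

Definition H2 (d : nat) (J : R -> 'rV[R]_d -> R) (J1 : 'rV[R]_d -> R)
    (delta C0 : R) : Prop :=
  prob_density J1 /\
  (forall xi, vnorm xi <= 1 ->
     cmod (hatRe J1 xi - (1 - vnorm xi ^+ 2)) (hatIm J1 xi)
       <= C0 * vnorm xi `^ (2 + delta)) /\
  exists CC : R, 0 < CC /\
    forall s, 1/2 < s < 1 -> forall xi : 'rV[R]_d, xi != 0 ->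
      cmod ((1 - hatRe (J s) xi) / vnorm xi `^ (2 * s)
              - (1 - hatRe J1 xi) / vnorm xi ^+ 2)
           (- hatIm (J s) xi / vnorm xi `^ (2 * s)
              + hatIm J1 xi / vnorm xi ^+ 2)
        <= CC * (1 - s) * vnorm xi `^ delta * Num.max 1 `|ln (vnorm xi)|.

End Defs.

(* Main.v *)
(* Let [psi t] be the Fourier transform at [t xi] of an equilibrium with kernel
   [K] and exponent [al]. Testing the equation against truncated plane waves gives
   the ray equation [t psi' = - eps^(-al) (1 - Khat (eps t xi)) psi], [psi 0 = 1].
   The expansion of [Khat] at [0] makes [psi] Lipschitz at [0], so the mass outside
   the box of radius [r] carries [k]-th moments of order [r^(k - 1)]. Since
   [eps^(-2) >= 2 + delta + d / 2 = a], the equation also makes [|psi|] decay almost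
   like [|xi|^(-a)]; this needs [Re Khat] to be away from [1] at high frequencies on
   average, which follows from a uniform bound on the mass that [K] gives to thin
   slabs. Comparing the ray equations of the two equilibria, whose symbols differ by
   [O((1 - s) (|xi| + |xi|^b))] with [b] close to [2 + delta], bounds the difference
   of the two Fourier transforms by [(1 - s)^th |xi|^(- d / 2 - q)], with [th < 1]
   arbitrary and some [q > 0]. By an L2 duality the difference has mass
   [O((1 - s)^th r^(d / 2))] in the box of radius [r], and optimizing in [r] gives
   the rate. *)
Require Import Defs.
From HB Require Import structures.
From mathcomp Require Import all_boot all_order all_algebra.
From mathcomp Require Import all_classical all_reals all_analysis.
From mathcomp Require Import measurable_realfun ring lra.
Import Order.TTheory GRing.Theory Num.Theory.
Import numFieldNormedType.Exports.
Set Implicit Arguments. Unset Strict Implicit. Unset Printing Implicit Defensive.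
Local Open Scope classical_set_scope.
Local Open Scope ring_scope.

(** * Lebesgue measure on row vectors *)

(** Plane waves are not test functions, and x . grad of a truncated wave does not stay bounded as
    the truncation is removed. The cutoff therefore depends on a t^2 |x|^2: the test function is
    then a fixed function evaluated at t x, its t-derivative is x . grad divided by t, and the weak
    equation turns this derivative into a jump term bounded independently of a. The ray equation is
    first obtained in integrated form, where a can tend to 0.

    The two transforms are compared through their quotient, so that their difference inherits their
    decay.

    Exponents: with e = 1 - s, the box of radius r contributes r^(k + d/2) e^th and its complement
    r^(k - 1). For r = e^(- theta / (1 - k)) both equal e^theta as soon as th = theta (1 + d/2) / (1
    - k), and m < 1 makes th < 1. The gap 1 - th pays for every loss: mass in thin slabs, eps^(-2s)
    falling below eps^(-2), logarithms, integrability at infinity.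

    Plancherel is replaced by a smoothed identity that needs only Fubini. *)

Section BorelSpace.
Variable R : realType.

(* The carrier is ['rV[R]_d]; the type only adds the Borel sigma-algebra. *)
Definition bvec (d : nat) := g_sigma_algebraType (@rects R d).

Lemma meas_funP (d : nat) (f : 'rV[R]_d -> R) :
  meas_fun f <-> measurable_fun [set: bvec d] (f : bvec d -> R).
Proof.
split=> [mf _ B mB|mf B mB]; first by rewrite setTI; exact: mf.
by have := mf measurableT B mB; rewrite setTI.
Qed.

Lemma measurable_rect (d : nat) (B : 'I_d -> set R) :
  (forall i, measurable (B i)) ->
  measurable ([set x : 'rV[R]_d | forall i, B i (x 0 i)] : set (bvec d)).
Proof. by move=> mB; apply: sub_sigma_algebra; exists B. Qed.

Lemma measurable_coord (d : nat) (i : 'I_d) :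
  measurable_fun setT (fun x : bvec d => (x : 'rV[R]_d) 0 i).
Proof.
move=> _ B mB; rewrite setTI.
pose B' j := if j == i then B else setT.
rewrite (_ : _ @^-1` _ = [set x : 'rV[R]_d | forall j, B' j (x 0 j)]).
  by apply: measurable_rect => j; rewrite /B'; case: ifP.
apply/seteqP; split=> x /= H.
  by move=> j; rewrite /B'; case: eqP => [->|].
by have := H i; rewrite /B' eqxx.
Qed.

Lemma measurable_fun_bvec (disp : measure_display) (T : measurableType disp)
    (d : nat) (f : T -> 'rV[R]_d) :
  (forall i, measurable_fun setT (fun t => f t 0 i)) ->
  measurable_fun setT (f : T -> bvec d).
Proof.
move=> mf; apply: (@measurability _ _ _ (bvec d) setT f (@rects R d)) => //.
move=> _ [_ [B [mB ->] <-]].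
rewrite (_ : _ `&` _ = \bigcap_(i in [set: 'I_d]) ((fun t => f t 0 i) @^-1` B i)).
  apply: fin_bigcap_measurable; first exact: finite_finset.
  by move=> i _; rewrite -[X in measurable X]setTI; apply: mf.
by rewrite setTI; apply/seteqP; split=> t /= H i; [move=> _|]; apply: H.
Qed.

(** The block row by which the recursion of [iint] builds its argument, so that Tonelli for the
    image measure below reproduces that recursion. *)
Definition bcons (n : nat) (p : measurableTypeR R * bvec n) : bvec n.+1 :=
  row_mx (const_mx p.1 : 'rV[R]_1) (p.2 : 'rV[R]_n).

Lemma bcons0 (n : nat) (p : measurableTypeR R * bvec n) : (bcons p : 'rV[R]_n.+1) 0 ord0 = p.1.
Proof.
have -> : ord0 = lshift n (ord0 : 'I_1) by apply: val_inj.
by rewrite (@row_mxEl _ 1 1 n) mxE.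
Qed.

Lemma bconsS (n : nat) (p : measurableTypeR R * bvec n) (i : 'I_n) :
  (bcons p : 'rV[R]_n.+1) 0 (lift ord0 i) = (p.2 : 'rV[R]_n) 0 i.
Proof.
have -> : lift ord0 i = rshift 1 i by apply: val_inj.
by rewrite (@row_mxEr _ 1 1 n).
Qed.

Lemma measurable_bcons (n : nat) : measurable_fun setT (@bcons n).
Proof.
apply: measurable_fun_bvec => i; case: (unliftP ord0 i) => [j ->|->].
  under eq_fun do rewrite bconsS.
  exact: (measurableT_comp (measurable_coord j) measurable_snd).
by under eq_fun do rewrite bcons0; exact: measurable_fst.
Qed.

Lemma measurable_bcons_pair (n : nat) (x : measurableTypeR R) :
  measurable_fun setT (fun v : bvec n => bcons (x, v)).
Proof. exact: (measurableT_comp (@measurable_bcons n) (pair1_measurable x)). Qed.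

Section bmu_succ.
Variables (n : nat) (m : {sigma_finite_measure set (bvec n) -> \bar R}).
Let leb : {sigma_finite_measure set (measurableTypeR R) -> \bar R} :=
  @lebesgue_measure R.

(** Row vectors are not pairs, so the product measure is carried over to them by [bcons]. *)
Definition bmu_succ : set (bvec n.+1) -> \bar R :=
  pushforward (leb \x m)%E (@bcons n).

Let bmu_succ0 : bmu_succ set0 = 0%E.
Proof. by rewrite /bmu_succ /pushforward preimage_set0 measure0. Qed.

Let bmu_succ_ge0 A : (0 <= bmu_succ A)%E.
Proof. by rewrite /bmu_succ /pushforward; apply: (@measure_ge0 _ _ _ (leb \x m)%E). Qed.

Let bmu_succ_sigma_additive : semi_sigma_additive bmu_succ.
Proof.
move=> F mF tF mUF; rewrite /bmu_succ /pushforward preimage_bigcup.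
apply: measure_semi_sigma_additive.
- by move=> k; rewrite -[X in measurable X]setTI; exact: measurable_bcons.
- apply/trivIsetP => /= i j _ _ ij; rewrite -preimage_setI.
  by move/trivIsetP : tF => /(_ _ _ _ _ ij) ->//; rewrite preimage_set0.
- by rewrite -preimage_bigcup -[X in measurable X]setTI; exact: measurable_bcons.
Qed.

HB.instance Definition _ := isMeasure.Build _ _ _ bmu_succ
  bmu_succ0 bmu_succ_ge0 bmu_succ_sigma_additive.

Let bmu_succ_sigma_finite : sigma_finite setT bmu_succ.
Proof.
have [A [AT ndA mA]] := (sigma_finiteP setT leb).1 (sigma_finiteT leb).
have [B [BT ndB mB]] := (sigma_finiteP setT m).1 (sigma_finiteT m).
(* Head and tail invert [bcons]; they pull the exhausting sets of the two factors back to sets of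
   row vectors. *)
pose hd (x : bvec n.+1) := (x : 'rV[R]_n.+1) 0 ord0.
pose tl (x : bvec n.+1) : bvec n := \row_i (x : 'rV[R]_n.+1) 0 (lift ord0 i).
have mhd : measurable_fun setT hd by exact: measurable_coord.
have mtl : measurable_fun setT tl.
  apply: measurable_fun_bvec => i.
  by under eq_fun do rewrite mxE; exact: measurable_coord.
exists (fun k => hd @^-1` A k `&` tl @^-1` B k).
  apply/seteqP; split=> x // _.
  have : [set: measurableTypeR R] (hd x) by [].
  rewrite AT => -[i _ Ai]; have : [set: bvec n] (tl x) by [].
  rewrite BT => -[j _ Bj]; exists (maxn i j) => //; split => /=.
    by move/subsetPset: (ndA _ _ (leq_maxl i j)); exact.
  by move/subsetPset: (ndB _ _ (leq_maxr i j)); exact.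
move=> k; split.
  by apply: measurableI; rewrite -[X in measurable X]setTI;
    [apply: mhd => //; exact: (mA k).1|apply: mtl => //; exact: (mB k).1].
rewrite /bmu_succ /pushforward (_ : _ @^-1` _ = A k `*` B k).
  by rewrite product_measure1E ?lte_mul_pinfty// ?ge0_fin_numE; case: (mA k); case: (mB k).
apply/seteqP; split=> -[u v]; rewrite /preimage /= /hd /tl bcons0/=;
  rewrite (_ : \row_i _ = v) //; apply/rowP => i; by rewrite mxE (bconsS (u, v)).
Qed.

HB.instance Definition _ := @Measure_isSigmaFinite.Build _ _ _ bmu_succ
  bmu_succ_sigma_finite.

End bmu_succ.

Fixpoint bmu (n : nat) : {sigma_finite_measure set (bvec n) -> \bar R} :=
  match n with
  | 0 => @dirac _ (bvec 0) (0 : 'rV[R]_0) R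
  | n'.+1 => bmu_succ (bmu n')
  end.

Lemma ge0_integral_bmuS (n : nat) (f : bvec n.+1 -> \bar R) :
  measurable_fun setT f -> (forall x, 0 <= f x)%E ->
  (\int[bmu n.+1]_x f x =
   \int[@lebesgue_measure R]_x \int[bmu n]_v f (bcons (x, v)))%E.
Proof.
move=> mf f0.
have /= -> := @ge0_integral_pushforward _ _ _ _ R _ (@measurable_bcons n)
  ((@lebesgue_measure R : {sigma_finite_measure set (measurableTypeR R) -> \bar R}) \x bmu n)%E
  setT f measurableT mf (fun x _ => f0 x).
rewrite preimage_setT fubini_tonelli1//.
by apply: measurableT_comp => //; exact: measurable_bcons.
Qed.

(** Turns the iterated integral of the statement into integration against a sigma-finite measure,
    which opens the way to Fubini and dominated convergence. *)
Lemma iintE (d : nat) (f : bvec d -> \bar R) :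
  measurable_fun setT f -> (forall x, 0 <= f x)%E ->
  iint f = (\int[bmu d]_x f x)%E.
Proof.
elim: d f => [|n IH] f mf f0.
  by rewrite /= integral_dirac// diracT mul1e.
rewrite ge0_integral_bmuS//=; apply: eq_integral => x _.
by rewrite IH//; exact: (measurableT_comp mf (measurable_bcons_pair x)).
Qed.

Lemma lebesgue_measure_affine (c a : R) (A : set R) : 0 < c -> measurable A ->
  lebesgue_measure ((fun x : R => c * x + a) @^-1` A) =
  (c^-1%:E * lebesgue_measure A)%E.
Proof.
move=> c0 mA.
have mf : measurable_fun [set: measurableTypeR R]
    ((fun x : R => c * x + a) : _ -> measurableTypeR R).
  apply: (@continuous_measurable_fun R) => x.
  apply: cvgD; last exact: cvg_cst.
  by apply: cvgM; [exact: cvg_cst|exact: cvg_id].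
have c0' := ltW c0.
(* c times the image of Lebesgue measure under the affine map gives every interval its length;
   uniqueness of Lebesgue measure identifies the two. *)
pose m : {measure set (measurableTypeR R) -> \bar R} :=
  mscale (NngNum c0') (@measure_function_pushforward__canonical__measure_function_Measure
    _ _ _ _ _ (@lebesgue_measure R) _ mf).
have -> : lebesgue_measure A = m A.
  apply: lebesgue_measure_unique => // _ [[u v]] _ <-.
  rewrite /m /= /mscale /= /pushforward.
  have -> : (fun x : R => c * x + a) @^-1` `]u, v] = `](u - a) / c, (v - a) / c]%classic.
    apply/seteqP; split=> x /=; rewrite !in_itv/= ltr_pdivrMr// ler_pdivlMr//;
      by rewrite ltrBlDr lerBrDr mulrC.
  rewrite !lebesgue_measure_itv/= !lte_fin ltr_pM2r ?invr_gt0// ltrD2r.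
  case: ifP => _; last by rewrite mule0.
  by rewrite -!EFinB -EFinM; congr EFin; field; rewrite gt_eqF.
by rewrite /m /= /mscale /= muleA -EFinM mulVf ?gt_eqF// mul1e.
Qed.

Lemma ge0_integral_affine1 (c a : R) (f : R -> \bar R) : 0 < c ->
  measurable_fun [set: measurableTypeR R] f -> (forall x, 0 <= f x)%E ->
  (\int[@lebesgue_measure R]_x f (c * x + a)%R =
   c^-1%:E * \int[@lebesgue_measure R]_x f x)%E.
Proof.
move=> c0 mf f0.
have mg : measurable_fun [set: measurableTypeR R]
    ((fun x : R => c * x + a) : _ -> measurableTypeR R).
  apply: (@continuous_measurable_fun R) => x.
  apply: cvgD; last exact: cvg_cst.
  by apply: cvgM; [exact: cvg_cst|exact: cvg_id].
have := @ge0_integral_pushforward _ _ _ _ R _ mg (@lebesgue_measure R)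
  setT f measurableT mf (fun x _ => f0 x).
rewrite preimage_setT /comp => <-.
have c0' : 0 <= c^-1 by rewrite invr_ge0 ltW.
rewrite (eq_measure_integral (mscale (NngNum c0') (@lebesgue_measure R))).
  by rewrite ge0_integral_mscale.
by move=> A mA _; rewrite /= /mscale /pushforward; apply: lebesgue_measure_affine.
Qed.

Lemma measurable_affine (d : nat) (c : R) (a : 'rV[R]_d) :
  measurable_fun [set: bvec d] ((fun x : 'rV[R]_d => c *: x + a) : _ -> bvec d).
Proof.
apply: measurable_fun_bvec => i; under eq_fun do rewrite !mxE.
apply: measurable_funD; last exact: measurable_cst.
by apply: measurable_funM; [exact: measurable_cst|exact: measurable_coord].
Qed.

(** Induction on the dimension: every coordinate contributes one factor c^-1 through the
    one-variable substitution. *)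
Lemma ge0_integral_affine (d : nat) (c : R) (a : 'rV[R]_d) (f : bvec d -> \bar R) :
  0 < c -> measurable_fun setT f -> (forall x, 0 <= f x)%E ->
  (\int[bmu d]_x f (c *: (x : 'rV[R]_d) + a)%R =
   (c^-1 ^+ d)%:E * \int[bmu d]_x f x)%E.
Proof.
move=> c0; elim: d a f => [|n IH] a f mf f0.
  rewrite /= !integral_dirac//.
    rewrite diracT !mul1e; congr (f _).
    by apply/rowP => -[].
  exact: (measurableT_comp mf (measurable_affine c a)).
rewrite ge0_integral_bmuS//; last exact: (measurableT_comp mf (measurable_affine c a)).
rewrite ge0_integral_bmuS//.
pose a0 := a 0 ord0; pose a1 : 'rV[R]_n := \row_i a 0 (lift ord0 i).
pose G (x : measurableTypeR R) := (\int[bmu n]_v f (bcons (x, v)))%E.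
have mG : measurable_fun setT G.
  apply: (@measurable_fun_fubini_tonelli_F _ _ _ _ R (bmu n) (f \o @bcons n)); last by move=> z; apply: f0.
  exact: (measurableT_comp mf (@measurable_bcons n)).
transitivity (\int[@lebesgue_measure R]_x ((c^-1 ^+ n)%:E * G (c * x + a0)%R))%E.
  apply: eq_integral => x _.
  rewrite /G -(IH a1 (fun v => f (bcons (c * x + a0, v))))//; last first.
    exact: (measurableT_comp mf (measurable_bcons_pair _)).
  apply: eq_integral => v _; congr (f _).
  have E (u : 'rV[R]_n.+1) i : (c *: u + a) 0 i = c * u 0 i + a 0 i by rewrite !mxE.
  apply/rowP => i; rewrite E; case: (unliftP ord0 i) => [j ->|->].
    by rewrite !bconsS !mxE.
  by rewrite !bcons0.
have G0 x : (0 <= G x)%E by apply: integral_ge0.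
have mGa : measurable_fun [set: measurableTypeR R] (fun x => G (c * x + a0)).
  apply: (@measurableT_comp _ _ _ _ _ _ G) => //.
  apply: (@continuous_measurable_fun R) => x.
  apply: cvgD; last exact: cvg_cst.
  by apply: cvgM; [exact: cvg_cst|exact: cvg_id].
rewrite (ge0_integralZl (@lebesgue_measure R) measurableT mGa).
- by rewrite (ge0_integral_affine1 a0 c0 mG G0) muleA -EFinM -exprSr.
- by move=> x _; apply: G0.
- by rewrite lee_fin exprn_ge0// invr_ge0 ltW.
Qed.

Lemma ge0_integral_prod_coord (d : nat) (w : 'I_d -> R -> R) :
  (forall i, measurable_fun [set: R] (w i)) ->
  (forall i x, 0 <= w i x) ->
  (\int[bmu d]_x (\prod_i w i ((x : 'rV[R]_d) 0 i))%:E =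
   \prod_i \int[@lebesgue_measure R]_x (w i x)%:E)%E.
Proof.
elim: d w => [|n IH] w mw w0.
  rewrite /= integral_dirac//; first by rewrite diracT mul1e !big_ord0.
  by under eq_fun do rewrite big_ord0; exact: measurable_cst.
have mprod m (u : 'I_m -> R -> R) :
    (forall i, measurable_fun [set: R] (u i)) ->
    measurable_fun setT (fun x : bvec m => \prod_i u i ((x : 'rV[R]_m) 0 i)).
  move=> mu; apply: measurable_prod => i _.
  exact: (measurableT_comp (mu i) (measurable_coord i)).
rewrite ge0_integral_bmuS//; last 2 first.
- by apply/measurable_EFinP; apply: mprod.
- by move=> x; rewrite lee_fin; apply: prodr_ge0.
rewrite big_ord_recl.
pose P (v : bvec n) := \prod_(i < n) w (lift ord0 i) ((v : 'rV[R]_n) 0 i).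
have mP : measurable_fun setT (fun v => (P v)%:E).
  by apply/measurable_EFinP; apply: (mprod n (fun i => w (lift ord0 i))).
have P0 v : (0 <= (P v)%:E)%E by rewrite lee_fin; apply: prodr_ge0.
transitivity (\int[@lebesgue_measure R]_x
    ((w ord0 x)%:E * \int[bmu n]_v (P v)%:E))%E.
  apply: eq_integral => x _.
  rewrite -(ge0_integralZl (bmu n) measurableT mP)// ?lee_fin ?w0//.
  apply: eq_integral => v _; rewrite -EFinM; congr EFin.
  by rewrite big_ord_recl bcons0; under eq_bigr do rewrite bconsS.
have mw0 : measurable_fun [set: measurableTypeR R] (fun x => (w ord0 x)%:E).
  by apply/measurable_EFinP; exact: (mw ord0).
rewrite (ge0_integralZr (@lebesgue_measure R) measurableT mw0)//.
- by rewrite (IH (fun i => w (lift ord0 i))).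
- by move=> x _; rewrite lee_fin w0.
- exact: integral_ge0.
Qed.

End BorelSpace.

(** * Real-valued integrals *)

Section RealIntegral.
Context d (T : measurableType d) (R : realType) (m : {measure set T -> \bar R}).

Lemma integrable_le (f g : T -> R) : measurable_fun setT f ->
  (forall x, `|f x| <= g x) -> m.-integrable setT (EFin \o g) ->
  m.-integrable setT (EFin \o f).
Proof.
move=> mf fg ig; apply: (le_integrable _ _ _ ig) => //; first exact/measurable_EFinP.
by move=> x _ /=; rewrite lee_fin (le_trans (fg x))// ler_norm.
Qed.

Lemma ge0_integrable (f : T -> R) : measurable_fun setT f ->
  (forall x, 0 <= f x) -> (\int[m]_x (f x)%:E < +oo)%E ->
  m.-integrable setT (EFin \o f).
Proof.
move=> mf f0 foo; apply/integrableP; split; first exact/measurable_EFinP.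
by under eq_integral do rewrite /= ger0_norm//.
Qed.

Lemma Rintegral_EFin (f : T -> R) : m.-integrable setT (EFin \o f) ->
  (\int[m]_x f x)%:E = (\int[m]_x (f x)%:E)%E.
Proof. by move=> fi; rewrite /Rintegral fineK//; exact: integrable_fin_num. Qed.

Lemma integrable_mulr_bounded (f g : T -> R) (M : R) :
  measurable_fun setT g -> (forall x, `|g x| <= M) ->
  m.-integrable setT (EFin \o f) -> m.-integrable setT (EFin \o (fun x => g x * f x)).
Proof.
move=> mg gM fi.
have mf : measurable_fun setT f by apply/measurable_EFinP; exact: measurable_int fi.
apply: (@integrable_le _ (fun x => M * `|f x|)).
- exact: measurable_funM.
- by move=> x; rewrite normrM ler_wpM2r.
- rewrite (_ : _ \o _ = (fun x => M%:E * (`|f x|%R)%:E)%E)//.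
  by apply: integrableZl => //; exact: integrable_norm.
Qed.

Lemma Rintegral_dominated_cvg (D : set T) (f_ : nat -> T -> R) (f g : T -> R) :
  measurable D ->
  (forall n, measurable_fun D (f_ n)) ->
  measurable_fun D f ->
  m.-integrable D (EFin \o g) ->
  (forall n x, D x -> `|f_ n x| <= g x) ->
  (forall x, D x -> f_ n x @[n --> \oo] --> f x) ->
  \int[m]_(x in D) f_ n x @[n --> \oo] --> \int[m]_(x in D) f x.
Proof.
move=> mD mf_ mf ig fg cf.
have [] := @dominated_convergence _ _ _ m D mD
  (fun n => EFin \o f_ n) (EFin \o f) (EFin \o g).
- by move=> n; exact/measurable_EFinP.
- exact/measurable_EFinP.
- by apply: aeW => x Dx; apply: cvg_EFin; [exact: nearW|exact: cf].
- exact: ig.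
- by apply: aeW => x n Dx /=; rewrite lee_fin; exact: fg.
move=> fi _ h; rewrite /Rintegral.
have -> : (\int[m]_(x in D) (f x)%:E)%E = (fine (\int[m]_(x in D) (f x)%:E))%:E.
  by rewrite fineK//; exact: integrable_fin_num.
apply: fine_cvg; rewrite fineK//; exact: integrable_fin_num.
Qed.

End RealIntegral.

Section RealFubini.
Context d1 d2 (T1 : measurableType d1) (T2 : measurableType d2) (R : realType).
Variables (m1 : {sigma_finite_measure set T1 -> \bar R})
  (m2 : {sigma_finite_measure set T2 -> \bar R}).

Lemma integrable_prodM (f : T1 -> R) (g : T2 -> R) :
  m1.-integrable setT (EFin \o f) -> m2.-integrable setT (EFin \o g) ->
  (m1 \x m2)%E.-integrable setT (EFin \o (fun z => f z.1 * g z.2)).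
Proof.
move=> fi gi.
have mf : measurable_fun setT f by apply/measurable_EFinP; exact: measurable_int fi.
have mg : measurable_fun setT g by apply/measurable_EFinP; exact: measurable_int gi.
apply/integrable12ltyP.
  apply/measurable_EFinP; apply: measurable_funM.
    exact: (measurableT_comp mf measurable_fst).
  exact: (measurableT_comp mg measurable_snd).
rewrite (eq_integral (fun x => `|f x|%:E * \int[m2]_y `|g y|%:E)%E); last first.
  move=> x _ /=; rewrite -ge0_integralZl//.
    by apply: eq_integral => y _; rewrite normrM EFinM.
  by apply/measurable_EFinP; exact: measurableT_comp.
rewrite ge0_integralZr//.
- rewrite lte_mul_pinfty//.
  + exact: integral_ge0.
  + rewrite ge0_fin_numE ?integral_ge0//.
    by case/integrableP: fi.
  + by case/integrableP: gi.
- by apply/measurable_EFinP; exact: measurableT_comp.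
- exact: integral_ge0.
Qed.

(** Where the inner integral diverges, [fine] returns 0, so the real-valued inner integral is still
    dominated by the extended one. *)
Lemma integrable_Rint_section2 (f : T1 * T2 -> R) :
  (m1 \x m2)%E.-integrable setT (EFin \o f) ->
  m1.-integrable setT (EFin \o (fun x => \int[m2]_y f (x, y))).
Proof.
move=> fi; have Fi := integrable_fubini_F fi.
have mF : measurable_fun setT (fun x => \int[m2]_y f (x, y)).
  exact: (measurableT_comp (fine_measurable measurableT) (measurable_int _ Fi)).
apply/integrableP; split; first exact/measurable_EFinP.
apply: le_lt_trans (integrable_lty _ (integrable_abse Fi)); last exact: measurableT.
apply: ge0_le_integral => //.
- by apply: measurableT_comp => //; exact/measurable_EFinP.
- by apply: measurableT_comp => //; exact: measurable_int Fi.
- move=> x _ /=; rewrite /fubini_F /Rintegral /comp /=.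
  by case: (\int[m2]_y _)%E => //=; rewrite leey.
Qed.

Lemma Rintegral_fubini1 (f : T1 * T2 -> R) :
  (m1 \x m2)%E.-integrable setT (EFin \o f) ->
  \int[m1]_x \int[m2]_y f (x, y) = \int[(m1 \x m2)%E]_z f z.
Proof.
move=> fi; rewrite {3}/Rintegral -(integral12_prod_meas1 fi) {1}/Rintegral.
congr fine; apply: ae_eq_integral => //.
- exact: (measurable_int _ (integrable_Rint_section2 fi)).
- exact: (measurable_fubini_F fi).
have := integrable_ae measurableT (integrable_fubini_F fi).
apply: filterS => x /(_ I) h _ /=.
by rewrite /Rintegral fineK.
Qed.

End RealFubini.

Section RealFubiniSwap.
Context d1 d2 (T1 : measurableType d1) (T2 : measurableType d2) (R : realType).
Variables (m1 : {sigma_finite_measure set T1 -> \bar R})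
  (m2 : {sigma_finite_measure set T2 -> \bar R}).

Lemma integrable_prod_swap (f : T1 * T2 -> R) :
  (m1 \x m2)%E.-integrable setT (EFin \o f) ->
  (m2 \x m1)%E.-integrable setT (EFin \o (fun z => f (z.2, z.1))).
Proof.
move=> fi; have mf := measurable_int _ fi.
have := (integrable21ltyP m1 m2 mf).1 fi => h.
apply/integrable12ltyP => //.
by apply: (measurableT_comp mf); exact: measurable_swap.
Qed.

Lemma Rintegral_fubini_swap (f : T1 -> T2 -> R) :
  (m1 \x m2)%E.-integrable setT (EFin \o (fun z => f z.1 z.2)) ->
  \int[m1]_x \int[m2]_y f x y = \int[m2]_y \int[m1]_x f x y.
Proof.
move=> fi; have mf := measurable_int _ fi.
have fi' := integrable_prod_swap fi.
rewrite (Rintegral_fubini1 fi) (Rintegral_fubini1 fi').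
rewrite /Rintegral -(integral21_prod_meas1 fi) -(integral12_prod_meas1 fi').
by [].
Qed.

End RealFubiniSwap.

(** * One-variable calculus *)

Section Calculus.
Variable R : realType.
Implicit Types (f g : R -> R) (x a b : R).

Lemma derive_add f g x a b : is_derive x (1 : R) f a -> is_derive x (1 : R) g b ->
  is_derive x (1 : R) (fun y => f y + g y) (a + b).
Proof. by move=> df dg; exact: is_deriveD. Qed.

Lemma derive_opp f x a : is_derive x (1 : R) f a ->
  is_derive x (1 : R) (fun y => - f y) (- a).
Proof. by move=> df; exact: is_deriveN. Qed.

Lemma derive_sub f g x a b : is_derive x (1 : R) f a -> is_derive x (1 : R) g b ->
  is_derive x (1 : R) (fun y => f y - g y) (a - b).
Proof. by move=> df dg; exact: is_deriveB. Qed.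

Lemma derive_mul f g x a b : is_derive x (1 : R) f a -> is_derive x (1 : R) g b ->
  is_derive x (1 : R) (fun y => f y * g y) (a * g x + f x * b).
Proof.
move=> df dg; apply: (is_derive_eq (is_deriveM df dg)).
by rewrite addrC /GRing.scale/= mulrC.
Qed.

Lemma derive_const x a : is_derive x (1 : R) (fun=> a) (0 : R).
Proof. exact: is_derive_cst. Qed.

Lemma derive_idfun x : is_derive x (1 : R) (fun y : R => y) (1 : R).
Proof. exact: is_derive_id. Qed.

Lemma derive_comp f g x a b : is_derive x (1 : R) g b -> is_derive (g x) (1 : R) f a ->
  is_derive x (1 : R) (fun y => f (g y)) (a * b).
Proof. by move=> dg df; exact: is_derive1_comp. Qed.

Lemma derive_inv f x a : f x != 0 -> is_derive x (1 : R) f a ->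
  is_derive x (1 : R) (fun y => (f y)^-1) (- a / f x ^+ 2).
Proof.
move=> fx df; apply: (is_derive_eq (is_deriveV fx df)).
by rewrite /GRing.scale/= mulrC mulrN mulNr.
Qed.

Lemma derive_scale (c : R) x : is_derive x (1 : R) (fun y : R => c * y) c.
Proof.
by apply: (is_derive_eq (derive_mul (derive_const x c) (derive_idfun x))); rewrite mul0r mulr1 add0r.
Qed.

Lemma is_derive_continuous f x a : is_derive x (1 : R) f a -> {for x, continuous f}.
Proof.
move=> [df _]; apply: differentiable_continuous; exact/derivable1_diffP.
Qed.

Lemma derive1_eq f x a : is_derive x (1 : R) f a -> derive1 f x = a.
Proof. by move=> [_ <-]; rewrite derive1E. Qed.

(** The derivative is required only in the open interval, so that the ray equation, singular at t =
    0, can still be integrated from 0. *)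
Lemma nonincreasing_itv f (f' : R -> R) a b : a <= b ->
  (forall x, a < x < b -> is_derive x (1 : R) f (f' x)) ->
  (forall x, a < x < b -> f' x <= 0) ->
  {within `[a, b], continuous f} -> f b <= f a.
Proof.
move=> ab df f'0 cf.
have H x : x \in `]a, b[ -> a < x < b by rewrite in_itv.
apply: (@ler0_derive1_le_cc _ f a b) => //.
- by move=> x /H hx; case: (df x hx).
- by move=> x /H hx; rewrite (derive1_eq (df x hx)); exact: f'0.
- by rewrite in_itv/= lexx ab.
- by rewrite in_itv/= lexx ab.
Qed.

Lemma continuous_within f (A : set R) : (forall x, {for x, continuous f}) ->
  {within A, continuous f}.
Proof. by move=> cf; apply: continuous_subspaceT => x; exact: cf. Qed.

(** An antiderivative of e^(-u) cos(a u); it yields 1 / (1 + a^2) for the integral over the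
    half-line. *)
Let lapl a (u : R) := (expR (- u) * (a * sin (a * u) - cos (a * u))) / (1 + a ^+ 2).

Let den_neq0 a : 1 + a ^+ 2 != 0 :> R.
Proof. by rewrite gt_eqF// ltr_pwDl// sqr_ge0. Qed.

Let derive_expRN x : is_derive x (1 : R) (fun u : R => expR (- u)) (- expR (- x)).
Proof.
by apply: (is_derive_eq (derive_comp (derive_opp (derive_idfun x)) (is_derive_expR (- x)))); rewrite mulrN1.
Qed.

Let derive_lapl a x : is_derive x (1 : R) (lapl a) (expR (- x) * cos (a * x)).
Proof.
have ds := derive_comp (derive_scale a x) (is_derive_sin (a * x)).
have dc := derive_comp (derive_scale a x) (is_derive_cos (a * x)).
by apply: (is_derive_eq (derive_mul (derive_mul (derive_expRN x)
  (derive_sub (derive_mul (derive_const x a) ds) dc)) (derive_const x (1 + a ^+ 2)^-1))); field.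
Qed.

Let expRN_cvg0 : expR (- x) @[x --> +oo] --> (0 : R).
Proof.
apply/cvgrPdist_lt => e e0.
near=> x; rewrite sub0r normrN ger0_norm ?expR_ge0//.
have x0 : 0 < x by near: x; exact: nbhs_pinfty_gt.
rewrite expRN invf_plt ?posrE ?expR_gt0//.
apply: lt_le_trans (expR_ge1Dx x).
rewrite -ltrBlDl; near: x; apply: nbhs_pinfty_gt; exact: num_real.
Unshelve. all: by end_near. Qed.

Let lapl_cvg0 a : lapl a x @[x --> +oo] --> (0 : R).
Proof.
apply: (@squeeze_cvgr _ _ _ _ (fun x => - (expR (- x) * ((`|a| + 1) / (1 + a ^+ 2))))
  (fun x => expR (- x) * ((`|a| + 1) / (1 + a ^+ 2)))).
- apply: nearW => x.
  have : `|lapl a x| <= expR (- x) * ((`|a| + 1) / (1 + a ^+ 2)).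
    rewrite /lapl mulrA normrM [X in _ * X]ger0_norm; last first.
      by rewrite invr_ge0 addr_ge0// sqr_ge0.
    rewrite ler_wpM2r ?invr_ge0 ?addr_ge0 ?sqr_ge0//.
    rewrite normrM ger0_norm ?expR_ge0// ler_wpM2l ?expR_ge0//.
    apply: le_trans (ler_normB _ _) _; apply: lerD.
      by rewrite normrM -[leRHS]mulr1 ler_wpM2l// ler_norml sin_geN1 sin_le1.
    rewrite ler_norml. by rewrite cos_geN1 cos_le1.
  by rewrite ler_norml.
- rewrite -[X in _ --> X]oppr0; apply: cvgN.
  rewrite -[X in _ --> X](mul0r ((`|a| + 1) / (1 + a ^+ 2))).
  by apply: cvgM; [exact: expRN_cvg0|exact: cvg_cst].
- rewrite -[X in _ --> X](mul0r ((`|a| + 1) / (1 + a ^+ 2))).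
  by apply: cvgM; [exact: expRN_cvg0|exact: cvg_cst].
Qed.

Lemma integral_expRN :
  (\int[@lebesgue_measure R]_(u in `[0%R, +oo[) (expR (- u))%:E = 1)%E.
Proof.
rewrite (@ge0_continuous_FTC2y _ _ (fun u => - expR (- u)) 0 0).
- by rewrite !oppr0 expR0 sub0e EFinN oppeK.
- by move=> x _; exact: expR_ge0.
- apply: continuous_within => x; exact: is_derive_continuous (derive_expRN x).
- rewrite -[X in _ --> X]oppr0; apply: cvgN; exact: expRN_cvg0.
- by move=> x _; case: (derive_opp (derive_expRN x)).
- apply: cvg_at_right_filter.
  exact: is_derive_continuous (derive_opp (derive_expRN 0)).
- by move=> x _; rewrite (derive1_eq (derive_opp (derive_expRN x))) opprK.
Qed.

(** The difference 1 - cos keeps the integrand nonnegative, as the improper fundamental theorem of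
    calculus demands. *)
Lemma integral_expRN_subcos a :
  (\int[@lebesgue_measure R]_(u in `[0%R, +oo[) (expR (- u) * (1 - cos (a * u)))%:E =
  (1 - (1 + a ^+ 2)^-1)%:E)%E.
Proof.
have dF x := derive_sub (derive_opp (derive_expRN x)) (derive_lapl a x).
rewrite (@ge0_continuous_FTC2y _ _ (fun u => - expR (- u) - lapl a u) 0 0).
- rewrite /lapl oppr0 expR0 mulr0 sin0 cos0 mulr0 -EFinB; congr EFin.
  by field.
- by move=> x _; rewrite mulr_ge0 ?expR_ge0// subr_ge0 cos_le1.
- apply: continuous_within => x.
  exact: (is_derive_continuous (derive_mul (derive_expRN x) (derive_sub (derive_const x 1)
    (derive_comp (derive_scale a x) (is_derive_cos (a * x)))))).
- rewrite -[X in _ --> X]subr0 -[X in _ --> X - _]oppr0.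
  by apply: cvgB; [apply: cvgN; exact: expRN_cvg0|exact: lapl_cvg0].
- by move=> x _; case: (dF x).
- apply: cvg_at_right_filter; exact: is_derive_continuous (dF 0).
- by move=> x _; rewrite (derive1_eq (dF x)) opprK mulrBr mulr1.
Qed.

Lemma continuous_expRabs : continuous (fun u : R => expR (- `|u|)).
Proof.
move=> x; apply: (@continuous_comp _ _ _ (fun u : R => - `|u|) (@expR R)).
  by apply: cvgN; exact: norm_continuous.
exact: continuous_expR.
Qed.

Lemma continuous_coscale a : continuous (fun u : R => cos (a * u)).
Proof.
move=> x; exact: is_derive_continuous (derive_comp (derive_scale a x) (is_derive_cos (a * x))).
Qed.

Lemma integral_expRabs :
  (\int[@lebesgue_measure R]_u (expR (- `|u : R|))%:E = 2%:E)%E.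
Proof.
rewrite ge0_symfun_integralT; last 3 first.
- by move=> x; exact: expR_ge0.
- exact: continuous_expRabs.
- by move=> x /=; rewrite normrN.
rewrite -set_itvcy -[RHS]mule1 -integral_expRN; congr (_ * _)%E.
apply: eq_integral => x; rewrite inE/= in_itv/= andbT => x0; by rewrite ger0_norm.
Qed.

Lemma integral_expRabs_subcos a :
  (\int[@lebesgue_measure R]_u (expR (- `|u : R|) * (1 - cos (a * u)))%:E =
   (2 * (1 - (1 + a ^+ 2)^-1))%:E)%E.
Proof.
rewrite ge0_symfun_integralT; last 3 first.
- by move=> x; rewrite mulr_ge0 ?expR_ge0// subr_ge0 cos_le1.
- move=> x; apply: cvgM; first exact: continuous_expRabs.
  by apply: cvgB; [exact: cvg_cst|exact: continuous_coscale].
- by move=> x /=; rewrite normrN mulrN cosN.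
rewrite -set_itvcy EFinM -integral_expRN_subcos; congr (_ * _)%E.
apply: eq_integral => x; rewrite inE/= in_itv/= andbT => x0; by rewrite ger0_norm.
Qed.

Lemma powRN_cvgy (q : R) : 0 < q -> x `^ (- q) @[x --> +oo] --> (0 : R).
Proof.
move=> q0; apply/cvgrPdist_lt => e e0.
near=> x; rewrite sub0r normrN ger0_norm ?powR_ge0//.
have Ax : e^-1 `^ q^-1 < x by near: x; apply: nbhs_pinfty_gt; exact: num_real.
have A0 : 0 < e^-1 `^ q^-1 by rewrite powR_gt0// invr_gt0.
have x0 := lt_trans A0 Ax.
rewrite powRN invf_plt ?posrE ?powR_gt0//.
have : (e^-1 `^ q^-1) `^ q < x `^ q.
  by apply: gt0_ltr_powR => //; rewrite nnegrE ltW.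
by rewrite -powRrM mulVf ?gt_eqF// powRr1// invr_ge0 ltW.
Unshelve. all: by end_near. Qed.

Lemma integral_powR_tail a (q : R) : 0 < a -> 0 < q ->
  (\int[@lebesgue_measure R]_(x in `[a, +oo[) (x `^ (- 1 - q))%:E = (a `^ (- q) / q)%:E)%E.
Proof.
move=> a0 q0.
have dF x : 0 < x -> is_derive x (1 : R) (fun x => - (x `^ (- q) / q)) (x `^ (- 1 - q)).
  move=> x0; apply: (is_derive_eq (derive_opp (derive_mul (is_derive1_powR (- q) x0)
    (derive_const x q^-1)))).
  by rewrite mulr0 addr0 (addrC (- q)); field; rewrite gt_eqF.
have cp x : 0 < x -> {for x, continuous (fun x : R => x `^ (- 1 - q))}.
  by move=> x0; exact: is_derive_continuous (is_derive1_powR _ x0).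
rewrite (@ge0_continuous_FTC2y _ _ (fun x => - (x `^ (- q) / q)) a 0).
- by rewrite -EFinB sub0r opprK.
- by move=> x _; exact: powR_ge0.
- apply: continuous_in_subspaceT => x; rewrite inE/= in_itv/= andbT => ax.
  by apply: cp; exact: lt_le_trans ax.
- rewrite -[X in _ --> X]oppr0 -[X in _ --> - X](mul0r q^-1); apply: cvgN.
  by apply: cvgM; [exact: powRN_cvgy|exact: cvg_cst].
- by move=> x ax; case: (dF x (lt_trans a0 ax)).
- apply: cvg_at_right_filter; exact: is_derive_continuous (dF a a0).
- by move=> x; rewrite in_itv/= andbT => ax; rewrite (derive1_eq (dF x (lt_trans a0 ax))).
Qed.

Lemma integral_1abs_powR (q : R) : 0 < q ->
  (\int[@lebesgue_measure R]_x ((1 + `|x : R|) `^ (- 1 - q))%:E = (2 / q)%:E)%E.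
Proof.
move=> q0.
have p0 x : 0 <= x -> 0 < 1 + x :> R by move=> x0; rewrite ltr_pwDl.
have d1 x : is_derive x (1 : R) (fun x : R => 1 + x) 1.
  by apply: (is_derive_eq (derive_add (derive_const x 1) (derive_idfun x))); rewrite add0r.
have dF x : 0 <= x ->
    is_derive x (1 : R) (fun x => - ((1 + x) `^ (- q) / q)) ((1 + x) `^ (- 1 - q)).
  move=> x0; apply: (is_derive_eq (derive_opp (derive_mul (derive_comp (d1 x)
    (is_derive1_powR (- q) (p0 x x0))) (derive_const x q^-1)))).
  by rewrite mulr0 addr0 mulr1 (addrC (- q)); field; rewrite gt_eqF.
have cp x : 0 <= x -> {for x, continuous (fun x : R => (1 + x) `^ (- 1 - q))}.
  by move=> x0; exact: is_derive_continuous (derive_comp (d1 x) (is_derive1_powR _ (p0 x x0))).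
rewrite ge0_symfun_integralT; last 3 first.
- by move=> x; exact: powR_ge0.
- move=> x; apply: (@continuous_comp _ _ _ (fun x : R => `|x|) (fun x => (1 + x) `^ (- 1 - q))).
    exact: norm_continuous.
  exact: cp.
- by move=> x /=; rewrite normrN.
rewrite -set_itvcy EFinM; congr (_ * _)%E.
transitivity (\int[@lebesgue_measure R]_(x in `[0%R, +oo[) ((1 + x) `^ (- 1 - q))%:E)%E.
  by apply: eq_integral => x; rewrite inE/= in_itv/= andbT => x0; rewrite ger0_norm.
rewrite (@ge0_continuous_FTC2y _ _ (fun x => - ((1 + x) `^ (- q) / q)) 0 0).
- by rewrite -EFinB sub0r opprK addr0 powR1 div1r.
- by move=> x _; exact: powR_ge0.
- by apply: continuous_in_subspaceT => x; rewrite inE/= in_itv/= andbT; exact: cp.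
- rewrite -[X in _ --> X]oppr0 -[X in _ --> - X](mul0r q^-1); apply: cvgN.
  apply: cvgM; last exact: cvg_cst.
  apply: (@cvg_comp _ _ _ (fun x : R => 1 + x) (fun x => x `^ (- q)) _ +oo); last exact: powRN_cvgy.
  apply/cvgryPge => A; near=> x.
  by rewrite -lerBlDl; near: x; apply: nbhs_pinfty_ge; exact: num_real.
- by move=> x x0; case: (dF x (ltW x0)).
- apply: cvg_at_right_filter; exact: is_derive_continuous (dF 0 _).
- by move=> x; rewrite in_itv/= andbT => x0; rewrite (derive1_eq (dF x (ltW x0))).
Unshelve. all: by end_near. Qed.

End Calculus.

(** * Expectations and characteristic functions *)

Section Expectation.
Context d (T : measurableType d) (R : realType) (m : {measure set T -> \bar R}).
Implicit Types (F Z g h : T -> R).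

Definition is_pdf F := [/\ measurable_fun setT F, forall x, 0 <= F x &
  (\int[m]_x (F x)%:E = 1)%E].

Definition expect F g := \int[m]_x (g x * F x).

Lemma pdf_integrable F : is_pdf F -> m.-integrable setT (EFin \o F).
Proof. by move=> [mF F0 F1]; apply: ge0_integrable => //; rewrite F1 ltry. Qed.

Lemma expect_integrable F g (M : R) : is_pdf F -> measurable_fun setT g ->
  (forall x, `|g x| <= M) -> m.-integrable setT (EFin \o (fun x => g x * F x)).
Proof.
move=> pF mg gM; exact: (integrable_mulr_bounded mg gM (pdf_integrable pF)).
Qed.

Lemma expect_cst F (c : R) : is_pdf F -> expect F (fun=> c) = c.
Proof.
move=> pF; rewrite /expect RintegralZl//; last exact: pdf_integrable.
by case: pF => _ _ F1; rewrite /Rintegral F1 mulr1.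
Qed.

Lemma expectD F g h (M N : R) : is_pdf F ->
  measurable_fun setT g -> (forall x, `|g x| <= M) ->
  measurable_fun setT h -> (forall x, `|h x| <= N) ->
  expect F (fun x => g x + h x) = expect F g + expect F h.
Proof.
move=> pF mg gM mh hM; rewrite /expect -RintegralD//.
- by apply: eq_Rintegral => x _; rewrite mulrDl.
- exact: expect_integrable gM.
- exact: expect_integrable hM.
Qed.

Lemma expectZ F g (M c : R) : is_pdf F ->
  measurable_fun setT g -> (forall x, `|g x| <= M) ->
  expect F (fun x => c * g x) = c * expect F g.
Proof.
move=> pF mg gM; rewrite /expect -RintegralZl//; last exact: expect_integrable gM.
by apply: eq_Rintegral => x _; rewrite mulrA.
Qed.

Lemma expectB F g h (M N : R) : is_pdf F ->
  measurable_fun setT g -> (forall x, `|g x| <= M) ->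
  measurable_fun setT h -> (forall x, `|h x| <= N) ->
  expect F (fun x => g x - h x) = expect F g - expect F h.
Proof.
move=> pF mg gM mh hM; rewrite /expect -RintegralB//.
- by apply: eq_Rintegral => x _; rewrite mulrBl.
- exact: expect_integrable gM.
- exact: expect_integrable hM.
Qed.

Lemma expect_lin F g h (M N a b : R) : is_pdf F ->
  measurable_fun setT g -> (forall x, `|g x| <= M) ->
  measurable_fun setT h -> (forall x, `|h x| <= N) ->
  expect F (fun x => a * g x + b * h x) = a * expect F g + b * expect F h.
Proof.
move=> pF mg gM mh hM.
have scal (c : R) (f : T -> R) (P : R) : measurable_fun setT f -> (forall x, `|f x| <= P) ->
    measurable_fun setT (fun x => c * f x) /\ forall x, `|c * f x| <= `|c| * P.
  move=> mf fP; split; first by apply: measurable_funM => //; exact: measurable_cst.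
  by move=> x; rewrite normrM ler_wpM2l.
have [m1 b1] := scal a g M mg gM; have [m2 b2] := scal b h N mh hM.
by rewrite (expectD pF m1 b1 m2 b2) (expectZ _ pF mg gM) (expectZ _ pF mh hM).
Qed.

Lemma expect_le F g h (M N : R) : is_pdf F ->
  measurable_fun setT g -> (forall x, `|g x| <= M) ->
  measurable_fun setT h -> (forall x, `|h x| <= N) ->
  (forall x, g x <= h x) -> expect F g <= expect F h.
Proof.
move=> pF mg gM mh hM gh; apply: le_Rintegral => //.
- exact: expect_integrable gM.
- exact: expect_integrable hM.
- by move=> x _; rewrite ler_wpM2r//; case: pF.
Qed.

Lemma expect_norm_le F g (M : R) : is_pdf F ->
  measurable_fun setT g -> (forall x, `|g x| <= M) -> `|expect F g| <= M.
Proof.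
move=> pF mg gM.
have mM (c : R) : measurable_fun [set: T] (fun=> c : R) by exact: measurable_cst.
have M0 : forall c : R, T -> `|c| <= `|c| by move=> c _; exact: lexx.
rewrite ler_norml; apply/andP; split.
  rewrite -[leLHS](expect_cst _ pF).
  apply: (expect_le pF (mM _) (M0 _) mg gM) => x.
  by have := gM x; rewrite ler_norml => /andP[].
rewrite -[leRHS](expect_cst M pF).
apply: (expect_le pF mg gM (mM _) (M0 _)) => x.
by have := gM x; rewrite ler_norml => /andP[].
Qed.

Lemma expect_ge0 F g : is_pdf F -> (forall x, 0 <= g x) -> 0 <= expect F g.
Proof. by move=> [_ F0 _] g0; apply: Rintegral_ge0 => x _; rewrite mulr_ge0. Qed.

Lemma expect_EFin F g (M : R) : is_pdf F ->
  measurable_fun setT g -> (forall x, `|g x| <= M) ->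
  (expect F g)%:E = (\int[m]_x (g x * F x)%:E)%E.
Proof. by move=> pF mg gM; rewrite /expect Rintegral_EFin//; exact: expect_integrable gM. Qed.

Lemma expect_dominated_cvg F (g_ : nat -> T -> R) g (M : R) : is_pdf F ->
  (forall n, measurable_fun setT (g_ n)) -> measurable_fun setT g ->
  (forall n x, `|g_ n x| <= M) -> (forall x, g_ n x @[n --> \oo] --> g x) ->
  expect F (g_ n) @[n --> \oo] --> expect F g.
Proof.
move=> pF mg_ mg gM cg; have [mF F0 _] := pF.
apply: (@Rintegral_dominated_cvg _ _ _ m setT _ _ (fun x => M * F x)) => //.
- by move=> n; exact: measurable_funM.
- exact: measurable_funM.
- rewrite (_ : _ \o _ = (fun x => M%:E * (EFin \o F) x)%E)//.
  by apply: integrableZl => //; exact: pdf_integrable.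
- by move=> n x _; rewrite normrM (ger0_norm (F0 x)) ler_wpM2r.
- by move=> x _; apply: cvgM; [exact: cg|exact: cvg_cst].
Qed.

(** Real part, and with [chars] the imaginary part, of the characteristic function of Z under the
    density F. *)
Definition charc F Z r := expect F (fun x => cos (r * Z x)).
Definition chars F Z r := expect F (fun x => sin (r * Z x)).

Lemma cos_norm_le1 (x : R) : `|cos x| <= 1.
Proof. by rewrite ler_norml cos_geN1 cos_le1. Qed.

Lemma sin_norm_le1 (x : R) : `|sin x| <= 1.
Proof. by rewrite ler_norml sin_geN1 sin_le1. Qed.

Lemma measurable_cosM Z (r : R) : measurable_fun setT Z ->
  measurable_fun setT (fun x => cos (r * Z x)).
Proof.
move=> mZ; apply: (measurableT_comp (continuous_measurable_fun (@continuous_cos R))).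
by apply: measurable_funM => //; exact: measurable_cst.
Qed.

Lemma measurable_sinM Z (r : R) : measurable_fun setT Z ->
  measurable_fun setT (fun x => sin (r * Z x)).
Proof.
move=> mZ; apply: (measurableT_comp (continuous_measurable_fun (@continuous_sin R))).
by apply: measurable_funM => //; exact: measurable_cst.
Qed.

Lemma charcN F Z r : charc F Z (- r) = charc F Z r.
Proof. by rewrite /charc /expect; apply: eq_Rintegral => x _; rewrite mulNr cosN. Qed.

Lemma charc0 F Z : is_pdf F -> charc F Z 0 = 1.
Proof.
move=> pF; rewrite -[RHS](expect_cst 1 pF) /charc; congr expect.
by apply/funext => x; rewrite mul0r cos0.
Qed.

Lemma chars0 F Z : is_pdf F -> chars F Z 0 = 0.
Proof.
move=> pF; rewrite -[RHS](expect_cst 0 pF) /chars; congr expect.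
by apply/funext => x; rewrite mul0r sin0.
Qed.

Lemma charc_norm_le1 F Z r : is_pdf F -> measurable_fun setT Z -> `|charc F Z r| <= 1.
Proof.
move=> pF mZ; apply: expect_norm_le => //; first exact: measurable_cosM.
by move=> x; exact: cos_norm_le1.
Qed.

Lemma chars_norm_le1 F Z r : is_pdf F -> measurable_fun setT Z -> `|chars F Z r| <= 1.
Proof.
move=> pF mZ; apply: expect_norm_le => //; first exact: measurable_sinM.
by move=> x; exact: sin_norm_le1.
Qed.

Lemma continuous_charc F Z : is_pdf F -> measurable_fun setT Z ->
  continuous (charc F Z).
Proof.
move=> pF mZ r; apply/(@cvg_nbhsP _ R^o) => w wr.
apply: (expect_dominated_cvg pF (M := 1)).
- by move=> n; exact: measurable_cosM.
- exact: measurable_cosM.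
- by move=> n x; exact: cos_norm_le1.
- move=> x; apply: (@cvg_comp _ _ _ (fun n => w n * Z x) (@cos R)); last exact: continuous_cos.
  by apply: cvgM => //; exact: cvg_cst.
Qed.

Lemma continuous_chars F Z : is_pdf F -> measurable_fun setT Z ->
  continuous (chars F Z).
Proof.
move=> pF mZ r; apply/(@cvg_nbhsP _ R^o) => w wr.
apply: (expect_dominated_cvg pF (M := 1)).
- by move=> n; exact: measurable_sinM.
- exact: measurable_sinM.
- by move=> n x; exact: sin_norm_le1.
- move=> x; apply: (@cvg_comp _ _ _ (fun n => w n * Z x) (@sin R)); last exact: continuous_sin.
  by apply: cvgM => //; exact: cvg_cst.
Qed.

End Expectation.

(** * Tails and moments from the characteristic function near the origin *)

Section LaplaceTail.
Context d (T : measurableType d) (R : realType)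
  (m : {sigma_finite_measure set T -> \bar R}).
Variables (F Z : T -> R).
Hypotheses (pF : is_pdf m F) (mZ : measurable_fun setT Z).
Let leb : {sigma_finite_measure set (measurableTypeR R) -> \bar R} :=
  @lebesgue_measure R.

Let q2_bound (z : R) : 0 <= 1 - (1 + z ^+ 2)^-1 <= 1.
Proof.
have h : 1 <= 1 + z ^+ 2 by rewrite lerDl sqr_ge0.
have h0 := lt_le_trans ltr01 h.
rewrite subr_ge0 invf_le1// h/= gerBl invr_ge0; exact: ltW.
Qed.

Lemma measurable_subinv (a : R) :
  measurable_fun setT (fun x => 1 - (1 + (a * Z x) ^+ 2)^-1).
Proof.
apply: measurable_funB; first exact: measurable_cst.
apply: (measurableT_comp (f := fun y : R => (1 + y ^+ 2)^-1)).
  apply: continuous_measurable_fun => y; apply: cvgV.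
    by rewrite gt_eqF// ltr_pwDl// sqr_ge0.
  by apply: cvgD; [exact: cvg_cst|exact: exprn_continuous].
by apply: measurable_funM => //; exact: measurable_cst.
Qed.

Lemma subinv_norm_le1 (a : R) x : `|1 - (1 + (a * Z x) ^+ 2)^-1| <= 1.
Proof. by have /andP[h0 h1] := q2_bound (a * Z x); rewrite ger0_norm. Qed.

(** Tonelli: averaging cos(a u z) against e^(-|u|) produces 2 / (1 + (a z)^2). The resulting
    function of Z is comparable with the indicator of |Z| >= 1 / a, so the identity converts
    information on the characteristic function into mass estimates. *)
Lemma laplace_charc (a : R) :
  (\int[leb]_u (expR (- `|u : R|) * (1 - charc m F Z (a * u)))%:E =
   (2 * expect m F (fun x => 1 - (1 + (a * Z x) ^+ 2)^-1))%:E)%E.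
Proof.
have [mF F0 F1] := pF.
rewrite EFinM (expect_EFin pF (measurable_subinv a) (subinv_norm_le1 a)).
rewrite -ge0_integralZl//; last 2 first.
- by apply/measurable_EFinP; apply: measurable_funM => //; exact: measurable_subinv.
- by move=> x _; rewrite lee_fin mulr_ge0//; case/andP: (q2_bound (a * Z x)).
pose H (z : measurableTypeR R * T) :=
  (expR (- `|z.1|) * (1 - cos (a * z.1 * Z z.2)) * F z.2)%:E.
have mH : measurable_fun setT H.
  apply/measurable_EFinP; apply: measurable_funM.
    apply: measurable_funM.
      exact: (measurableT_comp (continuous_measurable_fun (@continuous_expRabs R)) measurable_fst).
    apply: measurable_funB; first exact: measurable_cst.
    apply: (measurableT_comp (continuous_measurable_fun (@continuous_cos R))).
    apply: measurable_funM.
      by apply: measurable_funM; [exact: measurable_cst|exact: measurable_fst].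
    exact: (measurableT_comp mZ measurable_snd).
  exact: (measurableT_comp mF measurable_snd).
have H0 z : (0 <= H z)%E.
  by rewrite lee_fin mulr_ge0// mulr_ge0 ?expR_ge0// subr_ge0 cos_le1.
have := @fubini_tonelli _ _ _ _ _ leb m H mH H0.
rewrite /fubini_F /fubini_G /H /= => E.
transitivity (\int[leb]_u \int[m]_x (expR (- `|u|) * (1 - cos (a * u * Z x)) * F x)%:E)%E.
  apply: eq_integral => u _.
  have -> : 1 - charc m F Z (a * u) = expect m F (fun x => 1 - cos (a * u * Z x)).
    rewrite (expectB pF (M := 1) (N := 1)) ?expect_cst//.
    - by move=> x; rewrite normr1.
    - exact: measurable_cosM.
    - by move=> x; exact: cos_norm_le1.
  rewrite EFinM (expect_EFin pF (M := 2)); last 2 first.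
  - by apply: measurable_funB; [exact: measurable_cst|exact: measurable_cosM].
  - move=> x; apply: le_trans (ler_normB _ _) _.
    by rewrite normr1 -[2]/(1 + 1) lerD2l cos_norm_le1.
  rewrite -ge0_integralZl//.
  - by apply: eq_integral => x _; rewrite -EFinM mulrA.
  - apply/measurable_EFinP; apply: measurable_funM => //.
    by apply: measurable_funB; [exact: measurable_cst|exact: measurable_cosM].
  - by move=> x _; rewrite lee_fin mulr_ge0// subr_ge0 cos_le1.
rewrite E; apply: eq_integral => x _.
transitivity (\int[leb]_u ((F x)%:E * (expR (- `|u|) * (1 - cos (a * Z x * u)))%:E))%E.
  by apply: eq_integral => u _; rewrite -EFinM mulrC (mulrAC a).
have mc : measurable_fun [set: measurableTypeR R]
    (fun u : measurableTypeR R => (expR (- `|u|) * (1 - cos (a * Z x * u)))%:E).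
  apply/measurable_EFinP; apply: (@continuous_measurable_fun R) => u.
  apply: cvgM; first exact: continuous_expRabs.
  by apply: cvgB; [exact: cvg_cst|exact: continuous_coscale].
rewrite (ge0_integralZl leb measurableT mc); last 2 first.
- by move=> u _; rewrite lee_fin mulr_ge0 ?expR_ge0// subr_ge0 cos_le1.
- by rewrite lee_fin.
by rewrite integral_expRabs_subcos -!EFinM; congr EFin; ring.
Qed.

Let F0 : forall x, 0 <= F x. Proof. by case: pF. Qed.
Let mF : measurable_fun setT F. Proof. by case: pF. Qed.

Lemma measurable_ge_abs (M : R) :
  measurable_fun setT (fun x => (M <= `|Z x|)%R%:R : R).
Proof.
rewrite (_ : (fun _ => _) = (fun x => if M <= `|Z x| then 1 else 0)); last first.
  by apply/funext => x; case: ifP.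
apply: measurable_fun_ifT; [|exact: measurable_cst|exact: measurable_cst].
apply: measurable_fun_ler; first exact: measurable_cst.
exact: (measurableT_comp (@normr_measurable R setT)).
Qed.

Lemma natb_norm_le1 (b : bool) : `|b%:R : R| <= 1.
Proof. by case: b; rewrite ?normr1 ?normr0. Qed.

(** With a = 1 / M the function 1 - 1 / (1 + (a Z)^2) is at least 1/2 on |Z| >= M, and its mean is
    an average of 1 - [charc] at the points u / M. *)
Lemma tail_charc (C : R) (M : R) : 0 < M ->
  (forall r, 0 < r -> 1 - charc m F Z r <= C * r) ->
  expect m F (fun x => (M <= `|Z x|)%R%:R) <= 8 * C / M.
Proof.
move=> M0 hC.
have C0 : 0 <= C.
  rewrite -[C]mulr1; apply: le_trans (hC 1 ltr01).
  by rewrite subr_ge0 (le_trans (ler_norm _))// charc_norm_le1.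
have h2 : expect m F (fun x => (M <= `|Z x|)%R%:R) <=
    2 * expect m F (fun x => 1 - (1 + (M^-1 * Z x) ^+ 2)^-1).
  rewrite -(expectZ 2 pF (measurable_subinv _) (subinv_norm_le1 _)).
  apply: (expect_le pF (M := 1) (N := 2)).
  - exact: measurable_ge_abs.
  - by move=> x; exact: natb_norm_le1.
  - by apply: measurable_funM; [exact: measurable_cst|exact: measurable_subinv].
  - move=> x; rewrite normrM ger0_norm// -[leRHS]mulr1 ler_wpM2l//.
    exact: subinv_norm_le1.
  move=> x; case: (leP M `|Z x|) => [Mz|_]; rewrite ?mulr0n ?mulr1n; last first.
    by rewrite mulr_ge0//; case/andP: (q2_bound (M^-1 * Z x)).
  rewrite mulrBr mulr1 lerBrDl -lerBrDr.
  have z1 : 1 <= (M^-1 * Z x) ^+ 2.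
    rewrite -real_normK ?num_real// -[1](expr1n _ 2) lerXn2r ?nnegrE//.
    by rewrite normrM gtr0_norm ?invr_gt0// ler_pdivlMl// mulr1.
  rewrite (_ : 2 - 1 = 1 :> R); last by ring.
  rewrite ler_pdivrMr ?ltr_pwDl ?sqr_ge0// mul1r.
  by rewrite -[leLHS]/(1 + 1) lerD2l.
apply: le_trans h2 _.
rewrite -lee_fin -(laplace_charc M^-1).
have mle : measurable_fun [set: measurableTypeR R]
    (fun u : measurableTypeR R => (expR (- `|2^-1 * u + 0|))%:E).
  apply/measurable_EFinP; apply: (@continuous_measurable_fun R) => u.
  apply: (@continuous_comp _ _ _ (fun u : R => 2^-1 * u + 0) (fun u => expR (- `|u|))).
    by apply: cvgD; [apply: cvgM; [exact: cvg_cst|exact: cvg_id]|exact: cvg_cst].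
  exact: continuous_expRabs.
(* Since |u| e^(-|u|/2) <= 2, the integrand is at most 2 C / M times e^(-|u|/2), whose integral is
   4; hence the constant 8. *)
apply: (@le_trans _ _ (\int[leb]_u ((2 * C / M)%:E * (expR (- `|2^-1 * u + 0|))%:E))%E).
  apply: ge0_le_integral => //.
  - move=> u _; rewrite lee_fin mulr_ge0 ?expR_ge0// subr_ge0.
    by rewrite (le_trans (ler_norm _))// charc_norm_le1.
  - apply/measurable_EFinP; apply: (@continuous_measurable_fun R) => u.
    apply: cvgM; first exact: continuous_expRabs.
    apply: cvgB; first exact: cvg_cst.
    apply: (@continuous_comp _ _ _ (fun u : R => M^-1 * u) (charc m F Z)).
      by apply: cvgM; [exact: cvg_cst|exact: cvg_id].
    exact: continuous_charc.
  - apply: emeasurable_funM => //; exact: measurable_cst.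
  - move=> u _; rewrite -EFinM lee_fin addr0 normrM (ger0_norm (_ : 0 <= 2^-1))//.
    have h : 1 - charc m F Z (M^-1 * u) <= C * (M^-1 * `|u|).
      have [->|u0] := eqVneq u 0.
        by rewrite mulr0 charc0// subrr normr0 !mulr0.
      have -> : charc m F Z (M^-1 * u) = charc m F Z (M^-1 * `|u|).
        by case: (ger0P u) => // _; rewrite mulrN charcN.
      by apply: hC; rewrite mulr_gt0 ?invr_gt0 ?normr_gt0.
    apply: le_trans (ler_wpM2l (expR_ge0 _) h) _.
    have -> : - `|u| = - (2^-1 * `|u|) + - (2^-1 * `|u|) by field.
    rewrite expRD -mulrA mulrC -[leRHS]mulrA.
    have e1 : 0 <= expR (- (2^-1 * `|u|)) by exact: expR_ge0.
    have e2 : expR (- (2^-1 * `|u|)) * `|u| <= 2.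
      rewrite expRN ler_pdivrMl ?expR_gt0//.
      have := expR_ge1Dx (2^-1 * `|u|).
      rewrite -(ler_pM2l (_ : 0 < 2))// mulrDr mulrA divff// mul1r mulr1 => h'.
      by rewrite mulrC; apply: le_trans h'; rewrite lerDr.
    rewrite [X in X <= _](_ : _ = (C * M^-1 * expR (- (2^-1 * `|u|))) *
      (expR (- (2^-1 * `|u|)) * `|u|)); last by ring.
    rewrite [leRHS](_ : _ = (C * M^-1 * expR (- (2^-1 * `|u|))) * 2); last by ring.
    by rewrite ler_wpM2l// mulr_ge0// mulr_ge0// invr_ge0 ltW.
rewrite (ge0_integralZl leb measurableT mle); last 2 first.
- by move=> u _; rewrite lee_fin expR_ge0.
- by rewrite lee_fin divr_ge0 ?mulr_ge0// ltW.
have h20 : (0 : R) < 2^-1 by rewrite invr_gt0.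
rewrite (@ge0_integral_affine1 _ 2^-1 0 (fun u => (expR (- `|u|))%:E) h20); last 2 first.
- apply/measurable_EFinP; apply: (@continuous_measurable_fun R); exact: continuous_expRabs.
- by move=> u; rewrite lee_fin expR_ge0.
by rewrite integral_expRabs invrK -!EFinM lee_fin le_eqVlt; apply/orP; left; apply/eqP; ring.
Qed.

(** A layer-cake argument. As k < 1, t^(k - 1) decreases, so |Z|^k is at most twice its integral
    over [|Z|/2, |Z|], an interval contained in t >= rho / 2. Exchanging the integrals leaves P(|Z|
    >= t) <= 8 C / t, and t^(k - 2) is integrable at infinity. *)
Lemma moment_tail_charc (C k rho : R) : 0 <= k < 1 -> 0 < rho ->
  (forall r, 0 < r -> 1 - charc m F Z r <= C * r) ->
  (\int[m]_x ((rho <= `|Z x|)%R%:R * (`|Z x| `^ k * F x))%:E <=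
   (16 * C / (1 - k) * (rho / 2) `^ (k - 1))%:E)%E.
Proof.
move=> /andP[k0 k1] rho0 hC.
pose W (t : measurableTypeR R) : R := (rho / 2 <= t)%R%:R * (t `^ (k - 1)).
pose H (z : T * measurableTypeR R) : R := W z.2 * (z.2 <= `|Z z.1|)%R%:R * F z.1.
have mnatb d' (T' : measurableType d') (b : T' -> bool) : measurable_fun setT b ->
    measurable_fun setT (fun x => (b x)%:R : R).
  move=> mb; rewrite (_ : (fun _ => _) = (fun x => if b x then 1 else 0)).
    by apply: measurable_fun_ifT; [|exact: measurable_cst|exact: measurable_cst].
  by apply/funext => x; case: (b x).
have mabsZ : measurable_fun setT (fun x => `|Z x|).
  exact: (measurableT_comp (@normr_measurable R setT)).
have mW : measurable_fun [set: R] (W : R -> R).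
  apply: measurable_funM; last exact: measurable_powR.
  by apply: mnatb; apply: measurable_fun_ler; [exact: measurable_cst|exact: measurable_id].
have mH : measurable_fun setT H.
  apply: measurable_funM; last exact: (measurableT_comp mF measurable_fst).
  apply: measurable_funM; first exact: (measurableT_comp mW measurable_snd).
  apply: mnatb; apply: measurable_fun_ler; first exact: measurable_snd.
  exact: (measurableT_comp mabsZ measurable_fst).
have W0 t : 0 <= W t by rewrite mulr_ge0// powR_ge0.
have H0 z : (0 <= (H z)%:E)%E by rewrite lee_fin mulr_ge0// mulr_ge0.
have mHE : measurable_fun setT (fun z => (H z)%:E) by exact/measurable_EFinP.
have := @fubini_tonelli _ _ _ _ _ m leb _ mHE H0.
rewrite /fubini_F /fubini_G => E.
have rho2 : 0 < rho / 2 by rewrite divr_gt0.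
apply: (@le_trans _ _ (2%:E * \int[m]_x \int[leb]_t (H (x, t))%:E)%E).
  rewrite -ge0_integralZl//; last 2 first.
  - exact: (measurable_fun_fubini_tonelli_F _ mHE H0).
  - by move=> x _; apply: integral_ge0.
  apply: ge0_le_integral => //.
  - by move=> x _; rewrite lee_fin mulr_ge0// mulr_ge0// powR_ge0.
  - apply/measurable_EFinP; apply: measurable_funM; first exact: measurable_ge_abs.
    by apply: measurable_funM => //; exact: (measurableT_comp (measurable_powR k)).
  - apply: emeasurable_funM; first exact: measurable_cst.
    exact: (measurable_fun_fubini_tonelli_F _ mHE H0).
  move=> x _; case: (leP rho `|Z x|) => [rz|_]; rewrite ?mulr0n ?mulr1n; last first.
    by rewrite mul0r mule_ge0//; apply: integral_ge0.
  have z0 : 0 < `|Z x| := lt_le_trans rho0 rz.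
  have z20 : 0 < `|Z x| / 2 by rewrite divr_gt0.
  pose I0 : set R := `[`|Z x| / 2, `|Z x|]%classic.
  apply: (@le_trans _ _ (2%:E * \int[leb]_t ((`|Z x| `^ (k - 1) * F x)%:E *
      (\1_I0 t)%:E))%E).
    have mI : measurable_fun [set: measurableTypeR R]
        (fun t => (\1_I0 t : R)%:E).
      by apply/measurable_EFinP; apply: measurable_indic; exact: measurable_itv.
    rewrite (ge0_integralZl leb measurableT mI); last 2 first.
    - by move=> t _; rewrite lee_fin.
    - by rewrite lee_fin mulr_ge0// powR_ge0.
    have mI0 : measurable (I0 : set (measurableTypeR R)) by exact: measurable_itv.
    have muI : (\int[leb]_t (\1_I0 t)%:E = (`|Z x| - `|Z x| / 2)%:E)%E.
      rewrite integral_indic// setIT; apply: etrans (lebesgue_measure_itv _) _.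
      by rewrite /= lte_fin ltr_pdivrMr// ltr_pMr// ltr1n.
    rewrite muI -!EFinM lee_fin mul1r.
    have -> : `|Z x| `^ k = `|Z x| `^ (k - 1) * `|Z x|.
      rewrite -[X in _ * X](powRr1 (ltW z0)) -powRD ?subrK//.
      by apply/implyP => _; rewrite gt_eqF.
    by rewrite le_eqVlt; apply/orP; left; apply/eqP; field.
  apply: lee_pmul => //.
    by apply: integral_ge0 => t _; rewrite -EFinM lee_fin mulr_ge0// mulr_ge0// powR_ge0.
  apply: ge0_le_integral => //.
  - by move=> t _; rewrite -EFinM lee_fin mulr_ge0// mulr_ge0// powR_ge0.
  - apply: emeasurable_funM; first exact: measurable_cst.
    by apply/measurable_EFinP; apply: measurable_indic; exact: measurable_itv.
  - exact: (measurableT_comp mHE (pair1_measurable x)).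
  - move=> t _; rewrite -EFinM lee_fin indicE; case: (boolP (t \in I0)); last first.
      by move=> _; rewrite mulr0 mulr_ge0// mulr_ge0.
    rewrite inE /I0 /= in_itv/= => /andP[t1 t2]; rewrite /H /W /= t2 !mulr1n !mulr1.
    rewrite ler_wpM2r// (le_trans _ t1) ?mulr1n ?mul1r; last by rewrite ler_pM2r.
    have t0 : 0 < t := lt_le_trans z20 t1.
    rewrite (_ : k - 1 = - (1 - k)); last by ring.
    rewrite !powRN lef_pV2 ?posrE ?powR_gt0//.
    by apply: ge0_ler_powR => //; rewrite ?nnegrE ?subr_ge0 ?ltW.
rewrite E.
apply: (@le_trans _ _ (2%:E * \int[leb]_t ((8 * C)%:E *
   (((rho / 2 <= t)%R%:R * t `^ (- 1 - (1 - k)))%:E)))%E).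
  apply: lee_pmul => //.
    by apply: integral_ge0 => t _; apply: integral_ge0.
  apply: ge0_le_integral => //.
  - by move=> t _; apply: integral_ge0.
  - exact: (measurable_fun_fubini_tonelli_G _ mHE H0).
  - apply: emeasurable_funM; first exact: measurable_cst.
    apply/measurable_EFinP; apply: measurable_funM; last exact: measurable_powR.
    by apply: mnatb; apply: measurable_fun_ler; [exact: measurable_cst|exact: measurable_id].
  move=> t _.
  have -> : (\int[m]_x (H (x, t))%:E)%E =
      (W t * expect m F (fun x => (t <= `|Z x|)%R%:R))%:E.
    rewrite EFinM (expect_EFin pF (measurable_ge_abs t) (fun x => natb_norm_le1 _)).
    rewrite -ge0_integralZl//; last 3 first.
    - apply/measurable_EFinP; apply: measurable_funM => //; exact: measurable_ge_abs.
    - by move=> x _; rewrite lee_fin mulr_ge0.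
    - by rewrite lee_fin.
    by apply: eq_integral => x _; rewrite -EFinM mulrA.
  rewrite -EFinM lee_fin /W; case: (leP (rho / 2) t) => [t1|_]; rewrite ?mulr0n ?mulr1n; last by rewrite !mul0r mulr0.
  have t0 : 0 < t := lt_le_trans rho2 t1.
  rewrite !mul1r mulrC.
  have -> : t `^ (- 1 - (1 - k)) = t^-1 * t `^ (k - 1).
    rewrite -powR_inv1 ?ltW// -powRD; last by apply/implyP => _; rewrite gt_eqF.
    by congr (_ `^ _); ring.
  by rewrite mulrA ler_wpM2r ?powR_ge0// tail_charc.
have mR : measurable_fun [set: measurableTypeR R]
    (fun t : measurableTypeR R => ((rho / 2 <= t)%R%:R * t `^ (- 1 - (1 - k)))%:E).
  apply/measurable_EFinP; apply: measurable_funM; last exact: measurable_powR.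
  by apply: mnatb; apply: measurable_fun_ler; [exact: measurable_cst|exact: measurable_id].
have C0 : 0 <= C.
  rewrite -[C]mulr1; apply: le_trans (hC 1 ltr01).
  by rewrite subr_ge0 (le_trans (ler_norm _))// charc_norm_le1.
rewrite (ge0_integralZl leb measurableT mR); last 2 first.
- by move=> t _; rewrite lee_fin mulr_ge0// powR_ge0.
- by rewrite lee_fin mulr_ge0.
have -> : (\int[leb]_t ((rho / 2 <= t)%R%:R * t `^ (- 1 - (1 - k)))%:E)%E =
    ((rho / 2) `^ (- (1 - k)) / (1 - k))%:E.
  rewrite -integral_powR_tail ?subr_gt0// [RHS]integral_mkcond.
  apply: eq_integral => t _; rewrite patchE; case: ifPn.
    by rewrite inE/= in_itv/= andbT => ->; rewrite mul1r.
  by rewrite notin_setE/= in_itv/= andbT => /negP/negbTE ->; rewrite mul0r.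
rewrite -!EFinM lee_fin opprB le_eqVlt; apply/orP; left; apply/eqP; field.
by rewrite gt_eqF// subr_gt0.
Qed.

End LaplaceTail.

(** * Test functions *)

Section SmoothFunctions.
Variable R : realType.

(** Smoothness as a sequence of successive derivatives: shifting the sequence shows at once that the
    derivative is smooth too. *)
Definition smooth1 (g : R -> R) := exists G : nat -> R -> R,
  G 0%N = g /\ forall n x, is_derive x (1 : R) (G n) (G n.+1 x).

Lemma smooth1_const (c : R) : smooth1 (fun=> c).
Proof.
exists (fun n => if n is 0%N then fun=> c else fun=> 0); split=> // -[|n] x;
  exact: derive_const.
Qed.

Lemma smooth1_cos : smooth1 (@cos R).
Proof.
(* The period-four cycle cos, - sin, - cos, sin, read off from the parities of n and of n / 2. *)
exists (fun n => if odd n then (if odd n./2 then @sin R else fun x => - sin x)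
  else (if odd n./2 then fun x => - cos x else @cos R)); split=> // n x.
rewrite /= uphalf_half; case: (odd n) => /=; rewrite ?add1n ?add0n /=.
  case: (odd _) => /=; first exact: is_derive_sin.
  exact: (derive_opp (is_derive_sin x)).
case: (odd _) => /=; last exact: is_derive_cos.
by have := derive_opp (is_derive_cos x); rewrite opprK.
Qed.

Lemma smooth1_sin : smooth1 (@sin R).
Proof.
have [G [G0 dG]] := smooth1_cos.
exists (fun n => if n is n'.+1 then G n' else @sin R); split=> // -[|n] x; last exact: dG.
by rewrite G0; exact: is_derive_sin.
Qed.

Section FlatFunction.

(** The polynomial in 1/t in front of e^(-1/t) makes the family closed under differentiation;
    [flat_next] is the action on the polynomial. *)
Definition flat (p : {poly R}) (t : R) : R :=
  if 0 < t then p.[t^-1] * expR (- t^-1) else 0.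

Definition flat_bound (p : {poly R}) : R :=
  \sum_(i < size p) `|p`_i| * (i.+1%:R ^+ i.+1).

Lemma flat_bound_ge0 p : 0 <= flat_bound p.
Proof. by apply: sumr_ge0 => i _; rewrite mulr_ge0// exprn_ge0. Qed.

(* [e^u = (e^(u/(n+1)))^(n+1) >= (u/(n+1))^(n+1)] *)
Lemma exprn_expRN_le (n : nat) (u : R) : 0 < u ->
  u ^+ n * expR (- u) <= n.+1%:R ^+ n.+1 * u^-1.
Proof.
move=> u0; rewrite expRN ler_pdivrMr ?expR_gt0// mulrAC ler_pdivlMr// -exprSr.
have n0 : 0 < n.+1%:R :> R by [].
have -> : expR u = expR (u / n.+1%:R) ^+ n.+1.
  by rewrite -expRM_natr mulfVK// gt_eqF.
rewrite -exprMn lerXn2r ?nnegrE ?mulr_ge0 ?expR_ge0 ?(ltW u0)//.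
rewrite -ler_pdivrMl// mulrC.
by apply: le_trans (expR_ge1Dx _); rewrite lerDr.
Qed.

Lemma flat_le p t : `|flat p t| <= flat_bound p * `|t|.
Proof.
rewrite /flat; case: ltP => t0; last by rewrite normr0 mulr_ge0// flat_bound_ge0.
rewrite (gtr0_norm t0) horner_coef mulr_suml mulr_suml.
apply: le_trans (ler_norm_sum _ _ _) _; apply: ler_sum => i _.
rewrite -!mulrA normrM ler_wpM2l// ger0_norm; last first.
  by rewrite mulr_ge0 ?expR_ge0// exprn_ge0// invr_ge0 ltW.
by have := @exprn_expRN_le i t^-1; rewrite invrK invr_gt0; apply.
Qed.

Definition flat_next (p : {poly R}) : {poly R} := 'X^2 * (p - p^`()).

Lemma flatX p t : t != 0 -> flat p t / t = flat ('X * p) t.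
Proof.
by move=> t0; rewrite /flat; case: ifP => _; rewrite ?mul0r// hornerM hornerX; ring.
Qed.

(** Only t = 0 is delicate: the difference quotient there is [flat ('X * p)], again a member of the
    family, and the linear bound [flat_le] sends it to 0. *)
Lemma derive_flat p x : is_derive x (1 : R) (flat p) (flat (flat_next p) x).
Proof.
have [x0|x0|->] := ltgtP x 0.
- have -> : flat (flat_next p) x = 0 by rewrite /flat ltNge (ltW x0).
  apply: (near_eq_is_derive _ (derive_const x 0)).
  near=> y; rewrite /flat ltNge.
  have -> // : y <= 0 by near: y; exact: (cvgr_le x).
- have dV := derive_inv (lt0r_neq0 x0) (derive_idfun x).
  have dp : is_derive x^-1 (1 : R) (horner p) (p^`()).[x^-1].
    apply: DeriveDef; first exact: derivable_horner.
    by rewrite -derive1E -derivE.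
  have dE := derive_comp (derive_opp dV) (is_derive_expR (- x^-1)).
  have -> : flat (flat_next p) x = (flat_next p).[x^-1] * expR (- x^-1) by rewrite /flat x0.
  apply: (near_eq_is_derive _ (is_derive_eq (derive_mul (derive_comp dV dp) dE) _)).
    near=> y; rewrite /flat.
    have -> // : 0 < y by near: y; exact: (cvgr_gt x).
  rewrite /flat_next hornerM hornerXn hornerD hornerN; field.
  by rewrite gt_eqF.
- have -> : flat (flat_next p) 0 = 0 by rewrite /flat ltxx.
  suff h : h^-1 *: (flat p (h *: (1 : R) + 0) - flat p 0) @[h --> 0^'] --> (0 : R).
    by apply: DeriveDef; [apply/cvg_ex; exists 0|apply/cvg_lim].
  have B0 : 0 < flat_bound ('X * p) + 1 by rewrite ltr_wpDl// flat_bound_ge0.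
  apply/cvgrPdist_lt => e e0.
  near=> h.
  have h0 : h != 0 by near: h; exact: nbhs_dnbhs_neq.
  rewrite sub0r normrN {2}/flat ltxx subr0 addr0 /GRing.scale/= mulr1 mulrC flatX//.
  apply: le_lt_trans (flat_le _ _) _.
  apply: (@le_lt_trans _ _ ((flat_bound ('X * p) + 1) * `|h|)).
    by rewrite ler_wpM2r// lerDl.
  rewrite -ltr_pdivlMl//; near: h; apply: dnbhs0_lt; rewrite mulr_gt0// invr_gt0.
Unshelve. all: by end_near. Qed.

End FlatFunction.

(* [cutoff r] is [e * exp (- 1 / (1 - r))] for [r < 1]; it is applied to [r = a |x|^2]. *)
Definition cutoff (r : R) : R := expR 1 * flat 1 (1 - r).
Definition cutoff' (r : R) : R := - (expR 1 * flat (flat_next 1) (1 - r)).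

Lemma derive_1sub (x : R) : is_derive x (1 : R) (fun r => 1 - r) (- 1).
Proof.
by apply: (is_derive_eq (derive_sub (derive_const x 1) (derive_idfun x))); rewrite sub0r.
Qed.

Lemma smooth1_cutoff : smooth1 cutoff.
Proof.
exists (fun n r => (-1) ^+ n * (expR 1 * flat (iter n flat_next 1) (1 - r))); split.
  by apply/funext => r; rewrite expr0 mul1r.
move=> n x.
apply: (is_derive_eq (derive_mul (derive_const x ((-1) ^+ n)) (derive_mul
  (derive_const x (expR 1)) (derive_comp (derive_1sub x) (derive_flat _ (1 - x)))))).
by rewrite !mul0r !add0r exprS iterS; ring.
Qed.

Lemma derive_cutoff x : is_derive x (1 : R) cutoff (cutoff' x).
Proof.
apply: (is_derive_eq (derive_mul (derive_const x (expR 1))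
  (derive_comp (derive_1sub x) (derive_flat _ (1 - x))))).
by rewrite mul0r add0r mulrN1 mulrN.
Qed.

Lemma cutoff0 : cutoff 0 = 1.
Proof.
by rewrite /cutoff /flat subr0 ltr01 invr1 hornerC mul1r -expRD subrr expR0.
Qed.

Lemma cutoff_out r : 1 <= r -> cutoff r = 0.
Proof. by move=> r1; rewrite /cutoff /flat ltNge subr_le0 r1/= mulr0. Qed.

Lemma cutoff'_out r : 1 <= r -> cutoff' r = 0.
Proof. by move=> r1; rewrite /cutoff' /flat ltNge subr_le0 r1/= mulr0 oppr0. Qed.

Definition cutoff_bound : R := expR 1 * (flat_bound 1 + flat_bound (flat_next 1)).

Lemma cutoff_bound_ge0 : 0 <= cutoff_bound.
Proof. by rewrite mulr_ge0 ?expR_ge0// addr_ge0 ?flat_bound_ge0. Qed.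

Lemma cutoff_le r : 0 <= r -> `|cutoff r| <= cutoff_bound.
Proof.
move=> r0; have [r1|r1] := ltP r 1; last by rewrite cutoff_out// normr0 cutoff_bound_ge0.
rewrite /cutoff normrM ger0_norm ?expR_ge0// ler_wpM2l ?expR_ge0//.
apply: le_trans (flat_le _ _) _.
apply: (@le_trans _ _ (flat_bound 1)); last by rewrite lerDl flat_bound_ge0.
rewrite -[leRHS]mulr1 ler_wpM2l ?flat_bound_ge0// ger0_norm ?subr_ge0 ?(ltW r1)//.
by rewrite gerBl.
Qed.

Lemma cutoff'_le r : 0 <= r -> `|cutoff' r| <= cutoff_bound.
Proof.
move=> r0; have [r1|r1] := ltP r 1; last by rewrite cutoff'_out// normr0 cutoff_bound_ge0.
rewrite /cutoff' normrN normrM ger0_norm ?expR_ge0// ler_wpM2l ?expR_ge0//.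
apply: le_trans (flat_le _ _) _.
apply: (@le_trans _ _ (flat_bound (flat_next 1))); last by rewrite lerDr flat_bound_ge0.
rewrite -[leRHS]mulr1 ler_wpM2l ?flat_bound_ge0// ger0_norm ?subr_ge0 ?(ltW r1)//.
by rewrite gerBl.
Qed.

Section SmoothClass.
Variable d : nat.
Local Notation V := 'rV[R]_d.

(** A syntactic class stable under partial derivatives, so that one induction on the list of
    directions gives continuity and differentiability of all iterated partials. *)
Inductive smooth_class : (V -> R) -> Prop :=
| SC_coord i : smooth_class (fun x => x 0 i)
| SC_add f g : smooth_class f -> smooth_class g -> smooth_class (fun x => f x + g x)
| SC_mul f g : smooth_class f -> smooth_class g -> smooth_class (fun x => f x * g x)
| SC_comp g f : smooth1 g -> smooth_class f -> smooth_class (fun x => g (f x)).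

(** A constant arises by composing a constant profile with a member of the class, so some member
    must be at hand; in practice it is a coordinate, which requires d > 0. *)
Lemma SC_const (c : R) (f : V -> R) : smooth_class f -> smooth_class (fun=> c).
Proof. exact: SC_comp (smooth1_const c). Qed.

Lemma SC_sum (I : Type) (s : seq I) (f0 : V -> R) (f : I -> V -> R) : smooth_class f0 ->
  (forall i, smooth_class (f i)) -> smooth_class (fun x => \sum_(i <- s) f i x).
Proof.
move=> S0 Sf; elim: s => [|a s IH].
  by under eq_fun do rewrite big_nil; exact: SC_const S0.
by under eq_fun do rewrite big_cons; exact: SC_add.
Qed.

(** Restriction to a line reduces directional derivatives to one-variable ones; the product and
    chain rules below follow from their scalar versions. *)
Lemma is_derive_lineP (f : V -> R) (x v : V) (a : R) :
  is_derive (0 : R) (1 : R) (fun h : R => f (h *: v + x)) a <-> is_derive x v f a.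
Proof.
have E : (fun h : R => h^-1 *: (f (h *: v + x) - f x)) =
    (fun h : R => h^-1 *: (f ((h *: (1 : R) + 0) *: v + x) - f (0 *: v + x))).
  by apply/funext => h; rewrite scale0r add0r addr0 /GRing.scale/= mulr1.
by split=> -[dh ha]; apply: DeriveDef; move: dh ha; rewrite /derivable /derive E.
Qed.

Lemma derive_coord (i j : 'I_d) (x : V) :
  is_derive x (delta_mx 0 j : V) (fun y : V => y 0 i) ((i == j)%:R : R).
Proof.
apply/is_derive_lineP.
have -> : (fun h : R => (h *: (delta_mx 0 j : V) + x) 0 i) =
    (fun h : R => (i == j)%:R * h + x 0 i).
  by apply/funext => h; rewrite !mxE eqxx/= mulrC.
by apply: (is_derive_eq (derive_add (derive_scale _ 0) (derive_const 0 (x 0 i)))); rewrite addr0.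
Qed.

Lemma derive_vcomp (g : R -> R) (f : V -> R) (x v : V) (a b : R) :
  is_derive x v f b -> is_derive (f x) (1 : R) g a ->
  is_derive x v (fun y => g (f y)) (a * b).
Proof.
move=> /is_derive_lineP df dg; apply/is_derive_lineP.
have dg' : is_derive (f (0 *: v + x)) (1 : R) g a by rewrite scale0r add0r.
exact: (derive_comp df dg').
Qed.

Lemma derive_vmul (f g : V -> R) (x v : V) (a b : R) :
  is_derive x v f a -> is_derive x v g b ->
  is_derive x v (fun y => f y * g y) (a * g x + f x * b).
Proof.
move=> /is_derive_lineP df /is_derive_lineP dg; apply/is_derive_lineP.
by have := derive_mul df dg; rewrite scale0r add0r.
Qed.

Lemma derive_vadd (f g : V -> R) (x v : V) (a b : R) :
  is_derive x v f a -> is_derive x v g b ->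
  is_derive x v (fun y => f y + g y) (a + b).
Proof.
by move=> /is_derive_lineP df /is_derive_lineP dg; apply/is_derive_lineP.
Qed.

Lemma smooth_class_pd (f : V -> R) : smooth_class f ->
  continuous f /\ forall i, exists2 f' : V -> R, smooth_class f' &
    forall x, is_derive x (delta_mx 0 i : V) f (f' x).
Proof.
elim=> {f} [i|f g Sf [cf df] Sg [cg dg]|f g Sf [cf df] Sg [cg dg]|g f [G [G0 dG]] Sf [cf df]].
- split; first exact: coord_continuous.
  move=> j; exists (fun=> (i == j)%:R); first exact: SC_const (SC_coord i).
  by move=> x; exact: derive_coord.
- split=> [x|i]; first exact: (cvgD (cf x) (cg x)).
  have [f' Sf' df'] := df i; have [g' Sg' dg'] := dg i.
  by exists (fun x => f' x + g' x); [exact: SC_add|move=> x; exact: derive_vadd].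
- split=> [x|i]; first exact: (cvgM (cf x) (cg x)).
  have [f' Sf' df'] := df i; have [g' Sg' dg'] := dg i.
  exists (fun x => f' x * g x + f x * g' x); last by move=> x; exact: derive_vmul.
  by apply: SC_add; apply: SC_mul.
- have dg x : is_derive x (1 : R) g (G 1%N x) by rewrite -G0; exact: dG.
  split=> [x|i].
    apply: (@continuous_comp _ _ _ f g); first exact: cf.
    exact: is_derive_continuous (dg _).
  have [f' Sf' df'] := df i.
  exists (fun x => G 1%N (f x) * f' x).
    apply: SC_mul => //; apply: SC_comp => //.
    by exists (fun n => G n.+1); split=> // n x; exact: dG.
  by move=> x; exact: derive_vcomp.
Qed.

Lemma smooth_class_smooth (f : V -> R) : smooth_class f -> smooth f.
Proof.
move=> Sf l.
suff Sl : smooth_class (iter_pd l f).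
  have [cl dl] := smooth_class_pd Sl; split=> // i x.
  by have [f' _ df'] := dl i; case: (df' x).
elim: l => [//|i l IH] /=.
have [_ dl] := smooth_class_pd IH; have [f' Sf' df'] := dl i.
rewrite (_ : pd i _ = f')//; apply/funext => x; rewrite /pd.
by have [_ ->] := df' x.
Qed.

Lemma SC_vdot (i0 : 'I_d) (xi : V) : smooth_class (fun x => vdot x xi).
Proof.
apply: (SC_sum _ (SC_coord i0)) => i.
by apply: SC_mul; [exact: SC_coord|exact: SC_const (SC_coord i0)].
Qed.

Lemma SC_vdotvv (i0 : 'I_d) : smooth_class (fun x => vdot x x).
Proof.
by apply: (SC_sum _ (SC_coord i0)) => i; apply: SC_mul; exact: SC_coord.
Qed.

End SmoothClass.

End SmoothFunctions.

(** Holds also for divergent integrals, because [fine] then makes both sides 0. This matters for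
    convolutions, which may diverge at individual points. *)
Lemma ge0_RintegralZl disp (T : measurableType disp) (R : realType)
    (m : {measure set T -> \bar R}) (c : R) (g : T -> R) :
  measurable_fun setT g -> (forall x, 0 <= g x) ->
  \int[m]_x (c * g x) = c * \int[m]_x g x.
Proof.
move=> mg g0; have mg' : measurable_fun setT (fun x => (g x)%:E) by exact/measurable_EFinP.
have g0' x : setT x -> (0 <= (g x)%:E)%E by rewrite lee_fin.
have [/[dup] foo /ge0_integrable gi|] := ltP (\int[m]_x (g x)%:E)%E +oo%E.
  by rewrite RintegralZl//; exact: gi.
rewrite leye_eq => /eqP goo; rewrite /Rintegral goo mulr0.
have pos k : 0 <= k -> fine (\int[m]_x (k * g x)%:E)%E = 0.
  move=> k0; under eq_integral do rewrite EFinM.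
  rewrite (ge0_integralZl m measurableT mg' g0') ?lee_fin// goo.
  have [->|kp] := eqVneq k 0; first by rewrite mul0e.
  by rewrite gt0_muley// lte_fin lt_neqAle eq_sym kp.
have [c0|c0] := leP 0 c; first exact: pos.
have -> : (\int[m]_x (c * g x)%:E)%E = (- \int[m]_x (- c * g x)%:E)%E.
  rewrite -integral_ge0N.
    by apply: eq_integral => x _; rewrite -EFinN mulNr opprK.
  by move=> x _; rewrite lee_fin mulr_ge0// oppr_ge0 ltW.
by rewrite fineN pos ?oppr0// oppr_ge0 ltW.
Qed.

(** * The definitions of the statement as integrals against [bmu] *)

Section DefsBridge.
Variables (R : realType) (d : nat).
Local Notation V := 'rV[R]_d.
Local Notation mu := (bmu R d).

Lemma measurable_vdot (xi : V) : measurable_fun setT (fun x : bvec R d => vdot (x : V) xi).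
Proof.
rewrite /vdot; apply: measurable_sum => i.
by apply: measurable_funM; [exact: measurable_coord|exact: measurable_cst].
Qed.

Lemma measurable_vdotvv : measurable_fun setT (fun x : bvec R d => vdot (x : V) x).
Proof. by rewrite /vdot; apply: measurable_sum => i; apply: measurable_funM; exact: measurable_coord. Qed.

Lemma prob_density_pdf (f : V -> R) : prob_density f -> is_pdf mu f.
Proof.
move=> [mf [f0 f1]]; split=> //; first exact/meas_funP.
by rewrite -iintE//; apply/measurable_EFinP; exact/meas_funP.
Qed.

Lemma LintE (f : bvec R d -> R) : measurable_fun setT f ->
  Lint (f : V -> R) = (\int[mu]_x (f x)%:E)%E.
Proof.
move=> mf; rewrite /Lint integralE; congr (_ - _)%E.
  rewrite iintE; first by apply: eq_integral => x _; rewrite funeposE EFin_max.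
    by apply/measurable_EFinP; apply: measurable_maxr => //; exact: measurable_cst.
  by move=> x; rewrite lee_fin le_max lexx orbT.
rewrite iintE; first by apply: eq_integral => x _; rewrite funenegE EFin_max EFinN.
  apply/measurable_EFinP; apply: measurable_maxr; last exact: measurable_cst.
  exact: measurableT_comp.
by move=> x; rewrite lee_fin le_max lexx orbT.
Qed.

Lemma vdotZr (r : R) (x xi : V) : vdot x (r *: xi) = r * vdot x xi.
Proof. by rewrite /vdot mulr_sumr; apply: eq_bigr => i _; rewrite mxE mulrCA. Qed.

Lemma vdotZl (r : R) (x xi : V) : vdot (r *: x) xi = r * vdot x xi.
Proof. by rewrite /vdot mulr_sumr; apply: eq_bigr => i _; rewrite mxE mulrA. Qed.

Lemma vdotDl (x y xi : V) : vdot (x + y) xi = vdot x xi + vdot y xi.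
Proof. by rewrite /vdot -big_split; apply: eq_bigr => i _; rewrite mxE mulrDl. Qed.

Lemma hatReZ (f : V -> R) (xi : V) (r : R) : prob_density f ->
  hatRe f (r *: xi) = charc mu f (fun x => vdot x xi) r.
Proof.
move=> pf; have [mf f0 _] := prob_density_pdf pf.
rewrite /hatRe LintE.
  by congr fine; apply: eq_integral => x _; rewrite vdotZr.
apply: measurable_funM => //.
under eq_fun do rewrite vdotZr.
by apply: measurable_cosM; exact: measurable_vdot.
Qed.

Lemma hatImZ (f : V -> R) (xi : V) (r : R) : prob_density f ->
  hatIm f (r *: xi) = - chars mu f (fun x => vdot x xi) r.
Proof.
move=> pf; have [mf f0 _] := prob_density_pdf pf.
rewrite /hatIm LintE.
  by congr (- fine _); apply: eq_integral => x _; rewrite vdotZr.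
apply: measurable_funM => //.
under eq_fun do rewrite vdotZr.
by apply: measurable_sinM; exact: measurable_vdot.
Qed.

Lemma Rintegral_affine (c : R) (a : V) (f : bvec R d -> R) : 0 < c ->
  mu.-integrable setT (EFin \o f) ->
  \int[mu]_x f (c *: (x : V) + a) = c^-1 ^+ d * \int[mu]_x f x.
Proof.
move=> c0 fi; have mf := measurable_int _ fi.
rewrite /Rintegral integralE [in RHS]integralE.
have pE := @ge0_integral_affine R d c a ((EFin \o f)^\+)%E c0
  (measurable_funepos mf) (funepos_ge0 _).
have nE := @ge0_integral_affine R d c a ((EFin \o f)^\-)%E c0
  (measurable_funeneg mf) (funeneg_ge0 _).
have -> : (\int[mu]_x ((fun x : bvec R d => (f (c *: (x : V) + a))%:E)^\+ x) =
    \int[mu]_x ((EFin \o f)^\+ (c *: (x : V) + a)%R))%E.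
  by apply: eq_integral => x _; rewrite !funeposE.
have -> : (\int[mu]_x ((fun x : bvec R d => (f (c *: (x : V) + a))%:E)^\- x) =
    \int[mu]_x ((EFin \o f)^\- (c *: (x : V) + a)%R))%E.
  by apply: eq_integral => x _; rewrite !funenegE.
rewrite pE nE.
have p_fin := integrable_pos_fin_num measurableT fi; have n_fin := integrable_neg_fin_num measurableT fi.
rewrite -(fineK p_fin) -(fineK n_fin) -!EFinM -!EFinB /=.
by rewrite mulrBr.
Qed.

End DefsBridge.

(** * Pairing a convolution with a bounded function *)

Section Convolution.
Variables (R : realType) (d : nat) (K F : 'rV[R]_d -> R) (eps : R).
Local Notation V := 'rV[R]_d.
Local Notation mu := (bmu R d).
Hypotheses (pK : is_pdf mu K) (pF : is_pdf mu F) (eps0 : 0 < eps).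

Let Ke (x : V) : R := scale eps K x.

Let KeE x : Ke x = eps^-1 ^+ d * K (eps^-1 *: x + 0).
Proof. by rewrite /Ke /scale powR_invn ?ltW// exprVn addr0. Qed.

Let mKe : measurable_fun setT (Ke : bvec R d -> R).
Proof.
have [mK _ _] := pK.
have -> : Ke = (fun x => eps^-1 ^+ d * K (eps^-1 *: x + 0)).
  by apply/funext => x; exact: KeE.
apply: measurable_funM; first exact: measurable_cst.
exact: (measurableT_comp mK (measurable_affine _ _)).
Qed.

Let Ke0 x : 0 <= Ke x.
Proof. by have [_ K0 _] := pK; rewrite KeE mulr_ge0// exprn_ge0// invr_ge0 ltW. Qed.

Lemma measurable_vsub :
  measurable_fun setT (fun z : bvec R d * bvec R d => (z.1 : V) - z.2 : bvec R d).
Proof.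
apply: measurable_fun_bvec => i; under eq_fun do rewrite !mxE.
by apply: measurable_funB; [exact: (measurableT_comp (measurable_coord i) measurable_fst)
  |exact: (measurableT_comp (measurable_coord i) measurable_snd)].
Qed.

Lemma measurable_vadd_scale (c : R) :
  measurable_fun setT (fun z : bvec R d * bvec R d => (z.1 : V) + c *: (z.2 : V) : bvec R d).
Proof.
apply: measurable_fun_bvec => i; under eq_fun do rewrite !mxE.
apply: measurable_funD; first exact: (measurableT_comp (measurable_coord i) measurable_fst).
apply: measurable_funM; first exact: measurable_cst.
exact: (measurableT_comp (measurable_coord i) measurable_snd).
Qed.

Let Ke_shift (y : V) (g : bvec R d -> R) (M : R) : measurable_fun setT g ->
  (forall x, `|g x| <= M) ->
  mu.-integrable setT (EFin \o (fun x => g x * Ke (x - y))) /\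
  \int[mu]_x (g x * Ke (x - y)) = expect mu K (fun z => g (y + eps *: z)).
Proof.
move=> mg gM; have [mK K0 K1] := pK.
have mKy : measurable_fun setT (fun x : bvec R d => Ke ((x : V) - y)).
  have := measurableT_comp mKe (@measurable_affine R d 1 (- y)).
  by apply: eq_measurable_fun => x _; rewrite /= scale1r.
have KeEx x : Ke (eps *: x + y - y) = eps^-1 ^+ d * K x.
  by rewrite addrK KeE scalerA mulVf ?gt_eqF// scale1r addr0.
have Kint : mu.-integrable setT (EFin \o (fun x : bvec R d => Ke ((x : V) - y))).
  apply: ge0_integrable => //.
  have E := @ge0_integral_affine R d eps y (fun x => (Ke ((x : V) - y))%:E) eps0 _ (fun x => Ke0 _).
  have mKyE : measurable_fun setT (fun x : bvec R d => (Ke ((x : V) - y))%:E).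
    exact/measurable_EFinP.
  have {}E := E mKyE.
  have e1 : (\int[mu]_x (Ke (eps *: (x : V) + y - y)%R)%:E = (eps^-1 ^+ d)%:E)%E.
    under eq_integral do rewrite KeEx EFinM.
    rewrite ge0_integralZl//; first by rewrite K1 mule1.
    - exact/measurable_EFinP.
    - by move=> x _; rewrite lee_fin.
    - by rewrite lee_fin exprn_ge0// invr_ge0 ltW.
  move: E; rewrite e1 => E.
  rewrite ltNge leye_eq; apply/negP => /eqP H.
  by move: E; rewrite H gt0_muley// lte_fin exprn_gt0// invr_gt0.
have gint : mu.-integrable setT (EFin \o (fun x => g x * Ke (x - y))).
  exact: (integrable_mulr_bounded mg gM Kint).
split=> //.
have := Rintegral_affine y eps0 gint.
rewrite [LHS](_ : _ = eps^-1 ^+ d * expect mu K (fun z => g (y + eps *: z))); last first.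
  rewrite /expect -RintegralZl//.
    by apply: eq_Rintegral => x _; rewrite KeEx addrC mulrCA.
  apply: (expect_integrable (M := M) pK) => //.
  have := measurableT_comp mg (@measurable_affine R d eps y).
  by apply: eq_measurable_fun => x _; rewrite /= addrC.
by move/mulfI => -> //; rewrite gt_eqF// exprn_gt0// invr_gt0.
Qed.

(* [E phi(X + eps Y)] for independent [X ~ F] and [Y ~ K]. *)
Definition jump (phi : V -> R) : R :=
  expect mu F (fun y => expect mu K (fun z => phi (y + eps *: z))).

Let convE (x : V) : Defs.conv (scale eps K) F x = \int[mu]_y (Ke (x - y) * F y).
Proof.
have [mF F0 _] := pF.
rewrite /Defs.conv LintE//; apply: measurable_funM => //.
have mx : measurable_fun setT (fun y : bvec R d => x - (y : V) : bvec R d).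
  apply: measurable_fun_bvec => i; under eq_fun do rewrite !mxE.
  by apply: measurable_funB; [exact: measurable_cst|exact: measurable_coord].
exact: (measurableT_comp mKe mx).
Qed.

(** Fubini and a translation move phi onto the two densities. Joint integrability is checked by
    integrating in x first, where the rescaled kernel has mass 1 and only F remains. *)
Lemma conv_jump (phi : bvec R d -> R) (M : R) : measurable_fun setT phi ->
  (forall x, `|phi x| <= M) ->
  mu.-integrable setT (EFin \o (fun x => Defs.conv (scale eps K) F x * phi x)) /\
  \int[mu]_x (Defs.conv (scale eps K) F x * phi x) = jump phi.
Proof.
move=> mphi phiM; have [mF F0 F1] := pF.
pose f (x y : bvec R d) := phi x * Ke ((x : V) - y) * F y.
have mKe2 : measurable_fun setT (fun z : bvec R d * bvec R d => Ke ((z.1 : V) - z.2)).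
  exact: (measurableT_comp mKe measurable_vsub).
have mf : measurable_fun setT (fun z : bvec R d * bvec R d => f z.1 z.2).
  apply: measurable_funM; last exact: (measurableT_comp mF measurable_snd).
  by apply: measurable_funM => //; exact: (measurableT_comp mphi measurable_fst).
have M0 : 0 <= M by apply: le_trans (phiM (0 : V)).
have fint : (mu \x mu)%E.-integrable setT (EFin \o (fun z => f z.1 z.2)).
  have h : (mu \x mu)%E.-integrable setT (EFin \o
      (fun z : bvec R d * bvec R d => Ke ((z.1 : V) - z.2) * F z.2)).
    apply/integrable21ltyP.
      apply/measurable_EFinP; apply: measurable_funM => //.
      exact: (measurableT_comp mF measurable_snd).
    rewrite (eq_integral (fun y : bvec R d => (F y)%:E)) ?F1 ?ltry// => y _.
    have n1 : forall x : bvec R d, `|1 : R| <= 1 by move=> _; rewrite normr1.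
    have [i1 e1] := @Ke_shift y (fun=> 1) 1 (measurable_cst _) n1.
    rewrite expect_cst// in e1.
    have e2 : (\int[mu]_x (Ke ((x : V) - y))%:E = 1)%E.
      rewrite -[RHS]/(1%:E) -e1 Rintegral_EFin//.
      by apply: eq_integral => x _; rewrite mul1r.
    rewrite -[RHS]mule1 -e2 -ge0_integralZl//.
    - apply: eq_integral => x _ /=.
      rewrite ger0_norm; last by apply: mulr_ge0; [exact: Ke0|exact: F0].
      by rewrite mulrC EFinM.
    - have := measurable_int _ i1; apply: eq_measurable_fun => x _ /=.
      by rewrite mul1r.
    - by move=> x _; rewrite lee_fin.
    - by rewrite lee_fin; exact: F0.
  rewrite (_ : (fun z => f z.1 z.2) = (fun z => phi z.1 * (Ke ((z.1 : V) - z.2) * F z.2))).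
    apply: (integrable_mulr_bounded (M := M) _ _ h) => //.
    exact: (measurableT_comp mphi measurable_fst).
  by apply/funext => z; rewrite /f mulrA.
have mKF : measurable_fun setT
    (fun z : bvec R d * bvec R d => Ke ((z.1 : V) - z.2) * F z.2).
  by apply: measurable_funM => //; exact: (measurableT_comp mF measurable_snd).
have cE x : Defs.conv (scale eps K) F x * phi x = \int[mu]_y f x y.
  rewrite convE mulrC.
  rewrite -ge0_RintegralZl.
  - by apply: eq_Rintegral => y _; rewrite /f mulrA.
  - exact: (measurableT_comp mKF (pair1_measurable (x : bvec R d))).
  - by move=> y; rewrite mulr_ge0.
split.
  have := integrable_Rint_section2 fint.
  by congr (_.-integrable _ _); apply/funext => x /=; rewrite cE.
transitivity (\int[mu]_x \int[mu]_y f x y).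
  by apply: eq_Rintegral => x _; exact: cE.
rewrite (Rintegral_fubini_swap fint) /jump /expect.
apply: eq_Rintegral => y _; rewrite /f.
have [i1 e1] := Ke_shift y mphi phiM.
by rewrite RintegralZr// e1.
Qed.

End Convolution.

(** * Truncated plane waves as test functions *)

Section TestFunctions.
Variables (R : realType) (d : nat) (i0 : 'I_d).
Local Notation V := 'rV[R]_d.
Local Notation mu := (bmu R d).

Lemma continuous_cutoff : continuous (@cutoff R).
Proof. by move=> x; exact: is_derive_continuous (derive_cutoff x). Qed.

Lemma continuous_cutoff' : continuous (@cutoff' R).
Proof.
move=> x; exact: (is_derive_continuous (derive_opp (derive_mul (derive_const x (expR 1))
  (derive_comp (derive_1sub x) (derive_flat _ (1 - x)))))).
Qed.

Lemma vdotvv_ge0 (x : V) : 0 <= vdot x x.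
Proof. by apply: sumr_ge0 => i _; rewrite -expr2 sqr_ge0. Qed.

Lemma vdot_le (x y : V) : `|vdot x y| <= (vdot x x + vdot y y) / 2.
Proof.
rewrite /vdot -big_split/= mulr_suml; apply: le_trans (ler_norm_sum _ _ _) _.
apply: ler_sum => i _; rewrite ler_norml; apply/andP; split.
  rewrite -subr_ge0 (_ : _ - _ = (x 0 i + y 0 i) ^+ 2 / 2); last by field.
  by rewrite divr_ge0// sqr_ge0.
rewrite -subr_ge0 (_ : _ - _ = (x 0 i - y 0 i) ^+ 2 / 2); last by field.
by rewrite divr_ge0// sqr_ge0.
Qed.

(** A profile of x . xi supported in |x|^2 <= 1 / a; at a = 0 the truncation disappears, since
    [cutoff] is 1 at 0. *)
Definition bump (a : R) (w : R -> R) (xi x : V) : R := cutoff (a * vdot x x) * w (vdot x xi).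

(* [x . grad] of [bump a w xi], where [w'] is the derivative of [w]. *)
Definition euler (a : R) (w w' : R -> R) (xi x : V) : R :=
  2 * (a * vdot x x) * cutoff' (a * vdot x x) * w (vdot x xi) +
  vdot x xi * cutoff (a * vdot x x) * w' (vdot x xi).

Lemma derive_vdotvv (x v : V) : is_derive x v (fun y : V => vdot y y : R) (2 * vdot x v).
Proof.
apply/is_derive_lineP.
have -> : (fun h : R => vdot (h *: v + x) (h *: v + x)) =
    (fun h : R => (h * h) * vdot v v + h * (2 * vdot x v) + vdot x x).
  apply/funext => h; rewrite /vdot mulr_sumr mulr_sumr mulr_sumr -!big_split/=.
  by apply: eq_bigr => i _; rewrite !mxE; ring.
have := derive_add (derive_add
  (derive_mul (derive_mul (derive_idfun (0 : R)) (derive_idfun 0)) (derive_const 0 (vdot v v)))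
  (derive_mul (derive_idfun 0) (derive_const 0 (2 * vdot x v)))) (derive_const 0 (vdot x x)).
move=> h; apply: (is_derive_eq h); by ring.
Qed.

Lemma derive_vdot (x v xi : V) : is_derive x v (fun y : V => vdot y xi : R) (vdot v xi).
Proof.
apply/is_derive_lineP.
have -> : (fun h : R => vdot (h *: v + x) xi) = (fun h : R => vdot v xi * h + vdot x xi).
  by apply/funext => h; rewrite vdotDl vdotZl mulrC.
by apply: (is_derive_eq (derive_add (derive_scale _ 0) (derive_const 0 (vdot x xi))));
  rewrite addr0.
Qed.

Lemma vdot_delta (i : 'I_d) (x : V) : vdot (delta_mx 0 i) x = x 0 i.
Proof.
rewrite /vdot (bigD1 i)//= big1 ?addr0; first by rewrite mxE !eqxx mul1r.
by move=> j ji; rewrite mxE (negbTE ji) andbF mul0r.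
Qed.

Lemma vdotC (x y : V) : vdot x y = vdot y x.
Proof. by apply: eq_bigr => i _; rewrite mulrC. Qed.

Lemma derive_bump (a : R) (w w' : R -> R) (xi x v : V) :
  (forall r, is_derive r (1 : R) w (w' r)) ->
  is_derive x v (bump a w xi)
    (cutoff' (a * vdot x x) * (a * (2 * vdot x v)) * w (vdot x xi) +
     cutoff (a * vdot x x) * (w' (vdot x xi) * vdot v xi)).
Proof.
move=> dw; apply: derive_vmul; last exact: (derive_vcomp (derive_vdot x v xi) (dw _)).
have dc := derive_vcomp (derive_vdotvv x v) (derive_scale a (vdot x x)).
exact: (derive_vcomp dc (derive_cutoff _)).
Qed.

Lemma euler_bump (a : R) (w w' : R -> R) (xi x : V) :
  (forall r, is_derive r (1 : R) w (w' r)) ->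
  \sum_i x 0 i * pd i (bump a w xi) x = euler a w w' xi x.
Proof.
move=> dw.
have pdE i : pd i (bump a w xi) x =
    cutoff' (a * vdot x x) * (a * (2 * x 0 i)) * w (vdot x xi) +
     cutoff (a * vdot x x) * (w' (vdot x xi) * xi 0 i).
  rewrite /pd; have [_ ->] := derive_bump a xi x (delta_mx 0 i) dw.
  by rewrite (vdotC x) !vdot_delta.
rewrite /euler.
under eq_bigr do rewrite pdE mulrDr.
set c := cutoff _; set c' := cutoff' _; set W := w _; set W' := w' _.
rewrite big_split/= /vdot; congr (_ + _); last first.
  by rewrite !mulr_suml; apply: eq_bigr => i _; ring.
by rewrite !mulr_sumr !mulr_suml; apply: eq_bigr => i _; ring.
Qed.

Lemma smooth_bump (a : R) (w : R -> R) (xi : V) : smooth1 w -> smooth (bump a w xi).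
Proof.
move=> sw; apply: smooth_class_smooth; apply: SC_mul.
  apply: (SC_comp (@smooth1_cutoff R)); apply: SC_mul; last exact: (SC_vdotvv R i0).
  exact: SC_const (SC_coord R i0).
by apply: SC_comp => //; exact: (SC_vdot i0).
Qed.

Lemma test_fun_bump (a : R) (w : R -> R) (xi : V) : 0 < a -> smooth1 w ->
  test_fun (bump a w xi).
Proof.
move=> a0 sw; split; first exact: smooth_bump.
exists (1 + a^-1) => x Mx; rewrite /bump cutoff_out ?mul0r//.
have a1 : 0 < a^-1 by rewrite invr_gt0.
rewrite -ler_pdivrMl// mulr1.
have <- : vnorm x ^+ 2 = vdot x x by rewrite sqr_sqrtr// vdotvv_ge0.
have M0 : 0 <= 1 + a^-1 by rewrite addr_ge0// ltW.
apply: (@le_trans _ _ ((1 + a^-1) ^+ 2)).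
  rewrite sqrrD expr1n mul1r addrAC -[leLHS]add0r lerD//.
    by rewrite addr_ge0// sqr_ge0.
  by rewrite mulr2n lerDl ltW.
by rewrite lerXn2r// ?nnegrE ?sqrtr_ge0// ltW.
Qed.

Lemma bump_le (a : R) (w : R -> R) (xi x : V) : 0 <= a -> (forall r, `|w r| <= 1) ->
  `|bump a w xi x| <= cutoff_bound R.
Proof.
move=> a0 w1; rewrite normrM -[leRHS]mulr1 ler_pM//.
by rewrite cutoff_le// mulr_ge0 ?vdotvv_ge0.
Qed.

(** On the support of the cutoff |x|^2 < 1 / a, hence |x . xi| <= (1 / a + |xi|^2) / 2. The bound
    degenerates as a tends to 0. *)
Lemma euler_le (a : R) (w w' : R -> R) (xi x : V) : 0 < a ->
  (forall r, `|w r| <= 1) -> (forall r, `|w' r| <= 1) ->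
  `|euler a w w' xi x| <= cutoff_bound R * (2 + (a^-1 + vdot xi xi) / 2).
Proof.
move=> a0 w1 w'1.
have r0 : 0 <= a * vdot x x by rewrite mulr_ge0 ?vdotvv_ge0 ?ltW.
have B0 := cutoff_bound_ge0 R.
have X0 : 0 <= vdot xi xi := vdotvv_ge0 xi.
have ai : 0 < a^-1 by rewrite invr_gt0.
have [r1|r1] := leP 1 (a * vdot x x).
  rewrite /euler cutoff_out// cutoff'_out// mulr0 mul0r mulr0 mul0r addr0 normr0.
  by rewrite mulr_ge0// addr_ge0// divr_ge0// addr_ge0// ltW.
have r1' : vdot x x <= a^-1 by rewrite -[leRHS]mulr1 -ler_pdivrMl ?invr_gt0// invrK ltW.
rewrite /euler mulrDr; set r := a * vdot x x in r0 r1 *; clearbody r.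
have cr := cutoff_le r0; have cr' := cutoff'_le r0.
move: (cutoff r) (cutoff' r) cr cr' => c c' cr cr'.
apply: le_trans (ler_normD _ _) _; apply: lerD.
  rewrite !normrM (ger0_norm r0) (ger0_norm (_ : 0 <= 2))//.
  rewrite -[leRHS]mulr1 ler_pM//; first by rewrite !mulr_ge0.
  rewrite mulrC ler_pM//; first by rewrite mulr_ge0.
  by rewrite -[leRHS]mulr1 ler_wpM2l// ltW.
rewrite !normrM -[leRHS]mulr1 ler_pM//.
rewrite mulrC ler_pM//.
by apply: le_trans (vdot_le _ _) _; rewrite ler_wpM2r// lerD2r.
Qed.

Lemma measurable_bump (a : R) (w : R -> R) (xi : V) : continuous w ->
  measurable_fun setT (bump a w xi : bvec R d -> R).
Proof.
move=> cw; apply: measurable_funM.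
  apply: (measurableT_comp (continuous_measurable_fun continuous_cutoff)).
  by apply: measurable_funM; [exact: measurable_cst|exact: measurable_vdotvv].
exact: (measurableT_comp (continuous_measurable_fun cw) (measurable_vdot xi)).
Qed.

Lemma measurable_euler (a : R) (w w' : R -> R) (xi : V) : continuous w -> continuous w' ->
  measurable_fun setT (euler a w w' xi : bvec R d -> R).
Proof.
move=> cw cw'.
have mr : measurable_fun setT (fun x : bvec R d => a * vdot (x : V) x).
  by apply: measurable_funM; [exact: measurable_cst|exact: measurable_vdotvv].
apply: measurable_funD; apply: measurable_funM.
- apply: measurable_funM; first by apply: measurable_funM => //; exact: measurable_cst.
  exact: (measurableT_comp (continuous_measurable_fun continuous_cutoff') mr).
- exact: (measurableT_comp (continuous_measurable_fun cw) (measurable_vdot xi)).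
- apply: measurable_funM; first exact: measurable_vdot.
  exact: (measurableT_comp (continuous_measurable_fun continuous_cutoff) mr).
- exact: (measurableT_comp (continuous_measurable_fun cw') (measurable_vdot xi)).
Qed.

(* [t |-> bump (a t^2) w (t xi) x] is [t |-> bump a w xi (t x)] *)
Lemma derive_bump_dil (a : R) (w w' : R -> R) (xi x : V) (t : R) : t != 0 ->
  (forall r, is_derive r (1 : R) w (w' r)) ->
  is_derive t (1 : R) (fun t => bump (a * t ^+ 2) w (t *: xi) x)
    (t^-1 * euler (a * t ^+ 2) w w' (t *: xi) x).
Proof.
move=> t0 dw.
have -> : (fun t => bump (a * t ^+ 2) w (t *: xi) x) =
    (fun t => cutoff (a * vdot x x * (t * t)) * w (vdot x xi * t)).
  by apply/funext => s; rewrite /bump vdotZr; congr (cutoff _ * w _); ring.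
have d2 := derive_mul (derive_const t (a * vdot x x))
  (derive_mul (derive_idfun t) (derive_idfun t)).
apply: (is_derive_eq (derive_mul (derive_comp d2 (derive_cutoff _))
  (derive_comp (derive_scale (vdot x xi) t) (dw _)))).
rewrite /euler vdotZr.
have -> : a * vdot x x * (t * t) = a * t ^+ 2 * vdot x x by ring.
by rewrite (mulrC (vdot x xi)); field.
Qed.

End TestFunctions.

(** * The ray equation of an equilibrium *)

Section EquilibriumODE.
Variables (R : realType) (d : nat) (i0 : 'I_d) (K F : 'rV[R]_d -> R) (eps alpha : R).
Local Notation V := 'rV[R]_d.
Local Notation mu := (bmu R d).
Hypotheses (pK : is_pdf mu K) (pF : is_pdf mu F) (eps0 : 0 < eps).
Hypothesis eqF : equilibrium K eps alpha F.
Let lam := eps `^ (- alpha).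

(** The weak equation split into three separately convergent integrals, its nonlocal term rewritten
    by [conv_jump]. *)
Lemma equilibrium_jump (phi : V -> R) (M N : R) : test_fun phi ->
  measurable_fun setT (phi : bvec R d -> R) -> (forall x, `|phi x| <= M) ->
  measurable_fun setT ((fun x : V => \sum_i x 0 i * pd i phi x) : bvec R d -> R) ->
  (forall x : V, `|\sum_i x 0 i * pd i phi x| <= N) ->
  expect mu F (fun x => \sum_i (x : V) 0 i * pd i phi x) =
  lam * (jump K F eps phi - expect mu F phi).
Proof.
move=> tphi mphi phiM mg gN; have := eqF.2 _ tphi.
set g := fun x : V => \sum_i x 0 i * pd i phi x in mg gN *.
have [ci cE] := conv_jump pK pF eps0 mphi phiM.
have iF := expect_integrable pF mphi phiM.
have ig := expect_integrable pF mg gN.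
pose h x := lam * (Defs.conv (scale eps K) F x * phi x) - lam * (phi x * F x) - g x * F x.
have ilin c (f : bvec R d -> R) : mu.-integrable setT (EFin \o f) ->
    mu.-integrable setT (EFin \o (fun x => c * f x)).
  move=> fi; rewrite (_ : _ \o _ = (fun x => c%:E * (EFin \o f) x)%E)//.
  exact: integrableZl.
have isub (f1 f2 : bvec R d -> R) : mu.-integrable setT (EFin \o f1) ->
    mu.-integrable setT (EFin \o f2) -> mu.-integrable setT (EFin \o (fun x => f1 x - f2 x)).
  move=> i1 i2; rewrite (_ : _ \o _ = ((EFin \o f1) \- (EFin \o f2))%E).
    exact: integrableB.
  by apply/funext => x /=; rewrite EFinB.
have i12 := isub _ _ (ilin lam _ ci) (ilin lam _ iF).
have ih : mu.-integrable setT (EFin \o h) by exact: (isub _ _ i12 ig).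
rewrite [X in Lint X](_ : _ = h); last by apply/funext => x; rewrite /h /g /lam; ring.
rewrite LintE; last by apply/measurable_EFinP; exact: measurable_int ih.
move/(congr1 (@fine R)); rewrite -/(Rintegral mu setT h) /=.
rewrite (RintegralB measurableT i12 ig).
rewrite (RintegralB measurableT (ilin lam _ ci) (ilin lam _ iF)).
rewrite !RintegralZl// cE -/(expect mu F phi) -/(expect mu F g) -mulrBr => /eqP.
by rewrite subr_eq0 => /eqP.
Qed.

Section Profile.
Variables (w w' : R -> R) (xi : V).
Hypotheses (sw : smooth1 w) (dw : forall r, is_derive r (1 : R) w (w' r)).
Hypotheses (w1 : forall r, `|w r| <= 1) (w'1 : forall r, `|w' r| <= 1) (cw' : continuous w').

Let cw : continuous w. Proof. by move=> x; exact: is_derive_continuous (dw x). Qed.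
Let mw : measurable_fun setT w. Proof. exact: continuous_measurable_fun. Qed.

(** The truncation a t^2 varies with t so that x enters only through t x; differentiation in t then
    produces the Euler term of the weak equation. *)
Let U (a t : R) := expect mu F (bump (a * t ^+ 2) w (t *: xi)).
Let g (a t : R) := lam / t * (jump K F eps (bump (a * t ^+ 2) w (t *: xi)) - U a t).

(** Differentiation under the integral gives the mean of [euler] divided by t, and the weak equation
    replaces that mean by a jump term. *)
Let U_derive (a t : R) : 0 < a -> 0 < t -> is_derive t (1 : R) (U a) (g a t).
Proof.
move=> a0 t0.
pose f (s : R) (x : bvec R d) : R := bump (a * s ^+ 2) w (s *: xi) x * F x.
have [mF F0 F1] := pF.
have at0 s : 0 < s -> 0 < a * s ^+ 2 by move=> s0; rewrite mulr_gt0// exprn_gt0.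
(* Away from s = 0 the s-derivatives share the bound C, which multiplied by F serves as dominating
   function. *)
pose I := `]t / 2, 2 * t[%classic : set R.
have Ipos s : I s -> 0 < s.
  by rewrite /I/= in_itv/= => /andP[+ _]; apply: lt_trans; rewrite divr_gt0.
have df s x : I s -> is_derive s (1 : R) (f ^~ x)
    (s^-1 * euler (a * s ^+ 2) w w' (s *: xi) x * F x).
  move=> /Ipos s0.
  have := derive_mul (derive_bump_dil a xi x (lt0r_neq0 s0) dw) (derive_const s (F x)).
  by rewrite mulr0 addr0.
pose C := (t / 2)^-1 * (cutoff_bound R *
  (2 + ((a * (t / 2) ^+ 2)^-1 + (2 * t) ^+ 2 * vdot xi xi) / 2)).
have t20 : 0 < t / 2 by rewrite divr_gt0.
have C0 : 0 <= C.
  rewrite mulr_ge0 ?invr_ge0 ?(ltW t20)// mulr_ge0 ?cutoff_bound_ge0// addr_ge0//.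
  rewrite divr_ge0// addr_ge0 ?invr_ge0 ?(ltW (at0 _ t20))//.
  by rewrite mulr_ge0 ?sqr_ge0// vdotvv_ge0.
have eC s x : I s -> `|s^-1 * euler (a * s ^+ 2) w w' (s *: xi) x| <= C.
  move=> Is; have s0 := Ipos _ Is.
  move: Is; rewrite /I/= in_itv/= => /andP[ts st].
  rewrite normrM; apply: ler_pM => //.
    by rewrite ger0_norm ?invr_ge0 ?(ltW s0)// lef_pV2// ?posrE// ltW.
  apply: le_trans (euler_le _ _ (at0 s s0) w1 w'1) _.
  rewrite ler_wpM2l ?cutoff_bound_ge0// lerD2l ler_wpM2r// lerD//.
    rewrite lef_pV2 ?posrE ?at0// ler_wpM2l ?(ltW a0)//.
    by rewrite lerXn2r ?nnegrE ?(ltW t20) ?(ltW s0)// ltW.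
  rewrite vdotZr vdotZl mulrA -expr2 ler_wpM2r ?vdotvv_ge0// lerXn2r ?nnegrE ?(ltW s0)//.
    by rewrite mulr_ge0// ltW.
  exact: ltW.
have int_f s : I s -> mu.-integrable setT (EFin \o f s).
  move=> /Ipos s0; apply: (expect_integrable (M := cutoff_bound R) pF).
    exact: measurable_bump.
  by move=> x; apply: bump_le => //; apply: ltW; exact: at0.
have It : I t.
  by rewrite /I/= in_itv/= ltr_pdivrMr// ltr_pMr// ltr1n ltr_pMl// ltr1n.
have CF_int : mu.-integrable setT (EFin \o (fun x => C * F x)).
  rewrite (_ : _ \o _ = (fun x => C%:E * (EFin \o F) x)%E)//.
  by apply: integrableZl => //; exact: pdf_integrable.
have CF0 x : 0 <= C * F x by rewrite mulr_ge0.
have derf1 s x : I s -> setT x -> derivable (f ^~ x) s 1.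
  by move=> Is _; case: (df s x Is).
have d1E s x : I s -> partial1of2 f s x = s^-1 * euler (a * s ^+ 2) w w' (s *: xi) x * F x.
  by move=> Is; rewrite partial1of2E; have [_ ->] := df s x Is.
have G_ub s x : I s -> setT x -> `|partial1of2 f s x| <= C * F x.
  move=> Is _; rewrite (d1E s x Is) normrM (ger0_norm (F0 x)) ler_wpM2r//.
  exact: eC.
have DU := @derivable_under_integral R _ _ mu f setT measurableT t _ _ It int_f derf1
  (fun x => C * F x) CF0 CF_int G_ub.
have EU := @differentiation_under_integral R _ _ mu f setT measurableT t _ _ It int_f derf1
  (fun x => C * F x) CF0 CF_int G_ub.
apply: DeriveDef; first exact: DU.
rewrite -derive1E; apply: etrans EU _.
have tE := @euler_bump R d (a * t ^+ 2) w w' (t *: xi).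
transitivity (t^-1 * expect mu F (fun x => \sum_i (x : V) 0 i *
    pd i (bump (a * t ^+ 2) w (t *: xi)) x)).
  rewrite /expect -RintegralZl//.
    by apply: eq_Rintegral => x _; rewrite (d1E t x It) tE// mulrA.
  apply: (expect_integrable (M := cutoff_bound R *
      (2 + ((a * t ^+ 2)^-1 + vdot (t *: xi) (t *: xi)) / 2)) pF).
    under eq_fun do rewrite tE//.
    exact: measurable_euler.
  by move=> x; rewrite tE//; apply: euler_le => //; exact: at0.
rewrite (@equilibrium_jump _ (cutoff_bound R) (cutoff_bound R *
    (2 + ((a * t ^+ 2)^-1 + vdot (t *: xi) (t *: xi)) / 2))).
- by rewrite /g mulrA (mulrC t^-1).
- by apply: test_fun_bump => //; exact: at0.
- exact: measurable_bump.
- by move=> x; apply: bump_le => //; apply: ltW; exact: at0.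
- under eq_fun do rewrite tE//.
  exact: measurable_euler.
- by move=> x; rewrite tE//; apply: euler_le => //; exact: at0.
Qed.

Let measurable_jump_bump (a : R) (zeta : V) :
  measurable_fun setT (fun z : bvec R d * bvec R d =>
    bump a w zeta ((z.1 : V) + eps *: (z.2 : V))).
Proof.
exact: (measurableT_comp (measurable_bump a zeta cw) (measurable_vadd_scale eps)).
Qed.

Let jump_integrable (a : R) (zeta : V) : 0 <= a ->
  mu.-integrable setT (EFin \o (fun y : bvec R d =>
    expect mu K (fun z => bump a w zeta (y + eps *: z)) * F y)).
Proof.
move=> a0.
have iFK := integrable_prodM (pdf_integrable pF) (pdf_integrable pK).
have iFKb := integrable_mulr_bounded (measurable_jump_bump a zeta)
  (fun z => bump_le zeta _ a0 w1) iFK.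
have := integrable_Rint_section2 iFKb; congr (is_true (_.-integrable _ _)).
apply/funext => y /=; congr EFin.
rewrite /expect -RintegralZr//; first by apply: eq_Rintegral => z _; ring.
apply: (expect_integrable (M := cutoff_bound R) pK); last by move=> z; exact: bump_le.
exact: (measurableT_comp (measurable_jump_bump a zeta) (pair1_measurable y)).
Qed.

Let cvg_bump (a_ t_ : nat -> R) (a t : R) (x : V) :
  a_ n @[n --> \oo] --> a -> t_ n @[n --> \oo] --> t ->
  bump (a_ n * t_ n ^+ 2) w (t_ n *: xi) x @[n --> \oo] --> bump (a * t ^+ 2) w (t *: xi) x.
Proof.
move=> ca ct; rewrite /bump; apply: cvgM.
  apply: (@cvg_comp _ _ _ (fun n => a_ n * t_ n ^+ 2 * vdot x x) (@cutoff R)); last first.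
    exact: continuous_cutoff.
  by apply: cvgM; [apply: cvgM => //; rewrite expr2; exact: cvgM|exact: cvg_cst].
under eq_fun do rewrite vdotZr; rewrite vdotZr.
apply: (@cvg_comp _ _ _ (fun n => t_ n * vdot x xi) w); last exact: cw.
by apply: cvgM => //; exact: cvg_cst.
Qed.

Let cvg_U (a_ t_ : nat -> R) (a t : R) : (forall n, 0 <= a_ n) -> 
  a_ n @[n --> \oo] --> a -> t_ n @[n --> \oo] --> t ->
  U (a_ n) (t_ n) @[n --> \oo] --> U a t.
Proof.
move=> a0 ca ct; apply: (expect_dominated_cvg pF (M := cutoff_bound R)).
- by move=> n; exact: measurable_bump.
- exact: measurable_bump.
- by move=> n x; apply: bump_le => //; rewrite mulr_ge0// sqr_ge0.
- by move=> x; exact: cvg_bump.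
Qed.

Let J (a t : R) := jump K F eps (bump (a * t ^+ 2) w (t *: xi)).

Let cvg_J (a_ t_ : nat -> R) (a t : R) : (forall n, 0 <= a_ n) -> 0 <= a ->
  a_ n @[n --> \oo] --> a -> t_ n @[n --> \oo] --> t ->
  J (a_ n) (t_ n) @[n --> \oo] --> J a t.
Proof.
move=> an0 a0 ca ct; have [mF F0 F1] := pF.
have p0 b s : 0 <= b -> 0 <= b * s ^+ 2 :> R by move=> b0; rewrite mulr_ge0// sqr_ge0.
have mK b (zeta y : V) : measurable_fun setT (fun z : bvec R d => bump b w zeta (y + eps *: (z : V))).
  exact: (measurableT_comp (measurable_jump_bump b zeta) (pair1_measurable (y : bvec R d))).
have EK b s y : 0 <= b -> `|expect mu K (fun z => bump (b * s ^+ 2) w (s *: xi) (y + eps *: z))| <=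
    cutoff_bound R.
  move=> b0; apply: (expect_norm_le pK); first exact: mK.
  by move=> z; apply: bump_le => //; exact: p0.
apply: (@Rintegral_dominated_cvg _ _ _ mu setT _ _ (fun x => cutoff_bound R * F x)) => //.
- move=> n; apply/measurable_EFinP; apply: measurable_int; apply: jump_integrable; exact: p0.
- apply/measurable_EFinP; apply: measurable_int; apply: jump_integrable; exact: p0.
- rewrite (_ : _ \o _ = (fun x => (cutoff_bound R)%:E * (EFin \o F) x)%E)//.
  by apply: integrableZl => //; exact: pdf_integrable.
- by move=> n x _; rewrite normrM (ger0_norm (F0 x)) ler_wpM2r//; exact: EK.
- move=> y _; apply: cvgM; last exact: cvg_cst.
  apply: (expect_dominated_cvg pK (M := cutoff_bound R)).
  + by move=> n; exact: mK.
  + exact: mK.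
  + by move=> n x; apply: bump_le => //; exact: p0.
  + by move=> x; exact: cvg_bump.
Qed.

Let lam0 : 0 < lam. Proof. exact: powR_gt0. Qed.

Let U_le a t : 0 <= a -> `|U a t| <= cutoff_bound R.
Proof.
move=> a0; apply: (expect_norm_le pF); first exact: measurable_bump.
by move=> x; apply: bump_le => //; rewrite mulr_ge0// sqr_ge0.
Qed.

Let J_le a t : 0 <= a -> `|J a t| <= cutoff_bound R.
Proof.
move=> a0; rewrite /J /jump.
have p0 : 0 <= a * t ^+ 2 by rewrite mulr_ge0// sqr_ge0.
have i1 := jump_integrable (t *: xi) p0.
have [mF F0 F1] := pF.
apply: le_trans (le_normr_Rintegral _ i1) _ => //.
rewrite -[leRHS](expect_cst (cutoff_bound R) pF); apply: le_Rintegral => //.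
- exact: integrable_norm.
- rewrite (_ : _ \o _ = (fun x => (cutoff_bound R)%:E * (EFin \o F) x)%E)//.
  by apply: integrableZl => //; exact: pdf_integrable.
- move=> y _; rewrite normrM (ger0_norm (F0 y)) ler_wpM2r//.
  apply: (expect_norm_le pK); last by move=> z; exact: bump_le.
  exact: (measurableT_comp (measurable_jump_bump _ _) (pair1_measurable y)).
Qed.

(** The bound does not involve a, unlike [euler_le]: the equation has traded the Euler term for
    differences of bounded expectations. *)
Let g_le a t1 t : 0 <= a -> 0 < t1 -> t1 <= t -> `|g a t| <= lam / t1 * (cutoff_bound R + cutoff_bound R).
Proof.
move=> a0 t10 t1t; have t0 := lt_le_trans t10 t1t.
rewrite /g normrM ler_pM//.
  rewrite ger0_norm ?divr_ge0 ?(ltW lam0) ?(ltW t0)//.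
  by rewrite ler_wpM2l ?(ltW lam0)// lef_pV2.
by apply: le_trans (ler_normB _ _) _; apply: lerD; [exact: J_le|exact: U_le].
Qed.

Let cvg_g (a_ t_ : nat -> R) (a t : R) : (forall n, 0 <= a_ n) -> 0 <= a -> 0 < t ->
  a_ n @[n --> \oo] --> a -> t_ n @[n --> \oo] --> t ->
  g (a_ n) (t_ n) @[n --> \oo] --> g a t.
Proof.
move=> an0 a0 t0 ca ct; apply: cvgM; last by apply: cvgB; [exact: cvg_J|exact: cvg_U].
by apply: cvgM; [exact: cvg_cst|apply: cvgV => //; rewrite gt_eqF].
Qed.

Let continuous_g a t : 0 <= a -> 0 < t -> {for t, continuous (g a)}.
Proof.
move=> a0 t0; apply/(@cvg_nbhsP _ R^o) => s st.
by apply: cvg_g => //; exact: cvg_cst.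
Qed.

Let within_g a t1 t2 : 0 <= a -> 0 < t1 -> {within `[t1, t2], continuous (g a)}.
Proof.
move=> a0 t10; apply: continuous_in_subspaceT => x; rewrite inE/= in_itv/= => /andP[tx _].
by apply: continuous_g => //; exact: lt_le_trans tx.
Qed.

Let U_FTC a t1 t2 : 0 < a -> 0 < t1 -> t1 < t2 ->
  \int[@lebesgue_measure R]_(t in `[t1, t2]) g a t = U a t2 - U a t1.
Proof.
move=> a0 t10 t12; have t20 := lt_trans t10 t12.
rewrite /Rintegral (@continuous_FTC2 _ (g a) (U a) t1 t2)//.
- by apply: within_g => //; exact: ltW.
- split.
  + by move=> x; rewrite in_itv/= => /andP[tx _]; case: (U_derive a0 (lt_trans t10 tx)).
  + apply: cvg_at_right_filter; exact: is_derive_continuous (U_derive a0 t10).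
  + apply: cvg_at_left_filter; exact: is_derive_continuous (U_derive a0 t20).
- move=> x; rewrite in_itv/= => /andP[tx _].
  exact: derive1_eq (U_derive a0 (lt_trans t10 tx)).
Qed.

(** The limit a = 1 / (n + 1) -> 0 of the integrated equation, by dominated convergence on both
    sides. Passing to the limit in the derivatives directly would need uniformity in t. *)
Let U0_FTC t1 t2 : 0 < t1 -> t1 < t2 ->
  \int[@lebesgue_measure R]_(t in `[t1, t2]) g 0 t = U 0 t2 - U 0 t1.
Proof.
move=> t10 t12.
pose a_ (n : nat) : R := n.+1%:R^-1.
have a0 n : 0 < a_ n by rewrite invr_gt0.
have ca : a_ n @[n --> \oo] --> (0 : R) by exact: cvg_harmonic.
have L : \int[@lebesgue_measure R]_(t in `[t1, t2]) g (a_ n) t @[n --> \oo] -->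
    \int[@lebesgue_measure R]_(t in `[t1, t2]) g 0 t.
  have mg a : 0 <= a -> measurable_fun `[t1, t2] (g a).
    move=> a_0; apply: subspace_continuous_measurable_fun; first exact: measurable_itv.
    exact: within_g.
  apply: (@Rintegral_dominated_cvg _ _ _ (@lebesgue_measure R) `[t1, t2]%classic _ _
    (fun=> lam / t1 * (cutoff_bound R + cutoff_bound R))).
  - exact: measurable_itv.
  - by move=> n; apply: mg; exact: ltW.
  - exact: mg.
  - apply: continuous_compact_integrable; first exact: segment_compact.
    by apply: continuous_subspaceT => x; exact: cvg_cst.
  - by move=> n x; rewrite /= in_itv/= => /andP[tx _]; apply: g_le => //; exact: ltW.
  - move=> x; rewrite /= in_itv/= => /andP[tx _].
    apply: cvg_g => //; [by move=> n; exact: ltW|exact: lt_le_trans tx|exact: cvg_cst].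
have L' : (U (a_ n) t2 - U (a_ n) t1) @[n --> \oo] --> U 0 t2 - U 0 t1.
  apply: cvgB; apply: cvg_U => //; [by move=> n; exact: ltW|exact: cvg_cst|
    by move=> n; exact: ltW|exact: cvg_cst].
have E : (fun n => \int[@lebesgue_measure R]_(t in `[t1, t2]) g (a_ n) t) =
   (fun n => U (a_ n) t2 - U (a_ n) t1).
  by apply/funext => n; exact: U_FTC.
by rewrite E in L; exact: (cvg_unique _ L L').
Qed.

(** The untruncated equation holds in integrated form with continuous right-hand side, so the
    fundamental theorem of calculus restores the derivative. *)
Lemma expect_profile_derive (t : R) : 0 < t ->
  is_derive t (1 : R) (fun t => expect mu F (fun x => w (t * vdot (x : V) xi)))
    (lam / t * (jump K F eps (fun x => w (t * vdot x xi)) -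
      expect mu F (fun x => w (t * vdot (x : V) xi)))).
Proof.
move=> t0.
have bE s : bump (0 * s ^+ 2) w (s *: xi) = (fun x => w (s * vdot x xi)).
  by apply/funext => x; rewrite /bump !mul0r cutoff0 mul1r vdotZr.
have UE : U 0 = (fun t => expect mu F (fun x => w (t * vdot (x : V) xi))).
  by apply/funext => s; rewrite /U bE.
suff : is_derive t (1 : R) (U 0) (g 0 t) by rewrite /g UE bE.
pose t1 := t / 2.
have t10 : 0 < t1 by rewrite divr_gt0.
have t1t : t1 < t by rewrite ltr_pdivrMr// ltr_pMr// ltr1n.
have gi : (@lebesgue_measure R).-integrable `[t1, (2 * t)] (EFin \o g 0).
  by apply: continuous_compact_integrable; [exact: segment_compact|exact: within_g].
have t2t : t < 2 * t by rewrite ltr_pMl// ltr1n.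
have [d1 d2] := @continuous_FTC1 R (g 0) (BLeft t1) t (2 * t) t2t gi
  t1t (continuous_g (lexx _) t0).
have dI : is_derive t (1 : R)
    (fun x => \int[@lebesgue_measure R]_(s in [set` Interval (BLeft t1) (BRight x)]) g 0 s) (g 0 t).
  by split; [exact: d1|rewrite -derive1E; exact: d2].
have dA := derive_add dI (derive_const t (U 0 t1)); rewrite addr0 in dA.
apply: (near_eq_is_derive _ dA).
near=> s; have t1s : t1 < s by near: s; exact: (cvgr_gt t).
by rewrite (U0_FTC t10 t1s) subrK.
Unshelve. all: by end_near. Qed.

End Profile.

Lemma continuous_sinN : continuous (fun x : R => - sin x).
Proof. by move=> x; apply: cvgN; exact: continuous_sin. Qed.

Local Notation proj xi := (fun x : bvec R d => vdot (x : V) xi).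

Let expect_trig (G : bvec R d -> R) xi t a b : is_pdf mu G ->
  expect mu G (fun x => a * cos (t * vdot (x : V) xi) + b * sin (t * vdot (x : V) xi)) =
  a * charc mu G (proj xi) t + b * chars mu G (proj xi) t.
Proof.
move=> pG; apply: (expect_lin (M := 1) (N := 1) _ _ pG).
- by apply: measurable_cosM; exact: measurable_vdot.
- by move=> x; exact: cos_norm_le1.
- by apply: measurable_sinM; exact: measurable_vdot.
- by move=> x; exact: sin_norm_le1.
Qed.

(** Addition formulas: the characteristic function of X + eps Y, for independent X and Y, is the
    product of the two; this is the real part, and [jump_sinE] is the imaginary one. *)
Let jump_cosE xi t : jump K F eps (fun x => cos (t * vdot x xi)) =
  charc mu F (proj xi) t * charc mu K (proj xi) (eps * t) -
  chars mu F (proj xi) t * chars mu K (proj xi) (eps * t).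
Proof.
set p := charc mu K _ _; set q := chars mu K _ _.
have inner y : expect mu K (fun z => cos (t * vdot (y + eps *: z) xi)) =
    p * cos (t * vdot y xi) + - q * sin (t * vdot y xi).
  have := expect_trig xi (eps * t) (cos (t * vdot y xi)) (- sin (t * vdot y xi)) pK.
  rewrite -/p -/q => E; rewrite mulrC mulNr (mulrC q) -mulNr -E; congr expect.
  apply/funext => z; rewrite vdotDl vdotZl mulrDr mulNr -cosD.
  by congr (cos (_ + _)); ring.
rewrite /jump; under eq_fun do rewrite inner.
by rewrite (expect_trig _ _ _ _ pF); ring.
Qed.

Let jump_sinE xi t : jump K F eps (fun x => sin (t * vdot x xi)) =
  chars mu F (proj xi) t * charc mu K (proj xi) (eps * t) +
  charc mu F (proj xi) t * chars mu K (proj xi) (eps * t).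
Proof.
set p := charc mu K _ _; set q := chars mu K _ _.
have inner y : expect mu K (fun z => sin (t * vdot (y + eps *: z) xi)) =
    q * cos (t * vdot y xi) + p * sin (t * vdot y xi).
  have := expect_trig xi (eps * t) (sin (t * vdot y xi)) (cos (t * vdot y xi)) pK.
  rewrite -/p -/q => E; rewrite addrC mulrC (mulrC q) -E; congr expect.
  apply/funext => z; rewrite vdotDl vdotZl mulrDr sinD.
  by congr (sin _ * cos _ + cos _ * sin _); ring.
rewrite /jump; under eq_fun do rewrite inner.
by rewrite (expect_trig _ _ _ _ pF); ring.
Qed.

Lemma charc_derive (xi : V) (t : R) : 0 < t -> is_derive t (1 : R) (charc mu F (proj xi))
  (lam / t * (charc mu F (proj xi) t * charc mu K (proj xi) (eps * t) -
    chars mu F (proj xi) t * chars mu K (proj xi) (eps * t) - charc mu F (proj xi) t)).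
Proof.
move=> t0; rewrite -jump_cosE.
apply: (@expect_profile_derive (@cos R) (fun x => - sin x) xi) => //.
- exact: smooth1_cos.
- by move=> r; exact: cos_norm_le1.
- by move=> r; rewrite normrN; exact: sin_norm_le1.
- exact: continuous_sinN.
Qed.

Lemma chars_derive (xi : V) (t : R) : 0 < t -> is_derive t (1 : R) (chars mu F (proj xi))
  (lam / t * (chars mu F (proj xi) t * charc mu K (proj xi) (eps * t) +
    charc mu F (proj xi) t * chars mu K (proj xi) (eps * t) - chars mu F (proj xi) t)).
Proof.
move=> t0; rewrite -jump_sinE.
apply: (@expect_profile_derive (@sin R) (@cos R) xi) => //.
- exact: smooth1_sin.
- by move=> r; exact: sin_norm_le1.
- by move=> r; exact: cos_norm_le1.
- exact: continuous_cos.
Qed.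

End EquilibriumODE.

(** * Comparison for ray equations *)

Section PlanarODE.
Variable R : realType.

(* Real form of [t psi' = - (A - i B) psi] for [psi = u + i v]. *)
Definition planar_ode (u v A B : R -> R) :=
  [/\ forall t : R, 0 < t -> is_derive t (1 : R) u (- (A t * u t + B t * v t) / t),
      forall t : R, 0 < t -> is_derive t (1 : R) v (- (A t * v t - B t * u t) / t),
      forall t : R, 0 <= t -> {for t, continuous u},
      forall t : R, 0 <= t -> {for t, continuous v} & u 0 = 1 /\ v 0 = 0].

Definition sqmod (u v : R -> R) (t : R) : R := u t ^+ 2 + v t ^+ 2.

Lemma sqmod_ge0 u v t : 0 <= sqmod u v t.
Proof. by rewrite addr_ge0// sqr_ge0. Qed.

Lemma continuous_nneg_within (f : R -> R) (a b : R) : 0 <= a ->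
  (forall t : R, 0 <= t -> {for t, continuous f}) -> {within `[a, b], continuous f}.
Proof.
move=> a0 cf; apply: continuous_in_subspaceT => x; rewrite inE/= in_itv/= => /andP[ax _].
by apply: cf; exact: le_trans ax.
Qed.

Lemma within_continuousM (A : set R) (f g : R -> R) : {within A, continuous f} ->
  {within A, continuous g} -> {within A, continuous (fun x => f x * g x)}.
Proof. by move=> cf cg x; exact: (cvgM (cf x) (cg x)). Qed.

Lemma within_continuousD (A : set R) (f g : R -> R) : {within A, continuous f} ->
  {within A, continuous g} -> {within A, continuous (fun x => f x + g x)}.
Proof. by move=> cf cg x; exact: (cvgD (cf x) (cg x)). Qed.

Lemma within_continuousN (A : set R) (f : R -> R) : {within A, continuous f} ->
  {within A, continuous (fun x => - f x)}.
Proof. by move=> cf x; exact: (cvgN (cf x)). Qed.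

Lemma within_continuous_comp (A : set R) (f g : R -> R) : {within A, continuous f} ->
  continuous g -> {within A, continuous (fun x => g (f x))}.
Proof. by move=> cf cg x; exact: (cvg_comp _ _ (cf x) (cg (f x))). Qed.

Lemma within_cst (A : set R) (c : R) : {within A, continuous (fun=> c : R)}.
Proof. by apply: continuous_subspaceT => x; exact: cvg_cst. Qed.

Lemma derive_expR2 (beta : R -> R) (t b : R) : is_derive t (1 : R) beta b ->
  is_derive t (1 : R) (fun t => expR (2 * beta t)) (2 * b * expR (2 * beta t)).
Proof.
move=> db; have d2 := derive_mul (derive_const t (2 : R)) db.
by apply: (is_derive_eq (derive_comp d2 (is_derive_expR _))); rewrite mul0r add0r mulrC.
Qed.

Section System.
Variables (u v A B : R -> R).
Hypothesis ode : planar_ode u v A B.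

Let N := sqmod u v.

Lemma derive_sqmod (t : R) : 0 < t -> is_derive t (1 : R) N (- 2 * A t / t * N t).
Proof.
case: ode => du dv _ _ _ t0.
have := derive_add (derive_mul (du t t0) (du t t0)) (derive_mul (dv t t0) (dv t t0)).
rewrite (_ : (fun y => _) = N); last by apply/funext => y; rewrite /N /sqmod !expr2.
by move=> h; apply: (is_derive_eq h); rewrite /N /sqmod; field; rewrite gt_eqF.
Qed.

Lemma continuous_sqmod (t : R) : 0 <= t -> {for t, continuous N}.
Proof.
case: ode => _ _ cu cv _ t0.
rewrite (_ : N = fun y => u y * u y + v y * v y); last first.
  by apply/funext => y; rewrite /N /sqmod !expr2.
by apply: cvgD; apply: cvgM; [exact: cu|exact: cu|exact: cv|exact: cv].
Qed.

(** B only rotates psi, so N = |psi|^2 satisfies N' = - 2 A N / t. If t beta' <= A, the integrating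
    factor e^(2 beta) makes the product nonincreasing. *)
Lemma sqmod_le_exp (beta beta' : R -> R) (a b : R) : 0 <= a -> a <= b ->
  (forall t : R, a < t < b -> is_derive t (1 : R) beta (beta' t)) ->
  (forall t : R, a < t < b -> t * beta' t <= A t) ->
  {within `[a, b], continuous beta} ->
  N b * expR (2 * beta b) <= N a * expR (2 * beta a).
Proof.
move=> a0 ab db bA cb.
have pos t : a < t < b -> 0 < t by move=> /andP[at_ _]; exact: le_lt_trans at_.
apply: (@nonincreasing_itv _ (fun t => N t * expR (2 * beta t))
  (fun t => 2 * N t * expR (2 * beta t) * (beta' t - A t / t)) a b ab).
- move=> t tab; have t0 := pos t tab.
  apply: (is_derive_eq (derive_mul (derive_sqmod t0) (derive_expR2 (db t tab)))).
  by field; rewrite gt_eqF.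
- move=> t tab; have t0 := pos t tab.
  rewrite mulr_ge0_le0// ?mulr_ge0 ?expR_ge0 ?sqmod_ge0//.
  by rewrite subr_le0 ler_pdivlMr// mulrC bA.
- apply: within_continuousM; first exact: continuous_nneg_within continuous_sqmod.
  apply: within_continuous_comp; last exact: continuous_expR.
  by apply: within_continuousM => //; exact: within_cst.
Qed.

Lemma sqmod_ge_exp (beta beta' : R -> R) (a b : R) : 0 <= a -> a <= b ->
  (forall t : R, a < t < b -> is_derive t (1 : R) beta (beta' t)) ->
  (forall t : R, a < t < b -> A t <= t * beta' t) ->
  {within `[a, b], continuous beta} ->
  N a * expR (2 * beta a) <= N b * expR (2 * beta b).
Proof.
move=> a0 ab db bA cb.
have pos t : a < t < b -> 0 < t by move=> /andP[at_ _]; exact: le_lt_trans at_.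
rewrite -lerN2.
apply: (@nonincreasing_itv _ (fun t => - (N t * expR (2 * beta t)))
  (fun t => - (2 * N t * expR (2 * beta t) * (beta' t - A t / t))) a b ab).
- move=> t tab; have t0 := pos t tab.
  apply: (is_derive_eq (derive_opp (derive_mul (derive_sqmod t0) (derive_expR2 (db t tab))))).
  by field; rewrite gt_eqF.
- move=> t tab; have t0 := pos t tab.
  rewrite oppr_le0 mulr_ge0// ?mulr_ge0 ?expR_ge0 ?sqmod_ge0//.
  by rewrite subr_ge0 ler_pdivrMr// mulrC bA.
- apply: within_continuousN.
  apply: within_continuousM; first exact: continuous_nneg_within continuous_sqmod.
  apply: within_continuous_comp; last exact: continuous_expR.
  by apply: within_continuousM => //; exact: within_cst.
Qed.

Lemma sqmod0 : N 0 = 1.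
Proof. by case: ode => _ _ _ _ [u0 v0]; rewrite /N /sqmod u0 v0 expr1n expr0n addr0. Qed.

(* A solution driven by a small symbol stays close to [1]. *)
Lemma ode_near1 (h h' : R -> R) (b : R) : 0 <= b -> h 0 = 0 ->
  (forall t : R, 0 < t < b -> is_derive t (1 : R) h (h' t)) ->
  (forall t : R, 0 < t < b -> `|A t| <= t * h' t /\ `|B t| <= t * h' t) ->
  {within `[0, b], continuous h} ->
  (u b - 1) ^+ 2 + v b ^+ 2 <= 8 * (expR (h b) - 1) ^+ 2.
Proof.
move=> b0 h0 dh AB ch.
have Nle t : 0 <= t <= b -> N t <= expR (h t) ^+ 2.
  move=> /andP[t0 tb].
  have := @sqmod_le_exp (fun s => - h s) (fun s => - h' s) 0 t (lexx _) t0.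
  rewrite h0 oppr0 mulr0 expR0 mulr1 sqmod0 mulrN => H.
  rewrite -expRM_natl -[leRHS]mul1r -ler_pdivrMr ?expR_gt0// -expRN; apply: H.
  - move=> s /andP[s0 st]; apply: derive_opp; apply: dh.
    by rewrite s0 (lt_le_trans st tb).
  - move=> s /andP[s0 st]; rewrite mulrN lerNl.
    have [|+ _] := AB s; first by rewrite s0 (lt_le_trans st tb).
    by apply: le_trans; rewrite -normrN ler_norm.
  - apply: within_continuousN; apply: continuous_subspaceW ch.
    exact: subset_itvl.
have [du dv cu cv [u0 v0]] := ode.
have h'0 t : 0 < t < b -> 0 <= h' t.
  move=> tb; have [+ _] := AB t tb; move/(le_trans (normr_ge0 _)).
  by case/andP: tb => t0 _; rewrite pmulr_rge0.
have ule t : 0 <= t <= b -> `|u t| <= expR (h t) /\ `|v t| <= expR (h t).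
  move=> /Nle H; split; rewrite -ler_sqr ?nnegrE ?expR_ge0// real_normK ?num_real//;
    apply: le_trans H; rewrite /N /sqmod ?lerDl ?lerDr ?sqr_ge0//.
(* From |psi| <= e^h both components of psi' are at most 2 h' e^h, which is the derivative of 2 e^h;
   comparison with this function gives the bound 2 (e^h - 1). *)
have bnd t : 0 < t < b -> `|(A t * u t + B t * v t) / t| <= 2 * (h' t * expR (h t)) /\
    `|(A t * v t - B t * u t) / t| <= 2 * (h' t * expR (h t)).
  move=> tb; have [tA tB] := AB t tb; have [t0 tb'] := andP tb.
  have [|tu tv] := ule t; first by rewrite !ltW.
  have key x y : `|x| <= t * h' t -> `|y| <= expR (h t) -> `|x * y| <= t * (h' t * expR (h t)).
    by move=> hx hy; rewrite normrM mulrA ler_pM.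
  split; rewrite normrM (ger0_norm (_ : 0 <= t^-1)) ?invr_ge0 ?(ltW t0)// ler_pdivrMr//.
    apply: le_trans (ler_normD _ _) _.
    rewrite (_ : 2 * _ * t = t * (h' t * expR (h t)) + t * (h' t * expR (h t))); last by ring.
    by apply: lerD; apply: key.
  apply: le_trans (ler_normB _ _) _.
  rewrite (_ : 2 * _ * t = t * (h' t * expR (h t)) + t * (h' t * expR (h t))); last by ring.
  by apply: lerD; apply: key.
have dE (t : R) : 0 < t < b -> is_derive t (1 : R) (fun t => 2 * expR (h t)) (2 * (h' t * expR (h t))).
  move=> tb; apply: (is_derive_eq (derive_mul (derive_const t (2 : R))
    (derive_comp (dh t tb) (is_derive_expR _)))).
  by rewrite mul0r add0r (mulrC (h' t)).
have cE : {within `[0, b], continuous (fun t => 2 * expR (h t))}.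
  apply: within_continuousM; first exact: within_cst.
  by apply: within_continuous_comp => //; exact: continuous_expR.
have main (f f' : R -> R) : (forall t : R, 0 < t < b -> is_derive t (1 : R) f (f' t)) ->
    (forall t : R, 0 < t < b -> `|f' t| <= 2 * (h' t * expR (h t))) ->
    (forall t : R, 0 <= t -> {for t, continuous f}) -> `|f b - f 0| <= 2 * (expR (h b) - 1).
  move=> df f'b cf; rewrite ler_norml; apply/andP; split.
    have := @nonincreasing_itv _ (fun t => - f t - 2 * expR (h t))
      (fun t => - f' t - 2 * (h' t * expR (h t))) 0 b b0.
    rewrite h0 expR0 => H; have {}H : - f b - 2 * expR (h b) <= - f 0 - 2 * 1.
      apply: H.
      - by move=> t tb; apply: derive_sub; [apply: derive_opp; exact: df|exact: dE].
      - move=> t tb; rewrite subr_le0; apply: le_trans (f'b t tb).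
        by rewrite -normrN ler_norm.
      - apply: within_continuousD; last exact: within_continuousN.
        by apply: within_continuousN; exact: continuous_nneg_within.
    by lra.
  have := @nonincreasing_itv _ (fun t => f t - 2 * expR (h t))
    (fun t => f' t - 2 * (h' t * expR (h t))) 0 b b0.
  rewrite h0 expR0 => H; have {}H : f b - 2 * expR (h b) <= f 0 - 2 * 1.
    apply: H.
    - by move=> t tb; apply: derive_sub; [exact: df|exact: dE].
    - move=> t tb; rewrite subr_le0; apply: le_trans (f'b t tb); exact: ler_norm.
    - apply: within_continuousD; last exact: within_continuousN.
      exact: continuous_nneg_within.
  by lra.
have Hu : `|u b - u 0| <= 2 * (expR (h b) - 1).
  apply: (main u (fun t => - (A t * u t + B t * v t) / t)) => // t tb.
    by apply: du; case/andP: tb.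
  by rewrite mulNr normrN; case: (bnd t tb).
have Hv : `|v b - v 0| <= 2 * (expR (h b) - 1).
  apply: (main v (fun t => - (A t * v t - B t * u t) / t)) => // t tb.
    by apply: dv; case/andP: tb.
  by rewrite mulNr normrN; case: (bnd t tb).
move: Hu Hv; rewrite u0 v0 subr0 => Hu Hv.
have e0 : 0 <= 2 * (expR (h b) - 1) by apply: le_trans Hu.
have sq y : `|y| <= 2 * (expR (h b) - 1) -> y ^+ 2 <= (2 * (expR (h b) - 1)) ^+ 2.
  by move=> hy; rewrite -(real_normK (num_real y)) ler_sqr ?nnegrE.
apply: le_trans (lerD (sq _ Hu) (sq _ Hv)) _.
by rewrite exprMn -mulr2n -mulrnAl -(natrX _ 2 2) -mulr_natr -natrM.
Qed.

(** A / t is bounded by C (1 + t), hence integrable down to 0, and |psi|^2 decays at most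
    exponentially in its integral. Nonvanishing is what allows division by a solution. *)
Lemma sqmod_gt0 (C : R) : (forall t : R, 0 < t -> A t <= C * (t + t ^+ 2)) ->
  forall t : R, 0 <= t -> 0 < N t.
Proof.
move=> AC t t0.
have := @sqmod_ge_exp (fun s => C * (s + s * s / 2)) (fun s => C * (1 + s)) 0 t (lexx _) t0.
rewrite sqmod0 mul1r => H.
suff : 0 < N t * expR (2 * (C * (t + t * t / 2))) by rewrite pmulr_lgt0 ?expR_gt0.
apply: lt_le_trans (expR_gt0 _) (H _ _ _).
- move=> s _.
  have := derive_mul (derive_const s C) (derive_add (derive_idfun s)
    (derive_mul (derive_mul (derive_idfun s) (derive_idfun s)) (derive_const s (2^-1)))).
  by move=> h; apply: (is_derive_eq h); field.
- by move=> s /andP[s0 _]; rewrite mulrCA mulrDr mulr1 -expr2 AC.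
- apply: continuous_subspaceT => s.
  apply: cvgM; first exact: cvg_cst.
  apply: cvgD; first exact: cvg_id.
  by apply: cvgM; [apply: cvgM; exact: cvg_id|exact: cvg_cst].
Qed.

End System.

Section Ratio.
Variables (u1 v1 A1 B1 u2 v2 A2 B2 : R -> R).
Hypotheses (ode1 : planar_ode u1 v1 A1 B1) (ode2 : planar_ode u2 v2 A2 B2).
Hypothesis N2 : forall t : R, 0 <= t -> 0 < sqmod u2 v2 t.

Let rx t := (u1 t * u2 t + v1 t * v2 t) / sqmod u2 v2 t.
Let ry t := (v1 t * u2 t - u1 t * v2 t) / sqmod u2 v2 t.

(* The quotient [psi1 / psi2] is driven by the difference of the symbols. *)
Lemma planar_ode_ratio : planar_ode rx ry (fun t => A1 t - A2 t) (fun t => B1 t - B2 t).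
Proof.
have [du1 dv1 cu1 cv1 [u10 v10]] := ode1; have [du2 dv2 cu2 cv2 [u20 v20]] := ode2.
have N0 t : 0 <= t -> sqmod u2 v2 t != 0 by move=> t0; rewrite gt_eqF// N2.
have dN (t : R) : 0 < t -> is_derive t (1 : R) (fun t => (sqmod u2 v2 t)^-1)
    (2 * A2 t / t / sqmod u2 v2 t).
  move=> t0; have := derive_inv (N0 t (ltW t0)) (derive_sqmod ode2 t0).
  move=> h; apply: (is_derive_eq h); field.
  by rewrite (N0 _ (ltW t0)) gt_eqF.
have cN (t : R) : 0 <= t -> {for t, continuous (fun t => (sqmod u2 v2 t)^-1)}.
  by move=> t0; apply: cvgV; [exact: N0|exact: (continuous_sqmod ode2)].
split.
- move=> t t0; have := derive_mul (derive_add (derive_mul (du1 t t0) (du2 t t0))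
    (derive_mul (dv1 t t0) (dv2 t t0))) (dN t t0).
  move=> h; apply: (is_derive_eq h); rewrite /rx /ry; field.
  by rewrite (N0 _ (ltW t0)) gt_eqF.
- move=> t t0; have := derive_mul (derive_sub (derive_mul (dv1 t t0) (du2 t t0))
    (derive_mul (du1 t t0) (dv2 t t0))) (dN t t0).
  move=> h; apply: (is_derive_eq h); rewrite /rx /ry; field.
  by rewrite (N0 _ (ltW t0)) gt_eqF.
- move=> t t0; apply: cvgM; last exact: cN.
  by apply: cvgD; apply: cvgM; [exact: cu1|exact: cu2|exact: cv1|exact: cv2].
- move=> t t0; apply: cvgM; last exact: cN.
  by apply: cvgB; apply: cvgM; [exact: cv1|exact: cu2|exact: cu1|exact: cv2].
- split.
    by rewrite /rx (sqmod0 ode2) u10 u20 v10 v20 mul0r addr0 mulr1 divr1.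
  by rewrite /ry (sqmod0 ode2) u10 u20 v10 v20 mul0r mulr0 subr0 mul0r.
Qed.

(** If h(b) <= 1, the quotient psi1 / psi2 is within O(h(b)) of 1, and multiplication by |psi2|^2
    recovers the difference. If h(b) > 1, the bound |psi1 - psi2|^2 <= 2 (|psi1|^2 + |psi2|^2) is
    enough. The constant is 72 = 8 . 9. *)
Lemma ode_diff_le (h h' : R -> R) (b : R) : 0 <= b -> h 0 = 0 -> 0 <= h b ->
  (forall t : R, 0 < t < b -> is_derive t (1 : R) h (h' t)) ->
  (forall t : R, 0 < t < b -> `|A1 t - A2 t| <= t * h' t /\ `|B1 t - B2 t| <= t * h' t) ->
  {within `[0, b], continuous h} ->
  (u1 b - u2 b) ^+ 2 + (v1 b - v2 b) ^+ 2 <=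
  72 * Num.min 1 (h b ^+ 2) * (sqmod u1 v1 b + sqmod u2 v2 b).
Proof.
move=> b0 h0 hb0 dh AB ch.
have N10 := sqmod_ge0 u1 v1 b; have N20 := sqmod_ge0 u2 v2 b.
have [hb1|hb1] := leP (h b) 1; last first.
  have -> : Num.min 1 (h b ^+ 2) = 1.
    by apply/min_idPl; rewrite -[leLHS](expr1n _ 2) ler_sqr ?nnegrE// ltW.
  have : 0 <= (u1 b + u2 b) ^+ 2 + (v1 b + v2 b) ^+ 2 by rewrite addr_ge0// sqr_ge0.
  by rewrite /sqmod in N10 N20 *; nra.
have -> : Num.min 1 (h b ^+ 2) = h b ^+ 2.
  by apply/min_idPr; rewrite -[leRHS](expr1n _ 2) ler_sqr ?nnegrE.
have E := ode_near1 planar_ode_ratio b0 h0 dh AB ch.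
(* For y = e^(h/2), the inequality e^(-h/2) >= 1 - h/2 gives first y <= 2, then y - 1 <= h y / 2 <=
   h, and so y^2 - 1 <= 3 h. *)
have e1 : expR (h b) - 1 <= 3 * h b.
  have := expR_ge1Dx (- (h b / 2)).
  rewrite expRN; set y := expR (h b / 2) => Hy.
  have y0 : 0 < y by exact: expR_gt0.
  have -> : expR (h b) = y * y by rewrite -expRD; congr expR; field.
  have {}Hy : (1 - h b / 2) * y <= 1.
    by rewrite -ler_pdivlMr// div1r.
  have y2 : y <= 2 by nra.
  nra.
have e0 : 0 <= expR (h b) - 1.
  by rewrite subr_ge0 (le_trans _ (expR_ge1Dx _))// lerDl.
have e2 : (expR (h b) - 1) ^+ 2 <= 9 * h b ^+ 2.
  by rewrite (_ : 9 * h b ^+ 2 = (3 * h b) ^+ 2) ?ler_sqr ?nnegrE ?mulr_ge0//; ring.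
have -> : (u1 b - u2 b) ^+ 2 + (v1 b - v2 b) ^+ 2 =
    ((rx b - 1) ^+ 2 + ry b ^+ 2) * sqmod u2 v2 b.
  have n0 := lt0r_neq0 (N2 b0); rewrite /rx /ry; rewrite /sqmod in n0 *; by field.
apply: (@le_trans _ _ (72 * h b ^+ 2 * sqmod u2 v2 b)).
  rewrite ler_wpM2r//; apply: le_trans E _; by lra.
by rewrite ler_wpM2l ?mulr_ge0 ?sqr_ge0// lerDr.
Qed.

End Ratio.

End PlanarODE.

(** * Decay of the Fourier transform *)

Section LogDecay.
Context d (T : measurableType d) (R : realType) (m : {measure set T -> \bar R}).
Variables (F Z : T -> R) (b0 : R).
Hypotheses (pF : is_pdf m F) (mZ : measurable_fun setT Z) (b0_gt0 : 0 < b0).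

(* [l t = ln t - sin (t b) / (t b) + 1 / (t b)] satisfies [t l' <= 1 - cos (t b)]. *)
Let lg (b t : R) : R := ln t - sin (t * b) / (t * b) + (t * b)^-1.
Let lg' (b t : R) : R :=
  t^-1 * (1 - cos (t * b) + (sin (t * b) - 1) / (t * b)).

Let derive_lg (b t : R) : 0 < b -> 0 < t -> is_derive t (1 : R) (lg b) (lg' b t).
Proof.
move=> bp tp; have tb : t * b != 0 by rewrite mulf_neq0 ?gt_eqF.
have dtb := derive_mul (derive_idfun t) (derive_const t b).
have ds := derive_comp dtb (is_derive_sin (t * b)).
have dV := @derive_inv _ (fun s => s * b) t _ tb dtb.
have dl := is_derive1_ln tp.
have := derive_add (derive_sub dl (derive_mul ds dV)) dV.
move=> h; apply: (is_derive_eq h); rewrite /lg'; field.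
by rewrite !gt_eqF.
Qed.

Let ind x : R := (b0 <= `|Z x|)%R%:R.

(** Equal to |Z| wherever [ind] is nonzero, and bounded away from 0 elsewhere, where [lg] would be
    singular at b = 0. *)
Let bz x : R := Num.max b0 `|Z x|.

(** Averages [lg] over the jumps with |Z| >= b0 only; a multiple of it will be the exponent beta of
    an integrating factor. *)
Definition log_lower (t : R) : R := expect m F (fun x => ind x * lg (bz x) t).

Definition log_lower' (t : R) : R := expect m F (fun x => ind x * lg' (bz x) t).

Let ind_le1 x : `|ind x| <= 1. Proof. exact: natb_norm_le1. Qed.

Let mind : measurable_fun setT ind.
Proof.
rewrite (_ : ind = (fun x => if b0 <= `|Z x| then 1 else 0)); last first.
  by apply/funext => x; rewrite /ind; case: ifP.
apply: measurable_fun_ifT; [|exact: measurable_cst|exact: measurable_cst].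
apply: measurable_fun_ler; first exact: measurable_cst.
exact: (measurableT_comp (@normr_measurable R setT)).
Qed.

Let bz_ge x : b0 <= bz x. Proof. by rewrite le_max lexx. Qed.
Let bz_gt0 x : 0 < bz x. Proof. exact: lt_le_trans (bz_ge x). Qed.

Let mbz (g : R -> R) : (forall b, 0 < b -> {for b, continuous g}) ->
  measurable_fun setT (fun x => g (bz x)).
Proof.
move=> cg; apply: (measurableT_comp (f := fun r : R => g (Num.max b0 `|r|))) => //.
apply: continuous_measurable_fun => r.
apply: (@continuous_comp _ _ _ (fun r : R => Num.max b0 `|r|) g).
  by apply: (@continuous_max _ _ (fun=> b0) (fun r : R => `|r|)); [exact: cvg_cst|exact: norm_continuous].
by apply: cg; rewrite lt_max b0_gt0.
Qed.

Let dlg_b (b t : R) : 0 < b -> 0 < t -> {for b, continuous (lg ^~ t)}.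
Proof.
move=> bp tp; have tb : t * b != 0 by rewrite mulf_neq0 ?gt_eqF.
have dV := @derive_inv _ (fun b => t * b) b _ tb (derive_scale t b).
have ds := derive_comp (derive_scale t b) (is_derive_sin (t * b)).
exact: (is_derive_continuous (derive_add (derive_sub (derive_const b (ln t)) (derive_mul ds dV)) dV)).
Qed.

Let dlg'_b (b t : R) : 0 < b -> 0 < t -> {for b, continuous (lg' ^~ t)}.
Proof.
move=> bp tp; have tb : t * b != 0 by rewrite mulf_neq0 ?gt_eqF.
have dV := @derive_inv _ (fun b => t * b) b _ tb (derive_scale t b).
have ds := derive_comp (derive_scale t b) (is_derive_sin (t * b)).
have dc := derive_comp (derive_scale t b) (is_derive_cos (t * b)).
exact: (is_derive_continuous (derive_mul (derive_const b t^-1) (derive_add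
  (derive_sub (derive_const b 1) dc) (derive_mul (derive_sub ds (derive_const b 1)) dV)))).
Qed.

Let lg_osc (b t : R) : b0 <= b -> 0 < t ->
  0 <= - (sin (t * b) / (t * b)) + (t * b)^-1 <= 2 / (t * b0).
Proof.
move=> bb tp; have bp := lt_le_trans b0_gt0 bb.
have tb : 0 < t * b by rewrite mulr_gt0.
rewrite -mulNr -[X in _ + X]mul1r -mulrDl; apply/andP; split.
  by rewrite mulr_ge0 ?invr_ge0 ?(ltW tb)// addrC subr_ge0 sin_le1.
apply: ler_pM.
- by rewrite addrC subr_ge0 sin_le1.
- by rewrite invr_ge0 ltW.
- have := sin_geN1 (t * b); lra.
- by rewrite lef_pV2 ?posrE ?mulr_gt0// ler_wpM2l// ltW.
Qed.

Let lg_le (b t t1 t2 : R) : b0 <= b -> 0 < t1 -> t1 <= t -> t <= t2 ->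
  `|lg b t| <= `|ln t1| + `|ln t2| + 2 / (t1 * b0).
Proof.
move=> bb t10 t1t tt2; have t0 := lt_le_trans t10 t1t; have t20 := lt_le_trans t0 tt2.
rewrite /lg -addrA; apply: le_trans (ler_normD _ _) _; apply: lerD.
  have l1 : ln t1 <= ln t by rewrite ler_ln ?posrE.
  have l2 : ln t <= ln t2 by rewrite ler_ln ?posrE.
  rewrite ler_norml; apply/andP; split.
    have := ler_norm (- ln t1); have := normr_ge0 (ln t2); rewrite normrN; lra.
  have := ler_norm (ln t2); have := normr_ge0 (ln t1); lra.
have /andP[h1 h2] := lg_osc bb t0; rewrite ger0_norm//; apply: le_trans h2 _.
by rewrite ler_wpM2l// lef_pV2 ?posrE ?mulr_gt0// ler_wpM2r// ltW.
Qed.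

Let lg'_le (b t t1 : R) : b0 <= b -> 0 < t1 -> t1 <= t ->
  `|lg' b t| <= t1^-1 * (2 + 2 / (t1 * b0)).
Proof.
move=> bb t10 t1t; have t0 := lt_le_trans t10 t1t.
rewrite /lg' normrM; apply: ler_pM => //.
  by rewrite ger0_norm ?invr_ge0 ?(ltW t0)// lef_pV2.
apply: le_trans (ler_normD _ _) _; apply: lerD.
  apply: le_trans (ler_normB _ _) _; rewrite normr1 -[2]/(1 + 1) lerD2l; exact: cos_norm_le1.
have /andP[h1 h2] := lg_osc bb t0.
rewrite -normrN (_ : - _ = - (sin (t * b) / (t * b)) + (t * b)^-1); last by ring.
rewrite ger0_norm//; apply: le_trans h2 _.
by rewrite ler_wpM2l// lef_pV2 ?posrE ?mulr_gt0// ler_wpM2r// ltW.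
Qed.

Let ind_bounded (g : T -> R) (M : R) : (forall x, `|g x| <= M) ->
  forall x, `|ind x * g x| <= M.
Proof.
move=> gM x; rewrite normrM -[leRHS]mul1r; exact: ler_pM.
Qed.

Lemma derive_log_lower (t : R) : 0 < t -> is_derive t (1 : R) log_lower (log_lower' t).
Proof.
move=> t0; have [mF F0 F1] := pF.
pose f (s : R) (x : T) : R := ind x * lg (bz x) s * F x.
pose I := `]t / 2, 2 * t[%classic : set R.
have t20 : 0 < t / 2 by rewrite divr_gt0.
have Ib s : I s -> t / 2 <= s /\ s <= 2 * t.
  by rewrite /I/= in_itv/= => /andP[/ltW ? /ltW].
have Ipos s : I s -> 0 < s by move=> /Ib[+ _]; exact: lt_le_trans.
have df s x : I s -> is_derive s (1 : R) (f ^~ x) (ind x * lg' (bz x) s * F x).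
  move=> /Ipos s0.
  have := derive_mul (derive_mul (derive_const s (ind x)) (derive_lg (bz_gt0 x) s0))
    (derive_const s (F x)).
  by move=> h; apply: (is_derive_eq h); rewrite mul0r add0r mulr0 addr0.
pose C := (t / 2)^-1 * (2 + 2 / (t / 2 * b0)).
have C0 : 0 <= C.
  by rewrite mulr_ge0 ?invr_ge0 ?(ltW t20)// addr_ge0// divr_ge0// mulr_ge0// ltW.
have It : I t.
  by rewrite /I/= in_itv/= ltr_pdivrMr// ltr_pMr// ltr1n ltr_pMl// ltr1n.
have mlg s : 0 < s -> measurable_fun setT (fun x => ind x * lg (bz x) s).
  by move=> s0; apply: measurable_funM => //; apply: (mbz (g := lg ^~ s)) => b bp; exact: dlg_b.
have int_f s : I s -> m.-integrable setT (EFin \o f s).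
  move=> Is; have [s1 s2] := Ib _ Is.
  apply: (expect_integrable pF (mlg s (Ipos _ Is))).
  exact: (ind_bounded (fun x => lg_le (bz_ge x) t20 s1 s2)).
have CF_int : m.-integrable setT (EFin \o (fun x => C * F x)).
  rewrite (_ : _ \o _ = (fun x => C%:E * (EFin \o F) x)%E)//.
  by apply: integrableZl => //; exact: pdf_integrable.
have CF0 x : 0 <= C * F x by rewrite mulr_ge0.
have derf1 s x : I s -> setT x -> derivable (f ^~ x) s 1.
  by move=> Is _; case: (df s x Is).
have d1E s x : I s -> partial1of2 f s x = ind x * lg' (bz x) s * F x.
  by move=> Is; rewrite partial1of2E; have [_ ->] := df s x Is.
have G_ub s x : I s -> setT x -> `|partial1of2 f s x| <= C * F x.
  move=> Is _; rewrite (d1E s x Is) normrM (ger0_norm (F0 x)) ler_wpM2r//.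
  exact: (ind_bounded (fun y => lg'_le (bz_ge y) t20 (Ib _ Is).1)).
have DU := @derivable_under_integral R _ _ m f setT measurableT t _ _ It int_f derf1
  (fun x => C * F x) CF0 CF_int G_ub.
have EU := @differentiation_under_integral R _ _ m f setT measurableT t _ _ It int_f derf1
  (fun x => C * F x) CF0 CF_int G_ub.
split; first exact: DU.
rewrite -derive1E; apply: etrans EU _.
by apply: eq_Rintegral => x _; rewrite (d1E t x It).
Qed.

(** Pointwise in x: for large jumps the extra term (sin - 1) / (t b) of [lg'] is nonpositive, and
    small jumps contribute 0 on the left and 1 - cos >= 0 on the right. *)
Lemma log_lower'_le (t : R) : 0 < t -> t * log_lower' t <= 1 - charc m F Z t.
Proof.
move=> t0.
have mlg' : measurable_fun setT (fun x => ind x * lg' (bz x) t).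
  by apply: measurable_funM => //; apply: (mbz (g := lg' ^~ t)) => b bp; exact: dlg'_b.
have lg'M := ind_bounded (fun x => lg'_le (bz_ge x) t0 (lexx t)).
have mc := measurable_cosM t mZ.
have c1 x : `|cos (t * Z x)| <= 1 by exact: cos_norm_le1.
rewrite /log_lower' -(expectZ t pF mlg' lg'M) -[X in _ <= X - _](expect_cst 1 pF).
have m1 : measurable_fun [set: T] (fun=> 1 : R) by exact: measurable_cst.
rewrite -(expectB pF m1 (fun=> lexx `|1 : R|) mc c1).
apply: (@expect_le _ _ _ m F _ _ (t * (t^-1 * (2 + 2 / (t * b0)))) 2 pF).
- by apply: measurable_funM => //; exact: measurable_cst.
- by move=> x; rewrite normrM (gtr0_norm t0) ler_wpM2l// ltW.
- by apply: measurable_funB => //; exact: measurable_cst.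
- by move=> x; apply: le_trans (ler_normB _ _) _; rewrite normr1 -[2]/(1 + 1) lerD2l.
move=> x; rewrite /ind; case: (leP b0 `|Z x|) => [bZ|_]; last first.
  by rewrite mul0r mulr0 subr_ge0 cos_le1.
rewrite mul1r /lg' mulrA divff ?gt_eqF// mul1r.
have -> : bz x = `|Z x| by apply/max_idPr.
have -> : cos (t * Z x) = cos (t * `|Z x|).
  by case: (ger0P (Z x)) => // _; rewrite mulrN cosN.
rewrite gerDl; apply: mulr_le0_ge0; first by rewrite subr_le0 sin_le1.
by rewrite invr_ge0 mulr_ge0// ltW.
Qed.

(** The oscillating part of [lg] lies between 0 and 2 / (t b0), so the logarithm dominates: between
    t < 1 and 1 the accumulated damping is P(|Z| >= b0) |ln t| up to a bounded error. This is the
    source of polynomial decay. *)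
Lemma log_lower_diff (t : R) : 0 < t ->
  expect m F ind * - ln t - 2 / (t * b0) <= log_lower 1 - log_lower t.
Proof.
move=> t0.
have mlg s : 0 < s -> measurable_fun setT (fun x => ind x * lg (bz x) s).
  by move=> s0; apply: measurable_funM => //; apply: (mbz (g := lg ^~ s)) => b bp; exact: dlg_b.
have lgM s : 0 < s -> forall x, `|ind x * lg (bz x) s| <= `|ln s| + `|ln s| + 2 / (s * b0).
  move=> s0; exact: (ind_bounded (fun x => lg_le (bz_ge x) s0 (lexx s) (lexx s))).
have h1 : 0 <= log_lower 1.
  apply: expect_ge0 => // x; rewrite mulr_ge0// /lg ln1 sub0r.
  by case/andP: (lg_osc (bz_ge x) ltr01).
have h2 : log_lower t <= expect m F ind * ln t + 2 / (t * b0).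
  have tb0 : 0 <= 2 / (t * b0) by rewrite divr_ge0// mulr_ge0// ltW.
  have mI := ind_le1.
  rewrite mulrC -(expectZ (ln t) pF mind ind_le1) -[X in _ <= _ + X](expect_cst _ pF).
  have mlI : measurable_fun setT (fun x => ln t * ind x).
    by apply: measurable_funM => //; exact: measurable_cst.
  have bI x : `|ln t * ind x| <= `|ln t| by rewrite normrM -[leRHS]mulr1 ler_wpM2l.
  have m2 : measurable_fun [set: T] (fun=> 2 / (t * b0) : R) by exact: measurable_cst.
  rewrite -(expectD pF mlI bI m2 (fun=> lexx `|2 / (t * b0)|)).
  apply: (@expect_le _ _ _ m F _ _ _ (`|ln t| + `|2 / (t * b0)|) pF (mlg t t0) (lgM t t0)).
  - by apply: measurable_funD => //; exact: measurable_cst.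
  - by move=> x; apply: le_trans (ler_normD _ _) _; rewrite lerD2r.
  move=> x; rewrite /ind; case: (leP b0 `|Z x|) => [bZ|_]; last first.
    by rewrite mul0r mulr0 add0r.
  rewrite mul1r mulr1 /lg -addrA lerD2l.
  by case/andP: (lg_osc (bz_ge x) t0).
by lra.
Qed.

End LogDecay.

(** * Euclidean norm and elementary power inequalities *)

Section VectorNorm.
Variables (R : realType) (d : nat).
Implicit Types x : 'rV[R]_d.

Lemma sqr_vnorm x : vnorm x ^+ 2 = vdot x x.
Proof. by rewrite sqr_sqrtr// vdotvv_ge0. Qed.

Lemma vnorm_ge0 x : 0 <= vnorm x. Proof. exact: sqrtr_ge0. Qed.

Lemma vnormZ (r : R) x : 0 <= r -> vnorm (r *: x) = r * vnorm x.
Proof.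
by move=> r0; rewrite /vnorm vdotZl vdotZr mulrA -expr2 sqrtrM ?sqr_ge0// sqrtr_sqr ger0_norm.
Qed.

Lemma coord_le_vnorm x i : `|x 0 i| <= vnorm x.
Proof.
rewrite -ler_sqr ?nnegrE ?vnorm_ge0// sqr_vnorm real_normK ?num_real//.
rewrite /vdot (bigD1 i)//= -expr2 lerDl; apply: sumr_ge0 => j _.
by rewrite -expr2 sqr_ge0.
Qed.

Lemma vnorm_eq0 x : vnorm x = 0 -> x = 0.
Proof.
move=> x0; apply/rowP => i; rewrite mxE; apply/eqP; rewrite -normr_le0 -x0.
exact: coord_le_vnorm.
Qed.

Lemma vnorm_delta (i : 'I_d) : vnorm (delta_mx 0 i : 'rV[R]_d) = 1.
Proof. by rewrite /vnorm vdot_delta mxE !eqxx sqrtr1. Qed.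

End VectorNorm.

Section PowerBounds.
Variable R : realType.

(** With z = y / (g + 1), y^g = (g + 1)^g z^g, and z^g <= e^(g z) <= e^y. *)
Lemma powR_le_expR (g y : R) : 0 <= g -> 0 < y -> y `^ g <= (g + 1) `^ g * expR y.
Proof.
move=> g0 y0; have g1 : 0 < g + 1 by rewrite ltr_wpDl.
pose z := y / (g + 1); have z0 : 0 < z by rewrite divr_gt0.
have -> : y = (g + 1) * z by rewrite /z mulrCA divff ?gt_eqF// mulr1.
rewrite powRM ?(ltW g1) ?(ltW z0)// ler_wpM2l ?powR_ge0//.
apply: (@le_trans _ _ (expR z `^ g)).
  apply: ge0_ler_powR => //; rewrite ?nnegrE ?expR_ge0 ?(ltW z0)//.
  by apply: le_trans (expR_ge1Dx z); rewrite lerDr.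
by rewrite -expRM ler_expR mulrDl mul1r mulrC lerDl ltW.
Qed.

Lemma powR12_le (al y : R) : 1 <= al <= 2 -> 0 <= y -> y `^ al <= y + y ^+ 2.
Proof.
move=> /andP[a1 a2] y0; have [y1|y1] := leP y 1.
  have [->|yn0] := eqVneq y 0; first by rewrite powR0 ?expr0n ?addr0// gt_eqF// (lt_le_trans ltr01).
  apply: (@le_trans _ _ y); last by rewrite lerDl sqr_ge0.
  by apply: ge1r_powR => //; rewrite lt_neqAle eq_sym yn0 y0.
apply: (@le_trans _ _ (y ^+ 2)); last by rewrite lerDr.
rewrite -powR_mulrn//; apply: ler_powR => //; exact: ltW.
Qed.

Lemma powR12_le1 (al y : R) : 1 <= al -> 0 <= y <= 1 -> y `^ al <= y.
Proof.
move=> a1 /andP[y0 y1].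
have [->|yn0] := eqVneq y 0; first by rewrite powR0// gt_eqF// (lt_le_trans ltr01).
by rewrite ge1r_powR// lt_neqAle eq_sym yn0 y0.
Qed.

End PowerBounds.

(** * The Fourier transform of one equilibrium along a ray *)

Section Ray.
Variables (R : realType) (d : nat).
Local Notation V := 'rV[R]_d.
Local Notation mu := (bmu R d).
Local Notation proj xi := (fun x : bvec R d => vdot (x : V) xi).

Definition fourc (G : V -> R) (xi : V) : R := charc mu G (proj xi) 1.
Definition fours (G : V -> R) (xi : V) : R := chars mu G (proj xi) 1.

Lemma charc_fourc (G : V -> R) xi r : charc mu G (proj xi) r = fourc G (r *: xi).
Proof.
by rewrite /fourc /charc; congr expect; apply/funext => x; rewrite mul1r vdotZr.
Qed.

Lemma chars_fours (G : V -> R) xi r : chars mu G (proj xi) r = fours G (r *: xi).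
Proof.
by rewrite /fours /chars; congr expect; apply/funext => x; rewrite mul1r vdotZr.
Qed.

Lemma hatReE (G : V -> R) xi : prob_density G -> hatRe G xi = fourc G xi.
Proof. by move=> pG; rewrite -[in LHS](scale1r xi) hatReZ. Qed.

Lemma hatImE (G : V -> R) xi : prob_density G -> hatIm G xi = - fours G xi.
Proof. by move=> pG; rewrite -[in LHS](scale1r xi) hatImZ. Qed.

Definition sqfour (G : V -> R) (xi : V) : R := fourc G xi ^+ 2 + fours G xi ^+ 2.

Definition symbol_le (K : V -> R) (al C : R) := forall eta : V,
  `|1 - fourc K eta| <= C * vnorm eta `^ al /\ `|fours K eta| <= C * vnorm eta `^ al.

(** The coefficients A and B of [planar_ode] for the ray through xi: real part, and with [rayskew]
    the skew part, of eps^(-al) (1 - Khat(eps t xi)). *)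
Definition raysym (K : V -> R) (eps al : R) (xi : V) (t : R) : R :=
  eps `^ (- al) * (1 - charc mu K (proj xi) (eps * t)).
Definition rayskew (K : V -> R) (eps al : R) (xi : V) (t : R) : R :=
  eps `^ (- al) * chars mu K (proj xi) (eps * t).

Section OneEquilibrium.
Variables (i0 : 'I_d) (K F : V -> R) (eps al C1 : R).
Hypotheses (pK : is_pdf mu K) (pF : is_pdf mu F) (eps01 : 0 < eps < 1).
Hypothesis eqF : equilibrium K eps al F.
Hypotheses (al12 : 1 <= al <= 2) (hK : symbol_le K al C1).

Let eps0 : 0 < eps. Proof. by case/andP: eps01. Qed.
Let lam := eps `^ (- al).
Let lam0 : 0 < lam. Proof. exact: powR_gt0. Qed.

Lemma ray_ode xi : planar_ode (charc mu F (proj xi)) (chars mu F (proj xi))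
  (raysym K eps al xi) (rayskew K eps al xi).
Proof.
have mp := measurable_vdot xi; split.
- move=> t t0; apply: (is_derive_eq (charc_derive i0 pK pF eps0 eqF xi t0)).
  by rewrite /raysym /rayskew; field; rewrite gt_eqF.
- move=> t t0; apply: (is_derive_eq (chars_derive i0 pK pF eps0 eqF xi t0)).
  by rewrite /raysym /rayskew; field; rewrite gt_eqF.
- by move=> t _; exact: continuous_charc.
- by move=> t _; exact: continuous_chars.
- by split; [exact: charc0|exact: chars0].
Qed.

Lemma sqfourE xi t : sqmod (charc mu F (proj xi)) (chars mu F (proj xi)) t = sqfour F (t *: xi).
Proof. by rewrite /sqmod charc_fourc chars_fours. Qed.

(** The time scale eps^(-al) cancels the rescaling of the kernel exactly; this is why the
    low-frequency bounds are uniform in eps. *)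
Let lamM y : 0 <= y -> lam * (eps * y) `^ al = y `^ al.
Proof.
move=> y0; rewrite powRM ?(ltW eps0)// mulrA /lam powRN mulVf ?mul1r// gt_eqF//.
exact: powR_gt0.
Qed.

Lemma raysym_le xi t : 0 <= t -> `|raysym K eps al xi t| <= C1 * (t * vnorm xi) `^ al /\
  `|rayskew K eps al xi t| <= C1 * (t * vnorm xi) `^ al.
Proof.
move=> t0; have et0 : 0 <= eps * t by rewrite mulr_ge0// ltW.
have [h1 h2] := hK ((eps * t) *: xi).
have tx0 : 0 <= t * vnorm xi by rewrite mulr_ge0// vnorm_ge0.
rewrite vnormZ// -mulrA in h1 h2.
rewrite -(lamM tx0) mulrCA /raysym /rayskew charc_fourc chars_fours.
by rewrite !normrM (gtr0_norm lam0) !ler_wpM2l// ltW.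
Qed.

Let C1_ge0 : 0 <= C1.
Proof.
have [h _] := hK (delta_mx 0 i0); move: h; rewrite vnorm_delta powR1 mulr1.
exact: le_trans.
Qed.

Lemma sqfour_gt0 xi t : 0 <= t ->
  0 < sqmod (charc mu F (proj xi)) (chars mu F (proj xi)) t.
Proof.
move=> t0; have x0 := vnorm_ge0 xi.
apply: (sqmod_gt0 (ray_ode xi) (C := C1 * (vnorm xi + vnorm xi ^+ 2))) => // s s0.
have [h _] := raysym_le xi (ltW s0).
apply: le_trans (ler_norm _) _; apply: le_trans h _.
rewrite -mulrA ler_wpM2l//; apply: le_trans (powR12_le al12 _) _.
  by rewrite mulr_ge0// ltW.
have s0' := ltW s0; rewrite exprMn mulrDr !mulrDl.
have a1 : 0 <= s * vnorm xi ^+ 2 by rewrite mulr_ge0// sqr_ge0.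
have a2 : 0 <= s ^+ 2 * vnorm xi by rewrite mulr_ge0// sqr_ge0.
rewrite (mulrC (vnorm xi) s) (mulrC (vnorm xi) (s ^+ 2)) (mulrC (vnorm xi ^+ 2) s)
  (mulrC (vnorm xi ^+ 2) (s ^+ 2)).
lra.
Qed.

Lemma sqfour_le1 xi : sqfour F xi <= 1.
Proof.
have -> : sqfour F xi = sqmod (charc mu F (proj xi)) (chars mu F (proj xi)) 1.
  by rewrite sqfourE scale1r.
have := @sqmod_le_exp _ _ _ _ _ (ray_ode xi) (fun=> 0) (fun=> 0) 0 1 (lexx _) ler01.
rewrite (sqmod0 (ray_ode xi)) mulr0 expR0 !mulr1; apply.
- move=> t _; rewrite mulr0 mulr_ge0 ?(ltW lam0)// subr_ge0.
  apply: le_trans (ler_norm _) _; apply: charc_norm_le1 => //; exact: measurable_vdot.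
- exact: within_cst.
Qed.

(** For t |xi| <= 1 and al >= 1 both coefficients are at most C1 t |xi|, so the real part of psi
    changes along the ray at rate at most 2 C1 |xi|, whatever eps is. *)
Lemma fourc_near0 xi : vnorm xi <= 1 -> 1 - fourc F xi <= 2 * C1 * vnorm xi.
Proof.
move=> x1; have x0 := vnorm_ge0 xi; have mp := measurable_vdot xi.
have [du _ cu _ [u0 _]] := ray_ode xi.
set u := charc mu F (proj xi) in du cu u0 *; set v := chars mu F (proj xi) in du.
have -> : fourc F xi = u 1 by rewrite /u charc_fourc scale1r.
have := @nonincreasing_itv _ (fun t => - u t - (2 * C1 * vnorm xi) * t)
  (fun t => - (- (raysym K eps al xi t * u t + rayskew K eps al xi t * v t) / t) -
     2 * C1 * vnorm xi) 0 1 ler01.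
rewrite u0 mulr1 mulr0 subr0 => H.
suff: - u 1 - 2 * C1 * vnorm xi <= - 1 by lra.
apply: H.
- move=> t /andP[t0 _]; apply: derive_sub; first by apply: derive_opp; exact: du.
  exact: derive_scale.
- move=> t /andP[t0 t1]; rewrite subr_le0 mulNr opprK ler_pdivrMr//.
  have [hA hB] := raysym_le xi (ltW t0).
  have tx : (t * vnorm xi) `^ al <= t * vnorm xi.
    apply: powR12_le1; first by case/andP: al12.
    by rewrite mulr_ge0 ?(ltW t0)//= mulr_ile1// ltW.
  have key x y : `|x| <= C1 * (t * vnorm xi) `^ al -> `|y| <= 1 -> x * y <= C1 * (t * vnorm xi).
    move=> hx hy; apply: le_trans (ler_norm _) _; rewrite normrM -[leRHS]mulr1.
    by apply: ler_pM => //; apply: le_trans hx _; rewrite ler_wpM2l.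
  have k1 := key _ _ hA (charc_norm_le1 t pF mp).
  have k2 := key _ _ hB (chars_norm_le1 t pF mp).
  rewrite -/u -/v in k1 k2.
  have -> : 2 * C1 * vnorm xi * t = C1 * (t * vnorm xi) + C1 * (t * vnorm xi) by ring.
  exact: lerD.
- apply: within_continuousD.
    by apply: within_continuousN; exact: continuous_nneg_within.
  apply: within_continuousN; apply: continuous_subspaceT => t.
  exact: is_derive_continuous (derive_scale _ t).
Qed.

Section Decay.
Variables (c1 x0 kap lam1 : R).
Hypotheses (c10 : 0 < c1) (x00 : 0 < x0) (kap01 : 0 <= kap < 1) (lam10 : 0 < lam1).
Hypothesis lam1_le : lam1 <= eps `^ (- al).
Hypothesis hc1 : forall eta : V, vnorm eta <= c1 -> vnorm eta `^ al / 2 <= 1 - fourc K eta.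
Hypothesis hslab : forall omega : V, vnorm omega = 1 ->
  1 - kap <= expect mu K (fun y => (x0 <= `|vdot (y : V) omega|)%R%:R).

(** As long as eps s |xi| <= c1, A(s) >= (s |xi|)^al / 2, which is at least s |xi| / 2 once s |xi|
    >= 1. Starting at s = 1 / |xi| with |psi| <= 1, the integrating factor is e^(s |xi|). *)
Let decay_low xi t : 1 <= vnorm xi -> 0 <= t -> eps * t * vnorm xi <= c1 ->
  sqmod (charc mu F (proj xi)) (chars mu F (proj xi)) t <= expR (1 - t * vnorm xi).
Proof.
move=> x1 t0 tc; have xp : 0 < vnorm xi := lt_le_trans ltr01 x1.
have N1 s : sqmod (charc mu F (proj xi)) (chars mu F (proj xi)) s <= 1.
  by rewrite sqfourE sqfour_le1.
have [tx|tx] := leP (t * vnorm xi) 1.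
  by apply: le_trans (N1 t) _; rewrite -[leLHS]expR0 ler_expR subr_ge0.
have xt : (vnorm xi)^-1 <= t by rewrite -div1r ler_pdivrMr// ltW.
have xi0 : 0 <= (vnorm xi)^-1 by rewrite invr_ge0 ltW.
have := @sqmod_le_exp _ _ _ _ _ (ray_ode xi) (fun s => vnorm xi / 2 * s)
  (fun=> vnorm xi / 2) _ t xi0 xt.
have -> : 2 * (vnorm xi / 2 * (vnorm xi)^-1) = 1 by field; rewrite gt_eqF.
have -> : 2 * (vnorm xi / 2 * t) = t * vnorm xi by field.
move=> H; rewrite expRD expRN -ler_pdivrMr ?invr_gt0 ?expR_gt0// invrK.
apply: le_trans (H _ _ _) _.
- by move=> s _; exact: derive_scale.
- move=> s /andP[s1 s2]; have s0 : 0 < s := le_lt_trans xi0 s1.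
  have sx1 : 1 <= s * vnorm xi by rewrite -ler_pdivrMr// div1r ltW.
  apply: (@le_trans _ _ ((s * vnorm xi) `^ al / 2)).
    rewrite mulrA ler_wpM2r//; apply: le1r_powR => //; by case/andP: al12.
  have esx : 0 <= s * vnorm xi by apply: le_trans sx1.
  have es0 : 0 <= eps * s by rewrite mulr_ge0 ?(ltW eps0) ?(ltW s0).
  rewrite -(lamM esx) /raysym charc_fourc -mulrA ler_wpM2l ?(ltW lam0)//.
  have := hc1 (eta := (eps * s) *: xi); rewrite vnormZ// -mulrA; apply.
  apply: le_trans tc; rewrite -mulrA ler_wpM2l ?(ltW eps0)//.
  by rewrite ler_wpM2r ?(ltW xp) ?(ltW s2).
- apply: continuous_subspaceT => s; exact: is_derive_continuous (derive_scale _ s).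
- by rewrite -[leRHS]mul1r ler_wpM2r ?expR_ge0.
Qed.

Let g := 2 * lam1 * (1 - kap).
Definition decay_const : R := expR 1 * ((g + 1) `^ g) * expR (4 * lam1 / (c1 * x0)).

Let g0 : 0 <= g.
Proof. by case/andP: kap01 => _ k1; rewrite mulr_ge0 ?mulr_ge0 ?subr_ge0 ?(ltW lam10) ?(ltW k1). Qed.

(* Up to frequency [c1 / eps] the expansion of [Khat] at [0] gives exponential decay;
   beyond, [log_lower] bounds the integral of the damping coefficient along the ray. *)
Lemma sqfour_decay xi : 1 <= vnorm xi -> sqfour F xi <= decay_const * vnorm xi `^ (- g).
Proof.
move=> x1; have xp : 0 < vnorm xi := lt_le_trans ltr01 x1.
have -> : sqfour F xi = sqmod (charc mu F (proj xi)) (chars mu F (proj xi)) 1.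
  by rewrite sqfourE scale1r.
have E2 : 1 <= expR (4 * lam1 / (c1 * x0)).
  by rewrite -[leLHS]expR0 ler_expR divr_ge0 ?mulr_ge0 ?(ltW c10) ?(ltW x00) ?(ltW lam10).
have tail y : 0 < y -> expR (1 - y) <= expR 1 * (g + 1) `^ g * y `^ (- g).
  move=> y0; rewrite expRD -mulrA ler_wpM2l ?expR_ge0// powRN.
  rewrite ler_pdivlMr ?powR_gt0// expRN mulrC ler_pdivrMr ?expR_gt0//.
  exact: powR_le_expR.
have [small|large] := leP (eps * vnorm xi) c1.
  apply: le_trans (decay_low x1 ler01 _) _; first by rewrite mulr1.
  rewrite mul1r; apply: le_trans (tail _ xp) _.
  rewrite /decay_const ler_wpM2r ?powR_ge0// ler_peMr// mulr_ge0 ?expR_ge0 ?powR_ge0//.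
have ex0 : 0 < eps * vnorm xi by rewrite mulr_gt0.
(* The time at which eps t xi leaves the ball where the expansion at 0 is effective; there t0 |xi| =
   c1 / eps. *)
pose t0 := c1 / (eps * vnorm xi).
have t00 : 0 < t0 by rewrite divr_gt0.
have t01 : t0 <= 1 by rewrite ler_pdivrMr// mul1r ltW.
have Nt0 : sqmod (charc mu F (proj xi)) (chars mu F (proj xi)) t0 <= expR (1 - c1 / eps).
  apply: le_trans (decay_low x1 (ltW t00) _) _.
    by rewrite /t0 mulrAC mulrCA divff ?mulr1// gt_eqF.
  rewrite (_ : t0 * vnorm xi = c1 / eps)//; rewrite /t0; field.
  by rewrite !gt_eqF.
have mp := measurable_vdot xi.
(* The jump scaled so that [charc] of Z at t is the symbol at eps t xi. The event |Z| >= b0 is the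
   complement of a slab of half-width x0, and t0 b0 = c1 x0 depends on neither eps nor xi. *)
pose Z (y : bvec R d) : R := eps * vdot (y : V) xi.
have mZ : measurable_fun setT Z by apply: measurable_funM => //; exact: measurable_cst.
pose b0 := eps * vnorm xi * x0.
have b00 : 0 < b0 by rewrite mulr_gt0.
have t0b0 : t0 * b0 = c1 * x0 by rewrite /t0 /b0; field; rewrite !gt_eqF.
have charcZ t : charc mu K Z t = charc mu K (proj xi) (eps * t).
  by rewrite /charc; congr expect; apply/funext => y; rewrite /Z mulrCA mulrA.
have P1 : 1 - kap <= expect mu K (fun y => (b0 <= `|Z y|)%R%:R).
  have w1 : vnorm ((vnorm xi)^-1 *: xi) = 1.
    by rewrite vnormZ ?invr_ge0 ?(ltW xp)// mulVf// gt_eqF.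
  apply: le_trans (hslab w1) _; rewrite le_eqVlt; apply/orP; left; apply/eqP.
  congr expect; apply/funext => y; congr (_%:R); congr nat_of_bool.
  rewrite vdotZr normrM gtr0_norm ?invr_gt0// ler_pdivlMl//.
  by rewrite /b0 /Z normrM (gtr0_norm eps0) -mulrA ler_pM2l.
have D := log_lower_diff pK mZ b00 t00.
have dll (s : R) : 0 < s -> is_derive s (1 : R) (fun s => lam1 * log_lower mu K Z b0 s)
    (lam1 * log_lower' mu K Z b0 s).
  move=> s0; apply: (is_derive_eq (derive_mul (derive_const s lam1) (derive_log_lower pK mZ b00 s0))).
  by rewrite mul0r add0r.
have H := @sqmod_le_exp _ _ _ _ _ (ray_ode xi) (fun s => lam1 * log_lower mu K Z b0 s)
  (fun s => lam1 * log_lower' mu K Z b0 s) t0 1 (ltW t00) t01.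
have {}H : sqmod (charc mu F (proj xi)) (chars mu F (proj xi)) 1 * expR (2 * (lam1 * log_lower mu K Z b0 1)) <=
    sqmod (charc mu F (proj xi)) (chars mu F (proj xi)) t0 * expR (2 * (lam1 * log_lower mu K Z b0 t0)).
  apply: H => [s /andP[s0 _]|s /andP[s1 s2]|].
  - exact: dll (lt_trans t00 s0).
  - have s0 : 0 < s := lt_trans t00 s1.
    rewrite mulrCA /raysym; apply: (@le_trans _ _ (lam1 * (1 - charc mu K Z s))).
      by rewrite ler_wpM2l ?(ltW lam10)// log_lower'_le.
    rewrite charcZ ler_wpM2r// subr_ge0.
    by apply: le_trans (ler_norm _) _; apply: charc_norm_le1.
  - apply: continuous_in_subspaceT => s; rewrite inE /= in_itv /= => /andP[s1 _].
    exact: is_derive_continuous (dll _ (lt_le_trans t00 s1)).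
(* t0^g splits into (c1 / eps)^g |xi|^(-g). The first factor is unbounded as eps -> 0, but the
   factor e^(1 - c1 / eps) gained at low frequencies absorbs it. *)
have tg : expR (g * ln t0) = (c1 / eps) `^ g * vnorm xi `^ (- g).
  have ce : 0 < c1 / eps by rewrite divr_gt0.
  have -> : t0 = (c1 / eps) * (vnorm xi)^-1 by rewrite /t0 invfM mulrA.
  have xi0 : 0 < (vnorm xi)^-1 by rewrite invr_gt0.
  have -> : expR (g * ln (c1 / eps * (vnorm xi)^-1)) = (c1 / eps * (vnorm xi)^-1) `^ g.
    by rewrite /powR gt_eqF// mulr_gt0.
  by rewrite powRM ?(ltW ce) ?(ltW xi0)// -(powR_inv1 (ltW xp)) -powRrM mulN1r.
have ce : 0 < c1 / eps by rewrite divr_gt0.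
apply: (@le_trans _ _ (expR (1 - c1 / eps) * expR (g * ln t0) * expR (4 * lam1 / (c1 * x0)))).
  rewrite -(ler_pM2r (expR_gt0 (2 * (lam1 * log_lower mu K Z b0 1)))).
  apply: le_trans H _; apply: (@le_trans _ _ (expR (1 - c1 / eps) *
    expR (2 * (lam1 * log_lower mu K Z b0 t0)))); first by rewrite ler_wpM2r ?expR_ge0.
  rewrite -!expRD ler_expR -!addrA lerD2l.
  have lnt : ln t0 <= 0 by rewrite -ln1 ler_ln ?posrE.
  have D2 : (1 - kap) * - ln t0 - 2 / (c1 * x0) <=
      log_lower mu K Z b0 1 - log_lower mu K Z b0 t0.
    apply: le_trans D; rewrite t0b0 lerD2r mulrN mulrN lerN2.
    by rewrite -lerN2 -!mulrN ler_wpM2r ?oppr_ge0.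
  have := ler_wpM2l (mulr_ge0 (ler0n R 2) (ltW lam10)) D2.
  rewrite mulrBr !mulrBr /g.
  have -> : 2 * lam1 * (2 / (c1 * x0)) = 4 * lam1 / (c1 * x0).
    by field; rewrite !gt_eqF.
  move: (_ / _) => q; lra.
have := tail _ ce; rewrite tg /decay_const => T1.
have cg0 : 0 < (c1 / eps) `^ g by rewrite powR_gt0.
rewrite powRN ler_pdivlMr// in T1.
have -> : expR 1 * (g + 1) `^ g * expR (4 * lam1 / (c1 * x0)) * vnorm xi `^ (- g) =
    expR 1 * (g + 1) `^ g * (vnorm xi `^ (- g) * expR (4 * lam1 / (c1 * x0))) by ring.
by rewrite mulrA -mulrA ler_wpM2r// mulr_ge0 ?expR_ge0 ?powR_ge0.
Qed.

End Decay.

End OneEquilibrium.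

End Ray.

(** * Consequences of the hypotheses on the kernels *)

Section PowerLog.
Variable R : realType.

Lemma powR_between (p b z : R) : 1 <= p <= b -> 0 <= z -> z `^ p <= z + z `^ b.
Proof.
move=> /andP[p1 pb] z0; have [z1|z1] := leP z 1.
  apply: (@le_trans _ _ z); last by rewrite lerDl powR_ge0.
  by apply: powR12_le1 => //; rewrite z0.
apply: (@le_trans _ _ (z `^ b)); last by rewrite lerDr.
by apply: ler_powR => //; exact: ltW.
Qed.

Lemma ln_le_powR (q y : R) : 0 < q -> 0 < y -> ln y <= y `^ q / q.
Proof.
move=> q0 y0; rewrite ler_pdivlMr// mulrC -ln_powR; apply: ltW.
by apply: ln_sublinear; exact: powR_gt0.
Qed.

Lemma powR_absln_le (q kap y : R) : 0 < q -> 0 < kap -> 0 < y ->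
  y `^ q * `|ln y| <= q^-1 + y `^ (q + kap) / kap.
Proof.
move=> q0 k0 y0; have [y1|y1] := leP y 1.
  have yV0 : 0 < y^-1 by rewrite invr_gt0.
  have -> : `|ln y| = ln y^-1.
    by rewrite lnV ?posrE// ler0_norm// -ln1 ler_ln ?posrE.
  apply: (@le_trans _ _ q^-1); last by rewrite lerDl mulr_ge0 ?powR_ge0// invr_ge0 ltW.
  apply: (@le_trans _ _ (y `^ q * (y^-1 `^ q / q))).
    by rewrite ler_wpM2l ?powR_ge0// ln_le_powR.
  by rewrite mulrA -powRM ?(ltW y0) ?(ltW yV0)// divff ?gt_eqF// powR1 mul1r.
have l0 : 0 <= ln y by rewrite ln_ge0// ltW.
rewrite ger0_norm//; apply: (@le_trans _ _ (y `^ q * (y `^ kap / kap))).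
  by rewrite ler_wpM2l ?powR_ge0// ln_le_powR.
by rewrite mulrA -powRD ?lerDr ?invr_ge0 ?(ltW q0)//; apply/implyP => _; rewrite gt_eqF.
Qed.

(** Gives up an exponent kap at infinity to remove the logarithm; near 0 the positive power q
    already controls it. *)
Lemma powR_max1ln_le (q kap y : R) : 0 < q -> 0 < kap -> 0 < y ->
  y `^ q * Num.max 1 `|ln y| <= (1 + q^-1 + kap^-1) * (1 + y `^ (q + kap)).
Proof.
move=> q0 k0 y0; have h := powR_absln_le q0 k0 y0.
have hY : y `^ q <= 1 + y `^ (q + kap).
  have [y1|y1] := leP y 1.
    rewrite (@le_trans _ _ 1)// ?lerDl ?powR_ge0//.
    by rewrite -(powRr0 y); apply: ger_powR; rewrite ?y0 ?y1 ?(ltW q0).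
  rewrite (@le_trans _ _ (y `^ (q + kap)))// ?lerDr//.
  by apply: ler_powR; rewrite ?(ltW y1)// lerDl ltW.
apply: (@le_trans _ _ (y `^ q * (1 + `|ln y|))).
  by rewrite ler_wpM2l ?powR_ge0// ge_max lerDl normr_ge0/= lerDr.
rewrite mulrDr mulr1; have := powR_ge0 y (q + kap); move: h hY.
have qV : 0 < q^-1 by rewrite invr_gt0.
have kV : 0 < kap^-1 by rewrite invr_gt0.
move=> h1 h2 Y0; have qY := mulr_ge0 (ltW qV) Y0; rewrite addrC.
apply: le_trans (lerD h1 h2) _; rewrite mulrDr mulr1 !mulrDl mul1r.
by lra.
Qed.

(** z^b = z^a e^(- (a - b) ln z) and e^y >= 1 + y give one inequality; exchanging the exponents
    gives the other. *)
Lemma powR_sub_le (p q z : R) : 0 < z ->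
  `|z `^ p - z `^ q| <= `|p - q| * (`|ln z| * (z `^ p + z `^ q)).
Proof.
move=> z0; have key a b : z `^ a - z `^ b <= `|a - b| * (`|ln z| * (z `^ a + z `^ b)).
  rewrite mulrA -normrM; have zb := powR_ge0 z b; have za := powR_ge0 z a.
  apply: (@le_trans _ _ (`|(a - b) * ln z| * z `^ a)); last first.
    by rewrite ler_wpM2l// lerDl.
  apply: (@le_trans _ _ ((a - b) * ln z * z `^ a)); last by rewrite ler_wpM2r// ler_norm.
  have -> : z `^ b = z `^ a * expR (- ((a - b) * ln z)).
    by rewrite /powR gt_eqF// -expRD; congr expR; ring.
  have := ler_wpM2l za (expR_ge1Dx (- ((a - b) * ln z))).
  by move: (expR _) => e; nra.
rewrite ler_norml key andbT lerNl opprB distrC (addrC (z `^ p)); exact: key.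
Qed.

Lemma powR_sub2_le (p kap z : R) : 3 / 2 <= p <= 2 -> 0 < kap -> 0 < z ->
  `|z `^ p - z ^+ 2| <= (2 - p) * (2 * (2 + kap^-1)) * (z + z `^ (2 + kap)).
Proof.
move=> /andP[p1 p2] k0 z0.
have kV : 0 < kap^-1 by rewrite invr_gt0.
have key r : 3 / 2 <= r <= 2 -> `|ln z| * z `^ r <= (2 + kap^-1) * (z + z `^ (2 + kap)).
  move=> /andP[r1 r2].
  (* The factor z^(1/2) tames the logarithm at 0; the exponent r - 1/2 >= 1 that remains still
     allows the bound by z near 0. *)
  have -> : z `^ r = z `^ (2^-1) * z `^ (r - 2^-1).
    rewrite -powRD; last by apply/implyP => _; rewrite gt_eqF.
    by congr powR; ring.
  have := powR_absln_le (q := 2^-1) _ k0 z0; rewrite invrK invr_gt0 => /(_ (ltr0n _ 2)) h.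
  rewrite mulrA (mulrC `|_|); apply: le_trans (ler_wpM2r (powR_ge0 _ _) h) _.
  have h1 : z `^ (r - 2^-1) <= z + z `^ (2 + kap).
    by apply: powR_between; last exact: ltW; apply/andP; split; lra.
  have h2 : z `^ (2^-1 + kap) * z `^ (r - 2^-1) <= z + z `^ (2 + kap).
    rewrite -powRD; last by apply/implyP => _; rewrite gt_eqF.
    by apply: powR_between; last exact: ltW; apply/andP; split; lra.
  rewrite [leRHS]mulrDl [leLHS]mulrDl; apply: lerD; first by rewrite ler_wpM2l.
  by rewrite mulrAC mulrC ler_wpM2l// ltW.
rewrite -powR_mulrn ?(ltW z0)//; apply: le_trans (powR_sub_le _ _ z0) _.
rewrite distrC ger0_norm ?subr_ge0// -!mulrA ler_wpM2l ?subr_ge0// mulrDr mulrDl mul1r.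
by rewrite lerD// key// ?p1 ?p2//; apply/andP; split; lra.
Qed.

End PowerLog.

(** * Size and difference of the kernel symbols *)

Section Symbols.
Variables (R : realType) (d : nat).
Local Notation V := 'rV[R]_d.
Local Notation mu := (bmu R d).

Lemma le_cmodl (a b : R) : `|a| <= cmod a b.
Proof. by rewrite -sqrtr_sqr ler_wsqrtr// lerDl sqr_ge0. Qed.

Lemma le_cmodr (a b : R) : `|b| <= cmod a b.
Proof. by rewrite -sqrtr_sqr ler_wsqrtr// lerDr sqr_ge0. Qed.

Lemma fourc_norm_le1 (K : V -> R) xi : prob_density K -> `|fourc K xi| <= 1.
Proof.
move=> pK; apply: charc_norm_le1; first exact: prob_density_pdf.
exact: measurable_vdot.
Qed.

Lemma fours_norm_le1 (K : V -> R) xi : prob_density K -> `|fours K xi| <= 1.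
Proof.
move=> pK; apply: chars_norm_le1; first exact: prob_density_pdf.
exact: measurable_vdot.
Qed.

Section Expansion.
Variables (K : V -> R) (al delta C0 : R).
Hypotheses (pK : prob_density K) (al1 : 1 <= al) (delta0 : 0 < delta) (C00 : 0 < C0).
Hypothesis hK : forall xi : V, vnorm xi <= 1 ->
  cmod (hatRe K xi - (1 - vnorm xi `^ al)) (hatIm K xi) <= C0 * vnorm xi `^ (al + delta).

(** The expansion is available only for |eta| <= 1; beyond, the trivial bound 2 is at most 2
    |eta|^al. *)
Lemma expansion_symbol_le : symbol_le K al (2 + C0).
Proof.
move=> eta; have y0 := vnorm_ge0 eta; have ya := powR_ge0 (vnorm eta) al.
have [y1|y1] := leP (vnorm eta) 1; last first.
  have h1 : 1 <= vnorm eta `^ al by rewrite -(powRr0 (vnorm eta)) ler_powR ?(ltW y1) ?(le_trans ler01).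
  have h2 : 2 <= (2 + C0) * vnorm eta `^ al.
    by have p := mulr_ge0 (ltW C00) ya; lra.
  split; apply: le_trans h2.
    apply: le_trans (ler_normB _ _) _; rewrite normr1 (_ : 2 = 1 + 1)// lerD2l.
    exact: fourc_norm_le1.
  by apply: le_trans (fours_norm_le1 _ pK) _; rewrite ler1n.
have h := hK y1; have ha := le_trans (le_cmodl _ _) h; have hb := le_trans (le_cmodr _ _) h.
have yad : vnorm eta `^ (al + delta) <= vnorm eta `^ al.
  have [->|yn0] := eqVneq (vnorm eta) 0.
    by rewrite !powR0// gt_eqF// (lt_le_trans ltr01)// -[leLHS]addr0 lerD// ltW.
  by apply: ger_powR; rewrite ?lerDl ?(ltW delta0)// lt_neqAle eq_sym yn0 y0.
have hC := ler_wpM2l (ltW C00) yad.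
rewrite hatReE// in ha; rewrite hatImE// normrN in hb; split.
  have -> : 1 - fourc K eta = vnorm eta `^ al - (fourc K eta - (1 - vnorm eta `^ al)) by ring.
  apply: le_trans (ler_normB _ _) _; rewrite (ger0_norm ya).
  by move: (le_trans ha hC); nra.
by apply: le_trans (le_trans hb hC) _; nra.
Qed.

(** c1 is small enough for the remainder C0 |eta|^(al + delta) to be at most half of |eta|^al. *)
Lemma expansion_lower c1 : c1 <= 1 -> C0 * c1 `^ delta <= 2^-1 ->
  forall eta : V, vnorm eta <= c1 -> vnorm eta `^ al / 2 <= 1 - fourc K eta.
Proof.
move=> c11 hc eta hy; have y0 := vnorm_ge0 eta; have ya := powR_ge0 (vnorm eta) al.
have h := hK (le_trans hy c11); have ha := le_trans (le_cmodl _ _) h.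
rewrite hatReE// in ha.
have yad : C0 * vnorm eta `^ (al + delta) <= vnorm eta `^ al / 2.
  rewrite powRD; last by rewrite [_ + _ == 0]gt_eqF// addr_gt0// (lt_le_trans ltr01).
  rewrite mulrCA ler_wpM2l//; apply: le_trans hc; rewrite ler_wpM2l ?(ltW C00)//.
  by apply: ge0_ler_powR; rewrite ?nnegrE ?(ltW delta0)// (le_trans y0).
move: (le_trans (ler_norm _) (le_trans ha yad)); lra.
Qed.

End Expansion.

Section Difference.
Variables (Ks K1 : V -> R) (s delta kap CC C1 : R).
Hypotheses (pKs : prob_density Ks) (pK1 : prob_density K1).
Hypotheses (s34 : (3 / 4 : R) <= s < 1) (delta0 : 0 < delta) (kap0 : 0 < kap) (CC0 : 0 < CC).
Hypothesis hK1 : symbol_le K1 2 C1.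
Hypothesis hKs : forall xi : V, xi != 0 ->
  cmod ((1 - hatRe Ks xi) / vnorm xi `^ (2 * s) - (1 - hatRe K1 xi) / vnorm xi ^+ 2)
       (- hatIm Ks xi / vnorm xi `^ (2 * s) + hatIm K1 xi / vnorm xi ^+ 2)
    <= CC * (1 - s) * vnorm xi `^ delta * Num.max 1 `|ln (vnorm xi)|.

(** The first summand comes from the assumed closeness of the normalized symbols, the second from
    |x^(2s) - x^2|; kap is the exponent given up to absorb logarithms. *)
Definition symbol_diff_const : R :=
  2 * CC * (1 + delta^-1 + kap^-1) + 8 * (2 + kap^-1) * C1.

Let diff_le (eps x p1 p2 : R) : 0 < eps <= 1 -> 0 < x -> 0 <= C1 ->
  `|p1 / (eps * x) `^ (2 * s) - p2 / (eps * x) ^+ 2| <=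
    CC * (1 - s) * (eps * x) `^ delta * Num.max 1 `|ln (eps * x)| ->
  `|p2| <= C1 * (eps * x) `^ 2 ->
  `|eps `^ (- (2 * s)) * p1 - eps `^ (- 2) * p2| <=
    symbol_diff_const * (1 - s) * (x + x `^ (2 + delta + kap)).
Proof.
move: (s34) (delta0) (kap0) => /andP[s1' s2'] d0 k0.
have b1 : 1 <= 2 * s <= 2 + delta + kap by apply/andP; split; lra.
have b2 : 1 <= 2 * s + (delta + kap) <= 2 + delta + kap by apply/andP; split; lra.
have b3 : 1 <= 2 + kap <= 2 + delta + kap by apply/andP; split; lra.
have b4 : 3 / 2 <= 2 * s <= 2 by apply/andP; split; lra.
have b5 : 0 <= 2 - 2 * s by lra.
move=> /andP[e0 e1] x0 C10 hd hp2; have y0 : 0 < eps * x by rewrite mulr_gt0.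
have s1 : 0 <= 1 - s by case/andP: s34 => _ /ltW; rewrite subr_ge0.
have eE a p : eps `^ (- a) * p = x `^ a * (p / (eps * x) `^ a).
  rewrite powRM ?(ltW e0) ?(ltW x0)// powRN; field.
  by rewrite !gt_eqF ?powR_gt0.
rewrite !eE -powR_mulrn ?(ltW y0)// in hd *.
set q1 := p1 / _ in hd *; set q2 := p2 / _ in hd *.
have q2C : `|q2| <= C1.
  rewrite /q2 normrM normfV (gtr0_norm (powR_gt0 _ y0)) ler_pdivrMr ?powR_gt0//.
(* q1 and q2 are the symbols divided by their leading powers. Either the normalized symbols differ
   or the powers do, and each effect costs one factor 1 - s. *)
have -> : x `^ (2 * s) * q1 - x `^ 2 * q2 =
    x `^ (2 * s) * (q1 - q2) + (x `^ (2 * s) - x `^ 2) * q2 by ring.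
apply: le_trans (ler_normD _ _) _; rewrite (normrM (x `^ _)) (normrM (_ - _)) (gtr0_norm (powR_gt0 _ x0)).
set b := 2 + delta + kap.
have pb p : 1 <= p <= b -> x `^ p <= x + x `^ b by move=> h; apply: powR_between => //; exact: ltW.
have T1 : x `^ (2 * s) * `|q1 - q2| <=
    2 * CC * (1 + delta^-1 + kap^-1) * (1 - s) * (x + x `^ b).
  have M0 : 0 <= 1 + delta^-1 + kap^-1 by rewrite !addr_ge0// invr_ge0 ltW.
  have hM := powR_max1ln_le delta0 kap0 y0.
  have hyx : (eps * x) `^ (delta + kap) <= x `^ (delta + kap).
    apply: ge0_ler_powR; rewrite ?nnegrE ?(ltW y0) ?(ltW x0)//.
      by rewrite addr_ge0// ltW.
    by rewrite ler_piMl// ltW.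
  have h1 : `|q1 - q2| <= CC * (1 - s) * ((1 + delta^-1 + kap^-1) * (1 + x `^ (delta + kap))).
    apply: le_trans hd _; rewrite -mulrA ler_wpM2l ?mulr_ge0 ?(ltW CC0)//.
    by apply: le_trans hM _; rewrite ler_wpM2l// lerD2l.
  have h2 : x `^ (2 * s) * (1 + x `^ (delta + kap)) <= 2 * (x + x `^ b).
    rewrite mulrDr mulr1 -powRD; last by apply/implyP => _; rewrite gt_eqF.
    by rewrite [leRHS](_ : _ = (x + x `^ b) + (x + x `^ b)) ?lerD ?pb//; ring.
  apply: le_trans (ler_wpM2l (powR_ge0 _ _) h1) _.
  rewrite [leLHS](_ : _ = CC * (1 - s) * (1 + delta^-1 + kap^-1) *
    (x `^ (2 * s) * (1 + x `^ (delta + kap)))); last by ring.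
  apply: le_trans (ler_wpM2l _ h2) _; first by rewrite !mulr_ge0// ltW.
  by rewrite le_eqVlt; apply/orP; left; apply/eqP; ring.
have T2 : `|x `^ (2 * s) - x `^ 2| * `|q2| <= 8 * (2 + kap^-1) * C1 * (1 - s) * (x + x `^ b).
  have kV : 0 < kap^-1 by rewrite invr_gt0.
  have h1 : `|x `^ (2 * s) - x `^ 2| <= (2 - 2 * s) * (2 * (2 + kap^-1)) * (x + x `^ (2 + kap)).
    by rewrite [x `^ 2]powR_mulrn ?(ltW x0)//; exact: powR_sub2_le.
  have h2 : x + x `^ (2 + kap) <= 2 * (x + x `^ b).
    rewrite [leRHS](_ : _ = (x + x `^ b) + (x + x `^ b)); last by ring.
    by rewrite lerD ?pb// lerDl powR_ge0.
  have c0 : 0 <= (2 - 2 * s) * (2 * (2 + kap^-1)) by rewrite mulr_ge0// mulr_ge0// addr_ge0// ltW.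
  apply: le_trans (ler_pM _ _ (le_trans h1 (ler_wpM2l c0 h2)) q2C) _ => //.
  by rewrite le_eqVlt; apply/orP; left; apply/eqP; ring.
apply: le_trans (lerD T1 T2) _.
by rewrite le_eqVlt; apply/orP; left; apply/eqP; rewrite /symbol_diff_const; ring.
Qed.

Lemma symbol_diff_le (eps : R) (xi : V) : 0 <= C1 -> 0 < eps <= 1 -> xi != 0 ->
  `|eps `^ (- (2 * s)) * (1 - fourc Ks (eps *: xi)) - eps `^ (- 2) * (1 - fourc K1 (eps *: xi))|
    <= symbol_diff_const * (1 - s) * (vnorm xi + vnorm xi `^ (2 + delta + kap)) /\
  `|eps `^ (- (2 * s)) * fours Ks (eps *: xi) - eps `^ (- 2) * fours K1 (eps *: xi)|
    <= symbol_diff_const * (1 - s) * (vnorm xi + vnorm xi `^ (2 + delta + kap)).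
Proof.
move=> C10 e01 xi0; have /andP[e0 _] := e01.
have x0 : 0 < vnorm xi.
  by rewrite lt_neqAle vnorm_ge0 eq_sym andbT; apply: contra xi0 => /eqP/vnorm_eq0 ->.
have exi : eps *: xi != 0 by rewrite scaler_eq0 negb_or gt_eqF.
have := hKs exi; rewrite !hatReE// !hatImE// !opprK vnormZ ?(ltW e0)// => h.
have [k1 k2] := hK1 (eps *: xi); rewrite vnormZ ?(ltW e0)// in k1 k2.
split; apply: diff_le => //; first exact: le_trans (le_cmodl _ _) h.
by move: (le_trans (le_cmodr _ _) h); rewrite mulNr.
Qed.

End Difference.
End Symbols.

(** * Boxes, and the mass of thin slabs *)

Section BoxesAndSlabs.
Variables (R : realType) (d : nat).
Local Notation V := 'rV[R]_d.
Local Notation mu := (bmu R d).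
Let leb : {sigma_finite_measure set (measurableTypeR R) -> \bar R} := @lebesgue_measure R.

Lemma measurable_natb disp (T : measurableType disp) (b : T -> bool) :
  measurable_fun setT b -> measurable_fun setT (fun x => (b x)%:R : R).
Proof.
move=> mb; rewrite (_ : (fun _ => _) = (fun x => if b x then 1 else 0)); last first.
  by apply/funext => x; case: ifP.
by apply: measurable_fun_ifT => //; exact: measurable_cst.
Qed.

Lemma integral_interval_ind (r : R) : 0 <= r ->
  (\int[@lebesgue_measure R]_u ((`|u : R| <= r)%R%:R)%:E = (2 * r)%:E)%E.
Proof.
move=> r0; transitivity (\int[leb]_u (\1_(`[- r, r]%classic) u)%:E)%E.
  by apply: eq_integral => u _; rewrite indicE mem_setE in_itv/= ler_norml.
rewrite integral_indic// setIT; transitivity (@lebesgue_measure R `[- r, r]%classic) => //.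
rewrite lebesgue_measure_itv/= lte_fin.
case: ltgtP => [_|h|h].
- by rewrite -EFinD; congr EFin; ring.
- by exfalso; lra.
- by congr EFin; lra.
Qed.

Lemma integral_slab_ind (a w x : R) : w != 0 -> 0 <= x ->
  (\int[@lebesgue_measure R]_u ((`|a - (u : R) * w| < x)%R%:R)%:E = (2 * x / `|w|)%:E)%E.
Proof.
move=> w0 x0; have wp : 0 < `|w| by rewrite normr_gt0.
transitivity (\int[leb]_u (\1_(ball (a / w) (x / `|w|)) u)%:E)%E.
  apply: eq_integral => u _; rewrite indicE; congr (_%:R%:E); congr nat_of_bool.
  rewrite [RHS](_ : _ = (`|a / w - u| < x / `|w|)); last first.
    by apply/idP/idP; rewrite inE.
  by rewrite ltr_pdivlMr// -normrM mulrBl divfK.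
rewrite integral_indic//; last exact: measurable_ball.
rewrite setIT; transitivity (@lebesgue_measure R (ball (a / w) (x / `|w|))) => //.
by rewrite lebesgue_measure_ball ?divr_ge0//; rewrite -mulrnAl mulr_natl.
Qed.

(** The indicator of a cube, written as a product so that its integral factorizes. *)
Definition boxw (r : R) (y : V) : R := \prod_i (`|y 0 i| <= r)%R%:R.

Lemma boxw_ge0 r y : 0 <= boxw r y.
Proof. by apply: prodr_ge0. Qed.

Lemma boxw1 r (y : V) : (forall i, `|y 0 i| <= r) -> boxw r y = 1.
Proof. by move=> h; rewrite /boxw big1// => i _; rewrite h. Qed.

Lemma boxw0 r (y : V) i : r < `|y 0 i| -> boxw r y = 0.
Proof. by move=> h; rewrite /boxw (bigD1 i)//= leNgt h mul0r. Qed.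

Lemma boxw_le1 r y : boxw r y <= 1.
Proof. by rewrite /boxw; apply: prodr_ile1 => i _; rewrite ler0n lern1 leq_b1. Qed.

Lemma measurable_prod_coord (w : 'I_d -> R -> R) : (forall i, measurable_fun setT (w i)) ->
  measurable_fun setT (fun x : bvec R d => \prod_i w i ((x : V) 0 i)).
Proof.
move=> mw; apply: measurable_prod => i _.
exact: (measurableT_comp (mw i) (measurable_coord i)).
Qed.

Lemma measurable_abs_le (r : R) : measurable_fun setT (fun u : R => (`|u| <= r)%R%:R : R).
Proof.
apply: measurable_natb; apply: measurable_fun_ler; last exact: measurable_cst.
exact: normr_measurable.
Qed.

Lemma measurable_boxw r : measurable_fun [set: bvec R d] (boxw r).
Proof.
apply: (measurable_prod_coord (w := fun _ u => (`|u| <= r)%R%:R)) => i.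
exact: measurable_abs_le.
Qed.

Lemma integral_boxw r : 0 <= r -> (\int[mu]_y (boxw r y)%:E = ((2 * r) ^+ d)%:E)%E.
Proof.
move=> r0; rewrite (@ge0_integral_prod_coord R d (fun _ u => (`|u| <= r)%R%:R)).
- under eq_bigr do rewrite (integral_interval_ind r0).
  by rewrite prodEFin prodr_const card_ord.
- by move=> i; exact: measurable_abs_le.
- by [].
Qed.

Lemma measurable_vnorm : measurable_fun [set: bvec R d] (@vnorm R d).
Proof.
apply: (measurableT_comp (f := @Num.sqrt R)); last exact: measurable_vdotvv.
by apply: continuous_measurable_fun => x; exact: sqrt_continuous.
Qed.

Lemma measurable_slab (omega : V) x :
  measurable_fun setT (fun y : bvec R d => (`|vdot (y : V) omega| < x)%R%:R : R).
Proof.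
apply: measurable_natb; apply: measurable_fun_ltr; last exact: measurable_cst.
by apply: (measurableT_comp (@normr_measurable R setT)); exact: measurable_vdot.
Qed.

(* The integral is averaged over translations along the axis [i], which move the slab across itself. *)
Lemma slab_volume (omega : V) (i : 'I_d) (n x : R) : omega 0 i != 0 -> 0 <= n -> 0 <= x ->
  (\int[mu]_y ((`|vdot (y : V) omega| < x)%R%:R * boxw n y)%:E <=
   (2 * x / `|omega 0 i| * (2 * (n + 1)) ^+ d)%:E)%E.
Proof.
move=> w0 n0 x0.
pose e : V := delta_mx 0 i.
pose A (y : bvec R d) := ((`|vdot (y : V) omega| < x)%R%:R * boxw n y).
have mA : measurable_fun setT (EFin \o A).
  by apply/measurable_EFinP; apply: measurable_funM; [exact: measurable_slab|exact: measurable_boxw].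
have A0 y : 0 <= A y by rewrite mulr_ge0// boxw_ge0.
pose B (z : measurableTypeR R * bvec R d) : \bar R :=
  ((`|vdot (z.2 : V) omega - z.1 * omega 0 i| < x)%R%:R * boxw (n + 1) z.2)%:E.
have mB : measurable_fun setT B.
  apply/measurable_EFinP; apply: measurable_funM; last first.
    exact: (measurableT_comp (measurable_boxw _) measurable_snd).
  apply: measurable_natb; apply: measurable_fun_ltr; last exact: measurable_cst.
  apply: (measurableT_comp (@normr_measurable R setT)); apply: measurable_funB.
    exact: (measurableT_comp (measurable_vdot omega) measurable_snd).
  by apply: measurable_funM; [exact: measurable_fst|exact: measurable_cst].
have B0 z : (0 <= B z)%E by rewrite lee_fin mulr_ge0// boxw_ge0.
have shift u : (\int[mu]_y (A ((y : V) + (- u) *: e)%R)%:E = \int[mu]_y (A y)%:E)%E.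
  have := @ge0_integral_affine R d 1 ((- u) *: e) (EFin \o A) ltr01 mA _.
  rewrite invr1 expr1n mul1e => <-; last by move=> y; rewrite lee_fin.
  by apply: eq_integral => y _ /=; rewrite scale1r.
have shift_le (u : R) (y : V) : `|u| <= 1 -> ((A ((y : V) + (- u) *: e))%:E <= B (u, y))%E.
  move=> u1; rewrite lee_fin /A vdotDl vdotZl vdotC vdot_delta mulNr.
  apply: ler_wpM2l => //.
  have [h|] := boolP [forall j, `|y 0 j| <= n + 1].
    by rewrite (boxw1 (forallP h)) boxw_le1.
  rewrite negb_forall => /existsP[j]; rewrite -ltNge => hj.
  rewrite (@boxw0 n _ j) ?boxw_ge0//.
  rewrite !mxE; apply: (@lt_le_trans _ _ (`|y 0 j| - 1)); first by lra.
  have ej : `|(j == i)%:R : R| <= 1 by case: (j == i); rewrite ?normr1 ?normr0.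
  apply: (@le_trans _ _ (`|y 0 j| - `|u * ((0 == 0 :> 'I_1) && (j == i))%:R|)).
    rewrite lerD2l lerN2 normrM eqxx /= -[leRHS]mulr1; exact: ler_pM.
  by rewrite mulNr lerB_dist.
pose I (u : R) : R := (`|u| <= 1)%R%:R.
have mI : measurable_fun setT I := measurable_abs_le 1.
have IA0 : (0 <= \int[mu]_y (A y)%:E)%E by apply: integral_ge0 => y _; rewrite lee_fin.
apply: (@le_trans _ _ (\int[leb]_u ((I u)%:E * \int[mu]_y (A y)%:E))%E).
  rewrite (ge0_integralZr leb measurableT) //; last 2 first.
  - exact/measurable_EFinP.
  - by move=> u _; rewrite lee_fin.
  by rewrite integral_interval_ind// mulr1 lee_pemull// lee_fin ler1n.
apply: (@le_trans _ _ (\int[leb]_u \int[mu]_y B (u, y))%E).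
  apply: ge0_le_integral => //.
  - by move=> u _; rewrite mule_ge0// lee_fin.
  - by apply: emeasurable_funM; [exact/measurable_EFinP|exact: measurable_cst].
  - exact: (measurable_fun_fubini_tonelli_F _ mB B0).
  move=> u _; rewrite /I; case: (leP `|u| 1) => u1; last by rewrite mul0e integral_ge0.
  rewrite mul1e -(shift u); apply: ge0_le_integral => //.
  - by move=> y _; rewrite lee_fin.
  - have := measurableT_comp mA (@measurable_affine R d 1 (- u *: e)).
    by apply: eq_measurable_fun => y _; rewrite /= scale1r.
  - exact: (measurableT_comp mB (pair1_measurable u)).
  - by move=> y _; exact: shift_le.
rewrite (@fubini_tonelli _ _ _ _ _ leb mu _ mB B0).
have w1 : 0 <= 2 * x / `|omega 0 i| by rewrite !mulr_ge0// invr_ge0.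
rewrite le_eqVlt; apply/orP; left; apply/eqP.
rewrite EFinM -(integral_boxw (addr_ge0 n0 ler01)) -ge0_integralZl//; last 2 first.
- by apply/measurable_EFinP; exact: measurable_boxw.
- by move=> y _; rewrite lee_fin boxw_ge0.
apply: eq_integral => y _; rewrite -(integral_slab_ind (vdot (y : V) omega) w0 x0) /B /=.
under eq_integral do rewrite EFinM.
rewrite (ge0_integralZr leb measurableT) //.
- apply/measurable_EFinP; apply: measurable_natb; apply: measurable_fun_ltr; last exact: measurable_cst.
  apply: (measurableT_comp (@normr_measurable R setT)); apply: measurable_funB.
    exact: measurable_cst.
  by apply: measurable_funM; [exact: measurable_id|exact: measurable_cst].
- by rewrite lee_fin boxw_ge0.
Qed.

(** Outside this set the density is at most n and the point lies in the box of radius n. *)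
Definition exceed (K : V -> R) (n : nat) (y : V) : R := ((n%:R < K y) || (n%:R < vnorm y))%R%:R.

Lemma measurable_exceed K n : is_pdf mu K -> measurable_fun [set: bvec R d] (exceed K n).
Proof.
move=> [mK _ _]; apply: measurable_natb; apply: measurable_or.
  by apply: measurable_fun_ltr => //; exact: measurable_cst.
by apply: measurable_fun_ltr; [exact: measurable_cst|exact: measurable_vnorm].
Qed.

(** Every point eventually leaves the sets, and K itself dominates. *)
Lemma exceed_cvg0 K : is_pdf mu K -> expect mu K (exceed K n) @[n --> \oo] --> (0 : R).
Proof.
move=> pK; rewrite -[X in _ --> X](expect_cst 0 pK).
apply: (@expect_dominated_cvg _ _ _ _ K (exceed K) (fun=> 0) 1 pK).
- by move=> n; exact: measurable_exceed.
- exact: measurable_cst.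
- by move=> n x; exact: natb_norm_le1.
move=> y; apply: cvg_near_cst.
near=> n.
rewrite /exceed (_ : (_ || _) = false)//.
apply/negbTE; rewrite negb_or -!leNgt; apply/andP; split.
  near: n; exact: nbhs_infty_ger.
near: n; exact: nbhs_infty_ger.
Unshelve. all: by end_near. Qed.

(** If all |omega_i| < 1 / d, then |omega|^2 <= sum |omega_i| < 1. *)
Lemma unit_large_coord (omega : V) : (0 < d)%N -> vnorm omega = 1 ->
  exists i, d%:R^-1 <= `|omega 0 i|.
Proof.
move=> d0 w1; apply: contrapT => /forallNP h.
have dR : 0 < d%:R :> R by rewrite ltr0n.
have : \sum_(i < d) omega 0 i * omega 0 i < \sum_(i < d) d%:R^-1.
  apply: ltr_sum => [|i _].
    by apply/hasP; exists (Ordinal d0) => //; exact: mem_index_enum.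
  apply: (@le_lt_trans _ _ `|omega 0 i|); last first.
    by have := h i => /negP; rewrite -ltNge.
  apply: le_trans (ler_norm _) _; rewrite normrM -[leRHS]mulr1 ler_wpM2l//.
  by rewrite -w1 coord_le_vnorm.
rewrite -/(vdot omega omega) -sqr_vnorm w1 expr1n sumr_const card_ord -[_ *+ d]mulr_natr mulVf ?gt_eqF//.
by rewrite ltxx.
Qed.

(** The density is cut at height n: the excess has mass at most kap / 2, and the rest is at most n
    on a bounded box, where a slab of half-width x has volume O(x). The direction enters only
    through a coordinate of size at least 1 / d, whence the uniformity in omega. *)
Lemma slab_small K kap : (0 < d)%N -> is_pdf mu K -> 0 < kap ->
  exists2 x : R, 0 < x & forall omega : V, vnorm omega = 1 ->
    expect mu K (fun y => (`|vdot (y : V) omega| < x)%R%:R) <= kap.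
Proof.
move=> d0 pK k0; have [mK K0 K1] := pK.
have k2 : 0 < kap / 2 by rewrite divr_gt0.
have [n hn] : exists n : nat, expect mu K (exceed K n) <= kap / 2.
  have /cvgrPdist_le/(_ _ k2)[N _ /(_ N (leqnn N)) h] := exceed_cvg0 pK.
  exists N; apply: le_trans h; rewrite sub0r normrN; exact: ler_norm.
(* n times the volume constant of [slab_volume], with 1 / |omega_i| replaced by d; x is then chosen
   so that c x <= kap / 2. *)
pose c : R := n%:R * (2 * d%:R * (2 * (n%:R + 1)) ^+ d).
have c0 : 0 <= c by rewrite !mulr_ge0// exprn_ge0// mulr_ge0// addr_ge0.
pose x := kap / 2 / (c + 1).
have x0 : 0 < x by rewrite divr_gt0// ltr_wpDl.
exists x => // omega w1; have [i hi] := unit_large_coord d0 w1.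
have dR : 0 < d%:R :> R by rewrite ltr0n.
have wi : 0 < `|omega 0 i| by apply: lt_le_trans hi; rewrite invr_gt0.
have mS := measurable_slab omega x.
rewrite -lee_fin (expect_EFin pK mS (fun=> natb_norm_le1 R _)).
pose A (y : bvec R d) := ((`|vdot (y : V) omega| < x)%R%:R * boxw n%:R y).
have mA : measurable_fun setT A.
  by apply: measurable_funM; [exact: mS|exact: measurable_boxw].
have A0 y : 0 <= A y by rewrite mulr_ge0// boxw_ge0.
apply: (@le_trans _ _ (\int[mu]_y (exceed K n y * K y)%:E + \int[mu]_y (n%:R%:E * (A y)%:E))%E).
  rewrite -ge0_integralD//.
  - apply: ge0_le_integral => //.
    + by move=> y _; rewrite lee_fin mulr_ge0.
    + by apply/measurable_EFinP; apply: measurable_funM.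
    + apply/measurable_EFinP; apply: measurable_funD; first by apply: measurable_funM => //; exact: measurable_exceed.
      by apply: measurable_funM => //; exact: measurable_cst.
    move=> y _; rewrite -EFinM -EFinD lee_fin /exceed.
    have q : (`|vdot (y : V) omega| < x)%R%:R * K y <= K y by rewrite ler_piMl ?lern1 ?leq_b1.
    have q' : K y <= true%:R * K y + n%:R * A y by rewrite mul1r lerDl mulr_ge0.
    case: (ltP n%:R (K y)) => h1 /=; first exact: le_trans q q'.
    case: (ltP n%:R (vnorm y)) => h2 /=; first exact: le_trans q q'.
    rewrite mul0r add0r /A boxw1 ?mulr1 1?mulrC ?ler_wpM2r// => j.
    exact: le_trans (coord_le_vnorm _ _) h2.
  - by move=> y _; rewrite lee_fin mulr_ge0.
  - by apply/measurable_EFinP; apply: measurable_funM => //; exact: measurable_exceed.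
  - by move=> y _; rewrite mule_ge0// lee_fin.
  - by apply: emeasurable_funM; [exact: measurable_cst|exact/measurable_EFinP].
rewrite -(expect_EFin pK (measurable_exceed n pK) (fun=> natb_norm_le1 R _)).
rewrite ge0_integralZl//; last 2 first.
- exact/measurable_EFinP.
- by move=> y _; rewrite lee_fin.
rewrite (_ : kap = kap / 2 + kap / 2); last by field.
rewrite EFinD leeD ?lee_fin//.
have w0 : omega 0 i != 0 by rewrite -normr_gt0.
apply: le_trans (lee_wpmul2l _ (slab_volume w0 (ler0n _ n) (ltW x0))) _; first by rewrite lee_fin.
rewrite -EFinM lee_fin; apply: (@le_trans _ _ (c * x)).
  have hV : `|omega 0 i|^-1 <= d%:R by rewrite -[leRHS]invrK lef_pV2 ?posrE ?invr_gt0.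
  rewrite /c; move: (`|omega 0 i|^-1) hV => q hq.
  have P0 : 0 <= (2 * (n%:R + 1)) ^+ d :> R by rewrite exprn_ge0// mulr_ge0// addr_ge0.
  move: (_ ^+ d) P0 => P P0.
  rewrite (_ : n%:R * (2 * x * q * P) = n%:R * 2 * P * x * q); last by ring.
  rewrite (_ : n%:R * (2 * d%:R * P) * x = n%:R * 2 * P * x * d%:R); last by ring.
  apply: ler_wpM2l => //; apply: (mulr_ge0 _ (ltW x0)); apply: (mulr_ge0 _ P0).
  by rewrite mulr_ge0.
have c1 : 0 < c + 1 by rewrite ltr_wpDl.
by rewrite /x mulrA ler_pdivrMr// mulrC; apply: ler_wpM2l (ltW k2) _ _ _; rewrite lerDl.
Qed.

End BoxesAndSlabs.

(** * Slab bounds carried from the limit kernel to nearby kernels *)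

Section SlabTransfer.
Variables (R : realType) (d : nat).
Local Notation V := 'rV[R]_d.
Local Notation mu := (bmu R d).
Let leb : {sigma_finite_measure set (measurableTypeR R) -> \bar R} := @lebesgue_measure R.

Lemma vnormZ_abs (r : R) (x : V) : vnorm (r *: x) = `|r| * vnorm x.
Proof. by rewrite /vnorm vdotZl vdotZr mulrA -expr2 sqrtrM ?sqr_ge0// sqrtr_sqr. Qed.

Lemma integral_expRhalf : (\int[@lebesgue_measure R]_u (expR (- (`|u : R| / 2)))%:E = 4%:E)%E.
Proof.
have h2 : 0 < 2^-1 :> R by rewrite invr_gt0.
have := @ge0_integral_affine1 R 2^-1 0 (fun u => (expR (- `|u|))%:E) h2 _ _.
rewrite invrK integral_expRabs -EFinM (_ : 2 * 2 = 4 :> R); last by ring.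
move=> <-.
- by apply: eq_integral => u _; rewrite addr0 normrM mulrC (gtr0_norm h2).
- apply/measurable_EFinP; apply: continuous_measurable_fun; exact: continuous_expRabs.
- by move=> u; rewrite lee_fin expR_ge0.
Qed.

(* [2 / (1 + (z / x0)^2)] dominates the indicator of [|z| < x0], and its mean is an
   [e^(-|u|)]-average of the characteristic function. *)
Lemma slab_transfer (K1 Ks : V -> R) (D b x0 x1 : R) (omega : V) :
  is_pdf mu K1 -> is_pdf mu Ks -> 0 <= D -> 1 <= b -> 0 < x0 -> 0 < x1 -> vnorm omega = 1 ->
  (forall eta, `|fourc Ks eta - fourc K1 eta| <= D * (vnorm eta + vnorm eta `^ b)) ->
  expect mu Ks (fun y => (`|vdot (y : V) omega| < x0)%R%:R) <=
  2 * expect mu K1 (fun y => (`|vdot (y : V) omega| < x1)%R%:R) + 2 * (x0 / x1) ^+ 2 +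
  4 * (D * (2 / x0 + (2 / x0) `^ b * (b + 1) `^ b)).
Proof.
move=> p1 ps D0 b1 x00 x10 w1 hD; set a := x0^-1.
have a0 : 0 < a by rewrite invr_gt0.
pose Z (y : bvec R d) := vdot (y : V) omega.
have mZ : measurable_fun setT Z := measurable_vdot omega.
pose q (y : bvec R d) : R := 1 - (1 + (a * Z y) ^+ 2)^-1.
have mq : measurable_fun setT q := measurable_subinv mZ a.
have q1 y : `|q y| <= 1 := subinv_norm_le1 Z a y.
set M := 2 * a + (2 * a) `^ b * (b + 1) `^ b.
have M0 : 0 <= M by rewrite addr_ge0 ?mulr_ge0 ?powR_ge0// ltW.
have mE : measurable_fun setT (fun u : R => expR (- `|u|)).
  by apply: continuous_measurable_fun; exact: continuous_expRabs.
have mEc K : is_pdf mu K -> measurable_fun setT (fun u : R => expR (- `|u|) * (1 - charc mu K Z (a * u))).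
  move=> pK; apply: measurable_funM => //; apply: measurable_funB; first exact: measurable_cst.
  apply: (measurableT_comp (f := charc mu K Z)).
    by apply: continuous_measurable_fun => r; exact: continuous_charc.
  by apply: measurable_funM => //; exact: measurable_cst.
have Ec0 K u : is_pdf mu K -> 0 <= expR (- `|u|) * (1 - charc mu K Z (a * u)).
  move=> pK; rewrite mulr_ge0 ?expR_ge0// subr_ge0.
  by apply: le_trans (ler_norm _) _; exact: charc_norm_le1.
(* One half of the exponential absorbs the growth |u|^b of the distance between the symbols; the
   other half remains integrable. *)
have pw (u : R) : expR (- `|u|) * `|charc mu Ks Z (a * u) - charc mu K1 Z (a * u)| <=
    D * M * expR (- (`|u| / 2)).
  rewrite !charc_fourc; apply: le_trans (ler_wpM2l (expR_ge0 _) (hD _)) _.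
  rewrite vnormZ_abs w1 mulr1 normrM (gtr0_norm a0).
  have -> : expR (- `|u|) = expR (- (`|u| / 2)) * expR (- (`|u| / 2)).
    by rewrite -expRD; congr expR; field.
  rewrite mulrCA -mulrA ler_wpM2l// mulrC mulrA ler_wpM2r ?expR_ge0//.
  rewrite expRN ler_pdivrMr ?expR_gt0//.
  have [->|u0] := eqVneq u 0.
    by rewrite normr0 mulr0 powR0 ?addr0 ?gt_eqF ?(lt_le_trans ltr01)// mulr_ge0 ?expR_ge0.
  set z := `|u| / 2; have z0 : 0 < z by rewrite divr_gt0// normr_gt0.
  have -> : a * `|u| = 2 * a * z by rewrite /z; field.
  have z0' := ltW z0; have a2 : 0 <= 2 * a by rewrite mulr_ge0// ltW.
  rewrite powRM// /M [leRHS]mulrDl; apply: lerD.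
    by rewrite ler_wpM2l//; apply: le_trans (expR_ge1Dx z); rewrite lerDr.
  rewrite -mulrA ler_wpM2l ?powR_ge0// powR_le_expR//.
  exact: le_trans ler01 b1.
have I1 : 2 * expect mu K1 q <= 2 * expect mu Ks q + 4 * (D * M).
  have mH : measurable_fun setT (fun u : R => D * M * expR (- (`|u| / 2))).
    apply: measurable_funM; first exact: measurable_cst.
    apply: continuous_measurable_fun => u; apply: continuous_comp; last exact: continuous_expR.
    by apply: cvgN; apply: cvgM; [exact: norm_continuous|exact: cvg_cst].
  have DM0 : 0 <= D * M by rewrite mulr_ge0.
  rewrite -lee_fin EFinD -(laplace_charc p1 mZ a) -(laplace_charc ps mZ a).
  have -> : (4 * (D * M))%:E = (\int[leb]_u (D * M * expR (- (`|u : R| / 2)))%:E)%E.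
    rewrite mulrC EFinM -integral_expRhalf -(ge0_integralZl leb measurableT)//.
    apply/measurable_EFinP; apply: continuous_measurable_fun => u.
    apply: continuous_comp; last exact: continuous_expR.
    by apply: cvgN; apply: cvgM; [exact: norm_continuous|exact: cvg_cst].
  rewrite -(ge0_integralD leb measurableT); last 4 first.
  - by move=> u _; rewrite lee_fin Ec0.
  - by apply/measurable_EFinP; exact: mEc.
  - by move=> u _; rewrite lee_fin mulr_ge0// expR_ge0.
  - exact/measurable_EFinP.
  apply: ge0_le_integral => //.
  - by move=> u _; rewrite lee_fin Ec0.
  - by apply/measurable_EFinP; exact: mEc.
  - by apply: emeasurable_funD; apply/measurable_EFinP => //; exact: mEc.
  move=> u _; rewrite -EFinD lee_fin -lerBlDl -mulrBr; apply: le_trans (pw u).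
  rewrite ler_wpM2l ?expR_ge0//; apply: le_trans (ler_norm _).
  by rewrite le_eqVlt; apply/orP; left; apply/eqP; ring.
have mc (c : R) : measurable_fun [set: bvec R d] (fun=> c) by exact: measurable_cst.
have c1 (c : R) (y : bvec R d) : `|c| <= `|c| by [].
have mS x := measurable_slab omega x.
have S1 x (y : bvec R d) : `|(`|vdot (y : V) omega| < x)%R%:R : R| <= 1 := natb_norm_le1 R _.
(* 2 - 2 q = 2 / (1 + (Z / x0)^2) is at least 1 on the slab |Z| < x0. *)
have I2 : expect mu Ks (fun y => (`|vdot (y : V) omega| < x0)%R%:R) <= 2 - 2 * expect mu Ks q.
  rewrite -[X in _ <= X - _](expect_cst 2 ps) -(expectZ 2 ps mq q1).
  have m2q : measurable_fun setT (fun y => 2 * q y) by exact: measurable_funM.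
  have b2q y : `|2 * q y| <= 2 by rewrite normrM ger0_norm// -[leRHS]mulr1 ler_wpM2l.
  rewrite -(expectB ps (mc 2) (c1 2) m2q b2q).
  apply: (expect_le (M := 1) (N := 4) ps) => //.
  - exact: measurable_funB.
  - move=> y; apply: le_trans (ler_normB _ _) _; rewrite [leRHS](_ : _ = 2 + 2); last by ring.
    by rewrite lerD// ger0_norm.
  move=> y; rewrite /q mulrBr mulr1 opprB addrC subrK -/(Z y).
  have h0 : 0 < 1 + (a * Z y) ^+ 2 by rewrite ltr_pwDl// sqr_ge0.
  case: (ltP `|Z y| x0) => h; last by rewrite mulr_ge0// invr_ge0 ltW.
  rewrite ler_pdivlMr// mul1r (_ : 2 = 1 + 1)// lerD2l.
  rewrite -real_normK ?num_real// -[leRHS](expr1n _ 2) ler_sqr ?nnegrE// normrM (gtr0_norm a0).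
  by rewrite /a mulrC ler_pdivrMr// mul1r ltW.
(* 1 - q = 1 / (1 + (Z / x0)^2) is at most 1 everywhere and at most (x0 / x1)^2 once |Z| >= x1. *)
have I3 : 1 <= expect mu K1 q + expect mu K1 (fun y => (`|vdot (y : V) omega| < x1)%R%:R) + (x0 / x1) ^+ 2.
  set c := (x0 / x1) ^+ 2; rewrite -[leLHS](expect_cst 1 p1) -[X in _ + X](expect_cst c p1).
  have mqs : measurable_fun setT (fun y : bvec R d => q y + (`|vdot (y : V) omega| < x1)%R%:R).
    exact: measurable_funD.
  have bqs (y : bvec R d) : `|q y + (`|vdot (y : V) omega| < x1)%R%:R| <= 2.
    by apply: le_trans (ler_normD _ _) _; rewrite (_ : 2 = 1 + 1)// lerD.
  rewrite -(expectD p1 mq q1 (mS x1) (S1 x1)) -(expectD p1 mqs bqs (mc c) (c1 c)).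
  apply: (expect_le (M := 1) (N := 2 + `|c|) p1) => //.
  - by move=> y; rewrite normr1.
  - exact: measurable_funD.
  - by move=> y; apply: le_trans (ler_normD _ _) _; rewrite lerD.
  move=> y; rewrite /q -/(Z y).
  have h0 : 0 < 1 + (a * Z y) ^+ 2 by rewrite ltr_pwDl// sqr_ge0.
  have c0 : 0 <= c by rewrite sqr_ge0.
  suff : (1 + (a * Z y) ^+ 2)^-1 <= (`|Z y| < x1)%R%:R + c by lra.
  case: (ltP `|Z y| x1) => h.
    by rewrite (@le_trans _ _ 1) ?lerDl// invf_le1// lerDl sqr_ge0.
  have z0 : 0 < `|Z y| := lt_le_trans x10 h.
  have az : 0 < `|a * Z y| by rewrite normrM mulr_gt0// normr_gt0 gt_eqF.
  rewrite add0r (@le_trans _ _ ((`|a * Z y| ^+ 2)^-1))//.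
    rewrite lef_pV2 ?posrE// ?exprn_gt0//.
    by rewrite real_normK ?num_real// lerDr.
  rewrite -exprVn /c ler_sqr ?nnegrE ?invr_ge0 ?(ltW az) ?divr_ge0 ?(ltW x00) ?(ltW x10)//.
  rewrite normrM (gtr0_norm a0) invfM /a invrK ler_pM2l// lef_pV2 ?posrE//.
move: I1 I2 I3; rewrite /M /a; move: (expect _ _ _) (expect _ _ _) (expect _ _ _) (expect _ _ _).
by move=> A B C E h1 h2 h3; lra.
Qed.

End SlabTransfer.

(** * Weights for the frequency integrals *)

Section Weights.
Variable R : realType.

Lemma min1_sqr_le_powR (h p : R) : 0 <= h -> 0 <= p <= 2 -> Num.min 1 (h ^+ 2) <= h `^ p.
Proof.
move=> h0 /andP[p0 p2]; have [h1|h1] := leP h 1; last first.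
  rewrite ge_min; apply/orP; left.
  by rewrite -[leLHS](powRr0 h) ler_powR// ltW.
rewrite ge_min; apply/orP; right.
have [->|hn0] := eqVneq h 0; first by rewrite expr0n/= powR_ge0.
by rewrite -powR_mulrn//; apply: ger_powR => //; rewrite lt_neqAle eq_sym hn0 h0.
Qed.

(** Lowering the exponent of eps^(-2) from 1 to s costs only O(1 - s) in the damping constant a. *)
Lemma powR_near1_ge (a s : R) : 1 <= a -> a - (1 - s) * (a * ln a) <= a `^ s.
Proof.
move=> a1; have a0 : 0 < a := lt_le_trans ltr01 a1.
have -> : a `^ s = a * expR (- ((1 - s) * ln a)).
  rewrite -[X in _ = X * _](lnK a0) -expRD /powR gt_eqF//; congr expR; ring.
have := ler_wpM2l (ltW a0) (expR_ge1Dx (- ((1 - s) * ln a))).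
by apply: le_trans; rewrite le_eqVlt; apply/orP; left; apply/eqP; ring.
Qed.

(** Each 1 + |xi_i| is at most 2 max(1, |xi|). The product weight is integrable by one-variable
    integrals, so no polar coordinates are needed. *)
Lemma max1_powR_le_prod d (xi : 'rV[R]_d) (q : R) : (0 < d)%N -> 0 < q ->
  (Num.max 1 (vnorm xi)) `^ (- (d%:R + q)) <=
  2 `^ (d%:R + q) * \prod_i (1 + `|xi 0 i|) `^ (- 1 - q / d%:R).
Proof.
move=> d0 q0; have dR : 0 < d%:R :> R by rewrite ltr0n.
set m := Num.max 1 _; have m1 : 1 <= m by rewrite le_max lexx.
have m0 : 0 < m := lt_le_trans ltr01 m1.
have r0 : 0 < 1 + q / d%:R by rewrite addr_gt0// divr_gt0.
rewrite -ler_pdivrMl ?powR_gt0// -powRN -powRM// ?(ltW m0)//.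
have -> : (2 * m) `^ (- (d%:R + q)) = \prod_(i < d) (2 * m) `^ (- 1 - q / d%:R).
  rewrite prodr_const card_ord -powR_mulrn ?powR_ge0// -powRrM; congr powR.
  by field; rewrite gt_eqF.
apply: ler_prod => i _; rewrite powR_ge0/= -opprD !powRN.
have h1 : 0 < 1 + `|xi 0 i| by rewrite ltr_pwDl.
rewrite lef_pV2 ?posrE ?powR_gt0 ?mulr_gt0//; apply: ge0_ler_powR; rewrite ?nnegrE ?(ltW r0) ?(ltW h1) ?mulr_ge0 ?(ltW m0)//.
rewrite (_ : 2 * m = m + m); last by ring.
by rewrite lerD// (le_trans (coord_le_vnorm _ _))// le_max lexx orbT.
Qed.

End Weights.

(** * Estimates uniform in s and eps *)

Section UniformBounds.
Variables (R : realType) (d : nat).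
Local Notation V := 'rV[R]_d.
Local Notation mu := (bmu R d).
Variables (J : R -> V -> R) (J1 : V -> R) (delta C0 CC : R).
Hypotheses (d0 : (0 < d)%N) (delta0 : 0 < delta) (C00 : 0 < C0) (CC0 : 0 < CC).
Hypothesis pJ : forall s, 1 / 2 < s < 1 -> prob_density (J s).
Hypothesis hJ : forall s, 1 / 2 < s < 1 -> forall xi, vnorm xi <= 1 ->
  cmod (hatRe (J s) xi - (1 - vnorm xi `^ (2 * s))) (hatIm (J s) xi)
    <= C0 * vnorm xi `^ (2 * s + delta).
Hypothesis pJ1 : prob_density J1.
Hypothesis hJ1 : forall xi, vnorm xi <= 1 ->
  cmod (hatRe J1 xi - (1 - vnorm xi ^+ 2)) (hatIm J1 xi) <= C0 * vnorm xi `^ (2 + delta).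
Hypothesis hJs : forall s, 1 / 2 < s < 1 -> forall xi : V, xi != 0 ->
  cmod ((1 - hatRe (J s) xi) / vnorm xi `^ (2 * s) - (1 - hatRe J1 xi) / vnorm xi ^+ 2)
       (- hatIm (J s) xi / vnorm xi `^ (2 * s) + hatIm J1 xi / vnorm xi ^+ 2)
    <= CC * (1 - s) * vnorm xi `^ delta * Num.max 1 `|ln (vnorm xi)|.

Let i0 : 'I_d := Ordinal d0.
Let hJ1' xi : vnorm xi <= 1 ->
  cmod (hatRe J1 xi - (1 - vnorm xi `^ 2)) (hatIm J1 xi) <= C0 * vnorm xi `^ (2 + delta).
Proof. by move=> x1; rewrite powR_mulrn ?vnorm_ge0//; exact: hJ1. Qed.

Lemma kernel_symbol_le s : 1 / 2 < s < 1 -> symbol_le (J s) (2 * s) (2 + C0).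
Proof.
move=> s12; apply: (expansion_symbol_le (pJ s12) _ delta0 C00) => //; last exact: hJ.
by move: s12 => /andP[h _]; lra.
Qed.

Lemma limit_symbol_le : symbol_le J1 2 (2 + C0).
Proof. by apply: (expansion_symbol_le pJ1 _ delta0 C00) => //; rewrite ler1n. Qed.

Section OneDimensionalTails.
Variables (K F : V -> R) (eps al C : R).
Hypotheses (pK : prob_density K) (eps01 : 0 < eps < 1) (al12 : 1 <= al <= 2).
Hypotheses (eqF : equilibrium K eps al F) (hK : symbol_le K al C) (C1 : 1 <= C).

(** For r <= 1 this is [fourc_near0] in a coordinate direction; for r > 1 the left side is at most 2
    <= 2 C r. *)
Lemma charc_coord_le (i : 'I_d) (r : R) : 0 < r ->
  1 - charc mu F (fun x : bvec R d => (x : V) 0 i) r <= 2 * C * r.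
Proof.
move=> r0; have pF := eqF.1; have pFp := prob_density_pdf pF.
have -> : charc mu F (fun x : bvec R d => (x : V) 0 i) r = fourc F (r *: delta_mx 0 i).
  rewrite -charc_fourc; congr charc; apply/funext => x.
  by rewrite vdotC vdot_delta.
have vr : vnorm (r *: (delta_mx 0 i : V)) = r by rewrite vnormZ ?ltW// vnorm_delta mulr1.
have [r1|r1] := leP r 1.
  have := fourc_near0 i0 (prob_density_pdf pK) pFp eps01 eqF al12 hK (xi := r *: delta_mx 0 i).
  by rewrite vr; apply.
have h := fourc_norm_le1 (r *: delta_mx 0 i : V) pF.
move: h; rewrite ler_norml => /andP[h _]; move: (C1) => C1'.
have : 1 * 1 <= C * r by apply: ler_pM => //; exact: ltW.
by move: (fourc _ _) h => f h; lra.
Qed.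

End OneDimensionalTails.

Lemma low_frequency_radius : exists c1 : R, [/\ 0 < c1, c1 <= 1 & C0 * c1 `^ delta <= 2^-1].
Proof.
pose q : R := (2 * C0)^-1; have q0 : 0 < q by rewrite invr_gt0 mulr_gt0.
exists (Num.min 1 (q `^ delta^-1)); split.
- by rewrite lt_min ltr01 powR_gt0.
- by rewrite ge_min lexx.
apply: (@le_trans _ _ (C0 * (q `^ delta^-1) `^ delta)).
  rewrite ler_wpM2l ?(ltW C00)//; apply: ge0_ler_powR; rewrite ?nnegrE ?(ltW delta0) ?powR_ge0//.
    by rewrite le_min ler01 powR_ge0.
  by rewrite ge_min lexx orbT.
rewrite -powRrM mulVf ?gt_eqF// powRr1 ?(ltW q0)// /q invfM mulrCA divff ?gt_eqF//.
by rewrite mulr1.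
Qed.

Section Closeness.
Variable kap : R.
Hypothesis kap0 : 0 < kap.
Let b := 2 + delta + kap.
Let D := symbol_diff_const delta kap CC (2 + C0).

Lemma symbol_diff_const_ge0 : 0 <= D.
Proof.
have [h1 h2 h3 h4] := And4 (ltW CC0) (ltW C00) (ltW delta0) (ltW kap0).
by rewrite /D /symbol_diff_const addr_ge0// !mulr_ge0// !addr_ge0// invr_ge0.
Qed.

Let C20 : 0 <= 2 + C0. Proof. by rewrite addr_ge0// ltW. Qed.
Let half_lt s : (3 / 4 : R) <= s < 1 -> 1 / 2 < s < 1.
Proof. by move=> /andP[h1 h2]; apply/andP; split; lra. Qed.

(** As b >= 1 and t < 1, (t |xi|)^b <= t |xi|^b, so a factor t comes out and the comparison function
    h of [ode_diff_le] can be linear in t. *)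
Lemma ray_diff_le s (eps : R) (xi : V) (t : R) : (3 / 4 : R) <= s < 1 -> 0 < eps <= 1 ->
  0 < t < 1 ->
  `|raysym (J s) eps (2 * s) xi t - raysym J1 eps 2 xi t|
    <= t * (D * (1 - s) * (vnorm xi + vnorm xi `^ b)) /\
  `|rayskew (J s) eps (2 * s) xi t - rayskew J1 eps 2 xi t|
    <= t * (D * (1 - s) * (vnorm xi + vnorm xi `^ b)).
Proof.
move=> s34 e01 /andP[t0 t1]; have s12 := half_lt s34.
have [p1 ps] := (prob_density_pdf pJ1, prob_density_pdf (pJ s12)).
have s1 : 0 <= 1 - s by case/andP: s34 => _ /ltW; rewrite subr_ge0.
have x0 := vnorm_ge0 xi.
have [->|xi0] := eqVneq xi 0.
  have z K : charc mu K (fun x : bvec R d => vdot (x : V) 0) (eps * t) = charc mu K (fun x : bvec R d => vdot (x : V) 0) 0.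
    by rewrite /charc; congr expect; apply/funext => x; rewrite mul0r -(scale0r (0 : V)) vdotZr mul0r mulr0.
  have w K : chars mu K (fun x : bvec R d => vdot (x : V) 0) (eps * t) = chars mu K (fun x : bvec R d => vdot (x : V) 0) 0.
    by rewrite /chars; congr expect; apply/funext => x; rewrite mul0r -(scale0r (0 : V)) vdotZr mul0r mulr0.
  rewrite /raysym /rayskew !z !w !charc0// !chars0//.
  by rewrite !subrr !mulr0 subrr normr0 !mulr_ge0 ?(ltW t0)// ?symbol_diff_const_ge0// addr_ge0 ?vnorm_ge0 ?powR_ge0.
have txi0 : t *: xi != 0 by rewrite scaler_eq0 (gt_eqF t0).
have := symbol_diff_le (pJ s12) pJ1 s34 delta0 kap0 CC0 limit_symbol_le (hJs s12) C20 e01 txi0.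
rewrite /raysym /rayskew !charc_fourc !chars_fours scalerA vnormZ ?(ltW t0)// -/D -/b.
have h : D * (1 - s) * (t * vnorm xi + (t * vnorm xi) `^ b) <= t * (D * (1 - s) * (vnorm xi + vnorm xi `^ b)).
  rewrite mulrCA ler_wpM2l ?mulr_ge0 ?symbol_diff_const_ge0// mulrDr lerD2l.
  rewrite powRM ?(ltW t0)// ler_wpM2r ?powR_ge0//; apply: powR12_le1.
    by rewrite /b; move: (delta0) (kap0) => h1 h2; lra.
  by rewrite !ltW.
by move=> [h1 h2]; split; [exact: le_trans h1 h|exact: le_trans h2 h].
Qed.

(** The difference of the symbols at eps = 1; it feeds [slab_transfer]. *)
Lemma fourc_kernel_close s (eta : V) : (3 / 4 : R) <= s < 1 ->
  `|fourc (J s) eta - fourc J1 eta| <= D * (1 - s) * (vnorm eta + vnorm eta `^ b).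
Proof.
move=> s34; have s12 := half_lt s34.
have [p1 ps] := (prob_density_pdf pJ1, prob_density_pdf (pJ s12)).
have s1 : 0 <= 1 - s by case/andP: s34 => _ /ltW; rewrite subr_ge0.
have [->|xi0] := eqVneq eta 0.
  rewrite -(scale0r (0 : V)) -!charc_fourc !charc0//.
  by rewrite subrr normr0 !mulr_ge0// ?symbol_diff_const_ge0// addr_ge0 ?vnorm_ge0 ?powR_ge0.
have e1 : 0 < (1 : R) <= 1 by rewrite ltr01 lexx.
have [h _] := symbol_diff_le (pJ s12) pJ1 s34 delta0 kap0 CC0 limit_symbol_le (hJs s12) C20 e1 xi0.
move: h; rewrite !powR1 !mul1r scale1r; apply: le_trans.
by rewrite distrC le_eqVlt; apply/orP; left; apply/eqP; congr (`|_|); ring.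
Qed.

End Closeness.

Lemma expect_slabC (K : V -> R) (x : R) (omega : V) : is_pdf mu K ->
  expect mu K (fun y => (x <= `|vdot (y : V) omega|)%R%:R) =
  1 - expect mu K (fun y => (`|vdot (y : V) omega| < x)%R%:R).
Proof.
move=> pK; have mc : measurable_fun [set: bvec R d] (fun=> 1 : R) by exact: measurable_cst.
have c1 (y : bvec R d) : `|1 : R| <= 1 by rewrite normr1.
rewrite -[X in X - _](expect_cst 1 pK) -(expectB pK mc c1 (measurable_slab omega x) (fun=> natb_norm_le1 R _)).
congr expect; apply/funext => y; case: (ltP `|vdot (y : V) omega| x) => _ /=.
  by rewrite subrr.
by rewrite subr0.
Qed.

(** A slab width found for the limit kernel is shrunk once and then serves all kernels with s close
    to 1. No equi-integrability of the family is required. *)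
Lemma uniform_slab (kap : R) : 0 < kap <= 1 ->
  exists x0 e0 : R, [/\ 0 < x0, 0 < e0,
    forall omega : V, vnorm omega = 1 ->
      1 - kap <= expect mu J1 (fun y => (x0 <= `|vdot (y : V) omega|)%R%:R) &
    forall s, (3 / 4 : R) <= s < 1 -> 1 - s <= e0 -> forall omega : V, vnorm omega = 1 ->
      1 - kap <= expect mu (J s) (fun y => (x0 <= `|vdot (y : V) omega|)%R%:R)].
Proof.
move=> /andP[k0 k1]; have p1 := prob_density_pdf pJ1.
have k6 : 0 < kap / 6 by rewrite divr_gt0.
have [x1 x10 hx1] := slab_small d0 p1 k6.
(* The three terms of [slab_transfer] receive kap / 3 each: twice the mass kap / 6, then 2 (x0 /
   x1)^2 = 2 (kap / 6)^2, then the symbol difference through the smallness of 1 - s. *)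
pose x0 := x1 * (kap / 6); have x00 : 0 < x0 by rewrite mulr_gt0.
pose b := 2 + delta + 1; pose D := symbol_diff_const delta 1 CC (2 + C0).
have D0 : 0 <= D := symbol_diff_const_ge0 ltr01.
have b1 : 1 <= b by rewrite /b; move: (delta0) => h; lra.
pose L := 2 / x0 + (2 / x0) `^ b * (b + 1) `^ b.
have L0 : 0 <= L by rewrite addr_ge0 ?mulr_ge0 ?powR_ge0// invr_ge0 ltW.
have e0 : 0 < kap / 3 / (4 * D * L + 1).
  by rewrite !divr_gt0// ltr_wpDl// !mulr_ge0.
exists x0, (kap / 3 / (4 * D * L + 1)); split => //.
  move=> omega w1; rewrite (expect_slabC _ _ p1) lerD2l lerN2.
  apply: (@le_trans _ _ (kap / 6)); last by rewrite ler_pdivrMr// ler_peMr ?(ltW k0)// ler1n.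
  apply: le_trans (hx1 _ w1); apply: (expect_le p1 (measurable_slab omega x0)
    (fun=> natb_norm_le1 R _) (measurable_slab omega x1) (fun=> natb_norm_le1 R _)) => y.
  case: (ltP _ x0) => // h; rewrite (lt_le_trans h)//.
  by rewrite /x0 ler_piMr ?(ltW x10)// ler_pdivrMr// mul1r (le_trans k1)// ler1n.
move=> s s34 se omega w1.
have s12 : 1 / 2 < s < 1 by case/andP: s34 => h1 h2; apply/andP; split; lra.
have s1 : 0 <= 1 - s by case/andP: s34 => _ /ltW; rewrite subr_ge0.
have ps := prob_density_pdf (pJ s12).
rewrite (expect_slabC _ _ ps) lerD2l lerN2.
have h := slab_transfer p1 ps (mulr_ge0 D0 s1) b1 x00 x10 w1
  (fun eta => fourc_kernel_close ltr01 eta s34).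
apply: le_trans h _; rewrite -/L.
have h1 := hx1 _ w1.
have h2 : 2 * (x0 / x1) ^+ 2 <= kap / 3.
  have -> : x0 / x1 = kap / 6 by rewrite /x0; field; rewrite gt_eqF.
  have : (kap / 6) ^+ 2 <= kap / 6.
    by rewrite expr2 ler_piMl ?(ltW k6)// ler_pdivrMr// mul1r (le_trans k1)// ler1n.
  by move: (_ ^+ 2) => q; lra.
have h3 : 4 * (D * (1 - s) * L) <= kap / 3.
  move: se; rewrite ler_pdivlMr; last by rewrite ltr_wpDl// !mulr_ge0.
  rewrite mulrDr mulr1 => h3.
  have -> : 4 * (D * (1 - s) * L) = (1 - s) * (4 * D * L) by ring.
  by apply: le_trans h3; rewrite lerDl.
move: h1 h2 h3; move: (_ ^+ 2) (4 * _) (expect _ _ _) => A B E h1 h2 h3; lra.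
Qed.

Let a : R := 2 + delta + d%:R / 2.
Let eps_max : R := Num.sqrt (2 / (4 + 2 * delta + d%:R)).
Let a1 : 1 <= a.
Proof.
have h : 0 <= d%:R / 2 :> R by rewrite divr_ge0.
by rewrite /a; move: (delta0) h; move: (d%:R / 2) => D h1 h2; lra.
Qed.

(* This is the only use of the restriction on [eps]. *)
Lemma eps_range (eps : R) : 0 < eps < eps_max -> 0 < eps < 1 /\ a <= eps `^ (- 2).
Proof.
move=> /andP[e0 e1]; have a0 : 0 < a := lt_le_trans ltr01 a1.
have aV : 2 / (4 + 2 * delta + d%:R) = a^-1.
  have -> : 4 + 2 * delta + d%:R = 2 * a by rewrite /a; field.
  by rewrite invfM mulrA divff ?mul1r// pnatr_eq0.
have e2 : eps ^+ 2 < a^-1.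
  rewrite -aV -[ltRHS]sqr_sqrtr ?divr_ge0 ?ltr_sqr ?nnegrE ?sqrtr_ge0 ?(ltW e0)//.
  rewrite -/eps_max in e1 *.
  by rewrite !addr_ge0// mulr_ge0// ltW.
have e3 : a <= eps `^ (- 2).
  rewrite powRN powR_mulrn ?(ltW e0)// -[leLHS]invrK lef_pV2 ?posrE ?invr_gt0 ?exprn_gt0//.
  exact: ltW.
split=> //; rewrite e0/= ltNge; apply/negP => e11.
have : 1 <= eps ^+ 2 by rewrite exprn_ege1.
by rewrite leNgt => /negP; apply; apply: lt_le_trans e2 _; rewrite invf_le1// (lt_le_trans ltr01).
Qed.

(** The exponent of |psi|^2 is 2 [lam1] (1 - [ks]), with [lam1] a lower bound of eps^(-2s) and [ks]
    the mass allowed in a slab; both are chosen close enough to a and 0. *)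
Lemma uniform_decay (eta : R) : 0 < eta < a -> exists Cd e0 : R, [/\ 0 <= Cd, 0 < e0,
  forall eps F, 0 < eps < eps_max -> equilibrium J1 eps 2 F ->
    forall xi, 1 <= vnorm xi -> sqfour F xi <= Cd * vnorm xi `^ (- (2 * a - eta / 2)) &
  forall s eps F, (3 / 4 : R) <= s < 1 -> 1 - s <= e0 -> 0 < eps < eps_max ->
    equilibrium (J s) eps (2 * s) F ->
    forall xi, 1 <= vnorm xi -> sqfour F xi <= Cd * vnorm xi `^ (- (2 * a - eta / 2))].
Proof.
move=> /andP[eta0 etaa]; have a0 : 0 < a := lt_le_trans ltr01 a1.
(* 2 (a - eta / 8) (1 - eta / (8 a)) >= 2 a - eta / 2: a loss of eta / 4 for the slab mass and eta /
   4 for eps^(-2s) below a. *)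
pose ks := eta / (8 * a); pose lam1 := a - eta / 8.
have ks0 : 0 < ks by rewrite !divr_gt0// mulr_gt0.
have ks1 : ks < 1 by rewrite /ks ltr_pdivrMr ?mulr_gt0// mul1r; move: (a0) etaa => h1 h2; lra.
have lam10 : 0 < lam1 by rewrite /lam1; move: (a0) etaa => h1 h2; lra.
have [x0 [es [x00 es0 sl1 sls]]] : exists x0 e0 : R, [/\ 0 < x0, 0 < e0,
    forall omega : V, vnorm omega = 1 ->
      1 - ks <= expect mu J1 (fun y => (x0 <= `|vdot (y : V) omega|)%R%:R) &
    forall s, (3 / 4 : R) <= s < 1 -> 1 - s <= e0 -> forall omega : V, vnorm omega = 1 ->
      1 - ks <= expect mu (J s) (fun y => (x0 <= `|vdot (y : V) omega|)%R%:R)].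
  by apply: uniform_slab; rewrite ks0 ltW.
have [c1 [c10 c11 c1C]] := low_frequency_radius.
have ks01 : 0 <= ks < 1 by rewrite (ltW ks0).
have lna : 0 <= a * ln a by rewrite mulr_ge0 ?(ltW a0)// ln_ge0.
have l8 : 0 < 8 * (a * ln a + 1) by rewrite mulr_gt0// ltr_wpDl.
have Cd0 : 0 <= decay_const c1 x0 ks lam1.
  by rewrite /decay_const !mulr_ge0 ?expR_ge0 ?powR_ge0.
have gle : 2 * a - eta / 2 <= 2 * lam1 * (1 - ks).
  have ka : a * ks = eta / 8 by rewrite /ks; field; rewrite gt_eqF.
  have : 0 <= eta / 8 * ks by rewrite mulr_ge0 ?(ltW ks0)// divr_ge0// ltW.
  have -> : 2 * lam1 * (1 - ks) = 2 * a - 2 * (a * ks) - eta / 4 + 2 * (eta / 8 * ks).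
    by rewrite /lam1; move: (ks) (a) => q b; field.
  by rewrite ka; move: (eta / 8 * ks) => q q0; lra.
have mono (xi : V) : 1 <= vnorm xi ->
    vnorm xi `^ (- (2 * lam1 * (1 - ks))) <= vnorm xi `^ (- (2 * a - eta / 2)).
  by move=> x1; rewrite ler_powR// lerN2.
have la : lam1 <= a by rewrite /lam1 lerBlDr lerDl divr_ge0// ltW.
(* The second entry of the minimum ensures (1 - s) a ln a <= eta / 8, hence a^s >= [lam1]. *)
exists (decay_const c1 x0 ks lam1), (Num.min es (eta / (8 * (a * ln a + 1)))).
split => //.
- by rewrite lt_min es0 divr_gt0.
- move=> eps F e01 eqF xi x1; have [e01' ea] := eps_range e01.
  have al12 : 1 <= (2 : R) <= 2 by rewrite lexx ler1n.
  have al1 : 1 <= (2 : R) by rewrite ler1n.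
  have h := sqfour_decay i0 (prob_density_pdf pJ1) (prob_density_pdf eqF.1) e01' eqF al12
    c10 x00 ks01 lam10 (le_trans la ea)
    (expansion_lower pJ1 al1 delta0 C00 hJ1' c11 c1C) sl1 x1.
  by apply: le_trans h _; rewrite ler_wpM2l// mono.
move=> s eps F s34; rewrite le_min => /andP[ses see] e01 eqF xi x1.
have [e01' ea] := eps_range e01.
have [s12 al12] : 1 / 2 < s < 1 /\ 1 <= 2 * s <= 2.
  by case/andP: s34 => h1 h2; split; apply/andP; split; lra.
have al1 : 1 <= 2 * s by case/andP: al12.
have s1 : 0 <= 1 - s by case/andP: s34 => _ /ltW; rewrite subr_ge0.
have s0 : 0 <= s by case/andP: s12 => h1 h2; lra.
have lam_le : lam1 <= eps `^ (- (2 * s)).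
  rewrite -mulNr powRrM; apply: (@le_trans _ _ (a `^ s)); last first.
    by apply: ge0_ler_powR; rewrite ?nnegrE ?(ltW a0) ?powR_ge0.
  apply: le_trans (powR_near1_ge s a1); rewrite /lam1 lerD2l lerN2.
  move: see; rewrite ler_pdivlMr// mulrCA mulrDr mulr1 => see.
  by rewrite ler_pdivlMr// mulrC; apply: le_trans see; rewrite mulrDr lerDl mulr_ge0.
have h := sqfour_decay i0 (prob_density_pdf (pJ s12)) (prob_density_pdf eqF.1) e01'
  eqF al12 c10 x00 ks01 lam10 lam_le
  (expansion_lower (pJ s12) al1 delta0 C00 (hJ s12) c11 c1C) (sls s s34 ses) x1.
by apply: le_trans h _; rewrite ler_wpM2l// mono.
Qed.

Lemma ray_compare (kap s eps : R) (Fs F : V -> R) (xi : V) : 0 < kap -> (3 / 4 : R) <= s < 1 ->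
  0 < eps < eps_max -> equilibrium (J s) eps (2 * s) Fs -> equilibrium J1 eps 2 F ->
  (fourc Fs xi - fourc F xi) ^+ 2 + (fours Fs xi - fours F xi) ^+ 2 <=
  72 * Num.min 1 ((symbol_diff_const delta kap CC (2 + C0) * (1 - s) *
    (vnorm xi + vnorm xi `^ (2 + delta + kap))) ^+ 2) * (sqfour Fs xi + sqfour F xi).
Proof.
move=> k0 s34 er eqFs eqF; have [e01 _] := eps_range er.
have [s12 al12] : 1 / 2 < s < 1 /\ 1 <= 2 * s <= 2.
  by case/andP: s34 => h1 h2; split; apply/andP; split; lra.
have al12' : 1 <= (2 : R) <= 2 by rewrite lexx ler1n.
have [ps p1] := (prob_density_pdf (pJ s12), prob_density_pdf pJ1).
have [pFs pF] := (prob_density_pdf eqFs.1, prob_density_pdf eqF.1).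
have s1 : 0 <= 1 - s by case/andP: s34 => _ /ltW; rewrite subr_ge0.
set h1 := _ * (_ + _ `^ _).
have h10 : 0 <= h1.
  by rewrite !mulr_ge0 ?symbol_diff_const_ge0// addr_ge0 ?vnorm_ge0 ?powR_ge0.
have e01' : 0 < eps <= 1 by case/andP: e01 => h2 h3; rewrite h2 ltW.
have := ode_diff_le (ray_ode i0 ps pFs e01 eqFs xi) (ray_ode i0 p1 pF e01 eqF xi)
  (fun t => @sqfour_gt0 _ _ i0 _ _ _ _ _ p1 pF e01 eqF al12' limit_symbol_le xi t)
  (h := fun t => h1 * t) (h' := fun=> h1) ler01.
rewrite mulr0 mulr1 !sqfourE !charc_fourc !chars_fours !scale1r; apply => //.
- by move=> t _; exact: derive_scale.
- by move=> t t01; exact: ray_diff_le.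
- by apply: continuous_subspaceT => t; exact: is_derive_continuous (derive_scale _ t).
Qed.

(* [min 1 h^2 <= h^(2 th)] trades part of the factor [1 - s] for decay: the growth
   exponent [2 th (2 + delta)] of [h^(2 th)] is beaten, by more than [d], by twice the
   decay exponent [2 + delta + d / 2]. *)
Lemma fourier_diff_bound (th : R) : 0 < th < 1 -> exists e0 q C : R, [/\ 0 < e0, 0 < q, 0 <= C &
  forall s eps Fs F, (3 / 4 : R) <= s < 1 -> 1 - s <= e0 -> 0 < eps < eps_max ->
    equilibrium (J s) eps (2 * s) Fs -> equilibrium J1 eps 2 F -> forall xi : V,
  (fourc Fs xi - fourc F xi) ^+ 2 + (fours Fs xi - fours F xi) ^+ 2 <=
    C * (1 - s) `^ (2 * th) * \prod_i (1 + `|xi 0 i|) `^ (- 1 - q)].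
Proof.
(* Taking the power th instead of 1 saves 2 eta in the growth exponent 2 (2 + delta); half of this
   saving pays for kap and for the loss of decay, the other half is left over for integrability. *)
move=> /andP[th0 th1]; pose eta := (1 - th) * (2 + delta).
have d2 : 0 <= d%:R / 2 :> R by rewrite divr_ge0.
have eta0 : 0 < eta.
  by rewrite mulr_gt0 ?subr_gt0// addr_gt0.
have etaa : 0 < eta < a.
  rewrite eta0 /eta mulrBl mul1r /a; move: d2 (mulr_gt0 th0 delta0) (delta0).
  by move: (d%:R / 2) => D; lra.
have [Cd [e0 [Cd0 e00 dec1 decs]]] := uniform_decay etaa.
pose kap := eta / 4; have k0 : 0 < kap by rewrite divr_gt0.
pose D := symbol_diff_const delta kap CC (2 + C0).
have D0 : 0 <= D := symbol_diff_const_ge0 k0.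
have dR : 0 < d%:R :> R by rewrite ltr0n.
pose B := 144 * (1 + Cd) * (2 * D) `^ (2 * th).
have B0 : 0 <= B by rewrite !mulr_ge0 ?powR_ge0// addr_ge0.
exists e0, (eta / d%:R), (B * 2 `^ (d%:R + eta)); split => //.
- by rewrite divr_gt0.
- by rewrite mulr_ge0// powR_ge0.
move=> s eps Fs F s34 se er eqFs eqF xi.
have s1 : 0 <= 1 - s by case/andP: s34 => _ /ltW; rewrite subr_ge0.
apply: (@le_trans _ _ (B * (1 - s) `^ (2 * th) * (Num.max 1 (vnorm xi)) `^ (- (d%:R + eta)))); last first.
  rewrite [leRHS](_ : _ = B * (1 - s) `^ (2 * th) *
    (2 `^ (d%:R + eta) * \prod_i (1 + `|xi 0 i|) `^ (- 1 - eta / d%:R))); last by ring.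
  by apply: ler_wpM2l; [rewrite mulr_ge0 ?powR_ge0|exact: max1_powR_le_prod].
apply: le_trans (ray_compare xi k0 s34 er eqFs eqF) _; rewrite -/D.
set x := vnorm xi; set b := 2 + delta + kap; have x0 : 0 <= x := vnorm_ge0 xi.
set m := Num.max 1 x; have m1 : 1 <= m by rewrite le_max lexx.
have m0 : 0 < m := lt_le_trans ltr01 m1.
have b0 : 1 <= b by rewrite /b; move: (delta0) k0 => h1 h2; lra.
have xb : x + x `^ b <= 2 * m `^ b.
  have xm : x <= m by rewrite le_max lexx orbT.
  rewrite (_ : 2 * _ = m `^ b + m `^ b); last by ring.
  apply: lerD; first by apply: le_trans xm _; exact: le1r_powR.
  by apply: ge0_ler_powR; rewrite ?nnegrE ?(ltW m0)// (le_trans ler01).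
have hle : D * (1 - s) * (x + x `^ b) <= 2 * D * (1 - s) * m `^ b.
  rewrite [leRHS](_ : _ = D * (1 - s) * (2 * m `^ b)); last by ring.
  by rewrite ler_wpM2l// mulr_ge0.
have h0 : 0 <= D * (1 - s) * (x + x `^ b) by rewrite !mulr_ge0// addr_ge0 ?powR_ge0.
have M1 : Num.min 1 ((D * (1 - s) * (x + x `^ b)) ^+ 2) <=
    (2 * D) `^ (2 * th) * (1 - s) `^ (2 * th) * m `^ (2 * th * b).
  apply: le_trans (min1_sqr_le_powR h0 (p := 2 * th) _) _.
    by apply/andP; split; lra.
  have -> : m `^ (2 * th * b) = (m `^ b) `^ (2 * th) by rewrite -powRrM mulrC.
  rewrite -!powRM ?mulr_ge0 ?powR_ge0//.
  by apply: ge0_ler_powR hle; rewrite ?nnegrE ?h0 ?mulr_ge0 ?powR_ge0 ?(ltW th0).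
have N1 : sqfour Fs xi + sqfour F xi <= 2 * (1 + Cd) * m `^ (- (2 * a - eta / 2)).
  rewrite (_ : 2 * (1 + Cd) * _ = (1 + Cd) * m `^ (- (2 * a - eta / 2)) +
    (1 + Cd) * m `^ (- (2 * a - eta / 2))); last by ring.
  have [x1|x1] := leP 1 x.
    have mx : m = x by rewrite /m; apply/max_idPr.
    rewrite mx; apply: lerD.
      apply: le_trans (decs _ _ _ s34 se er eqFs _ x1) _.
      by rewrite ler_wpM2r ?powR_ge0// lerDr.
    apply: le_trans (dec1 _ _ er eqF _ x1) _.
    by rewrite ler_wpM2r ?powR_ge0// lerDr.
  have mx : m = 1 by rewrite /m; apply/max_idPl; exact: ltW.
  have s12 : 1 / 2 < s < 1 by case/andP: s34 => h1 h2; apply/andP; split; lra.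
  have [e01 _] := eps_range er.
  have Cd1 : 1 <= 1 + Cd by rewrite lerDl.
  rewrite mx powR1 mulr1; apply: lerD; apply: le_trans Cd1.
    exact: (sqfour_le1 i0 (prob_density_pdf (pJ s12)) (prob_density_pdf eqFs.1) e01 eqFs).
  exact: (sqfour_le1 i0 (prob_density_pdf pJ1) (prob_density_pdf eqF.1) e01 eqF).
apply: (@le_trans _ _ (72 * ((2 * D) `^ (2 * th) * (1 - s) `^ (2 * th) * m `^ (2 * th * b)) *
  (2 * (1 + Cd) * m `^ (- (2 * a - eta / 2))))).
  apply: ler_pM => //.
  - by rewrite mulr_ge0// le_min ler01 sqr_ge0.
  - by rewrite addr_ge0// addr_ge0 ?sqr_ge0.
  - by rewrite ler_wpM2l.
rewrite [leLHS](_ : _ = B * (1 - s) `^ (2 * th) * (m `^ (2 * th * b) * m `^ (- (2 * a - eta / 2)))); last first.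
  by rewrite /B; ring.
apply: ler_wpM2l; first by rewrite mulr_ge0 ?powR_ge0.
rewrite -powRD; last by apply/implyP => _; rewrite gt_eqF.
apply: ler_powR => //.
(* Total exponent: 2 (2 + delta) - 2 eta + th eta / 2 - (2 a - eta / 2), with 2 a = 2 (2 + delta) +
   d; it is at most - d - eta. *)
have e1 : th * eta <= eta by rewrite ler_piMl ?ltW.
have -> : 2 * th * b = 2 * (2 + delta) - 2 * eta + (th * eta) / 2.
  by rewrite /b /kap /eta; field.
by rewrite /a; move: (th * eta) e1 eta0 => q h1 h2; lra.
Qed.

End UniformBounds.

(** * From Fourier bounds to local L1 bounds *)

Section PoissonKernel.
Variable R : realType.
Let leb : {sigma_finite_measure set (measurableTypeR R) -> \bar R} := @lebesgue_measure R.

Lemma ge0_integral_reflect (F : R -> R) : (forall x, 0 <= F x) -> continuous F ->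
  (\int[@lebesgue_measure R]_x (F x)%:E = \int[@lebesgue_measure R]_x (F (- x))%:E)%E.
Proof.
move=> F0 cF; have cN : continuous (fun x => F (- x)).
  by move=> x; apply: continuous_comp; [exact: opp_continuous|exact: cF].
have half (G : R -> R) : (forall x, 0 <= G x) -> continuous G ->
    (\int[leb]_x (G x)%:E = \int[leb]_(x in `[0%R, +oo[) (G x)%:E +
      \int[leb]_(x in `[0%R, +oo[) (G (- x))%:E)%E.
  move=> G0 cG; have mG : measurable_fun [set: R] G by exact: continuous_measurable_fun.
  rewrite -(setUv `[0%R, +oo[%classic) (ge0_integral_setU leb)//=; last 4 first.
  - exact: measurableC.
  - by apply/measurable_EFinP; rewrite setUv.
  - by move=> x _; rewrite lee_fin.
  - exact/disj_setPCl.
  congr (_ + _)%E; rewrite setCitvr.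
  rewrite integral_itv_bndo_bndc; last exact/measurable_EFinP/measurable_funTS.
  rewrite -{1}oppr0 ge0_integration_by_substitutionNy//.
  exact: continuous_subspaceT.
rewrite [LHS]half// [RHS]half//.
rewrite addeC; congr (_ + _)%E; apply: eq_integral => x _; by rewrite opprK.
Qed.

(** Reflection u -> - u changes the sign of phi; averaging the two integrals turns cos(phi + u z)
    into cos phi cos(u z), whose integral is known. *)
Lemma integral_expRabs_addcos (phi z : R) :
  (\int[@lebesgue_measure R]_u (expR (- `|u : R|) * (1 + cos (phi + u * z)))%:E =
   (2 + cos phi * (2 / (1 + z ^+ 2)))%:E)%E.
Proof.
pose F (p u : R) : R := expR (- `|u|) * (1 + cos (p + u * z)).
have cE := @continuous_expRabs R.
have cc (p : R) : continuous (fun u : R => cos (p + u * z)).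
  move=> u.
  apply: (continuous_comp (f := fun u : R => p + u * z)); last exact: continuous_cos.
  by apply: cvgD; [exact: cvg_cst|apply: cvgM; [exact: cvg_id|exact: cvg_cst]].
have cF p : continuous (F p).
  by move=> u; apply: cvgM; [exact: cE|apply: cvgD; [exact: cvg_cst|exact: cc]].
have F0 p u : 0 <= F p u.
  by rewrite mulr_ge0 ?expR_ge0// -lerBlDl sub0r cos_geN1.
have mF p : measurable_fun [set: R] (F p) by exact: continuous_measurable_fun.
have iE : leb.-integrable setT (EFin \o (fun u : R => expR (- `|u|))).
  apply: ge0_integrable => //; first exact: continuous_measurable_fun.
  by rewrite integral_expRabs ltry.
have ibd (g : R -> R) : continuous g -> (forall u, `|g u| <= 1) ->
    leb.-integrable setT (EFin \o (fun u : R => g u * expR (- `|u|))).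
  move=> cg g1; apply: (integrable_mulr_bounded (M := 1) _ _ iE) => //.
  exact: continuous_measurable_fun.
have iF p : leb.-integrable setT (EFin \o F p).
  have := integrableD measurableT iE (ibd _ (cc p) (fun u => cos_norm_le1 _)).
  apply: eq_integrable => // u _ /=.
  by rewrite /F -EFinD; congr EFin; ring.
have refl : \int[leb]_u F phi u = \int[leb]_u F (- phi) u.
  congr fine; rewrite ge0_integral_reflect//; apply: eq_integral => u _.
  by rewrite /F normrN mulNr -cosN opprD opprK.
have E1 : \int[leb]_u expR (- `|u|) = 2 by rewrite /Rintegral integral_expRabs.
have E2 : \int[leb]_u (cos (z * u) * expR (- `|u|)) = 2 / (1 + z ^+ 2).
  have cz : continuous (fun u : R => cos (z * u)).
    move=> u; exact: continuous_coscale.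
  have ic := ibd _ cz (fun u => cos_norm_le1 _).
  have := RintegralB measurableT iE ic; rewrite E1.
  have -> : \int[leb]_u (expR (- `|u|) - cos (z * u) * expR (- `|u|)) = 2 * (1 - (1 + z ^+ 2)^-1).
    have -> : 2 * (1 - (1 + z ^+ 2)^-1) = fine (2 * (1 - (1 + z ^+ 2)^-1))%:E by [].
    rewrite -integral_expRabs_subcos; congr fine; apply: eq_integral => u _.
    by congr EFin; ring.
  by move=> h; lra.
have cz : continuous (fun u : R => cos (z * u)).
  move=> u; exact: continuous_coscale.
have ic := ibd _ cz (fun u => cos_norm_le1 _).
rewrite -(Rintegral_EFin (iF phi)); congr EFin.
suff : \int[leb]_u F phi u + \int[leb]_u F (- phi) u =
    2 * (\int[leb]_u expR (- `|u|) + cos phi * \int[leb]_u (cos (z * u) * expR (- `|u|))).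
  by rewrite -refl E1 E2; move: (_ / _) => q h; lra.
rewrite -RintegralD// -RintegralZl// -RintegralD//; last first.
  rewrite (_ : _ \o _ = (fun u => (cos phi)%:E * (cos (z * u) * expR (- `|u|))%:E)%E)//.
  exact: integrableZl.
rewrite -RintegralZl//; last first.
  rewrite (_ : _ \o _ = (EFin \o (fun u : R => expR (- `|u|))) \+
    (fun u => (cos phi)%:E * (cos (z * u) * expR (- `|u|))%:E)%E)//.
  apply: integrableD => //; exact: integrableZl.
apply: eq_Rintegral => u _; rewrite /F (mulrC u) !cosD cosN sinN; ring.
Qed.

End PoissonKernel.

Section PoissonTransform.
Variable R : realType.

(* [lap] and [cau] are Fourier transforms of each other, up to constants; see [lap_transform]. *)
Definition lap d (xi : 'rV[R]_d) : R := \prod_i expR (- `|xi 0 i|).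
Definition cau d (z : 'rV[R]_d) : R := \prod_i (2 / (1 + z 0 i ^+ 2)).

Lemma lap_ge0 d (xi : 'rV[R]_d) : 0 <= lap xi.
Proof. by apply: prodr_ge0 => i _; exact: expR_ge0. Qed.

Lemma lap_le1 d (xi : 'rV[R]_d) : lap xi <= 1.
Proof.
apply: prodr_ile1 => i _; rewrite expR_ge0/= -[leRHS]expR0 ler_expR.
by rewrite oppr_le0.
Qed.

Lemma cau1_ge0 (u : R) : 0 <= 2 / (1 + u ^+ 2).
Proof. by rewrite divr_ge0// addr_ge0// sqr_ge0. Qed.

Lemma cau1_le2 (u : R) : 2 / (1 + u ^+ 2) <= 2.
Proof.
have h : 1 <= 1 + u ^+ 2 by rewrite lerDl sqr_ge0.
by rewrite ler_pdivrMr ?(lt_le_trans ltr01)// ler_peMr.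
Qed.

Lemma cau_ge0 d (z : 'rV[R]_d) : 0 <= cau z.
Proof. by apply: prodr_ge0 => i _; exact: cau1_ge0. Qed.

Lemma cau_le d (z : 'rV[R]_d) : cau z <= 2 ^+ d.
Proof.
rewrite -[X in _ <= 2 ^+ X]card_ord -prodr_const; apply: ler_prod => i _.
by rewrite cau1_ge0 cau1_le2.
Qed.

Lemma measurable_expRabs : measurable_fun [set: R] (fun u : R => expR (- `|u|)).
Proof. by apply: continuous_measurable_fun; exact: continuous_expRabs. Qed.

Lemma measurable_cau1 : measurable_fun [set: R] (fun u : R => 2 / (1 + u ^+ 2)).
Proof.
apply: continuous_measurable_fun => u; apply: cvgM; first exact: cvg_cst.
apply: cvgV; first by rewrite gt_eqF// ltr_pwDl// sqr_ge0.
by apply: cvgD; [exact: cvg_cst|exact: exprn_continuous].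
Qed.

Lemma measurable_lap d : measurable_fun [set: bvec R d] (@lap d).
Proof. by apply: (measurable_prod_coord (w := fun _ u => expR (- `|u|))) => i; exact: measurable_expRabs. Qed.

Lemma measurable_cau d : measurable_fun [set: bvec R d] (@cau d).
Proof. by apply: (measurable_prod_coord (w := fun _ u => 2 / (1 + u ^+ 2))) => i; exact: measurable_cau1. Qed.

Lemma lap_bcons n (u : R) (v : 'rV[R]_n) : lap (bcons (u, v) : 'rV[R]_n.+1) = expR (- `|u|) * lap v.
Proof.
rewrite /lap big_ord_recl bcons0; congr (_ * _); apply: eq_bigr => i _.
by rewrite bconsS.
Qed.

Lemma vdot_bcons n (u : R) (v : 'rV[R]_n) (z : 'rV[R]_n.+1) :
  vdot (bcons (u, v) : 'rV[R]_n.+1) z = u * z 0 ord0 + vdot v (\row_i z 0 (lift ord0 i)).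
Proof.
rewrite /vdot big_ord_recl bcons0; congr (_ + _); apply: eq_bigr => i _.
by rewrite bconsS mxE.
Qed.

Lemma cau_recl n (z : 'rV[R]_n.+1) :
  cau z = 2 / (1 + z 0 ord0 ^+ 2) * cau (\row_i z 0 (lift ord0 i)).
Proof.
by rewrite /cau big_ord_recl; congr (_ * _); apply: eq_bigr => i _; rewrite mxE.
Qed.

Lemma measurable_lapcos d (phi : R) (z : 'rV[R]_d) :
  measurable_fun setT (fun xi : bvec R d => lap (xi : 'rV[R]_d) * (1 + cos (phi + vdot (xi : 'rV[R]_d) z))).
Proof.
apply: measurable_funM; first exact: measurable_lap.
apply: measurable_funD; first exact: measurable_cst.
apply: (measurableT_comp (f := @cos R)).
  by apply: continuous_measurable_fun => x; exact: continuous_cos.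
by apply: measurable_funD; [exact: measurable_cst|exact: measurable_vdot].
Qed.

(* The phase makes the induction on [d] go through; [1 +] keeps the integrand nonnegative. *)
Lemma integral_lapcos d (phi : R) (z : 'rV[R]_d) :
  (\int[bmu R d]_xi (lap (xi : 'rV[R]_d) * (1 + cos (phi + vdot (xi : 'rV[R]_d) z)))%:E =
   (2 ^+ d + cos phi * cau z)%:E)%E.
Proof.
have c0 (x : R) : 0 <= 1 + cos x by rewrite -lerBlDl sub0r cos_geN1.
elim: d phi z => [|n IH] phi z.
  rewrite /= integral_dirac//; last by apply/measurable_EFinP; exact: measurable_lapcos.
  by rewrite diracT mul1e /lap /cau /vdot !big_ord0 addr0 mul1r mulr1 expr0.
rewrite ge0_integral_bmuS; last 2 first.
- by apply/measurable_EFinP; exact: measurable_lapcos.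
- by move=> x; rewrite lee_fin mulr_ge0 ?lap_ge0.
set z' : 'rV[R]_n := \row_i z 0 (lift ord0 i); set Q := cau z'.
have Q2 : Q <= 2 ^+ n := cau_le z'; have Q0 : 0 <= Q := cau_ge0 z'.
(* The inductive value 2^n + Q cos is split as (2^n - Q) + Q (1 + cos), both nonnegative because Q
   <= 2^n. *)
transitivity (\int[@lebesgue_measure R]_u ((2 ^+ n - Q)%:E * (expR (- `|u : R|))%:E +
    Q%:E * (expR (- `|u : R|) * (1 + cos (phi + u * z 0 ord0)))%:E))%E.
  apply: eq_integral => u _.
  under eq_integral do rewrite lap_bcons vdot_bcons -mulrA addrA EFinM.
  rewrite (ge0_integralZl (bmu R n) measurableT); last 3 first.
  - by apply/measurable_EFinP; exact: measurable_lapcos.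
  - by move=> v _; rewrite lee_fin mulr_ge0 ?lap_ge0.
  - by rewrite lee_fin expR_ge0.
  by rewrite IH -!EFinM -EFinD; congr EFin; rewrite -/z' -/Q; ring.
have mc : measurable_fun setT (fun u : R => expR (- `|u|) * (1 + cos (phi + u * z 0 ord0))).
  apply: measurable_funM; first exact: measurable_expRabs.
  apply: measurable_funD; first exact: measurable_cst.
  apply: (measurableT_comp (f := @cos R)).
    by apply: continuous_measurable_fun => x; exact: continuous_cos.
  apply: measurable_funD; first exact: measurable_cst.
  by apply: measurable_funM => //; exact: measurable_cst.
have ec0 u : 0 <= expR (- `|u|) * (1 + cos (phi + u * z 0 ord0)) by rewrite mulr_ge0 ?expR_ge0.
rewrite ge0_integralD//; last 4 first.
- by move=> u _; rewrite -EFinM lee_fin mulr_ge0 ?expR_ge0// subr_ge0.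
- apply: emeasurable_funM; first exact: measurable_cst.
  by apply/measurable_EFinP; exact: measurable_expRabs.
- by move=> u _; rewrite -EFinM lee_fin mulr_ge0.
- by apply: emeasurable_funM; [exact: measurable_cst|exact/measurable_EFinP].
have mE1 : measurable_fun [set: R] (fun u : R => (expR (- `|u|))%:E).
  by apply/measurable_EFinP; exact: measurable_expRabs.
have mE2 := (measurable_EFinP _ _).2 mc.
rewrite (ge0_integralZl (@lebesgue_measure R) measurableT mE1); last 2 first.
- by move=> u _; rewrite lee_fin expR_ge0.
- by rewrite lee_fin subr_ge0.
rewrite (ge0_integralZl (@lebesgue_measure R) measurableT mE2); last 2 first.
- by move=> u _; rewrite lee_fin.
- by rewrite lee_fin.
rewrite integral_expRabs integral_expRabs_addcos -!EFinM -EFinD cau_recl -/z' -/Q [2 ^+ n.+1]exprS.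
by congr EFin; ring.
Qed.

End PoissonTransform.

(** * Multiplication formula and a smoothed Plancherel identity *)

Section Pairing.
Variables (R : realType) (d : nat).
Local Notation V := 'rV[R]_d.
Local Notation mu := (bmu R d).

Lemma integral_lap : (\int[mu]_xi (lap (xi : V))%:E = (2 ^+ d)%:E)%E.
Proof.
rewrite (@ge0_integral_prod_coord R d (fun _ u => expR (- `|u|))).
- by under eq_bigr do rewrite integral_expRabs; rewrite prodEFin prodr_const card_ord.
- by move=> i; exact: measurable_expRabs.
- by move=> i x; exact: expR_ge0.
Qed.

Lemma integrable_lap : mu.-integrable setT (EFin \o @lap R d).
Proof.
apply: ge0_integrable; [exact: measurable_lap|exact: lap_ge0|].
by rewrite integral_lap ltry.
Qed.

Lemma measurable_cosvdot (z : V) : measurable_fun setT (fun xi : bvec R d => cos (vdot (xi : V) z)).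
Proof.
apply: (measurableT_comp (f := @cos R)); last exact: measurable_vdot.
by apply: continuous_measurable_fun => x; exact: continuous_cos.
Qed.

Lemma measurable_sinvdot (z : V) : measurable_fun setT (fun xi : bvec R d => sin (vdot (xi : V) z)).
Proof.
apply: (measurableT_comp (f := @sin R)); last exact: measurable_vdot.
by apply: continuous_measurable_fun => x; exact: continuous_sin.
Qed.

Lemma integrable_cosM (f : bvec R d -> R) (z : V) : mu.-integrable setT (EFin \o f) ->
  mu.-integrable setT (EFin \o (fun x : bvec R d => cos (vdot (x : V) z) * f x)).
Proof.
move=> fi; apply: (integrable_mulr_bounded (M := 1) _ _ fi); first exact: measurable_cosvdot.
by move=> x; exact: cos_norm_le1.
Qed.

Lemma integrable_sinM (f : bvec R d -> R) (z : V) : mu.-integrable setT (EFin \o f) ->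
  mu.-integrable setT (EFin \o (fun x : bvec R d => sin (vdot (x : V) z) * f x)).
Proof.
move=> fi; apply: (integrable_mulr_bounded (M := 1) _ _ fi); first exact: measurable_sinvdot.
by move=> x; exact: sin_norm_le1.
Qed.

Lemma lap_transform (z : V) : \int[mu]_xi (cos (vdot (xi : V) z) * lap (xi : V)) = cau z.
Proof.
have ic := integrable_cosM z integrable_lap.
have := RintegralD measurableT integrable_lap ic.
have -> : \int[mu]_xi lap (xi : V) = 2 ^+ d by rewrite /Rintegral integral_lap.
have -> : \int[mu]_xi (lap (xi : V) + cos (vdot (xi : V) z) * lap (xi : V)) = 2 ^+ d + cau z.
  have -> : 2 ^+ d + cau z = fine (2 ^+ d + cos 0 * cau z)%:E by rewrite cos0 mul1r.
  rewrite -integral_lapcos; congr fine; apply: eq_integral => xi _.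
  by rewrite add0r; congr EFin; ring.
by move=> /addrI ->.
Qed.

Lemma lap_transform_scaled (h : R) (z : V) : 0 < h ->
  \int[mu]_xi (cos (vdot (xi : V) z) * lap (h *: (xi : V))) = h^-1 ^+ d * cau (h^-1 *: z).
Proof.
move=> h0; rewrite -lap_transform.
rewrite -(Rintegral_affine 0 h0 (integrable_cosM _ integrable_lap)).
apply: eq_Rintegral => xi _; rewrite addr0 vdotZl vdotZr mulrA divff ?gt_eqF// mul1r.
by [].
Qed.

Lemma fourcE (f : V -> R) (xi : V) : fourc f xi = \int[mu]_x (cos (vdot (x : V) xi) * f x).
Proof. by rewrite /fourc /charc /expect; apply: eq_Rintegral => x _; rewrite mul1r. Qed.

Lemma foursE (f : V -> R) (xi : V) : fours f xi = \int[mu]_x (sin (vdot (x : V) xi) * f x).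
Proof. by rewrite /fours /chars /expect; apply: eq_Rintegral => x _; rewrite mul1r. Qed.

Let measurable_vdot2 : measurable_fun setT
  (fun q : bvec R d * bvec R d => vdot (q.1 : V) q.2).
Proof.
rewrite /vdot; apply: measurable_sum => i.
by apply: measurable_funM; [exact: (measurableT_comp (measurable_coord i) measurable_fst)
  |exact: (measurableT_comp (measurable_coord i) measurable_snd)].
Qed.

Section Multiplication.
Variables f a : V -> R.
Hypotheses (fi : mu.-integrable setT (EFin \o (f : bvec R d -> R)))
  (ai : mu.-integrable setT (EFin \o (a : bvec R d -> R))).

Let icos : (mu \x mu)%E.-integrable setT
  (EFin \o (fun q : bvec R d * bvec R d => cos (vdot (q.1 : V) q.2) * (f q.1 * a q.2))).
Proof.
apply: (integrable_mulr_bounded (M := 1) _ _ (integrable_prodM fi ai)).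
  apply: (measurableT_comp (f := @cos R)) => //.
  by apply: continuous_measurable_fun => x; exact: continuous_cos.
by move=> q; exact: cos_norm_le1.
Qed.

Let isin : (mu \x mu)%E.-integrable setT
  (EFin \o (fun q : bvec R d * bvec R d => sin (vdot (q.1 : V) q.2) * (f q.1 * a q.2))).
Proof.
apply: (integrable_mulr_bounded (M := 1) _ _ (integrable_prodM fi ai)).
  apply: (measurableT_comp (f := @sin R)) => //.
  by apply: continuous_measurable_fun => x; exact: continuous_sin.
by move=> q; exact: sin_norm_le1.
Qed.

Let fourc_in x : f x * fourc a x = \int[mu]_y (cos (vdot (x : V) y) * (f x * a y)).
Proof.
rewrite fourcE -RintegralZl//; last exact: integrable_cosM.
by apply: eq_Rintegral => y _; rewrite (vdotC x) mulrCA.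
Qed.

Let fours_in x : f x * fours a x = \int[mu]_y (sin (vdot (x : V) y) * (f x * a y)).
Proof.
rewrite foursE -RintegralZl//; last exact: integrable_sinM.
by apply: eq_Rintegral => y _; rewrite (vdotC x) mulrCA.
Qed.

Lemma integrable_mul_fourc : mu.-integrable setT (EFin \o (fun x : bvec R d => f x * fourc a x)).
Proof.
have := integrable_Rint_section2 icos; apply: eq_integrable => // x _ /=.
by rewrite fourc_in.
Qed.

Lemma integrable_mul_fours : mu.-integrable setT (EFin \o (fun x : bvec R d => f x * fours a x)).
Proof.
have := integrable_Rint_section2 isin; apply: eq_integrable => // x _ /=.
by rewrite fours_in.
Qed.

(** The multiplication formula for the Fourier transform, here for cosines: Fubini with a kernel
    symmetric in x and y. *)
Lemma mul_fourc_swap : \int[mu]_x (f x * fourc a x) = \int[mu]_x (a x * fourc f x).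
Proof.
under eq_Rintegral do rewrite fourc_in.
rewrite (Rintegral_fubini_swap (f := fun x y : bvec R d => cos (vdot (x : V) y) * (f x * a y)) icos).
apply: eq_Rintegral => y _; rewrite fourcE -RintegralZl//; last exact: integrable_cosM.
by apply: eq_Rintegral => x _; ring.
Qed.

Lemma mul_fours_swap : \int[mu]_x (f x * fours a x) = \int[mu]_x (a x * fours f x).
Proof.
under eq_Rintegral do rewrite fours_in.
rewrite (Rintegral_fubini_swap (f := fun x y : bvec R d => sin (vdot (x : V) y) * (f x * a y)) isin).
apply: eq_Rintegral => y _; rewrite foursE -RintegralZl//; last exact: integrable_sinM.
by apply: eq_Rintegral => x _; ring.
Qed.

End Multiplication.

Section Smoothing.
Variables (g : V -> R) (h : R).
Hypotheses (gi : mu.-integrable setT (EFin \o (g : bvec R d -> R))) (h0 : 0 < h).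
Let k (xi : V) : R := lap (h *: xi).

Lemma integrable_laph : mu.-integrable setT (EFin \o (k : bvec R d -> R)).
Proof.
have mf : measurable_fun setT (k : bvec R d -> R).
  have := measurableT_comp (@measurable_lap R d) (@measurable_affine R d h 0).
  by apply: eq_measurable_fun => x _ /=; rewrite addr0.
apply: ge0_integrable => //; first by move=> x; exact: lap_ge0.
have mE : measurable_fun setT (EFin \o (@lap R d : bvec R d -> R)).
  by apply/measurable_EFinP; exact: measurable_lap.
have := ge0_integral_affine 0 h0 mE _; rewrite integral_lap => E.
under eq_integral do rewrite /k -[h *: _]addr0.
by rewrite E ?ltry// => x; rewrite lee_fin lap_ge0.
Qed.

(** Convolution with the Cauchy product kernel at scale h. The transform of this kernel is
    integrable and explicit, so Fourier inversion of the smoothed function reduces to Fubini. *)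
Definition smoothing (x : V) : R :=
  \int[mu]_y (g y * (h^-1 ^+ d * cau (h^-1 *: (x - (y : V))))).

(** The kernel is itself a cosine integral of [lap]; cos(x - y) expands and the multiplication
    formula moves the transform onto g. *)
Lemma smoothingE (x : V) : smoothing x =
  fourc (fun xi => k xi * fourc g xi) x + fours (fun xi => k xi * fours g xi) x.
Proof.
have ki := integrable_laph.
have kci := integrable_cosM x ki; have ksi := integrable_sinM x ki.
have E (y : V) : h^-1 ^+ d * cau (h^-1 *: (x - y)) =
    fourc (fun xi : V => cos (vdot xi x) * k xi) y + fours (fun xi : V => sin (vdot xi x) * k xi) y.
  rewrite -(lap_transform_scaled _ h0) fourcE foursE -RintegralD//; last 2 first.
  - exact: integrable_cosM.
  - exact: integrable_sinM.
  apply: eq_Rintegral => xi _; rewrite vdotC vdotDl -scaleN1r vdotZl mulN1r -!(vdotC (xi : V)) cosB /k.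
  by ring.
rewrite /smoothing; under eq_Rintegral do rewrite E mulrDr.
rewrite RintegralD//; last 2 first.
- exact: integrable_mul_fourc.
- exact: integrable_mul_fours.
rewrite mul_fourc_swap// mul_fours_swap// fourcE foursE.
by congr (_ + _); apply: eq_Rintegral => xi _; rewrite mulrA.
Qed.

Lemma integrable_smoothing_mul (f : V -> R) : mu.-integrable setT (EFin \o (f : bvec R d -> R)) ->
  mu.-integrable setT (EFin \o (fun x : bvec R d => f x * smoothing x)).
Proof.
move=> fi; have ki := integrable_laph.
have := integrableD measurableT
  (integrable_mul_fourc fi (integrable_mul_fourc ki gi))
  (integrable_mul_fours fi (integrable_mul_fours ki gi)).
by apply: eq_integrable => // x _ /=; rewrite smoothingE mulrDr EFinD.
Qed.

Lemma integrable_lap_four2 (f : V -> R) : mu.-integrable setT (EFin \o (f : bvec R d -> R)) ->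
  mu.-integrable setT (EFin \o (fun xi : bvec R d =>
    k xi * (fourc f xi * fourc g xi + fours f xi * fours g xi))).
Proof.
move=> fi; have ki := integrable_laph.
have := integrableD measurableT
  (integrable_mul_fourc (integrable_mul_fourc ki gi) fi)
  (integrable_mul_fours (integrable_mul_fours ki gi) fi).
by apply: eq_integrable => // x _ /=; rewrite -EFinD; congr EFin; ring.
Qed.

(** Plancherel with the damping factor [lap (h xi)], valid for integrable f and g without any square
    integrability. *)
Lemma smoothing_pairing (f : V -> R) : mu.-integrable setT (EFin \o (f : bvec R d -> R)) ->
  \int[mu]_x (f x * smoothing x) =
  \int[mu]_xi (k xi * (fourc f xi * fourc g xi + fours f xi * fours g xi)).
Proof.
move=> fi; have ki := integrable_laph.
under eq_Rintegral do rewrite smoothingE mulrDr.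
have ca := integrable_mul_fourc ki gi; have sa := integrable_mul_fours ki gi.
rewrite RintegralD//; last 2 first.
- exact: integrable_mul_fourc.
- exact: integrable_mul_fours.
rewrite mul_fourc_swap// mul_fours_swap// -RintegralD//; last 2 first.
- exact: integrable_mul_fourc.
- exact: integrable_mul_fours.
by apply: eq_Rintegral => xi _; ring.
Qed.

End Smoothing.
End Pairing.

(** * The duality estimate *)

Section CauchyMass.
Variables (R : realType) (d : nat).
Local Notation V := 'rV[R]_d.
Local Notation mu := (bmu R d).

(** Coordinatewise, 2 / (1 + u^2) <= 4 / (1 + |u|)^2, a weight already integrated. *)
Lemma integral_cau_lty : (\int[mu]_z (cau (z : V))%:E < +oo)%E.
Proof.
pose w (i : 'I_d) (u : R) : R := 4 * (1 + `|u|) `^ (- 1 - 1).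
have mw1 : measurable_fun [set: R] (fun u : R => (1 + `|u|) `^ (- 1 - 1)).
  apply: (measurableT_comp (measurable_powR _)); apply: measurable_funD; first exact: measurable_cst.
  exact: normr_measurable.
have mw i : measurable_fun [set: R] (w i) by apply: measurable_funM => //; exact: measurable_cst.
have w0 i u : 0 <= w i u by rewrite mulr_ge0 ?powR_ge0.
apply: (@le_lt_trans _ _ (\int[mu]_z (\prod_i w i ((z : V) 0 i))%:E)%E).
  apply: ge0_le_integral => //.
  - by move=> z _; rewrite lee_fin cau_ge0.
  - by apply/measurable_EFinP; exact: measurable_cau.
  - by apply/measurable_EFinP; exact: measurable_prod_coord.
  move=> z _; rewrite lee_fin; apply: ler_prod => i _; rewrite cau1_ge0/= /w.
  set u := (z : V) 0 i; have u1 : 0 < 1 + `|u| by rewrite ltr_pwDl.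
  have -> : (1 + `|u|) `^ (- 1 - 1) = ((1 + `|u|) ^+ 2)^-1.
    by rewrite -opprD powRN -powR_mulrn ?(ltW u1).
  have u2 : 0 < 1 + u ^+ 2 by rewrite ltr_pwDl// sqr_ge0.
  rewrite ler_pdivlMr ?exprn_gt0// mulrAC ler_pdivrMr// -[u ^+ 2]real_normK ?num_real//.
  have := sqr_ge0 (1 - `|u|); move: `|u| => v; rewrite sqrrB sqrrD expr1n mul1r => h.
  by move: h; rewrite -mulr_natl; move: (v ^+ 2) => q h; lra.
rewrite (ge0_integral_prod_coord mw w0).
have -> : (\prod_(i < d) \int[@lebesgue_measure R]_x (w i x)%:E = \prod_(i < d) (4 * 2)%:E)%E.
  apply: eq_bigr => i _; rewrite /w; under eq_integral do rewrite EFinM.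
  rewrite (ge0_integralZl (@lebesgue_measure R) measurableT ((measurable_EFinP _ _).2 mw1)).
  - by rewrite integral_1abs_powR// divr1 -EFinM.
  - by move=> u _; rewrite lee_fin powR_ge0.
  - by rewrite lee_fin.
by rewrite prodEFin ltry.
Qed.

Lemma integrable_cau : mu.-integrable setT (EFin \o @cau R d).
Proof.
by apply: ge0_integrable; [exact: measurable_cau|exact: cau_ge0|exact: integral_cau_lty].
Qed.

(** Its value is (2 pi)^d, the constant of Fourier inversion; finiteness and positivity suffice
    below. *)
Definition cau_mass : R := \int[mu]_z cau (z : V).

Lemma cau_mass_gt0 : 0 < cau_mass.
Proof.
rewrite -lte_fin /cau_mass Rintegral_EFin; last exact: integrable_cau.
apply: (@lt_le_trans _ _ (\int[mu]_z (boxw 1 (z : V))%:E)%E).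
  by rewrite integral_boxw// lte_fin exprn_gt0.
apply: ge0_le_integral => //.
- by move=> z _; rewrite lee_fin boxw_ge0.
- by apply/measurable_EFinP; exact: measurable_boxw.
- by apply/measurable_EFinP; exact: measurable_cau.
move=> z _; rewrite lee_fin; apply: ler_prod => i _; rewrite ler0n/=.
set u := (z : V) 0 i; have u2 : 0 < 1 + u ^+ 2 by rewrite ltr_pwDl// sqr_ge0.
case: (leP `|u| 1) => h; last exact: cau1_ge0.
rewrite ler_pdivlMr// mul1r (_ : 2 = 1 + 1)// lerD2l -real_normK ?num_real//.
by rewrite expr_le1.
Qed.

Section Average.
Variables (g : V -> R).
Hypotheses (gi : mu.-integrable setT (EFin \o (g : bvec R d -> R)))
  (g01 : forall x, 0 <= g x <= 1).

Let mg : measurable_fun setT (g : bvec R d -> R).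
Proof. by apply/measurable_EFinP; exact: measurable_int gi. Qed.

Let g1 x : `|g x| <= 1. Proof. by have /andP[h0 h1] := g01 x; rewrite ger0_norm. Qed.

Let integrable_shift_cau (h : R) (x : V) :
  mu.-integrable setT (EFin \o (fun z : bvec R d => g (h *: (z : V) + x) * cau (z : V))).
Proof.
apply: (integrable_mulr_bounded (M := 1) _ _ integrable_cau) => //.
exact: (measurableT_comp mg (measurable_affine _ _)).
Qed.

Lemma smoothing_average (h : R) (x : V) : 0 < h ->
  smoothing g h x = \int[mu]_z (g (h *: (z : V) + x) * cau (z : V)).
Proof.
move=> h0; pose F (y : bvec R d) : R := h^-1 ^+ d * cau (h^-1 *: (x - (y : V))) * g y.
have hd0 : 0 <= h^-1 ^+ d by rewrite exprn_ge0// invr_ge0 ltW.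
have iF : mu.-integrable setT (EFin \o F).
  apply: (integrable_mulr_bounded (M := h^-1 ^+ d * 2 ^+ d) _ _ gi).
    apply: measurable_funM; first exact: measurable_cst.
    have := measurableT_comp (@measurable_cau R d) (@measurable_affine R d (- h^-1) (h^-1 *: x)).
    apply: eq_measurable_fun => y _ /=; congr cau.
    by rewrite scaleNr scalerBr addrC.
  by move=> y; rewrite ger0_norm ?mulr_ge0 ?cau_ge0// ler_wpM2l// cau_le.
transitivity (\int[mu]_y F y).
  by apply: eq_Rintegral => y _; rewrite /F mulrC.
have hne : h^-1 ^+ d != 0 by rewrite expf_neq0// invr_neq0// gt_eqF.
apply: (mulfI hne); rewrite -(Rintegral_affine x h0 iF) -RintegralZl//.
apply: eq_Rintegral => z _; rewrite /F.
have -> : h^-1 *: (x - (h *: (z : V) + x)) = - (z : V).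
  by rewrite opprD addrCA subrr addr0 -scalerN scalerA mulVf ?gt_eqF// scale1r.
rewrite (_ : cau (- (z : V)) = cau (z : V)); last first.
  by rewrite /cau; apply: eq_bigr => i _; rewrite mxE sqrrN.
by ring.
Qed.

Lemma smoothing_ge0 (h : R) (x : V) : 0 < h -> 0 <= smoothing g h x.
Proof.
move=> h0; apply: Rintegral_ge0 => y _; have /andP[y0 _] := g01 y.
by rewrite !mulr_ge0 ?cau_ge0// exprn_ge0// invr_ge0 ltW.
Qed.

Lemma smoothing_le (h : R) (x : V) : 0 < h -> smoothing g h x <= cau_mass.
Proof.
move=> h0; rewrite smoothing_average//; apply: le_Rintegral => //; first exact: integrable_cau.
by move=> z _; rewrite ler_piMl ?cau_ge0//; have /andP[] := g01 (h *: (z : V) + x).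
Qed.

Lemma smoothing_cvg (x : V) :
  (forall z, g (n.+1%:R^-1 *: z + x) @[n --> \oo] --> g x) ->
  smoothing g n.+1%:R^-1 x @[n --> \oo] --> g x * cau_mass.
Proof.
move=> gc; rewrite /cau_mass -RintegralZl//; last exact: integrable_cau.
have h0 n : 0 < n.+1%:R^-1 :> R by rewrite invr_gt0.
under eq_fun do rewrite smoothing_average//.
apply: (@Rintegral_dominated_cvg _ _ _ mu setT
  (fun n (z : bvec R d) => g (n.+1%:R^-1 *: (z : V) + x) * cau (z : V))
  (fun z : bvec R d => g x * cau (z : V)) (@cau R d)) => //.
- move=> n; apply: measurable_funM; last exact: measurable_cau.
  exact: (measurableT_comp mg (measurable_affine _ _)).
- by apply: measurable_funM; [exact: measurable_cst|exact: measurable_cau].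
- exact: integrable_cau.
- by move=> n z _; rewrite normrM (ger0_norm (cau_ge0 _)) ler_piMl ?cau_ge0.
- by move=> z _; apply: cvgM; [exact: gc|exact: cvg_cst].
Qed.

Section Duality.
Variables (f w : V -> R) (tau : R).
Hypotheses (fi : mu.-integrable setT (EFin \o (f : bvec R d -> R)))
  (wi : mu.-integrable setT (EFin \o (w : bvec R d -> R))) (tau0 : 0 < tau)
  (fw : forall xi, fourc f xi ^+ 2 + fours f xi ^+ 2 <= w xi).

(** A weighted arithmetic-geometric inequality takes the place of Cauchy-Schwarz. Its second half is
    the smoothed pairing of g with itself, which returns to physical space and is at most [cau_mass]
    times the integral of g, since 0 <= g <= 1. *)
Lemma smoothing_dual (h : R) : 0 < h ->
  \int[mu]_x (f x * smoothing g h x) <=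
  tau / 2 * (\int[mu]_xi w xi) + cau_mass / (2 * tau) * \int[mu]_x g x.
Proof.
move=> h0; have t2 : 0 < (2 * tau)^-1 by rewrite invr_gt0 mulr_gt0.
have iwt := integrableZl measurableT (tau / 2) wi.
have igg := integrable_lap_four2 gi h0 gi.
have iggt := integrableZl measurableT (2 * tau)^-1 igg.
rewrite (smoothing_pairing gi h0 fi).
apply: (@le_trans _ _ (tau / 2 * (\int[mu]_xi w xi) + (2 * tau)^-1 *
  \int[mu]_x (g x * smoothing g h x))).
  rewrite (smoothing_pairing gi h0 gi) -RintegralZl// -RintegralZl// -RintegralD//.
  apply: le_Rintegral => //.
  - exact: integrable_lap_four2.
  - by have := integrableD measurableT iwt iggt; apply: eq_integrable.
  move=> xi _; have := fw xi; have := lap_ge0 (h *: (xi : V)); have := lap_le1 (h *: (xi : V)).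
  move: (lap _) (fourc f _) (fours f _) (fourc g _) (fours g _) (w _) => k a b c e W k1 k0 abW.
  have amgm (u v : R) : u * v <= tau / 2 * u ^+ 2 + (2 * tau)^-1 * v ^+ 2.
    have q := sqr_ge0 (tau * u - v).
    rewrite -subr_ge0 (_ : tau / 2 * u ^+ 2 + (2 * tau)^-1 * v ^+ 2 - u * v =
      (2 * tau)^-1 * (tau * u - v) ^+ 2); last by field; rewrite gt_eqF.
    by rewrite mulr_ge0// ltW.
  apply: (@le_trans _ _ (k * (tau / 2 * (a ^+ 2 + b ^+ 2) + (2 * tau)^-1 * (c * c + e * e)))).
    apply: ler_wpM2l => //; have := lerD (amgm a c) (amgm b e).
    by move=> H; apply: le_trans H _; rewrite le_eqVlt; apply/orP; left; apply/eqP; ring.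
  rewrite mulrDr lerD//; last by rewrite mulrCA.
  apply: (@le_trans _ _ (tau / 2 * (a ^+ 2 + b ^+ 2))).
    by rewrite ler_piMl// mulr_ge0 ?divr_ge0 ?(ltW tau0)// addr_ge0 ?sqr_ge0.
  by rewrite ler_wpM2l// divr_ge0// ltW.
rewrite lerD2l mulrAC mulrC ler_wpM2r ?(ltW t2)// -RintegralZl//.
apply: le_Rintegral => //.
- exact: integrable_smoothing_mul.
- exact: (integrableZl measurableT cau_mass gi).
by move=> x _; rewrite mulrC; have /andP[x0 _] := g01 x; rewrite ler_wpM2r// smoothing_le.
Qed.

(** The limit h = 1 / (n + 1) -> 0 of [smoothing_dual], whose right side does not depend on h. *)
Lemma ray_continuous_dual :
  (forall x z, g (n.+1%:R^-1 *: z + x) @[n --> \oo] --> g x) ->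
  cau_mass * \int[mu]_x (f x * g x) <=
  tau / 2 * (\int[mu]_xi w xi) + cau_mass / (2 * tau) * \int[mu]_x g x.
Proof.
move=> gc; have mf : measurable_fun setT (f : bvec R d -> R).
  by apply/measurable_EFinP; exact: measurable_int fi.
have ifg : mu.-integrable setT (EFin \o (fun x : bvec R d => f x * g x)).
  have := integrable_mulr_bounded mg g1 fi; apply: eq_integrable => // x _ /=.
  by rewrite mulrC.
have H : \int[mu]_x (f x * smoothing g n.+1%:R^-1 x) @[n --> \oo] -->
    \int[mu]_x (f x * (g x * cau_mass)).
  apply: (@Rintegral_dominated_cvg _ _ _ mu setT
    (fun n (x : bvec R d) => f x * smoothing g n.+1%:R^-1 x)
    (fun x : bvec R d => f x * (g x * cau_mass)) (fun x : bvec R d => `|f x| * cau_mass)) => //.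
  - move=> n; apply/measurable_EFinP; apply: measurable_int.
    by apply: integrable_smoothing_mul => //; rewrite invr_gt0.
  - apply: measurable_funM => //; apply: measurable_funM => //; exact: measurable_cst.
  - have := integrableZl measurableT cau_mass (integrable_norm fi); apply: eq_integrable => // x _ /=.
    by rewrite mulrC EFinM.
  - move=> n x _; rewrite normrM ler_wpM2l// ger0_norm; first by rewrite smoothing_le// invr_gt0.
    by rewrite smoothing_ge0// invr_gt0.
  - by move=> x _; apply: cvgM; [exact: cvg_cst|apply: smoothing_cvg => z; exact: gc].
have -> : cau_mass * \int[mu]_x (f x * g x) = \int[mu]_x (f x * (g x * cau_mass)).
  by rewrite -RintegralZl//; apply: eq_Rintegral => x _; ring.
rewrite -(cvg_lim (@Rhausdorff R) H); apply: limr_le; first by apply/cvg_ex; eexists; exact: H.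
by apply: nearW => n; apply: smoothing_dual; rewrite invr_gt0.
Qed.

End Duality.

End Average.
End CauchyMass.

(** * Approximation of Borel indicators in the weight |f| *)

Section Approximation.
Variables (R : realType) (d : nat).
Local Notation V := 'rV[R]_d.
Local Notation mu := (bmu R d).
Variable f : V -> R.
Hypothesis fi : mu.-integrable setT (EFin \o (f : bvec R d -> R)).

(* Continuity along the dilations [h z + x], [h = 1 / (n + 1)], is all that
   [ray_continuous_dual] requires, and it avoids the topology of ['rV[R]_d]. *)
Definition ray_continuous (g : V -> R) :=
  [/\ measurable_fun setT (g : bvec R d -> R), forall x, 0 <= g x <= 1 &
    forall x z, g (n.+1%:R^-1 *: z + x) @[n --> \oo] --> g x].

(** The L1 distance for the finite measure with density |f|, exactly the error made when an
    indicator paired with f is replaced by g. *)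
Let err (g i : V -> R) : R := \int[mu]_x (`|g x - i x| * `|f x|).

Definition approximable (i : V -> R) :=
  [/\ measurable_fun setT (i : bvec R d -> R), forall x, 0 <= i x <= 1 &
    forall e, 0 < e -> exists2 g, ray_continuous g & err g i <= e].

Let dist1 (a b : R) : 0 <= a <= 1 -> 0 <= b <= 1 -> `|a - b| <= 1.
Proof. by move=> /andP[a0 a1] /andP[b0 b1]; rewrite ler_norml; apply/andP; split; lra. Qed.

Let ierr (g i : V -> R) : measurable_fun setT (g : bvec R d -> R) ->
  measurable_fun setT (i : bvec R d -> R) -> (forall x, 0 <= g x <= 1) ->
  (forall x, 0 <= i x <= 1) ->
  mu.-integrable setT (EFin \o (fun x : bvec R d => `|g x - i x| * `|f x|)).
Proof.
move=> mg mi g1 i1; apply: (integrable_mulr_bounded (M := 1) _ _ (integrable_norm fi)).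
  by apply: (measurableT_comp (@normr_measurable R setT)); exact: measurable_funB.
by move=> x; rewrite normr_id; exact: dist1.
Qed.

Lemma approximable_ray_continuous g : ray_continuous g -> approximable g.
Proof.
move=> [mg g1 gc]; split=> // e e0; exists g => //.
rewrite /err (_ : (fun x => _) = fun=> 0); last by apply/funext => x; rewrite subrr normr0 mul0r.
by rewrite Rintegral_cst// mul0r ltW.
Qed.

Lemma approximable_onem i : approximable i -> approximable (fun x => 1 - i x).
Proof.
move=> [mi i1 H]; have o1 (a : R) : 0 <= a <= 1 -> 0 <= 1 - a <= 1.
  by move=> /andP[a0 a1]; apply/andP; split; lra.
split=> [|x|e e0]; [by apply: measurable_funB => //; exact: measurable_cst|exact: o1|].
have [g [mg g1 gc] ge] := H e e0; exists (fun x => 1 - g x).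
  split=> [|x|x z]; [by apply: measurable_funB => //; exact: measurable_cst|exact: o1|].
  by apply: cvgB; [exact: cvg_cst|exact: gc].
apply: le_trans ge; rewrite le_eqVlt; apply/orP; left; apply/eqP.
apply: eq_Rintegral => x _; congr (_ * _).
by rewrite [LHS]distrC; congr (`|_|); ring.
Qed.

Lemma approximable_mul i j : approximable i -> approximable j ->
  approximable (fun x => i x * j x).
Proof.
move=> [mi i1 Hi] [mj j1 Hj]; have m1 (a b : R) : 0 <= a <= 1 -> 0 <= b <= 1 -> 0 <= a * b <= 1.
  by move=> /andP[a0 a1] /andP[b0 b1]; rewrite mulr_ge0//= mulr_ile1.
split=> [|x|e e0]; [exact: measurable_funM|exact: m1|].
have e2 : 0 < e / 2 by rewrite divr_gt0.
have [g [mg g1 gc] ge] := Hi _ e2; have [k [mk k1 kc] ke] := Hj _ e2.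
exists (fun x => g x * k x).
  split=> [|x|x z]; [exact: measurable_funM|exact: m1|].
  by apply: cvgM; [exact: gc|exact: kc].
rewrite (_ : e = e / 2 + e / 2); last by field.
apply: le_trans (lerD ge ke); rewrite -RintegralD//; [|exact: ierr|exact: ierr].
have [mgk mij] : measurable_fun setT (fun x : bvec R d => g x * k x) /\
    measurable_fun setT (fun x : bvec R d => i x * j x).
  by split; exact: measurable_funM.
apply: le_Rintegral => //.
- by apply: ierr => // x; exact: m1.
- by have := integrableD measurableT (ierr mg mi g1 i1) (ierr mk mj k1 j1); apply: eq_integrable.
move=> x _; rewrite -mulrDl ler_wpM2r//.
have -> : g x * k x - i x * j x = (g x - i x) * k x + i x * (k x - j x) by ring.
apply: le_trans (ler_normD _ _) _; rewrite !normrM.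
have /andP[a0 a1] := k1 x; have /andP[b0 b1] := i1 x.
by rewrite (ger0_norm a0) (ger0_norm b0) lerD// ?ler_piMr ?ler_piMl.
Qed.

(** The functions lie in [0, 1] and |f| is integrable, so pointwise convergence implies convergence
    of [err]. *)
Lemma approximable_lim (i_ : nat -> V -> R) i : (forall n, approximable (i_ n)) ->
  measurable_fun setT (i : bvec R d -> R) -> (forall x, 0 <= i x <= 1) ->
  (forall x, i_ n x @[n --> \oo] --> i x) -> approximable i.
Proof.
move=> Hi mi i1 ci; split=> // e e0; have e2 : 0 < e / 2 by rewrite divr_gt0.
have mi_ n : measurable_fun setT (i_ n : bvec R d -> R) by have [] := Hi n.
have i1_ n x : 0 <= i_ n x <= 1 by have [_ + _] := Hi n; apply.
have c0 : err (i_ n) i @[n --> \oo] --> (0 : R).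
  have -> : (0 : R) = \int[mu]_x (0 * `|f x|).
    rewrite (_ : (fun x => _) = fun=> 0); last by apply/funext => x; rewrite mul0r.
    by rewrite Rintegral_cst// mul0r.
  apply: (@Rintegral_dominated_cvg _ _ _ mu setT (fun n (x : bvec R d) => `|i_ n x - i x| * `|f x|)
    (fun x : bvec R d => 0 * `|f x|) (fun x : bvec R d => `|f x|)) => //.
  - by move=> n; apply/measurable_EFinP; apply: measurable_int; exact: ierr.
  - by under eq_fun do rewrite mul0r; exact: measurable_cst.
  - exact: integrable_norm.
  - by move=> n x _; rewrite normrM !normr_id ler_piMl//; exact: dist1.
  move=> x _; apply: cvgM; last exact: cvg_cst.
  rewrite -(normr0 R) -(subrr (i x)); apply: cvg_norm; apply: cvgB; [exact: ci|exact: cvg_cst].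
have /cvgrPdist_le/(_ _ e2)[N _ /(_ N (leqnn N)) hN] := c0.
have {}hN : err (i_ N) i <= e / 2 by apply: le_trans hN; rewrite sub0r normrN; exact: ler_norm.
have [_ _ /(_ _ e2)[g [mg g1 gc] ge]] := Hi N.
exists g => //; rewrite (_ : e = e / 2 + e / 2); last by field.
apply: le_trans (lerD ge hN); rewrite -RintegralD//; [|exact: ierr|exact: ierr].
apply: le_Rintegral => //; first exact: ierr.
  by have := integrableD measurableT (ierr mg (mi_ N) g1 (i1_ N)) (ierr (mi_ N) mi (i1_ N) i1); apply: eq_integrable.
move=> x _; rewrite -mulrDl ler_wpM2r//.
by apply: le_trans (ler_normD _ _); rewrite addrA subrK.
Qed.

Definition approximable_set (A : set (bvec R d)) := measurable A /\ approximable (\1_A : V -> R).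

Let ind1 (A : set (bvec R d)) (x : V) : 0 <= (\1_A x : R) <= 1.
Proof. by rewrite indicE ler0n lern1 leq_b1. Qed.

Lemma approximable_set_lim (i_ : nat -> V -> R) (A : set (bvec R d)) : measurable A ->
  (forall n, approximable (i_ n)) -> (forall x, i_ n x @[n --> \oo] --> (\1_A x : R)) ->
  approximable_set A.
Proof.
move=> mA Hi ci; split=> //; apply: approximable_lim Hi _ _ ci; last exact: ind1.
exact: measurable_indic.
Qed.

(** A countable union is the pointwise limit of 1 - prod (1 - 1_(A k)), built from complements and
    products only, so no monotone class argument is needed. *)
Lemma sigma_algebra_approximable : sigma_algebra setT approximable_set.
Proof.
split.
- split=> //; apply: approximable_ray_continuous; rewrite indic0; split.
  + exact: measurable_cst.
  + by move=> x; rewrite lexx ler01.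
  + by move=> x z; exact: cvg_cst.
- move=> A [mA aA]; split; first exact: measurableD.
  have -> : \1_(setT `\` A) = (fun x => 1 - \1_A x) :> (V -> R).
    by apply/funext => x; rewrite setTD !indicE in_setC; case: (_ \in _); rewrite ?subrr ?subr0.
  exact: approximable_onem.
move=> A HA; have mA n : measurable (A n) by have [] := HA n.
have HP n : approximable (fun x => \prod_(k < n) (1 - \1_(A k) x)).
  elim: n => [|n IH].
    rewrite (_ : (fun x => _) = fun=> 1); last by apply/funext => x; rewrite big_ord0.
    apply: approximable_ray_continuous; split; first exact: measurable_cst.
      by move=> x; rewrite lexx ler01.
    by move=> x z; exact: cvg_cst.
  rewrite (_ : (fun x => _) = fun x => \prod_(k < n) (1 - \1_(A k) x) * (1 - \1_(A n) x)).
    by apply: approximable_mul => //; apply: approximable_onem; have [] := HA n.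
  by apply/funext => x; rewrite big_ord_recr.
apply: (approximable_set_lim (i_ := fun n x => 1 - \prod_(k < n) (1 - \1_(A k) x))).
- exact: bigcupT_measurable.
- by move=> n; exact: approximable_onem.
move=> x; apply: cvg_near_cst.
have [[k _ Ak]|nA] := pselect ((\bigcup_n A n) x).
  near=> n.
  have kn : (k < n)%N by near: n; exact: nbhs_infty_gt.
  rewrite indicE mem_set; last by exists k.
  rewrite (bigD1 (Ordinal kn))//= indicE mem_set//= subrr mul0r subr0.
  by [].
near=> n; rewrite indicE memNset// big1 ?subrr// => k _.
by rewrite indicE memNset ?subr0// => Ak; apply: nA; exists k.
Unshelve. all: by end_near. Qed.

Let approximable_setC (A : set (bvec R d)) : approximable_set A -> approximable_set (~` A).
Proof. by have [_ + _] := sigma_algebra_approximable; move=> /(_ A); rewrite setTD. Qed.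

Let approximable_setI (A B : set (bvec R d)) :
  approximable_set A -> approximable_set B -> approximable_set (A `&` B).
Proof.
move=> [mA aA] [mB aB]; split; first exact: measurableI.
have -> : \1_(A `&` B) = (fun x => \1_A x * \1_B x) :> (V -> R) by rewrite indicI.
exact: approximable_mul.
Qed.

(** r is continuous, equal to 1 for t <= c and below 1 for t > c, so 1 - r^n tends to the indicator
    of the half-space. *)
Lemma approximable_halfspace (i : 'I_d) (c : R) :
  approximable_set [set x : bvec R d | c < (x : V) 0 i].
Proof.
pose r (t : R) : R := (1 + ((t - c) + `|t - c|))^-1.
have den (t : R) : 1 <= 1 + ((t - c) + `|t - c|).
  by rewrite lerDl -lerBlDl sub0r -normrN ler_norm.
have r01 t : 0 <= r t <= 1.
  by rewrite invr_ge0 (le_trans ler01 (den t))/= invf_le1 ?(lt_le_trans ltr01 (den t)).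
have cr : continuous r.
  move=> t; apply: cvgV; first by rewrite gt_eqF// (lt_le_trans ltr01).
  apply: cvgD; first exact: cvg_cst.
  have cb : {for t, continuous (fun t : R => t - c)} by apply: cvgB; [exact: cvg_id|exact: cvg_cst].
  by apply: cvgD => //; apply: cvg_norm.
have ar : ray_continuous (fun x : V => r (x 0 i)).
  split=> // [|x z].
    apply: (measurableT_comp (f := r)); last exact: measurable_coord.
    exact: continuous_measurable_fun.
  have h : (n.+1%:R^-1 *: z + x) 0 i @[n --> \oo] --> x 0 i.
    have h' : n.+1%:R^-1 * z 0 i + x 0 i @[n --> \oo] --> 0 * z 0 i + x 0 i.
      apply: cvgD; last exact: cvg_cst.
      by apply: cvgM; [exact: cvg_harmonic|exact: cvg_cst].
    move: h'; rewrite mul0r add0r; apply: cvg_trans; apply: near_eq_cvg.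
    by apply: nearW => n; rewrite !mxE.
  exact: (cvg_comp _ _ h (cr (x 0 i))).
have arn n : approximable (fun x : V => r (x 0 i) ^+ n).
  elim: n => [|n IH].
    apply: approximable_ray_continuous; split; first exact: measurable_cst.
      by move=> x; rewrite expr0 lexx ler01.
    by move=> x z; exact: cvg_cst.
  under eq_fun do rewrite exprS.
  apply: approximable_mul => //; exact: approximable_ray_continuous.
apply: (approximable_set_lim (i_ := fun n x => 1 - r (x 0 i) ^+ n)).
- have mC : measurable_fun setT (fun x : bvec R d => (x : V) 0 i) := measurable_coord i.
  have := mC measurableT _ (measurable_itv `]c, +oo[); rewrite setTI.
  by congr measurable; apply/seteqP; split=> x; rewrite /= in_itv/= andbT.
- by move=> n; exact: approximable_onem.
move=> x; case: (ltP c (x 0 i)) => h.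
  rewrite indicE mem_set//= -[X in _ --> X]subr0; apply: cvgB; first exact: cvg_cst.
  apply: cvg_expr; have /andP[h0 h1] := r01 (x 0 i).
  rewrite ger0_norm// /r invf_lt1 ?(lt_le_trans ltr01 (den _))//.
  by rewrite ltrDl gtr0_norm ?subr_gt0// addr_gt0// subr_gt0.
rewrite indicE memNset/=; last by rewrite ltNge h.
have -> : r (x 0 i) = 1.
  by rewrite /r ler0_norm ?subr_le0// subrr addr0 invr1.
under eq_fun do rewrite expr1n subrr; exact: cvg_cst.
Qed.

(** Open half-lines generate the Borel sets, and the approximable cylinders form a sigma-algebra. *)
Lemma approximable_coord (i : 'I_d) (B : set R) : measurable B ->
  approximable_set [set x : bvec R d | B ((x : V) 0 i)].
Proof.
move=> mB; have : <<s @RGenOInfty.G R >> B.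
  exact: (eq_ind _ (fun M : set (set R) => M B) mB _ (@RGenOInfty.measurableE R)).
move: B {mB}.
apply: (@smallest_sub _ (sigma_algebra [set: R]) _
  [set B : set R | approximable_set [set x : bvec R d | B ((x : V) 0 i)]]); last first.
  move=> _ [c ->] /=; have := approximable_halfspace i c.
  by congr approximable_set; apply/seteqP; split=> x; rewrite /= in_itv/= andbT.
have [H0 HC HU] := sigma_algebra_approximable.
split=> /=.
- exact: H0.
- by move=> A /HC.
- by move=> A HA; exact: (HU _ HA).
Qed.

Lemma approximable_measurable (A : set (bvec R d)) : measurable A -> approximable_set A.
Proof.
move: A; apply: (@smallest_sub _ (sigma_algebra [set: 'rV[R]_d]) _ approximable_set).
  exact: sigma_algebra_approximable.
move=> _ [B [mB ->]].
have H (s : seq 'I_d) : approximable_set [set x : bvec R d | forall i, i \in s -> B i ((x : V) 0 i)].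
  elim: s => [|i s IH].
    have [H0 _ _] := sigma_algebra_approximable; have := approximable_setC H0.
    by congr approximable_set; apply/seteqP; split=> x //= _ [].
  have := approximable_setI (approximable_coord i (mB i)) IH.
  congr approximable_set; apply/seteqP; split=> x /=.
    by move=> [h1 h2] j; rewrite inE => /predU1P[->|/h2].
  by move=> h; split=> [|j js]; apply: h; rewrite inE ?eqxx// js orbT.
have := H (enum 'I_d); congr approximable_set; apply/seteqP; split=> x /= h.
  by move=> i; apply: h; rewrite mem_enum.
by move=> i _; exact: h.
Qed.

End Approximation.

(** * L1 norm on a box from a bound on the Fourier transform *)

Section LocalL1.
Variables (R : realType) (d : nat).
Local Notation V := 'rV[R]_d.
Local Notation mu := (bmu R d).

Section Cutoff.
Variable r : R.
Hypothesis r0 : 0 < r.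

(** A substitute for the box indicator that is continuous along dilations: it lies in [0, 1], is at
    least 2^(-d) on the box, and has integral of order r^d. *)
Definition chi (x : V) : R := 2^-1 ^+ d * cau (r^-1 *: x).

Let h2 : 0 < 2^-1 ^+ d :> R. Proof. by rewrite exprn_gt0. Qed.

Lemma chi01 x : 0 <= chi x <= 1.
Proof.
rewrite mulr_ge0 ?(ltW h2) ?cau_ge0//=; apply: le_trans (ler_wpM2l (ltW h2) (cau_le _)) _.
by rewrite -exprMn mulVf ?expr1n// pnatr_eq0.
Qed.

Lemma measurable_chi : measurable_fun setT (chi : bvec R d -> R).
Proof.
apply: measurable_funM; first exact: measurable_cst.
have := measurableT_comp (@measurable_cau R d) (@measurable_affine R d r^-1 0).
by apply: eq_measurable_fun => x _ /=; rewrite addr0.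
Qed.

Lemma ray_continuous_chi : ray_continuous chi.
Proof.
split; [exact: measurable_chi|exact: chi01|move=> x z].
apply: cvgM; first exact: cvg_cst.
pose w (u : R) : R := 2 / (1 + u ^+ 2).
have cw : continuous w.
  move=> u; apply: cvgM; first exact: cvg_cst.
  apply: cvgV; first by rewrite gt_eqF// ltr_pwDl// sqr_ge0.
  by apply: cvgD; [exact: cvg_cst|exact: exprn_continuous].
have ci i : w ((r^-1 *: (n.+1%:R^-1 *: z + x)) 0 i) @[n --> \oo] --> w ((r^-1 *: x) 0 i).
  have h : (r^-1 *: (n.+1%:R^-1 *: z + x)) 0 i @[n --> \oo] --> (r^-1 *: x) 0 i.
    have h' : r^-1 * (n.+1%:R^-1 * z 0 i + x 0 i) @[n --> \oo] --> r^-1 * (0 * z 0 i + x 0 i).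
      apply: cvgM; first exact: cvg_cst.
      apply: cvgD; last exact: cvg_cst.
      by apply: cvgM; [exact: cvg_harmonic|exact: cvg_cst].
    move: h'; rewrite mul0r add0r mxE; apply: cvg_trans; apply: near_eq_cvg.
    by apply: nearW => n; rewrite !mxE.
  exact: (cvg_comp _ _ h (cw _)).
rewrite /cau; elim: (index_enum 'I_d) => [|i s IH].
  by under eq_fun do rewrite big_nil; rewrite big_nil; exact: cvg_cst.
under eq_fun do rewrite big_cons; rewrite big_cons.
by apply: cvgM => //; exact: ci.
Qed.

Lemma integrable_chi : mu.-integrable setT (EFin \o (chi : bvec R d -> R)).
Proof.
have mE : measurable_fun setT (EFin \o (@cau R d : bvec R d -> R)).
  by apply/measurable_EFinP; exact: measurable_cau.
apply: ge0_integrable; first exact: measurable_chi.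
  by move=> x; have /andP[] := chi01 x.
under eq_integral do rewrite /chi -[_ *: _]addr0 EFinM.
have mA : measurable_fun setT (fun x : bvec R d => (cau (r^-1 *: (x : V) + 0))%:E).
  exact: (measurableT_comp mE (measurable_affine _ _)).
rewrite (ge0_integralZl mu measurableT mA); last 2 first.
- by move=> x _; rewrite lee_fin cau_ge0.
- by rewrite lee_fin ltW.
have rV0 : 0 < r^-1 by rewrite invr_gt0.
rewrite (ge0_integral_affine 0 rV0 mE); last by move=> x; rewrite lee_fin cau_ge0.
rewrite -Rintegral_EFin; last exact: integrable_cau.
by rewrite -!EFinM ltry.
Qed.

Lemma Rintegral_chi : \int[mu]_x chi (x : V) = (2^-1 * r) ^+ d * cau_mass R d.
Proof.
rewrite /chi RintegralZl//; last first.
  have := integrableZl measurableT (2 ^+ d) integrable_chi; apply: eq_integrable => // x _ /=.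
  by rewrite -EFinM /chi mulrA -exprMn mulfV ?expr1n ?mul1r// pnatr_eq0.
have rV0 : 0 < r^-1 by rewrite invr_gt0.
have := Rintegral_affine 0 rV0 (integrable_cau R d); rewrite invrK => E.
under eq_Rintegral do rewrite -[_ *: _]addr0.
by rewrite E mulrA -exprMn.
Qed.

Lemma boxw_le_chi x : boxw r x <= 2 ^+ d * chi x.
Proof.
rewrite /chi mulrA -exprMn mulfV ?expr1n ?mul1r ?pnatr_eq0//.
apply: ler_prod => i _; rewrite ler0n/= mxE.
set u := r^-1 * x 0 i; have u2 : 0 < 1 + u ^+ 2 by rewrite ltr_pwDl// sqr_ge0.
case: (leP `|x 0 i| r) => h; last exact: cau1_ge0.
have u1 : `|u| <= 1 by rewrite normrM gtr0_norm ?invr_gt0// ler_pdivrMl// mulr1.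
rewrite ler_pdivlMr// mul1r (_ : 2 = 1 + 1)// lerD2l -real_normK ?num_real//.
by rewrite expr_le1.
Qed.

End Cutoff.

Lemma sqfourN (f : V -> R) xi : mu.-integrable setT (EFin \o (f : bvec R d -> R)) ->
  sqfour (fun x => - f x) xi = sqfour f xi.
Proof.
move=> fi; rewrite /sqfour !fourcE !foursE.
have -> : \int[mu]_x (cos (vdot (x : V) xi) * - f x) = - \int[mu]_x (cos (vdot (x : V) xi) * f x).
  rewrite -mulN1r -RintegralZl//; last exact: integrable_cosM.
  by apply: eq_Rintegral => x _; ring.
have -> : \int[mu]_x (sin (vdot (x : V) xi) * - f x) = - \int[mu]_x (sin (vdot (x : V) xi) * f x).
  rewrite -mulN1r -RintegralZl//; last exact: integrable_sinM.
  by apply: eq_Rintegral => x _; ring.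
by rewrite !sqrrN.
Qed.

Section Bound.
Variables (w : V -> R) (tau r : R).
Hypotheses (wi : mu.-integrable setT (EFin \o (w : bvec R d -> R))) (tau0 : 0 < tau) (r0 : 0 < r).
Let c := cau_mass R d.
Let c0 : 0 < c := cau_mass_gt0 R d.
Let bd : R := tau / 2 * (\int[mu]_xi w xi) / c + (2 * tau)^-1 * \int[mu]_x chi r x.

(** Duality with the test function 1_(f > 0) [chi]. The indicator is not ray-continuous, so it is
    first replaced by an approximation g. *)
Let positive_part_le (f : V -> R) : mu.-integrable setT (EFin \o (f : bvec R d -> R)) ->
  (forall xi, sqfour f xi <= w xi) ->
  \int[mu]_x ((0 < f x)%R%:R * chi r x * f x) <= bd.
Proof.
move=> fi fw; have mf : measurable_fun setT (f : bvec R d -> R).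
  by apply/measurable_EFinP; exact: measurable_int fi.
have mpos : measurable_fun setT (fun x : bvec R d => (0 < f x)%R%:R : R).
  by apply: measurable_natb; apply: measurable_fun_ltr => //; exact: measurable_cst.
pose A : set (bvec R d) := [set x | 0 < f x].
have mA : measurable A.
  have := mf measurableT _ (measurable_itv `]0, +oo[); rewrite setTI.
  by congr measurable; apply/seteqP; split=> x; rewrite /= in_itv/= andbT.
have AE (x : V) : \1_A x = (0 < f x)%R%:R :> R.
  by rewrite indicE; congr (_%:R); congr nat_of_bool; apply/idP/idP; rewrite inE.
have mchi := measurable_chi r.
have [_ [mi i01 H]] := approximable_measurable fi mA.
apply/ler_addgt0Pr => e e0; have [g [mg g01 gc] ge] := H e e0.
have [_ _ cc] := ray_continuous_chi r.
pose G x := g x * chi r x.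
have mG : measurable_fun setT (G : bvec R d -> R) by exact: measurable_funM.
have G1 (x : V) : `|g x| <= 1 by have /andP[h0 h1] := g01 x; rewrite ger0_norm.
have chi1 (x : V) : `|chi r x| <= 1 by have /andP[h0 h1] := chi01 r x; rewrite ger0_norm.
have iG : mu.-integrable setT (EFin \o (G : bvec R d -> R)).
  exact: (integrable_mulr_bounded mg G1 (integrable_chi r0)).
have G01 x : 0 <= G x <= 1.
  have /andP[h0 h1] := g01 x; have /andP[k0 k1] := chi01 r x.
  by rewrite mulr_ge0//= mulr_ile1.
have Gc x z : G (n.+1%:R^-1 *: z + x) @[n --> \oo] --> G x by apply: cvgM; [exact: gc|exact: cc].
have D := ray_continuous_dual iG G01 fi wi tau0 fw Gc.
have GN (x : V) : `|G x| <= 1 by have /andP[h0 h1] := G01 x; rewrite ger0_norm.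
have ifG : mu.-integrable setT (EFin \o (fun x : bvec R d => G x * f x)).
  exact: (integrable_mulr_bounded mG GN fi).
have ierr : mu.-integrable setT (EFin \o (fun x : bvec R d => `|g x - \1_A x| * `|f x|)).
  apply: (integrable_mulr_bounded (M := 1) _ _ (integrable_norm fi)).
    by apply: (measurableT_comp (@normr_measurable R setT)); exact: measurable_funB.
  move=> x; rewrite normr_id; have /andP[h0 h1] := g01 x; have /andP[k0 k1] := i01 x.
  by rewrite ler_norml; apply/andP; split; lra.
apply: (@le_trans _ _ (\int[mu]_x (f x * G x) + e)); last first.
  rewrite lerD2r -(ler_pM2l c0); apply: le_trans D _.
  rewrite /bd mulrDr mulrCA divff ?gt_eqF// mulr1 lerD2l [leRHS]mulrA.
  apply: ler_wpM2l; first by rewrite divr_ge0 ?mulr_ge0 ?(ltW tau0) ?(ltW c0).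
  apply: le_Rintegral => //; first exact: integrable_chi.
  move=> x _; rewrite /G; have /andP[h0 h1] := g01 x; have /andP[k0 k1] := chi01 r x.
  by rewrite ler_piMl.
apply: le_trans (lerD (lexx _) ge).
under [X in _ <= X + _]eq_Rintegral do rewrite mulrC.
rewrite -RintegralD//; apply: le_Rintegral => //.
- apply: (integrable_mulr_bounded (M := 1) _ _ fi); first exact: measurable_funM.
  move=> x; rewrite normrM -[leRHS]mulr1; apply: ler_pM => //; exact: natb_norm_le1.
- by have := integrableD measurableT ifG ierr; apply: eq_integrable.
move=> x _; rewrite -AE -lerBlDl.
have -> : \1_A x * chi r x * f x - G x * f x = (\1_A x - g x) * f x * chi r x by rewrite /G; ring.
apply: le_trans (ler_norm _) _; rewrite (normrM _ (chi r x)) (normrM _ (f x)) distrC -[leRHS]mulr1.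
by apply: ler_wpM2l; [exact: mulr_ge0|exact: chi1].
Qed.

(** |f| is the sum of the positive parts of f and - f, whose transforms have the same modulus; the
    factor 2^d comes from replacing the box indicator by [chi]. *)
Lemma local_L1_le (f : V -> R) : mu.-integrable setT (EFin \o (f : bvec R d -> R)) ->
  (forall xi, sqfour f xi <= w xi) ->
  \int[mu]_x (boxw r x * `|f x|) <=
  2 ^+ d * (tau * (\int[mu]_xi w xi) / c + tau^-1 * ((2^-1 * r) ^+ d * c)).
Proof.
move=> fi fw; have mf : measurable_fun setT (f : bvec R d -> R).
  by apply/measurable_EFinP; exact: measurable_int fi.
have fiN : mu.-integrable setT (EFin \o (fun x : bvec R d => - f x)).
  have := integrableN fi; exact: eq_integrable.
have P1 := positive_part_le fi fw.
have P2 : \int[mu]_x ((0 < - f x)%R%:R * chi r x * - f x) <= bd.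
  by apply: positive_part_le fiN _ => xi; rewrite sqfourN.
have pint (g : V -> R) : mu.-integrable setT (EFin \o (g : bvec R d -> R)) ->
    mu.-integrable setT (EFin \o (fun x : bvec R d => (0 < g x)%R%:R * chi r x * g x)).
  move=> gi; apply: (integrable_mulr_bounded (M := 1) _ _ gi).
    apply: measurable_funM; last exact: measurable_chi.
    apply: measurable_natb; apply: measurable_fun_ltr; first exact: measurable_cst.
    by apply/measurable_EFinP; exact: measurable_int gi.
  move=> x; rewrite normrM -[leRHS]mulr1; apply: ler_pM => //; first exact: natb_norm_le1.
  by have /andP[h0 h1] := chi01 r x; rewrite ger0_norm.
apply: (@le_trans _ _ (2 ^+ d * (bd + bd))); last first.
  rewrite /bd Rintegral_chi// -/c le_eqVlt; apply/orP; left; apply/eqP; congr (_ * _).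
  by move: (_ ^+ d * c) => q; field; rewrite !gt_eqF.
apply: le_trans (ler_wpM2l _ (lerD P1 P2)); last by rewrite exprn_ge0.
rewrite -RintegralD//; [|exact: pint|exact: (pint _ fiN)].
rewrite -RintegralZl//; last first.
  by have := integrableD measurableT (pint _ fi) (pint _ fiN); apply: eq_integrable.
apply: le_Rintegral => //.
- apply: (integrable_mulr_bounded (M := 1) _ _ (integrable_norm fi)); first exact: measurable_boxw.
  by move=> x; rewrite ger0_norm ?boxw_ge0 ?boxw_le1.
- have := integrableZl measurableT (2 ^+ d) (integrableD measurableT (pint _ fi) (pint _ fiN)).
  exact: eq_integrable.
move=> x _; have := boxw_le_chi r0 x; have /andP[k0 k1] := chi01 r x.
move: (boxw r x) (chi r x) k0 => b q q0 hb.
have -> : (0 < f x)%R%:R * q * f x + (0 < - f x)%R%:R * q * - f x = q * `|f x|.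
  rewrite oppr_gt0; case: (ltgtP (f x) 0) => h; rewrite ?mul0r ?mul1r ?add0r ?addr0.
  - by rewrite ltr0_norm.
  - by rewrite gtr0_norm.
  - by rewrite h normr0 mulr0.
by rewrite mulrA ler_wpM2r.
Qed.

End Bound.
End LocalL1.

(** * Weighted norm of the difference *)

Section WeightedNorm.
Variables (R : realType) (d : nat).
Local Notation V := 'rV[R]_d.
Local Notation mu := (bmu R d).
Hypothesis d0 : (0 < d)%N.

Definition tail_ind (k r : R) (i : 'I_d) (x : V) : R := (r <= `|x 0 i|)%R%:R * `|x 0 i| `^ k.

Lemma tail_ind_ge0 k r i x : 0 <= tail_ind k r i x.
Proof. by rewrite mulr_ge0 ?powR_ge0. Qed.

Lemma measurable_tail_ind k r i : measurable_fun setT (tail_ind k r i : bvec R d -> R).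
Proof.
apply: measurable_funM; first by apply: measurable_ge_abs; exact: measurable_coord.
apply: (measurableT_comp (measurable_powR k)).
by apply: (measurableT_comp (@normr_measurable R setT)); exact: measurable_coord.
Qed.

(** If all |x_i| <= m with m >= 1, then japan x <= sqrt(1 + d) m. Inside the box m = r works;
    outside, m is the largest coordinate, and its own tail term already carries m^k. *)
Lemma japan_powR_le (k r : R) (x : V) : 0 <= k -> 1 <= r ->
  japan x `^ k <= Num.sqrt (1 + d%:R) `^ k * (r `^ k * boxw r x + \sum_i tail_ind k r i x).
Proof.
move=> k0 r1; have r0 : 0 <= r := le_trans ler01 r1.
have key (m : R) : 1 <= m -> (forall i, `|x 0 i| <= m) ->
    japan x `^ k <= Num.sqrt (1 + d%:R) `^ k * m `^ k.
  move=> m1 hm; have m0 : 0 <= m := le_trans ler01 m1.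
  rewrite -powRM ?sqrtr_ge0//; apply: ge0_ler_powR; rewrite ?nnegrE ?sqrtr_ge0 ?mulr_ge0 ?sqrtr_ge0//.
  rewrite /japan -[X in _ * X](ger0_norm m0) -sqrtr_sqr -sqrtrM ?addr_ge0//.
  rewrite ler_wsqrtr// sqr_vnorm mulrDl mul1r; apply: lerD; first by rewrite exprn_ege1.
  rewrite /vdot mulr_natl -[X in _ <= _ *+ X](card_ord d) -sumr_const; apply: ler_sum => i _.
  by rewrite -expr2 -real_normK ?num_real// ler_sqr ?nnegrE.
have S0 : 0 <= \sum_i tail_ind k r i x by apply: sumr_ge0 => i _; exact: tail_ind_ge0.
have [h|] := boolP [forall i, `|x 0 i| <= r].
  apply: le_trans (key r r1 (forallP h)) _; rewrite ler_wpM2l ?powR_ge0//.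
  by rewrite (boxw1 (forallP h)) mulr1 lerDl.
rewrite negb_forall => /existsP[i]; rewrite -ltNge => hi.
pose j := [arg max_(j > i) `|x 0 j|]%O.
have jmax l : `|x 0 l| <= `|x 0 j|.
  by rewrite /j; case: arg_maxP => // q _; apply.
have rj : r <= `|x 0 j| := le_trans (ltW hi) (jmax i).
apply: le_trans (key _ (le_trans r1 rj) jmax) _; rewrite ler_wpM2l ?powR_ge0//.
apply: (@le_trans _ _ (\sum_i tail_ind k r i x)); last first.
  by rewrite lerDr mulr_ge0 ?powR_ge0 ?boxw_ge0.
rewrite (bigD1 j)//= {1}/tail_ind rj mul1r lerDl.
by apply: sumr_ge0 => l _; exact: tail_ind_ge0.
Qed.

Lemma measurable_japan_powR k : measurable_fun setT (fun x : bvec R d => japan (x : V) `^ k).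
Proof.
apply: (measurableT_comp (measurable_powR k)).
apply: (measurableT_comp (f := @Num.sqrt R)).
  by apply: continuous_measurable_fun => x; exact: sqrt_continuous.
apply: measurable_funD; first exact: measurable_cst.
by apply: measurable_funX; exact: measurable_vnorm.
Qed.

(** Cancellation between the two densities is used only inside the box; outside, each is bounded
    separately by its coordinate tails. *)
Lemma weighted_L1_le (k r B T : R) (G F : V -> R) : 0 <= k -> 1 <= r ->
  is_pdf mu G -> is_pdf mu F ->
  (forall i, \int[mu]_x (tail_ind k r i (x : V) * G x)%:E <= T%:E)%E ->
  (forall i, \int[mu]_x (tail_ind k r i (x : V) * F x)%:E <= T%:E)%E ->
  \int[mu]_x (boxw r (x : V) * `|G x - F x|) <= B ->
  (iint (fun x => (japan x `^ k * `|G x - F x|)%:E) <=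
   (Num.sqrt (1 + d%:R) `^ k * (r `^ k * B + d%:R * (2 * T)))%:E)%E.
Proof.
move=> k0 r1 pG pF tG tF hB; have [mG G0 G1] := pG; have [mF F0 F1] := pF.
have mD : measurable_fun setT (fun x : bvec R d => `|G x - F x|).
  by apply: (measurableT_comp (@normr_measurable R setT)); exact: measurable_funB.
set K := Num.sqrt _ `^ k; have K0 : 0 <= K := powR_ge0 _ _.
have mJ : measurable_fun setT (fun x : bvec R d => japan (x : V) `^ k * `|G x - F x|).
  by apply: measurable_funM => //; exact: measurable_japan_powR.
rewrite iintE; last 2 first.
- exact/measurable_EFinP.
- by move=> x; rewrite lee_fin mulr_ge0 ?powR_ge0.
pose b (x : bvec R d) : R := boxw r x * `|G x - F x|.
have mb : measurable_fun setT b by apply: measurable_funM => //; exact: measurable_boxw.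
have b0 x : 0 <= b x by rewrite mulr_ge0 ?boxw_ge0.
pose t i (x : bvec R d) : R := tail_ind k r i x * G x + tail_ind k r i x * F x.
have mtG i : measurable_fun setT (fun x : bvec R d => tail_ind k r i x * G x).
  by apply: measurable_funM => //; exact: measurable_tail_ind.
have mtF i : measurable_fun setT (fun x : bvec R d => tail_ind k r i x * F x).
  by apply: measurable_funM => //; exact: measurable_tail_ind.
have mt i : measurable_fun setT (t i) by exact: measurable_funD.
have tG0 i x : 0 <= tail_ind k r i x * G x by rewrite mulr_ge0 ?tail_ind_ge0.
have tF0 i x : 0 <= tail_ind k r i x * F x by rewrite mulr_ge0 ?tail_ind_ge0.
have t0 i x : 0 <= t i x by rewrite addr_ge0.
have rk0 : 0 <= r `^ k := powR_ge0 _ _.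
have mS : measurable_fun setT (fun x : bvec R d => \sum_i t i x) by exact: measurable_sum.
have S0 (x : bvec R d) : 0 <= \sum_i t i x by apply: sumr_ge0.
have mrb : measurable_fun setT (fun x : bvec R d => r `^ k * b x).
  by apply: measurable_funM => //; exact: measurable_cst.
apply: (@le_trans _ _ (\int[mu]_x (K%:E * (r `^ k * b x + \sum_i t i x)%:E))%E).
  apply: ge0_le_integral => //.
  - by move=> x _; rewrite lee_fin mulr_ge0 ?powR_ge0.
  - exact/measurable_EFinP.
  - apply: emeasurable_funM; first exact: measurable_cst.
    by apply/measurable_EFinP; exact: (measurable_funD mrb mS).
  move=> x _; rewrite -EFinM lee_fin.
  apply: le_trans (ler_wpM2r (normr_ge0 _) (japan_powR_le x k0 r1)) _.
  rewrite -/K -mulrA ler_wpM2l// mulrDl -mulrA lerD2l mulr_suml; apply: ler_sum => i _.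
  rewrite /t -mulrDr ler_wpM2l ?tail_ind_ge0//.
  by apply: le_trans (ler_normB _ _) _; rewrite !ger0_norm.
rewrite (ge0_integralZl mu measurableT); last 3 first.
- by apply/measurable_EFinP; exact: measurable_funD.
- by move=> x _; rewrite lee_fin addr_ge0// mulr_ge0.
- by rewrite lee_fin.
rewrite EFinM lee_wpmul2l ?lee_fin//.
under eq_integral do rewrite EFinD.
rewrite (ge0_integralD mu measurableT); last 4 first.
- by move=> x _; rewrite lee_fin mulr_ge0.
- exact/measurable_EFinP.
- by move=> x _; rewrite lee_fin.
- exact/measurable_EFinP.
rewrite EFinD; apply: leeD.
  have ib : mu.-integrable setT (EFin \o b).
    have iGF := integrable_norm (integrableB measurableT (pdf_integrable pG) (pdf_integrable pF)).
    have mbw := @measurable_boxw R d r.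
    have := integrable_mulr_bounded (M := 1) mbw _ iGF; apply.
    by move=> x; rewrite ger0_norm ?boxw_ge0 ?boxw_le1.
  under eq_integral do rewrite EFinM.
  rewrite (ge0_integralZl mu measurableT); last 3 first.
  - exact/measurable_EFinP.
  - by move=> x _; rewrite lee_fin.
  - by rewrite lee_fin.
  by rewrite -Rintegral_EFin// -EFinM lee_fin ler_wpM2l.
under eq_integral do rewrite -sumEFin.
rewrite ge0_integral_sum//; last 2 first.
- by move=> i; exact/measurable_EFinP.
- by move=> i x _; rewrite lee_fin.
apply: (@le_trans _ _ (\sum_(i < d) (2 * T)%:E)%E); last first.
  by rewrite sumEFin lee_fin sumr_const card_ord [leRHS]mulr_natl.
apply: lee_sum => i _; rewrite /t.
under eq_integral do rewrite EFinD.
rewrite (ge0_integralD mu measurableT); last 4 first.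
- by move=> x _; rewrite lee_fin.
- exact/measurable_EFinP.
- by move=> x _; rewrite lee_fin.
- exact/measurable_EFinP.
by rewrite (_ : 2 * T = T + T) ?EFinD ?leeD//; ring.
Qed.

Lemma polynomial_weight (q : R) : 0 < q ->
  (\int[mu]_xi (\prod_i (1 + `|(xi : V) 0 i|) `^ (- 1 - q))%:E = ((2 / q) ^+ d)%:E)%E /\
  measurable_fun setT (fun xi : bvec R d => \prod_i (1 + `|(xi : V) 0 i|) `^ (- 1 - q)).
Proof.
move=> q0; have mw : measurable_fun [set: R] (fun u : R => (1 + `|u|) `^ (- 1 - q)).
  apply: (measurableT_comp (measurable_powR _)); apply: measurable_funD; first exact: measurable_cst.
  exact: normr_measurable.
split; last exact: (measurable_prod_coord (w := fun _ u => (1 + `|u|) `^ (- 1 - q))).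
rewrite (@ge0_integral_prod_coord R d (fun _ u => (1 + `|u|) `^ (- 1 - q))).
- by under eq_bigr do rewrite integral_1abs_powR//; rewrite prodEFin prodr_const card_ord.
- by [].
- by move=> i u; exact: powR_ge0.
Qed.

Lemma sqfourB (G F : V -> R) xi : is_pdf mu G -> is_pdf mu F ->
  sqfour (fun x => G x - F x) xi =
  (fourc G xi - fourc F xi) ^+ 2 + (fours G xi - fours F xi) ^+ 2.
Proof.
move=> pG pF; have iG := pdf_integrable pG; have iF := pdf_integrable pF.
rewrite /sqfour !fourcE !foursE.
rewrite -RintegralB//; [|exact: integrable_cosM|exact: integrable_cosM].
rewrite -RintegralB//; [|exact: integrable_sinM|exact: integrable_sinM].
by congr (_ ^+ 2 + _ ^+ 2); apply: eq_Rintegral => x _; ring.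
Qed.

End WeightedNorm.

(** (m + D) (1 - k) - (m - k) (1 + D) = (1 - m) (D + k), so m < 1 is what keeps the ratio below
    1. *)
Lemma theta_ratio (R : realType) (k m D : R) : 0 < D -> 0 <= k -> k < m -> m < 1 ->
  0 < (m - k) / (m + D) * (1 + D) / (1 - k) < 1.
Proof.
move=> D0 k0 km m1; have mk : 0 < m - k by rewrite subr_gt0.
have k1 : 0 < 1 - k by rewrite subr_gt0 (lt_trans km).
have mD : 0 < m + D by rewrite addr_gt0// (le_lt_trans k0).
have D1 : 0 < 1 + D by rewrite addr_gt0.
apply/andP; split; first by rewrite divr_gt0// mulr_gt0// divr_gt0.
rewrite ltr_pdivrMr// mul1r mulrAC ltr_pdivrMr//.
rewrite -subr_gt0 (_ : _ - _ = (1 - m) * (D + k)); last by ring.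
by rewrite mulr_gt0 ?subr_gt0// ltr_wpDr.
Qed.

Section FinalEstimates.
Variables (R : realType) (d : nat).
Local Notation V := 'rV[R]_d.
Local Notation mu := (bmu R d).

(** [moment_tail_charc] for one coordinate with the Lipschitz constant 2 C of [charc_coord_le]; the
    bound is free of eps. *)
Lemma equilibrium_tail_le (K F : V -> R) (eps al C k r : R) (i : 'I_d) : (0 < d)%N ->
  prob_density K -> 0 < eps < 1 -> 1 <= al <= 2 -> equilibrium K eps al F ->
  symbol_le K al C -> 1 <= C -> 0 <= k < 1 -> 0 < r ->
  (\int[mu]_x (tail_ind k r i (x : V) * F x)%:E <=
   (16 * (2 * C) / (1 - k) * 2 `^ (1 - k) * r `^ (k - 1))%:E)%E.
Proof.
move=> d0 pK e01 al12 eqF hK C1 k01 r0.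
have h := moment_tail_charc (prob_density_pdf eqF.1) (measurable_coord i) k01 r0
  (charc_coord_le d0 pK e01 al12 eqF hK C1 i).
under eq_integral do rewrite /tail_ind -mulrA.
apply: le_trans h _; rewrite lee_fin le_eqVlt; apply/orP; left; apply/eqP.
rewrite -[RHS]mulrA; congr (_ * _); have r2 : 0 <= r by exact: ltW.
by rewrite powRM ?invr_ge0// mulrC; congr (_ * _); rewrite -powR_inv1// -powRrM mulN1r opprB.
Qed.

Lemma box_diff_le2 (r : R) (G F : V -> R) : is_pdf mu G -> is_pdf mu F ->
  \int[mu]_x (boxw r (x : V) * `|G x - F x|) <= 2.
Proof.
move=> pG pF; have [mG G0 G1] := pG; have [mF F0 F1] := pF.
have [iG iF] := (pdf_integrable pG, pdf_integrable pF).
have -> : (2 : R) = \int[mu]_x (G x + F x).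
  by rewrite RintegralD// /Rintegral G1 F1.
apply: le_Rintegral => //.
- apply: (integrable_mulr_bounded (M := 1) _ _ (integrable_norm (integrableB measurableT iG iF))).
    exact: measurable_boxw.
  by move=> x; rewrite ger0_norm ?boxw_ge0 ?boxw_le1.
- by have := integrableD measurableT iG iF; apply: eq_integrable.
move=> x _; apply: (@le_trans _ _ `|G x - F x|); first by rewrite ler_piMl ?boxw_le1.
by apply: le_trans (ler_normB _ _) _; rewrite !ger0_norm.
Qed.

End FinalEstimates.

Theorem theorem5p3 (R : realType) (d : nat) (J : R -> 'rV[R]_d -> R)
    (J1 : 'rV[R]_d -> R) (delta C0 : R) :
  (0 < d)%N -> H1 J delta C0 -> H2 J J1 delta C0 ->
  forall k m : R, 0 <= k -> k < m -> m < 1 ->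
  let theta := (m - k) / (m + d%:R / 2) in
  exists C : R,
    forall s eps : R, 1/2 < s < 1 ->
      0 < eps < Num.sqrt (2 / (4 + 2 * delta + d%:R)) ->
    forall Fs F : 'rV[R]_d -> R,
      equilibrium (J s) eps (2 * s) Fs -> equilibrium J1 eps 2 F ->
      (iint (fun x => (japan x `^ k * `|Fs x - F x|)%:E)
        <= (C * (1 - s) `^ theta * (1 + eps `^ (delta * theta) * `|ln eps|))%:E)%E.
Proof.
move=> d0 [delta0 [C00 [hs _]]] [pJ1 [hJ1 [CC [CC0 hJs]]]] k m k0 km m1 theta.
have pJ s (h : 1 / 2 < s < 1) := (hs s h).1.
have hJ s (h : 1 / 2 < s < 1) := (hs s h).2.2.2.
pose D : R := d%:R / 2.
have D0 : 0 < D by rewrite divr_gt0// ltr0n.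
have k1 : 0 < 1 - k by rewrite subr_gt0 (lt_trans km).
have theta0 : 0 < theta.
  by apply: divr_gt0; [rewrite subr_gt0|apply: addr_gt0 => //; exact: le_lt_trans km].
(* The power of 1 - s needed in the Fourier bound for the box and tail contributions to balance at
   (1 - s)^theta. *)
pose th := theta * (1 + D) / (1 - k).
have th01 : 0 < th < 1 := theta_ratio D0 k0 km m1.
have [e0 [q [C1 [e00 q0 C10 hF]]]] := fourier_diff_bound d0 delta0 C00 CC0 pJ hJ pJ1 hJ1 hJs th01.
pose c := cau_mass R d; have c0 : 0 < c := cau_mass_gt0 R d.
(* The bound 1/4 ensures s >= 3/4, the range of the comparison lemmas. *)
pose e1 : R := Num.min e0 4^-1; have e10 : 0 < e1 by rewrite lt_min e00 invr_gt0 ltr0n.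
pose W := C1 * (2 / q) ^+ d.
pose T := 16 * (2 * (2 + C0)) / (1 - k) * 2 `^ (1 - k).
pose B := 2 ^+ d * (W / c + 2^-1 ^+ d * c).
pose K : R := Num.sqrt (1 + d%:R) `^ k.
have W0 : 0 <= W by rewrite mulr_ge0// exprn_ge0// divr_ge0// ltW.
have T0 : 0 <= T by rewrite mulr_ge0 ?powR_ge0// divr_ge0 ?(ltW k1)// !mulr_ge0// addr_ge0// ltW.
have B0 : 0 <= B.
  apply: mulr_ge0; first exact: exprn_ge0.
  apply: addr_ge0; first by apply: divr_ge0 => //; exact: ltW.
  by apply: mulr_ge0; [rewrite exprn_ge0// invr_ge0|exact: ltW].
have K0 : 0 <= K := powR_ge0 _ _.
have dT0 : 0 <= d%:R * (2 * T) by apply: mulr_ge0 => //; apply: mulr_ge0.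
have KB0 : 0 <= K * (B + d%:R * (2 * T)) := mulr_ge0 K0 (addr_ge0 B0 dT0).
have KT0 : 0 <= K * (2 + d%:R * (2 * T)) := mulr_ge0 K0 (addr_ge0 (ler0n R 2) dT0).
exists (K * (B + d%:R * (2 * T)) + K * (2 + d%:R * (2 * T)) * e1 `^ (- theta)).
move=> s eps s12 er Fs F eqFs eqF; have [e01 _] := eps_range delta0 er.
set e := 1 - s; have e_gt0 : 0 < e by rewrite subr_gt0; case/andP: s12.
have e_le1 : e <= 1 by rewrite /e; case/andP: s12 => h _; lra.
have al12 : 1 <= 2 * s <= 2 by case/andP: s12 => h1 h2; apply/andP; split; lra.
have al12' : 1 <= (2 : R) <= 2 by rewrite lexx ler1n.
have k01 : 0 <= k < 1 by rewrite k0 -subr_gt0.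
have C21 : 1 <= 2 + C0 by move: C00; lra.
have [pFs pF] := (prob_density_pdf eqFs.1, prob_density_pdf eqF.1).
have tail r (r0 : 0 < r) i := equilibrium_tail_le i d0 (pJ s s12) e01 al12 eqFs
  (kernel_symbol_le delta0 C00 pJ hJ s12) C21 k01 r0.
have tail1 r (r0 : 0 < r) i := equilibrium_tail_le i d0 pJ1 e01 al12' eqF
  (limit_symbol_le delta0 C00 pJ1 hJ1) C21 k01 r0.
(* The factor 1 + eps^(delta theta) |ln eps| is at least 1, so a bound by a multiple of (1 -
   s)^theta suffices. *)
suff main : (iint (fun x => (japan x `^ k * `|Fs x - F x|)%:E) <=
    ((K * (B + d%:R * (2 * T)) + K * (2 + d%:R * (2 * T)) * e1 `^ (- theta)) * e `^ theta)%:E)%E.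
  apply: le_trans main _; rewrite lee_fin ler_peMr//; last first.
    by rewrite lerDl mulr_ge0 ?powR_ge0.
  exact: mulr_ge0 (addr_ge0 KB0 (mulr_ge0 KT0 (powR_ge0 _ _))) (powR_ge0 _ _).
have eth0 : 0 <= e `^ theta := powR_ge0 _ _.
(* For s away from 1 the distance is merely bounded, taking r = 1 and total mass 2 in the box; the
   factor e1^(- theta) converts this constant into a multiple of (1 - s)^theta. *)
rewrite mulrDl; have [large|small] := ltP e1 e.
  have := weighted_L1_le k0 (lexx 1) pFs pF (tail 1 ltr01) (tail1 1 ltr01) (box_diff_le2 1 pFs pF).
  rewrite !powR1 mul1r mulr1 -/K -/T => h; apply: le_trans h _; rewrite lee_fin.
  apply: (@le_trans _ _ (K * (2 + d%:R * (2 * T)) * e1 `^ (- theta) * e `^ theta)); last first.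
    by rewrite lerDr (mulr_ge0 KB0 eth0).
  rewrite -mulrA; apply: ler_peMr => //; rewrite powRN ler_pdivlMl ?powR_gt0// mulr1.
  by apply: ge0_ler_powR; rewrite ?nnegrE ?(ltW theta0) ?(ltW e10) ?(ltW e_gt0)// ltW.
have s34 : (3 / 4 : R) <= s < 1.
  case/andP: s12 => _ s1; rewrite s1 andbT.
  have : e <= 4^-1 by apply: le_trans small _; rewrite ge_min lexx orbT.
  by rewrite /e => h; lra.
have ee0 : e <= e0 by apply: le_trans small _; rewrite ge_min lexx.
(* Solves r^(k - 1) = e^theta, so the tails have the target size; e <= 1 gives r >= 1. *)
pose r := e `^ (- (theta / (1 - k))).
have r0 : 0 < r := powR_gt0 _ e_gt0.
have r1 : 1 <= r.
  have x0 : 0 <= theta / (1 - k) := divr_ge0 (ltW theta0) (ltW k1).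
  have e01' : 0 < e <= 1 by rewrite e_gt0.
  by rewrite /r powRN invf_ge1 ?powR_gt0//; have := ger_powR e01' x0; rewrite powRr0.
(* Balances the two terms of [local_L1_le], tau e^(2 th) and r^d / tau: both become r^(d/2) e^th. *)
pose tau := r `^ D * e `^ (- th); have tau0 : 0 < tau by rewrite mulr_gt0 ?powR_gt0.
pose w (xi : 'rV[R]_d) : R := C1 * e `^ (2 * th) * \prod_i (1 + `|xi 0 i|) `^ (- 1 - q).
have [wE mw] := polynomial_weight d q0.
have w0 (xi : 'rV[R]_d) : 0 <= \prod_i (1 + `|xi 0 i|) `^ (- 1 - q).
  by apply: prodr_ge0 => i _; exact: powR_ge0.
have iw' : (bmu R d).-integrable setT
    (EFin \o (fun xi : bvec R d => \prod_i (1 + `|(xi : 'rV[R]_d) 0 i|) `^ (- 1 - q))).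
  by apply: ge0_integrable => //; rewrite wE ltry.
have iw : (bmu R d).-integrable setT (EFin \o (w : bvec R d -> R)).
  by have := integrableZl measurableT (C1 * e `^ (2 * th)) iw'; apply: eq_integrable.
have Ew : \int[bmu R d]_xi w xi = e `^ (2 * th) * W.
  by rewrite /w RintegralZl// /Rintegral wE /W /=; ring.
have ifF : (bmu R d).-integrable setT (EFin \o (fun x : bvec R d => Fs x - F x)).
  have := integrableB measurableT (pdf_integrable pFs) (pdf_integrable pF).
  exact: eq_integrable.
have fw xi : sqfour (fun x => Fs x - F x) xi <= w xi.
  by rewrite sqfourB//; exact: (hF s eps Fs F s34 ee0 er eqFs eqF xi).
have := local_L1_le iw tau0 r0 ifF fw; rewrite Ew -/c => L1.
have {L1}L1 : \int[bmu R d]_x (boxw r (x : 'rV[R]_d) * `|Fs x - F x|) <= B * r `^ D * e `^ th.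
  apply: le_trans L1 _; rewrite le_eqVlt; apply/orP; left; apply/eqP.
  have rd : r ^+ d = r `^ D * r `^ D.
    rewrite -powR_mulrn ?(ltW r0)// -powRD; last by apply/implyP => _; rewrite gt_eqF.
    by congr powR; rewrite /D; field.
  have e2 : e `^ (2 * th) = e `^ th * e `^ th.
    rewrite -powRD; last by apply/implyP => _; rewrite gt_eqF.
    by congr powR; ring.
  rewrite exprMn rd e2 /tau powRN /B.
  have := powR_gt0 D r0; have := powR_gt0 th e_gt0.
  move: (r `^ D) (e `^ th) (2^-1 ^+ d) (2 ^+ d) => X Y p P Y0 X0.
  by field; rewrite !gt_eqF.
have := weighted_L1_le k0 r1 pFs pF (tail r r0) (tail1 r r0) L1.
rewrite -/K -/T => h; apply: le_trans h _; rewrite lee_fin.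
have rk1 : r `^ (k - 1) = e `^ theta.
  by rewrite /r -powRrM; congr powR; field; rewrite gt_eqF.
have rk : r `^ k * (B * r `^ D * e `^ th) = B * e `^ theta.
  rewrite (_ : _ * _ = B * (r `^ k * r `^ D * e `^ th)); last by ring.
  congr (_ * _); rewrite /r -!powRrM -!powRD; try by apply/implyP => _; rewrite gt_eqF.
  by congr powR; rewrite /th; field; rewrite gt_eqF.
rewrite rk rk1; apply: (@le_trans _ _ (K * (B + d%:R * (2 * T)) * e `^ theta)).
  by rewrite le_eqVlt; apply/orP; left; apply/eqP; ring.
by rewrite lerDl (mulr_ge0 (mulr_ge0 KT0 (powR_ge0 _ _)) eth0).
Qed.
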